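(* Let $g>1$ and let $m\ge4$ be even. Then $\widetilde\Delta_{g,m}(u,\tau)$ belongs to $k[u_a]_{a\in B_m}$, and it is the unique defining equation of the projective dual variety $\mathcal A_m^\vee$ which is monic in the variable $u_0$.
   Context: $\mathfrak S_g$: Siegel upper half space; $A_\tau=\mathbb C^g/(\mathbb Z^g+\tau\mathbb Z^g)$; $p:\mathbb A\to\mathfrak S_g$ the universal family with fibers $A_\tau$; $B_m=m^{-1}\mathbb Z^g/\mathbb Z^g$; $\theta_{a,b}(z,\tau)=\sum_{n\in\mathbb Z^g}\exp(\pi i\,{}^t(n+a)\tau(n+a)+2\pi i\,{}^t(n+a)(z+b))$. The field $k=\mathbb Q(\theta_{a,0}(0,m\tau)\theta_{b,0}(0,m\tau))_{a,b\in B_m}$ is the fraction field of $\mathbb Z[\theta_{a,0}(0,m\tau)\theta_{b,0}(0,m\tau)]_{a,b\in B_m}$, a subfield of the field $\mathcal M(\mathfrak S_g)$ of meromorphic functions on $\mathfrak S_g$. $\mathcal A_m\subset\mathbb P_k^{m^g-1}$ (homogeneous coordinates $X_a$, $a\in B_m$) is the variety defined by the following equations (Mumford's equations of $A_\tau$ embedded by $z\mapsto(\theta_{a,0}(mz,m\tau))_{a\in B_m}$): for all $a,b,a',b'\in\frac1m\mathbb Z^g/\mathbb Z^g$ with $a+b\equiv a'+b'\bmod\mathbb Z^g$, all $d\in\frac1m\mathbb Z^g$ and $c\in\frac12\mathbb Z^g/\mathbb Z^g$, $$\Big(\sum_\eta s(c,\eta)\theta_{a'+d+\eta,0}(0,m\tau)\theta_{b'+d+\eta,0}(0,m\tau)\Big)\Big(\sum_\eta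 s(c,\eta)X_{a+\eta}X_{b+\eta}\Big)=\Big(\sum_\eta s(c,\eta)\theta_{a+d+\eta,0}(0,m\tau)\theta_{b+d+\eta,0}(0,m\tau)\Big)\Big(\sum_\eta s(c,\eta)X_{a'+\eta}X_{b'+\eta}\Big),$$ with $s(c,\eta)=(-1)^{{}^t(2c)(2\eta)}$ and $\eta$ running over $\frac12\mathbb Z^g/\mathbb Z^g$. $\mathcal A_m^\vee\subset(\mathbb P_k^{m^g-1})^\vee$ is its projective dual variety, a hypersurface, with coordinates $(u_a)_{a\in B_m}$ dual to $(X_a)$; $u_0$ is the coordinate with $a=0$, and ''monic in $u_0$'' means that the pure power of $u_0$ has coefficient $1$. $\widetilde\Delta_{g,m}$: Let $\Theta_m=\{(u,z,\tau)\in\mathbb P(\mathbb C^{m^g})\times\mathbb A:\sum_{a\in B_m}u_a\theta_{a,0}(mz,m\tau)=0\}$, with fibers $\Theta_{m,(u,\tau)}\subset A_\tau$ over $\mathbb P(\mathbb C^{m^g})\times\mathfrak S_g$, carrying the metric induced from ${}^tdz(\operatorname{Im}\tau)^{-1}d\bar z$. $\lambda(\mathcal O_{\Theta_m})=\bigotimes_q(\det R^q\pi_*\mathcal O_{\Theta_m})^{(-1)^q}$, $\pi$ the projection to $\mathbb P(\mathbb C^{m^g})\times\mathfrak S_g$, has the Quillen metric $\|\cdot\|_Q^2=\tau\cdot\|\cdot\|_{L^2}^2$ (Ray–Singer torsion $\tau=\prod_q(\det\square^{0,q})^{(-1)^qq}$ of the fiber times the $L^2$-metric of harmonic forms). Via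 $0\to\mathcal O(-\Theta_m)\to\mathcal O\to\mathcal O_{\Theta_m}\to0$, Kodaira vanishing, Serre duality and the canonical trivialization of $\lambda(\mathcal O_{\mathbb A})$ (by $\bigotimes_q(\bigwedge_{|I|=q}e_I)^{(-1)^q}$ for any frame $e_i$ of $R^1p_*\mathcal O_{\mathbb A}$), $\lambda(\mathcal O_{\Theta_m})^{(-1)^g}\cong\det\pi_*\omega_{\mathbb A/\mathfrak S_g}(\Theta_m)$; for $|J|=m^g$ put $\sigma_J=u^J\bigwedge_{a\in B_m}\frac{\theta_{a,0}(mz,m\tau)}{\sum_bu_b\theta_{b,0}(mz,m\tau)}dz_1\wedge\cdots\wedge dz_g$. Then $\Delta_{g,m}(u,\tau)=\sum_Jf_J(\tau)u^J$ is the homogeneous polynomial in $u$ of degree $m^g(g+1)!$ with coefficients $f_J\in\mathcal O(\mathfrak S_g)$, unique up to a constant of modulus one, such that off the locus of singular fibers $\|\sigma_J\|_Q^2=(\det\operatorname{Im}\tau)^{\frac{(g-1)m^g}{2(g+1)}}|u^J|^2|\Delta_{g,m}(u,\tau)|^{-\frac2{(g+1)!}}$; its divisor in $\mathbb P(\mathbb C^{m^g})\times\mathfrak S_g$ is the discriminant of $\Theta_m$. The coefficient $f_{J_0}$ of $u_0^{m^g(g+1)!}$ is not identically zero, and $$\widetilde\Delta_{g,m}(u,\tau)=\frac{\Delta_{g,m}(u,\tau)}{f_{J_0}(\tau)}=u_0^{m^g(g+1)!}+\sum_{J\ne J_0}\frac{f_J(\tau)}{f_{J_0}(\tau)}u^J\in\mathcal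 M(\mathfrak S_g)[u_a]_{a\in B_m}.$$ *)

(* Defs.v *)
From HB Require Import structures.
From mathcomp Require Import all_boot all_order all_algebra.
From mathcomp Require Import all_classical all_reals all_analysis.
From mathcomp Require Import complex.
From mathcomp Require mpoly.
(* The notations of mpoly and of mathcomp-analysis cannot be loaded together. *)
Import -(notations) mpoly.
Set Implicit Arguments.
Unset Strict Implicit.
Unset Printing Implicit Defensive.
Import Order.TTheory GRing.Theory Num.Theory.
Import numFieldNormedType.Exports.
Local Open Scope classical_set_scope.
Local Open Scope ring_scope.

(* B_m = m^-1 Z^g / Z^g; [a] stands for the class of a / m.  Only used with
   m > 1, where 'Z_m really is Z / m. *)
Notation Bm g m := {ffun 'I_g -> 'Z_m}.
(* 2^-1 Z^g / Z^g; [e] stands for the class of e / 2. *)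
Notation half_chars g := {ffun 'I_g -> bool}.
Notation nB g m := #|{: Bm g m}|.

(* Polynomials in variables indexed by B_m: the variable of index [a] is the one
   of number [enum_rank a]. *)
Definition pt (g m : nat) (K : Type) (x : Bm g m -> K) : 'I_(nB g m) -> K :=
  fun i => x (enum_val i).

Definition homogeneous (n : nat) (K : nzRingType) (d : nat) (p : mpoly n K) : Prop :=
  p \is ishomog1 d (@mdeg n).

(* the exponent of the pure power u_0^d *)
Definition pure_power (g m d : nat) : multinom (nB g m) :=
  mnm_muln (mnm1 (enum_rank (0 : Bm g m))) d.

Section ComplexAnalysis.
Variable R : realType.
Local Notation C := R[i].

Definition toC (x : R) : C := (x%:C)%C.
Definition iC : C := Complex 0 1.
Definition re (z : C) : R := complex.Re z.
Definition im (z : C) : R := complex.Im z.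
Definition abs2 (z : C) : R := re z ^+ 2 + im z ^+ 2.
Definition cexp (z : C) : C := toC (expR (re z)) * Complex (cos (im z)) (sin (im z)).

Variable g : nat.
Local Notation Cg := 'rV[C]_g.

Definition conj_mx p q (M : 'M[C]_(p, q)) : 'M[C]_(p, q) := map_mx (fun z : C => z^*) M.
Definition ImM (tau : 'M[C]_g) : 'M[R]_g := map_mx im tau.

Definition siegel (tau : 'M[C]_g) : Prop :=
  tau^T = tau /\ forall x : 'rV[R]_g, x != 0 -> 0 < (x *m ImM tau *m x^T) ord0 ord0.

(* The sum over Z^g converges absolutely; it is computed along the boxes
   [-N, N]^g. *)
Definition theta (a b z : Cg) (tau : 'M[C]_g) : C :=
  limn ((fun N : nat => \sum_(n : {ffun 'I_g -> 'I_(N.*2).+1})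
    let p : Cg := (\row_i ((n i : nat)%:R - N%:R)) + a in
    cexp (toC pi * iC * (p *m tau *m p^T) ord0 ord0
          + 2%:R * toC pi * iC * (p *m (z + b)^T) ord0 ord0)) : nat -> C^o).

(* Complex differentiability on the open subset S_g of the space of symmetric
   matrices; values outside S_g play no role. *)
Definition holomorphic_on_siegel (f : 'M[C]_g -> C) : Prop :=
  forall tau, siegel tau -> exists L : 'M[C]_g,
  forall e : R, 0 < e -> exists2 d : R, 0 < d &
  forall H : 'M[C]_g, H^T = H -> (forall i j, `|H i j| < toC d) ->
    `|f (tau + H) - f tau - \sum_i \sum_j L i j * H i j|
      <= toC e * \sum_i \sum_j `|H i j|.

(* Directional derivative of a function on C^g = R^2g. *)
Definition rderive (v : Cg) (f : Cg -> C) (z : Cg) : C :=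
  Complex (derive1 (fun t : R => re (f (z + toC t *: v))) 0)
          (derive1 (fun t : R => im (f (z + toC t *: v))) 0).
Definition rderivable (v : Cg) (f : Cg -> C) (z : Cg) : Prop :=
  derivable (fun t : R => re (f (z + toC t *: v))) 0 1
  /\ derivable (fun t : R => im (f (z + toC t *: v))) 0 1.

Definition smooth (f : Cg -> C) : Prop :=
  forall s : seq Cg, let h := foldr rderive f s in
  continuous (h : 'rV[C^o]_g -> C^o) /\ forall v z, rderivable v h z.

Definition e_ (j : 'I_g) : Cg := delta_mx ord0 j.
(* d / dz_j and d / d(conj z_j) *)
Definition dz_ (j : 'I_g) (f : Cg -> C) (z : Cg) : C :=
  (rderive (e_ j) f z - iC * rderive (iC *: e_ j) f z) / 2%:R.
Definition dzb_ (j : 'I_g) (f : Cg -> C) (z : Cg) : C :=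
  (rderive (e_ j) f z + iC * rderive (iC *: e_ j) f z) / 2%:R.

(* Iterated Lebesgue integral over the cube [0, 1]^n. *)
Fixpoint cube_int (n : nat) (f : seq R -> R) : R :=
  if n is n'.+1 then
    Rintegral (@lebesgue_measure R) `[0, 1]
      (fun x : R => cube_int n' (fun s => f (x :: s)))
  else f [::].

(* Integral over A_tau for the volume of the metric (Im tau)^-1, of total mass 1:
   it is dx dy in the coordinates z = x + tau y. *)
Definition torus_int (tau : 'M[C]_g) (f : Cg -> C) : C :=
  let z s : Cg := \row_j (toC (nth 0 s j) + \sum_k tau j k * toC (nth 0 s (g + k))) in
  Complex (cube_int (g + g) (fun s => re (f (z s))))
          (cube_int (g + g) (fun s => im (f (z s)))).

Definition periodic (tau : 'M[C]_g) (f : Cg -> C) : Prop :=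
  forall (z : Cg) (a b : 'rV[int]_g),
    f (z + map_mx intr a + map_mx intr b *m tau^T) = f z.

Definition invY (tau : 'M[C]_g) : 'M[C]_g := map_mx toC (invmx (ImM tau)).
Definition sqnorm (tau : 'M[C]_g) (v : Cg) : R :=
  re ((v *m invY tau *m (conj_mx v)^T) ord0 ord0).

(* A mixed form sum_I psi_I d(conj z)_I on C^g, given by its coefficients. *)
Definition form := {set 'I_g} -> Cg -> C.

Definition smooth_form (tau : 'M[C]_g) (D : {set 'I_g} -> bool) (psi : form) : Prop :=
  forall I, smooth (psi I) /\ periodic tau (psi I) /\ (~~ D I -> forall z, psi I z = 0).
Definition deg_is (q : nat) (I : {set 'I_g}) : bool := #|I| == q.
(* degree q - 1; no set I satisfies this for q = 0 *)
Definition deg_is_pred (q : nat) (I : {set 'I_g}) : bool := #|I|.+1 == q.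

Definition dzbar (I : {set 'I_g}) : form := fun K _ => if K == I then 1 else 0.

Definition dbar (psi : form) : form := fun T z =>
  \sum_(j in T) (-1) ^+ #|[set i in T | (i < j)%N]| * dzb_ j (psi (T :\ j)) z.

(* The minor of E with rows t and columns I, for #|t| = #|I|. *)
Definition minor (E : 'M[C]_g) (t I : {set 'I_g}) : C :=
  \det (\matrix_(i < #|t|, j < #|t|)
          (if onth (enum I) j is Some c then E (enum_val i) c else 0)).

(* The value of a (0,q)-form, q = #|t|, on the rows of E of index in t. *)
Definition ev_form (psi : form) (E : 'M[C]_g) (t : {set 'I_g}) (z : Cg) : C :=
  \sum_(I : {set 'I_g} | #|I| == #|t|) psi I z * (minor E t I)^*.

(* The hypersurface {F = 0} of A_tau, with the metric induced by (Im tau)^-1.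
   F is holomorphic on C^g and {F = 0} is periodic and smooth (F = 0 implies
   dF <> 0).  A (0,q)-form on the hypersurface is represented by a periodic
   ambient form: every form extends. *)
Section Hypersurface.
Variables (tau : 'M[C]_g) (F : Cg -> C).

(* E is a unitary basis of C^g whose rows of nonzero index span ker dF(z). *)
Definition adapted_frame (z : Cg) (E : 'M[C]_g) : Prop :=
  E *m invY tau *m (conj_mx E)^T = 1%:M
  /\ forall i : 'I_g, (0 < i)%N -> \sum_j E i j * dz_ j F z = 0.
Definition frame (z : Cg) : 'M[C]_g := xget 0 [set E | adapted_frame z E].

Definition tangential (t : {set 'I_g}) : bool := [forall i in t, (0 < i)%N].

Definition tube (e : R) (z : Cg) : Prop :=
  exists2 w, F w = 0 & sqnorm tau (z - w) < e ^+ 2.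

(* Integral over {F = 0} for the Riemannian volume of the induced metric, as a
   Minkowski content: the volume of a tube of radius e about a submanifold of
   real codimension 2 is asymptotic to pi e^2 times the volume of the
   submanifold. *)
Definition fiber_int (f : Cg -> C) : C :=
  lim ((fun e : R => (toC (pi * e ^+ 2))^-1
          * torus_int tau (fun z => if `[< tube e z >] then f z else 0) : C^o)
       e @[e --> 0^'+]).

(* L^2 product of the restrictions of psi and phi to {F = 0}; pointwise, sum over
   a unitary basis of the tangent space. *)
Definition ip (psi phi : form) : C :=
  fiber_int (fun z => \sum_(t | tangential t)
    ev_form psi (frame z) t z * (ev_form phi (frame z) t z)^*).

Definition eq_on_fiber (psi phi : form) : Prop :=
  forall z, F z = 0 -> forall t, tangential t ->
    ev_form psi (frame z) t z = ev_form phi (frame z) t z.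

(* phi is a smooth (0,q)-form with box phi = lambda phi on {F = 0}, where
   box = dbar dbar^* + dbar^* dbar; beta represents dbar^* phi. *)
Definition eigenform (q : nat) (lambda : R) (phi : form) : Prop :=
  smooth_form tau (deg_is q) phi /\
  exists beta, [/\ smooth_form tau (deg_is_pred q) beta,
    forall chi, smooth_form tau (deg_is_pred q) chi ->
      ip beta chi = ip phi (dbar chi)
  & forall chi, smooth_form tau (deg_is q) chi ->
      ip (dbar phi) (dbar chi) + ip (dbar beta) chi = toC lambda * ip phi chi].

(* lam lists the positive eigenvalues of box on (0,q)-forms, with multiplicity. *)
Definition positive_spectrum (q : nat) (lam : nat -> R) : Prop :=
  exists e : nat -> form,
  [/\ forall n, 0 < lam n /\ eigenform q (lam n) (e n),
      forall n k, ip (e n) (e k) = (n == k)%:R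
    & forall lambda phi, 0 < lambda -> eigenform q lambda phi ->
        (forall n, ip phi (e n) = 0) -> ip phi phi = 0].

(* zeta is the meromorphic continuation of sum_n lam_n^-s; the series converges
   for Re s > g - 1, the complex dimension of the hypersurface, and there are
   finitely many poles. *)
Definition zeta_continuation (lam : nat -> R) (zeta : C -> C) : Prop :=
  exists poles : seq C,
  [/\ 0 \notin poles,
      forall s, s \notin poles -> derivable (zeta : C^o -> C^o) s 1
    & forall s, (g.-1)%:R < re s ->
        series ((fun n => cexp (- s * toC (ln (lam n)))) : nat -> C^o) @ \oo
          --> (zeta s : C^o)].

(* r = log det box^{0,q} = - zeta_q'(0) *)
Definition is_logdet (q : nat) (r : R) : Prop :=
  exists lam zeta, [/\ positive_spectrum q lam, zeta_continuation lam zeta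
    & r = - re ('D_1 (zeta : C^o -> C^o) 0)].

(* h is the harmonic form in the Dolbeault class of the restriction of phi. *)
Definition harmonic_rep (q : nat) (phi h : form) : Prop :=
  eigenform q 0 h /\ exists2 beta, smooth_form tau (deg_is_pred q) beta
    & eq_on_fiber h (fun I z => phi I z + dbar beta I z).

Definition gram (s : seq form) : C :=
  \det (\matrix_(i < size s, j < size s)
          ip (nth (fun _ _ => 0) s i) (nth (fun _ _ => 0) s j)).

End Hypersurface.

Section Theta.
Variable m : nat.
Local Notation B := (Bm g m).
Local Notation n := (nB g m).

Definition char (a : B) : Cg := \row_i ((a i : nat)%:R / m%:R).

(* theta_{a,0}(m z, m tau) *)
Definition th (a : B) (tau : 'M[C]_g) (z : Cg) : C :=
  theta (char a) 0 (m%:R *: z) (m%:R *: tau).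

Definition Th (u : B -> C) (tau : 'M[C]_g) (z : Cg) : C :=
  \sum_a u a * th a tau z.

Definition singular_fiber (u : B -> C) (tau : 'M[C]_g) : Prop :=
  exists2 z, Th u tau z = 0 & forall j, dz_ j (Th u tau) z = 0.

Definition monomial (u : B -> C) (J : multinom n) : C :=
  \prod_(i < n) pt u i ^+ J i.

(* [serre_pairing u tau x a] is the integral over A_tau of
   dbar x /\ (theta_a / sum_b u_b theta_b) dz_1 /\ ... /\ dz_g,
   that is, the Serre pairing of delta [x|_Theta] in H^g(A, O(-Theta)) with the
   a-th section of omega(Theta), delta being the connecting map of
   0 -> O(-Theta) -> O -> O_Theta -> 0.  The factor 2^g det(Im tau) comes from
   dz /\ d(conj z), up to a constant of modulus one. *)
Definition serre_pairing (u : B -> C) (tau : 'M[C]_g) (x : form) (a : B) : C :=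
  toC (2%:R ^+ g * \det (ImM tau))
  * torus_int tau (fun z => dbar x (finset.setTfor 'I_g) z * (th a tau z / Th u tau z)).

(* r = || sigma_J ||_Q^2 at a point (u, tau) with smooth fiber Theta.

   With N = m^g, the sequence above gives H^q(A, O) = H^q(Theta, O) for q < g - 1
   and the exact sequence
     0 -> H^{g-1}(A, O) -> H^{g-1}(Theta, O) -> H^g(A, O(-Theta)) -> H^g(A, O) -> 0.
   Take x_0, ..., x_{N-2} in H^{g-1}(Theta, O) which complete the d(conj z)_I,
   #|I| = g - 1, to a basis, and let y in H^g(A, O(-Theta)) be a lift of
   d(conj z)_1 /\ ... /\ d(conj z)_g; in the coordinates of the Serre pairing, y is
   any w with sum_a w_a u_a = 2^g det(Im tau), because sum_a u_a omega_a = dz.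
   If P is the matrix of (delta x_i, y) in these coordinates, then
   delta x_0 /\ ... /\ delta x_{N-2} /\ y = det P u^J sigma_J^*, and the element of
   lambda(O_Theta) corresponding to sigma_J (to the power (-1)^g) is
     (x)_{q < g-1} (/\_{#|I|=q} d(conj z)_I)^{(-1)^q}
     (x) ( /\_{#|I|=g-1} d(conj z)_I /\ x_0 /\ ... /\ x_{N-2}
           / (det P u^J) )^{(-1)^{g-1}}.
   As g > 1, the trivialization of lambda(O_A) is the same for every frame of
   H^1(A, O), so the frame d(conj z)_i is allowed. *)
Definition quillen_norm2 (u : B -> C) (tau : 'M[C]_g) (J : multinom n) (r : R) : Prop :=
  let F := Th u tau in
  exists (ld : nat -> R) (rep : {set 'I_g} -> form) (x : nat -> form) (w : B -> C),
  let P := \det (\matrix_(i < n, j < n)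
             (if (i.+1 < n)%N then serre_pairing u tau (x i) (enum_val j)
              else w (enum_val j))) in
  let harm q := [seq rep K | K : {set 'I_g} <- enum (deg_is q : pred {set 'I_g})] in
  let torsion := expR (\sum_(1 <= q < g) (-1) ^+ q * q%:R * ld q) in
  [/\ (forall q, (0 < q < g)%N -> is_logdet tau F q (ld q)),
      (forall I : {set 'I_g}, (#|I| < g)%N -> harmonic_rep tau F #|I| (dzbar I) (rep I)),
      (forall i, (i < n.-1)%N -> eigenform tau F g.-1 0 (x i)),
      (\sum_a w a * u a = toC (2%:R ^+ g * \det (ImM tau)) /\ P != 0)
    & r = abs2 P * abs2 (monomial u J)
          / re (gram tau F (harm g.-1 ++ [seq x i | i <- iota 0 n.-1]))
          * torsion ^ ((-1) ^+ g : int)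
          * \prod_(0 <= q < g.-1) re (gram tau F (harm q)) ^ ((-1) ^+ (g + q) : int)].

Definition disc_degree : nat := (m ^ g * (g.+1)`!)%N.

(* Delta tau is the polynomial Delta_{g,m}(., tau) = sum_J f_J(tau) u^J. *)
Record is_Delta (Delta : 'M[C]_g -> mpoly n C) : Prop := IsDelta {
  Delta_homog : forall tau, siegel tau -> homogeneous disc_degree (Delta tau);
  Delta_holo : forall J, holomorphic_on_siegel (fun tau => mcoeff J (Delta tau));
  Delta_quillen : forall (u : B -> C) tau, (exists a, u a != 0) -> siegel tau ->
    ~ singular_fiber u tau -> forall J : multinom n, mdeg J = (m ^ g)%N ->
    quillen_norm2 u tau J
      ((\det (ImM tau)) `^ ((g.-1 * m ^ g)%:R / (2 * g.+1)%:R)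
       * abs2 (monomial u J)
       * (abs2 (meval (pt u) (Delta tau))) `^ (- ((g.+1)`!)%:R^-1));
  (* the divisor of Delta is the discriminant, with multiplicity one: its support
     is the locus of singular fibers, and dDelta <> 0 on a dense subset of it *)
  Delta_support : forall (u : B -> C) tau, (exists a, u a != 0) -> siegel tau ->
    meval (pt u) (Delta tau) = 0 <-> singular_fiber u tau;
  Delta_reduced : forall (u : B -> C) tau (e : R), (exists a, u a != 0) ->
    siegel tau -> singular_fiber u tau -> 0 < e ->
    exists (u' : B -> C) (tau' : 'M[C]_g),
    [/\ siegel tau', singular_fiber u' tau',
        forall a, `|u' a - u a| < toC e,
        forall i j, `|tau' i j - tau i j| < toC e
      & exists i, meval (pt u') (mderiv i (Delta tau')) != 0];
  Delta_J0 : exists2 tau, siegel tau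
    & mcoeff (pure_power g m disc_degree) (Delta tau) != 0 }.

(* Integral polynomials in variables T_{a,b}, and their evaluation. *)
Definition ipoly := mpoly #|{: B * B}| int.
Definition ieval (A : nzRingType) (T : B -> B -> A) (p : ipoly) : A :=
  mmap intr (fun i => let ab : B * B := enum_val i in T ab.1 ab.2) p.

Definition thth (tau : 'M[C]_g) (a b : B) : C := th a tau 0 * th b tau 0.

Definition vanishes_on_siegel (p : ipoly) : Prop :=
  forall tau, siegel tau -> ieval (thth tau) p = 0.

(* k, with t a b = theta_{a,0}(0, m tau) theta_{b,0}(0, m tau), is the fraction
   field of the ring of functions Z[thth]; this determines (k, t) up to unique
   isomorphism. *)
Definition is_theta_field (k : fieldType) (t : B -> B -> k) : Prop :=
  (forall p : ipoly, ieval t p = 0 <-> vanishes_on_siegel p)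
  /\ (forall x : k, exists p q : ipoly, ieval t q != 0 /\ x = ieval t p / ieval t q).

(* The image of x under k -> M(S_g) is f / h, for a holomorphic function h which is
   not identically zero; fractions are compared by cross multiplication. *)
Definition is_quotient (k : fieldType) (t : B -> B -> k) (x : k)
    (f h : 'M[C]_g -> C) : Prop :=
  exists p q : ipoly, [/\ ieval t q != 0, x = ieval t p / ieval t q
    & forall tau, siegel tau ->
        f tau * ieval (thth tau) q = h tau * ieval (thth tau) p].

End Theta.
End ComplexAnalysis.

Section DualVariety.
Variables (g m : nat) (k : fieldType) (t : Bm g m -> Bm g m -> k).
Local Notation B := (Bm g m).
Local Notation n := (nB g m).

(* the class of e / 2 in B_m, for m even *)
Definition half_class (e : half_chars g) : B := [ffun i => if e i then (m./2)%:R else 0].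

Definition sgn (A : pzRingType) (c e : half_chars g) : A :=
  (-1) ^+ (\sum_(i < g) (c i && e i))%N.

Definition null_sum (c : half_chars g) (a b : B) : k :=
  \sum_(e : half_chars g) sgn k c e * t (a + half_class e) (b + half_class e).

(* Geometric points over an algebraically closed extension Omega of k. *)
Section Points.
Variables (Omega : closedFieldType) (iota : {rmorphism k -> Omega}).

Definition quad_sum (c : half_chars g) (X : B -> Omega) (a b : B) : Omega :=
  \sum_(e : half_chars g) sgn Omega c e * (X (a + half_class e) * X (b + half_class e)).

Definition nonzero (X : B -> Omega) : Prop := exists a, X a != 0.

(* homogeneous coordinates of the points of A_m; d only matters modulo Z^g *)
Definition on_Am (X : B -> Omega) : Prop :=
  nonzero X /\
  forall (a b a' b' d : B) (c : half_chars g), a + b = a' + b' ->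
    iota (null_sum c (a' + d) (b' + d)) * quad_sum c X a b
    = iota (null_sum c (a + d) (b + d)) * quad_sum c X a' b'.

Definition in_ideal (p : mpoly n Omega) : Prop :=
  forall X, on_Am X -> meval (pt X) p = 0.

(* v lies in the (affine cone of the) projective tangent space at X *)
Definition tangent (X v : B -> Omega) : Prop :=
  forall p, in_ideal p -> \sum_a meval (pt X) (mderiv (enum_rank a) p) * v a = 0.

(* Jacobian criterion: near X, the variety is cut out by r equations with linearly
   independent differentials at X. *)
Definition smooth_point (X : B -> Omega) : Prop :=
  on_Am X /\
  exists (r : nat) (p : 'I_r -> mpoly n Omega) (h : mpoly n Omega),
  [/\ forall i, in_ideal (p i) /\ (exists d, homogeneous d (p i)),
      (exists d, homogeneous d h) /\ meval (pt X) h != 0,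
      forall X', nonzero X' -> meval (pt X') h != 0 ->
        (forall i, meval (pt X') (p i) = 0) -> on_Am X'
    & row_free (\matrix_(i < r, j < n) meval (pt X) (mderiv j (p i)))].

Definition tangent_hyperplane (u : B -> Omega) : Prop :=
  nonzero u /\ exists2 X, smooth_point X
    & forall v, tangent X v -> \sum_a u a * v a = 0.

(* the Zariski closure of the set of tangent hyperplanes *)
Definition in_dual (u : B -> Omega) : Prop :=
  nonzero u /\ forall p : mpoly n Omega,
    (forall u', tangent_hyperplane u' -> meval (pt u') p = 0) -> meval (pt u) p = 0.

End Points.

(* F generates the homogeneous ideal of the dual variety in k[u_a]. *)
Definition defining_equation (F : mpoly n k) : Prop :=
  (exists d, homogeneous d F) /\
  forall G : mpoly n k,
    (forall (Omega : closedFieldType) (iota : {rmorphism k -> Omega}) (u : B -> Omega),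
       in_dual iota u -> meval (pt u) (map_mpoly iota G) = 0)
    <-> exists H, G = F * H.

Definition monic_in_u0 (F : mpoly n k) : Prop :=
  exists2 d, homogeneous d F & mcoeff (pure_power g m d) F = 1.

End DualVariety.

(* Main.v *)
Require Import Defs.
From HB Require Import structures.
From mathcomp Require Import all_boot all_order all_algebra.
From mathcomp Require Import all_classical all_reals all_analysis.
From mathcomp Require Import perm complex ring lra zify.
From mathcomp Require mpoly.
Import -(notations) mpoly.
Import Order.TTheory GRing.Theory Num.Theory.
Set Implicit Arguments.
Unset Strict Implicit.
Unset Printing Implicit Defensive.
Import numFieldNormedType.Exports.
Local Open Scope classical_set_scope.
Local Open Scope ring_scope.

(* Let Phi_tau(z) be the vector of the theta_{a,0}(mz, m tau).  Riemann's bilinear relation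
   puts the points Phi_tau(z) on A_m.  Modulo Mumford's quadrics, every monomial of degree d
   is a k-linear combination of (md)^g normal monomials: the linear system expressing this is
   nondegenerate because its leading terms at the cusp tau = i s, s -> oo, are.  In the same
   way the normal monomials in Phi_tau are independent for generic tau.  Hence the ideal of
   A_m over every extension of k is given by linear forms with coefficients in k, and for
   generic tau, where evaluation embeds k in C, it is the ideal of the cone over Phi_tau(C^g).

   A tangent hyperplane of A_m is the gradient at a point of an element of its ideal.
   Being zero on all these gradients is a k-linear condition on polynomials in u, and
   Delta(u, tau) satisfies it for generic tau, since such a gradient cuts out a singular
   fiber; so do then its components with coefficients in k.  Conversely, fix a generic tau
   near which the discriminant is reduced.  The discriminant is the union of the spaces
   W_z of hyperplanes containing the tangent space at z, any two of whose elements are joined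
   by an analytic path; hence it is irreducible and Delta(u, tau) generates its ideal, which
   is the ideal of the dual variety.  So the components of Delta are multiples of
   a single polynomial F over k, monic in u_0, and Delta = f_{J_0} F, first for
   generic tau and then everywhere by continuity. *)

(** * Unconditional sums *)

(** Evenness of m makes the half periods classes of B_m, so that the substitution of (N + N', N -
    N') for (N, N') turns products of two theta series into Riemann's relation. The bound m >= 4
    enters through the remark that a multiple of m of absolute value at most 3 is 0: this singles
    out the shortest vectors of the relevant congruence classes, and these give the leading terms at
    the cusp, where every nondegeneracy is checked. The dual variety is defined by points over all
    algebraically closed extensions of k, which need not have anything to do with C; so what is
    learned at one generic tau must be put in a form that transfers, namely linear conditions with
    coefficients in k. Primality of the ideal and irreducibility of the discriminant, by contrast,
    are needed over C only. There they follow from one principle: along a complex line everything is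
    a power series, and a product of power series vanishes only if a factor does. *)

Notation nrm := Normc.normc.

Section UnorderedSums.
Variable R : realType.
Local Notation C := R[i].

Lemma nrm_ge0 (z : C) : 0 <= nrm z.
Proof. by case: z => a b; exact: sqrtr_ge0. Qed.

Lemma nrmE (z : C) : `|z| = toC (nrm z).
Proof. by rewrite normc_def; case: z. Qed.

Lemma nrmB (x y : C) : nrm (x - y) = nrm (y - x).
Proof. by rewrite -(normcN (y - x)) opprB. Qed.

Lemma le_nrmB (x y : C) : nrm (x - y) <= nrm x + nrm y.
Proof. by rewrite -(normcN y); exact: le_normcD. Qed.

Lemma nrm_eq0 (z : C) : (nrm z == 0) = (z == 0).
Proof.
apply/eqP/eqP => [|->]; first exact: Normc.eq0_normc.
exact: Normc.normc0.
Qed.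

Lemma nrm_gt0 (z : C) : (0 < nrm z) = (z != 0).
Proof. by rewrite lt_def nrm_eq0 nrm_ge0 andbT. Qed.

Lemma nrm_sum (I : Type) (s : seq I) (P : pred I) (f : I -> C) :
  nrm (\sum_(i <- s | P i) f i) <= \sum_(i <- s | P i) nrm (f i).
Proof.
elim/big_rec2: _ => [|i x y _ H]; first by rewrite Normc.normc0.
by apply: le_trans (le_normcD _ _) _; rewrite lerD2l.
Qed.

Lemma nrm_Re (z : C) : `|re z| <= nrm z.
Proof.
case: z => a b /=; rewrite -sqrtr_sqr ler_sqrt ?addr_ge0 ?sqr_ge0 //.
by rewrite lerDl sqr_ge0.
Qed.

Lemma nrm_Im (z : C) : `|im z| <= nrm z.
Proof.
case: z => a b /=; rewrite -sqrtr_sqr ler_sqrt ?addr_ge0 ?sqr_ge0 //.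
by rewrite lerDr sqr_ge0.
Qed.

Lemma nrm_toC (x : R) : nrm (toC x) = `|x|.
Proof. by rewrite /= expr0n /= addr0 sqrtr_sqr. Qed.

Lemma nrmX (z : C) n : nrm (z ^+ n) = nrm z ^+ n.
Proof. by elim: n => [|n IH]; rewrite ?expr0 ?Normc.normc1 // !exprS Normc.normcM IH. Qed.

Lemma nrm_prod (I : Type) (s : seq I) (f : I -> C) :
  nrm (\prod_(i <- s) f i) = \prod_(i <- s) nrm (f i).
Proof. by elim: s => [|i s IH]; rewrite ?big_nil ?Normc.normc1 // !big_cons Normc.normcM IH. Qed.

Lemma nrm_eq0_small (z : C) : (forall e : R, 0 < e -> nrm z <= e) -> z = 0.
Proof.
move=> H; apply/eqP; rewrite -nrm_eq0 eq_le nrm_ge0 andbT.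
by apply/ler_addgt0Pr => e e0; rewrite add0r H.
Qed.

Lemma Re_sum (I : Type) (s : seq I) (P : pred I) (f : I -> C) :
  re (\sum_(i <- s | P i) f i) = \sum_(i <- s | P i) re (f i).
Proof. by elim/big_rec2: _ => [//|i x y _ <-]; case: (f i); case: y. Qed.

Lemma Im_sum (I : Type) (s : seq I) (P : pred I) (f : I -> C) :
  im (\sum_(i <- s | P i) f i) = \sum_(i <- s | P i) im (f i).
Proof. by elim/big_rec2: _ => [//|i x y _ <-]; case: (f i); case: y. Qed.

(* Unconditional summation over an arbitrary index type, along the net of its
   finite subsets. *)
Definition summable (I : eqType) (f : I -> C) : Prop :=
  exists M : R, forall s, uniq s -> \sum_(i <- s) nrm (f i) <= M.
Definition has_sum (I : eqType) (f : I -> C) (l : C) : Prop :=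
  forall e : R, 0 < e -> exists s0 : seq I,
  forall s, uniq s -> {subset s0 <= s} -> nrm (\sum_(i <- s) f i - l) < e.

Lemma mulrn_div_lt (c : R) n : 0 < c -> c / n.+1%:R *+ n < c.
Proof.
move=> c0; rewrite -mulr_natr -mulrA -[ltRHS]mulr1 ltr_pM2l // mulrC.
by rewrite ltr_pdivrMr ?ltr0n // mul1r ltr_nat.
Qed.

Lemma has_sum_ext (I : eqType) (f h : I -> C) l : f =1 h -> has_sum f l -> has_sum h l.
Proof. by move=> fh H e /H[s0 Hs]; exists s0 => s us ss; rewrite -(eq_bigr _ (fun i _ => fh i)) Hs. Qed.

Lemma summable_ext (I : eqType) (f h : I -> C) : f =1 h -> summable f -> summable h.
Proof. by move=> fh [M H]; exists M => s us; rewrite -(eq_bigr _ (fun i _ => f_equal _ (fh i))) H. Qed.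

Lemma summable_le (I : eqType) (f h : I -> C) :
  (forall i, nrm (h i) <= nrm (f i)) -> summable f -> summable h.
Proof. by move=> fh [M H]; exists M => s us; apply: le_trans (H s us); apply: ler_sum. Qed.

Lemma summableD (I : eqType) (f h : I -> C) :
  summable f -> summable h -> summable (fun i => f i + h i).
Proof.
move=> [M HM] [M' HM']; exists (M + M') => s us.
apply: le_trans (lerD (HM s us) (HM' s us)); rewrite -big_split /=.
by apply: ler_sum => i _; exact: le_normcD.
Qed.

Lemma summableZ (I : eqType) (f : I -> C) (c : C) :
  summable f -> summable (fun i => c * f i).
Proof.
move=> [M HM]; exists (nrm c * M) => s us.
under eq_bigr do rewrite Normc.normcM.
by rewrite -mulr_sumr ler_wpM2l ?nrm_ge0 ?HM.
Qed.

Lemma has_sum_uniq (I : eqType) (f : I -> C) l l' : has_sum f l -> has_sum f l' -> l = l'.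
Proof.
move=> H H'; apply/eqP; rewrite -subr_eq0; apply/eqP/nrm_eq0_small => e e0.
have e2 : 0 < e / 2 by rewrite divr_gt0.
have [s0 Hs] := H _ e2; have [s1 Hs'] := H' _ e2.
pose s := undup (s0 ++ s1).
have us : uniq s by rewrite undup_uniq.
have a0 : {subset s0 <= s} by move=> x; rewrite mem_undup mem_cat => ->.
have a1 : {subset s1 <= s} by move=> x; rewrite mem_undup mem_cat orbC => ->.
have -> : l - l' = (\sum_(i <- s) f i - l') - (\sum_(i <- s) f i - l).
  by ring.
apply: le_trans (le_nrmB _ _) _.
by rewrite [e]splitr lerD // ltW // ?Hs ?Hs'.
Qed.

Lemma has_sumD (I : eqType) (f h : I -> C) l l' :
  has_sum f l -> has_sum h l' -> has_sum (fun i => f i + h i) (l + l').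
Proof.
move=> H H' e e0.
have e2 : 0 < e / 2 by rewrite divr_gt0.
have [s0 Hs] := H _ e2; have [s1 Hs'] := H' _ e2.
exists (s0 ++ s1) => s us ss; rewrite big_split /= opprD addrACA [e]splitr.
apply: le_lt_trans (le_normcD _ _) _; apply: ltrD.
  by apply: Hs => // x xs; apply: ss; rewrite mem_cat xs.
by apply: Hs' => // x xs; apply: ss; rewrite mem_cat xs orbT.
Qed.

Lemma has_sumZ (I : eqType) (f : I -> C) c l :
  has_sum f l -> has_sum (fun i => c * f i) (c * l).
Proof.
move=> H e e0; have c1 : 0 < nrm c + 1 by rewrite ltr_wpDl ?nrm_ge0.
have [s0 Hs] := H _ (divr_gt0 e0 c1); exists s0 => s us ss.
rewrite -mulr_sumr -mulrBr Normc.normcM.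
have := Hs s us ss; rewrite ltr_pdivlMr // mulrC; apply: le_lt_trans.
by rewrite ler_wpM2r ?nrm_ge0 // lerDl.
Qed.

Lemma has_sumN (I : eqType) (f : I -> C) l : has_sum f l -> has_sum (fun i => - f i) (- l).
Proof. by move=> /(has_sumZ (-1)); rewrite mulN1r; apply: has_sum_ext => i; rewrite mulN1r. Qed.

Lemma has_sum_fin (I : eqType) (f : I -> C) (s : seq I) :
  uniq s -> (forall i, i \notin s -> f i = 0) -> has_sum f (\sum_(i <- s) f i).
Proof.
move=> us H e e0; exists s => s' us' ss.
suff -> : \sum_(i <- s') f i = \sum_(i <- s) f i by rewrite subrr Normc.normc0.
have P : perm_eq s [seq x <- s' | x \in s].
  apply: uniq_perm => //; first exact: filter_uniq.
  by move=> x; rewrite mem_filter /=; case: (boolP (x \in s)) => //= /ss ->.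
rewrite (perm_big _ P) big_filter /= [LHS](bigID (mem s)) /= [X in _ + X]big1 ?addr0 //.
Qed.

Lemma has_sum0 (I : eqType) : has_sum (fun _ : I => 0) 0.
Proof. by have := @has_sum_fin I (fun _ => 0) [::] erefl (fun _ _ => erefl); rewrite big_nil. Qed.

Lemma has_sum_sum (I : eqType) (J : Type) (s : seq J) (f : J -> I -> C) (l : J -> C) :
  (forall j, has_sum (f j) (l j)) ->
  has_sum (fun i => \sum_(j <- s) f j i) (\sum_(j <- s) l j).
Proof.
move=> H; elim: s => [|j s IH].
  by rewrite big_nil; apply: has_sum_ext (has_sum0 I) => i; rewrite big_nil.
rewrite big_cons; apply: has_sum_ext (has_sumD (H j) IH) => i.
by rewrite big_cons.
Qed.

Lemma summable_sum (I : eqType) (J : Type) (s : seq J) (f : J -> I -> C) :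
  (forall j, summable (f j)) -> summable (fun i => \sum_(j <- s) f j i).
Proof.
move=> H; elim: s => [|j s IH].
  by exists 0 => t _; rewrite big1 // => i _; rewrite big_nil Normc.normc0.
by apply: summable_ext (summableD (H j) IH) => i; rewrite big_cons.
Qed.

(** A finite set whose sum of norms comes within e of the supremum leaves less than e for anything
    disjoint from it. *)
Lemma summable_tail (I : eqType) (f : I -> C) : summable f ->
  forall e : R, 0 < e -> exists s0 : seq I, uniq s0 /\
  forall s, uniq s -> (forall i, i \in s -> i \notin s0) -> \sum_(i <- s) nrm (f i) < e.
Proof.
move=> [M HM] e e0.
pose E := [set x : R | exists2 s, uniq s & x = \sum_(i <- s) nrm (f i)]%classic.
have hE : has_sup E.
  split; first by exists 0; exists [::] => //; rewrite big_nil.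
  by exists M => x [s us ->]; exact: HM.
have [x [s0 us0 ->] Hx] := sup_adherent e0 hE.
exists s0; split => // s us dis.
have us' : uniq (s0 ++ s).
  rewrite cat_uniq us0 us andbT /=; apply/hasPn => y /dis.
  by rewrite /= => /negbTE ->.
have : \sum_(i <- s0 ++ s) nrm (f i) <= sup E.
  by apply: ub_le_sup; [case: hE | exists (s0 ++ s)].
rewrite big_cat /= => H; lra.
Qed.

Lemma has_sum_ge0R (I : eqType) (a : I -> R) : (forall i, 0 <= a i) ->
  summable (fun i => toC (a i)) -> exists l : R, has_sum (fun i => toC (a i)) (toC l).
Proof.
move=> a0 [M HM].
have HM' s : uniq s -> \sum_(i <- s) a i <= M.
  move=> us; apply: le_trans (HM s us); apply: ler_sum => i _.
  by rewrite nrm_toC ler_norm.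
pose E := [set x : R | exists2 s, uniq s & x = \sum_(i <- s) a i]%classic.
have hE : has_sup E.
  split; first by exists 0; exists [::] => //; rewrite big_nil.
  by exists M => x [s us ->]; exact: HM'.
exists (sup E) => e e0.
have [x [s0 us0 ->] Hx] := sup_adherent e0 hE.
exists s0 => s us ss.
have h1 : \sum_(i <- s) a i <= sup E by apply: ub_le_sup; [case: hE | exists s].
have h2 : \sum_(i <- s0) a i <= \sum_(i <- s) a i.
  have P : perm_eq s0 [seq x <- s | x \in s0].
    apply: uniq_perm => //; first exact: filter_uniq.
    by move=> y; rewrite mem_filter /=; case: (boolP (y \in s0)) => //= /ss ->.
  rewrite (perm_big _ P) big_filter /= [leRHS](bigID (mem s0)) /= lerDl.
  by apply: sumr_ge0.
have -> : \sum_(i <- s) toC (a i) - toC (sup E) = toC (\sum_(i <- s) a i - sup E).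
  by rewrite /toC rmorphB rmorph_sum.
rewrite nrm_toC ltr_norml; lra.
Qed.

(** [a] is the difference of the nonnegative families [|a| + a] and [|a|]. *)
Lemma has_sumR (I : eqType) (a : I -> R) :
  summable (fun i => toC (a i)) -> exists l : R, has_sum (fun i => toC (a i)) (toC l).
Proof.
move=> H.
have H1 : summable (fun i => toC `|a i|).
  by apply: summable_le H => i; rewrite !nrm_toC normr_id.
have H2 : summable (fun i => toC (`|a i| + a i)).
  by apply: summable_ext (summableD H1 H) => i; rewrite /toC rmorphD.
have [l1 h1] := has_sum_ge0R (fun i => normr_ge0 (a i)) H1.
have h0 i : 0 <= `|a i| + a i by rewrite -lerBlDr sub0r -normrN ler_norm.
have [l2 h2] := has_sum_ge0R h0 H2.
exists (l2 - l1).
have -> : toC (l2 - l1) = toC l2 + - toC l1 by rewrite /toC rmorphB.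
apply: has_sum_ext (has_sumD h2 (has_sumN h1)) => i.
by rewrite /toC -rmorphN -rmorphD addrAC addrN add0r.
Qed.

Lemma toCE (z : C) : z = toC (re z) + iC R * toC (im z).
Proof. by case: z => a b; rewrite /toC /iC; simpc. Qed.

Lemma summable_has_sum (I : eqType) (f : I -> C) : summable f -> exists l, has_sum f l.
Proof.
move=> H.
have [a ha] : exists l : R, has_sum (fun i => toC (re (f i))) (toC l).
  by apply: has_sumR; apply: summable_le H => i; rewrite nrm_toC nrm_Re.
have [b hb] : exists l : R, has_sum (fun i => toC (im (f i))) (toC l).
  by apply: has_sumR; apply: summable_le H => i; rewrite nrm_toC nrm_Im.
exists (toC a + iC R * toC b).
by apply: has_sum_ext (has_sumD ha (has_sumZ (iC R) hb)) => i; rewrite -toCE.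
Qed.

Lemma has_sum_nrm_le (I : eqType) (f : I -> C) l (M : R) :
  (forall s, uniq s -> \sum_(i <- s) nrm (f i) <= M) -> has_sum f l -> nrm l <= M.
Proof.
move=> HM H; apply/ler_addgt0Pr => e e0.
have [s0 Hs] := H _ e0.
have us := undup_uniq s0.
have := Hs _ us (fun x xs => ltac:(by rewrite mem_undup)).
move=> h; have := HM _ us; have := nrm_sum (undup s0) predT f.
have := le_nrmB (\sum_(i <- undup s0) f i) (\sum_(i <- undup s0) f i - l).
rewrite opprB addrC subrK; lra.
Qed.

Lemma sum_fiber (I J : eqType) (p : I -> J) (f : I -> C) (s : seq I) (t : seq J) :
  uniq t -> (forall i, i \in s -> p i \in t) ->
  \sum_(j <- t) \sum_(i <- s | p i == j) f i = \sum_(i <- s) f i.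
Proof.
move=> ut H; under eq_bigr do rewrite big_mkcond.
rewrite exchange_big big_seq [RHS]big_seq; apply: eq_bigr => i /H pit /=.
rewrite (bigD1_seq (p i)) //= eqxx big1 ?addr0 // => j /negbTE jn.
by rewrite eq_sym jn.
Qed.

(** Over a finite set t of fibres, the sum of h is approximated by a finite sum of f whose index set
    lies over t and contains a prescribed finite set; the error e / 2 is shared among the fibres of
    t. *)
Lemma has_sum_fiber (I J : eqType) (p : I -> J) (f : I -> C) (h : J -> C) l :
  summable f -> (forall j, has_sum (fun i => if p i == j then f i else 0) (h j)) ->
  has_sum f l -> has_sum h l.
Proof.
move=> sf Hh Hf e e0.
have e2 : 0 < e / 2 by rewrite divr_gt0.
have [s0 Hs0] := Hf _ e2; have [s1 [us1 Hs1]] := summable_tail sf e2.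
pose sI := undup (s0 ++ s1).
exists (map p sI) => t ut ht.
have [s [us [ss hs]]] : exists s, uniq s /\ {subset [seq i <- s | p i \in t] <= s} /\
   ({subset sI <= s} /\ (forall i, i \in s -> p i \in t)) /\
   nrm (\sum_(j <- t) h j - \sum_(i <- s) f i) < e / 2.
  have tn : 0 < e / 2 / (size t).+1%:R by rewrite divr_gt0 // ltr0n.
  have Q : forall j, exists s0 : seq I, forall s, uniq s -> {subset s0 <= s} ->
     nrm (\sum_(i <- s) (if p i == j then f i else 0) - h j) < e / 2 / (size t).+1%:R.
    by move=> j; exact: (Hh j _ tn).
  have [F HF] := boolp.choice Q.
  pose s := [seq i <- undup (sI ++ flatten (map F t)) | p i \in t].
  have us : uniq s by rewrite filter_uniq // undup_uniq.
  exists s; split => //; split; first by move=> i; rewrite mem_filter => /andP[].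
  split; first split.
  - move=> i ii; rewrite mem_filter mem_undup mem_cat ii /= andbT.
    by apply: ht; apply: map_f.
  - by move=> i; rewrite mem_filter => /andP[].
  have hs : forall i, i \in s -> p i \in t by move=> i; rewrite mem_filter => /andP[].
  rewrite -(sum_fiber f ut hs) -sumrB.
  apply: le_lt_trans (nrm_sum _ _ _) _.
  have : \sum_(j <- t) nrm (h j - \sum_(i <- s | p i == j) f i)
        <= \sum_(j <- t) (e / 2 / (size t).+1%:R).
    rewrite big_seq [leRHS]big_seq; apply: ler_sum => j jt.
    pose sj := undup (s ++ F j).
    have := HF j sj (undup_uniq _) (fun x xs => ltac:(by rewrite mem_undup mem_cat xs orbT)).
    rewrite nrmB => /ltW; apply: le_trans; rewrite le_eqVlt; apply/orP; left; apply/eqP.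
    congr (nrm (_ - _)); rewrite -big_mkcond /=.
    have P : perm_eq [seq i <- s | p i == j] [seq i <- sj | p i == j].
      apply: uniq_perm; rewrite ?filter_uniq ?undup_uniq // => x.
      rewrite !(@mem_filter _ (fun i => p i == j)); case: eqP => //= pxj.
      rewrite [RHS]mem_undup mem_cat; case: (boolP (x \in s)) => //= xs.
      apply/esym/negP => xF; move/negP: xs; apply.
      rewrite mem_filter pxj jt /= mem_undup mem_cat; apply/orP; right.
      by apply/flattenP; exists (F j) => //; apply: map_f.
    by rewrite -big_filter (perm_big _ P) big_filter.
  move=> /le_lt_trans; apply.
  rewrite big_const_seq count_predT iter_addr_0 -mulr_natr.
  by rewrite mulr_natr mulrn_div_lt.
have [[sIs hst] he] := hs.
have := Hs0 s us (fun x xs => sIs x ltac:(by rewrite mem_undup mem_cat xs)).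
move=> h1; rewrite [e]splitr.
have -> : \sum_(j <- t) h j - l = (\sum_(j <- t) h j - \sum_(i <- s) f i) + (\sum_(i <- s) f i - l).
  by rewrite addrA subrK.
by apply: le_lt_trans (le_normcD _ _) _; apply: ltrD.
Qed.

Lemma summable_if (I : eqType) (P : pred I) (f : I -> C) :
  summable f -> summable (fun i => if P i then f i else 0).
Proof. by apply: summable_le => i; case: (P i); rewrite ?Normc.normc0 ?nrm_ge0. Qed.

Lemma fiber_sums (I J : eqType) (p : I -> J) (f : I -> C) : summable f ->
  exists h : J -> C, forall j, has_sum (fun i => if p i == j then f i else 0) (h j).
Proof.
move=> sf.
have Q j : exists l, has_sum (fun i => if p i == j then f i else 0) l.
  by apply: summable_has_sum; exact: (@summable_if _ (fun i => p i == j)).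
by have [h Hh] := boolp.choice Q; exists h.
Qed.

(** The fibre sums of the norms dominate [nrm (h j)], and finitely many of them add up to at most
    the bound M for f. *)
Lemma summable_fiber (I J : eqType) (p : I -> J) (f : I -> C) (h : J -> C) :
  summable f -> (forall j, has_sum (fun i => if p i == j then f i else 0) (h j)) ->
  summable h.
Proof.
move=> sf; have [M HM] := sf.
have [h' Hh'] : exists h' : J -> C, forall j,
    has_sum (fun i => if p i == j then toC (nrm (f i)) else 0) (h' j).
  apply: fiber_sums; apply: summable_le sf => i.
  by rewrite nrm_toC ger0_norm ?nrm_ge0.
move=> Hh; exists M => t ut.
have hle : forall j, nrm (h j) <= re (h' j).
  move=> j; apply/ler_addgt0Pr => e e0.
  have [s0 H0] := Hh j _ (divr_gt0 e0 (ltr0Sn R 1)).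
  have [s1 H1] := Hh' j _ (divr_gt0 e0 (ltr0Sn R 1)).
  pose s := undup (s0 ++ s1).
  have {H0} := H0 s (undup_uniq _) (fun x xs => ltac:(by rewrite mem_undup mem_cat xs)).
  have {H1} := H1 s (undup_uniq _) (fun x xs => ltac:(by rewrite mem_undup mem_cat xs orbT)).
  set A := \sum_(i <- s) _; set B := \sum_(i <- s) _ => hA hB.
  have AE : A = toC (\sum_(i <- s | p i == j) nrm (f i)).
    by rewrite /A -big_mkcond /toC rmorph_sum.
  have hBA : nrm B <= re A.
    by rewrite AE /B -big_mkcond /=; exact: nrm_sum.
  have := le_nrmB B (B - h j); rewrite opprB addrC subrK.
  have := nrm_Re (A - h' j).
  have -> : re (A - h' j) = re A - re (h' j) by case: (A) => ? ?; case: (h' j) => ? ?.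
  move=> a1 a2; have := ler_norm (re A - re (h' j)).
  have e2 := splitr e; move: (e / 2) e2 hA hB => e' -> hA hB.
  lra.
apply: le_trans (ler_sum _ (fun j _ => hle j)) _.
rewrite -Re_sum.
have H := has_sum_sum t Hh'.
have : nrm (\sum_(j <- t) h' j) <= M.
  apply: (has_sum_nrm_le _ H) => s us; apply: le_trans (HM s us).
  apply: ler_sum => i _.
  apply: le_trans (nrm_sum _ _ _) _.
  under eq_bigr do rewrite fun_if Normc.normc0 nrm_toC ger0_norm ?nrm_ge0 //.
  case: (boolP (p i \in t)) => pit.
    rewrite (bigD1_seq (p i)) //= eqxx big1 ?addr0 // => j /negbTE jn.
    by rewrite eq_sym jn.
  rewrite big_seq big1 ?nrm_ge0 // => j jt; case: eqP => // pj.
  by rewrite pj jt in pit.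
by apply: le_trans; apply: le_trans (ler_norm _) (nrm_Re _).
Qed.

Lemma has_sum_inj (I J : eqType) (q : J -> I) (f : I -> C) l :
  injective q -> (forall i, (forall j, q j != i) -> f i = 0) ->
  has_sum (f \o q) l -> has_sum f l.
Proof.
move=> iq f0 H e e0; have [s0 Hs] := H _ e0; exists (map q s0) => s us ss.
have [t [ut [t0 Ht]]] : exists t, uniq t /\ {subset s0 <= t} /\
    \sum_(i <- s) f i = \sum_(j <- t) f (q j).
  have [r Hr] : exists r : I -> option J, forall i, match r i with
      | Some j => q j = i | None => forall j, q j != i end.
    have Q i : exists o, match o with
      | Some j => q j = i | None => forall j, q j != i end.
      case: (pselect (exists j, q j = i)) => [[j hj]|nh]; first by exists (Some j).
      by exists None => j; apply/eqP => hj; apply: nh; exists j.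
    by have [r Hr] := boolp.choice Q; exists r.
  have rq j : r (q j) = Some j.
    by have := Hr (q j); case: (r (q j)) => [j' /iq -> //|/(_ j)]; rewrite eqxx.
  exists (pmap r s); split.
    by apply: (@pmap_uniq _ _ _ q) => // i; have := Hr i; case: (r i) => //= j ->.
  split.
    by move=> j js; rewrite mem_pmap; apply/mapP; exists (q j); rewrite ?rq // ss ?map_f.
  elim: (s) => [|i s' IH]; first by rewrite !big_nil.
  rewrite big_cons IH /=; have := Hr i; case: (r i) => [j <-|/f0 ->] /=.
    by rewrite big_cons.
  by rewrite add0r.
by rewrite Ht; apply: Hs.
Qed.

Lemma summable_inj (I J : eqType) (q : J -> I) (f : I -> C) :
  injective q -> summable f -> summable (f \o q).
Proof.
move=> iq [M HM]; exists M => s us; have := HM (map q s).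
by rewrite big_map map_inj_uniq //; apply.
Qed.

Lemma summable_pair (I J : eqType) (f : I -> C) (h : J -> C) :
  summable f -> summable h -> summable (fun x : I * J => f x.1 * h x.2).
Proof.
move=> [M HM] [N HN].
have M0 : 0 <= M by have := HM [::] erefl; rewrite big_nil.
exists (M * N) => s us.
pose s1 := undup (map fst s); pose s2 := undup (map snd s).
have : \sum_(x <- s) nrm (f x.1 * h x.2) <=
  \sum_(x <- [seq (a, b) | a <- s1, b <- s2]) nrm (f x.1 * h x.2).
  set t := [seq _ | _ <- _, _ <- _].
  have st : {subset s <= t}.
    move=> [a b] xs; apply/allpairsP; exists (a, b) => /=; split => //.
      by rewrite mem_undup; apply/mapP; exists (a, b).
    by rewrite mem_undup; apply/mapP; exists (a, b).
  have P : perm_eq s [seq x <- t | x \in s].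
    apply: uniq_perm => //.
      rewrite filter_uniq // allpairs_uniq ?undup_uniq //.
      by move=> [a b] [a' b'] _ _ [-> ->].
    by move=> y; rewrite mem_filter /=; case: (boolP (y \in s)) => //= /st ->.
  rewrite (perm_big _ P) big_filter [leRHS](bigID (mem s)) /= lerDl.
  by apply: sumr_ge0 => ? _; exact: nrm_ge0.
move=> /le_trans; apply.
rewrite big_allpairs_dep /=.
under eq_bigr do under eq_bigr do rewrite Normc.normcM.
under eq_bigr do rewrite -mulr_sumr.
rewrite -mulr_suml; apply: ler_pM; rewrite ?HM ?HN ?undup_uniq //;
  by apply: sumr_ge0 => ? _; exact: nrm_ge0.
Qed.

Lemma summable_pair_row (I J : eqType) (f : I * J -> C) (h : I -> C) l :
  summable f -> (forall i, has_sum (fun j => f (i, j)) (h i)) ->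
  has_sum f l -> summable h /\ has_sum h l.
Proof.
move=> sf Hh Hl.
have H i : has_sum (fun x : I * J => if x.1 == i then f x else 0) (h i).
  apply: (@has_sum_inj _ _ (fun j : J => (i, j))); first by move=> ? ? [].
    move=> [a b] /= H; case: eqP => // ai.
    by have := H b; rewrite ai eqxx.
  by apply: has_sum_ext (Hh i) => j /=; rewrite eqxx.
by split; [exact: summable_fiber sf H | exact: has_sum_fiber sf H Hl].
Qed.

Lemma has_sum_pair (I J : eqType) (f : I -> C) (h : J -> C) a b :
  summable f -> summable h -> has_sum f a -> has_sum h b ->
  has_sum (fun x : I * J => f x.1 * h x.2) (a * b).
Proof.
move=> sf sh Hf Hh; have sfh := summable_pair sf sh.
have [l Hl] := summable_has_sum sfh; suff -> : a * b = l by [].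
have [_ H] := summable_pair_row sfh (fun i => has_sumZ (f i) Hh) Hl.
apply: has_sum_uniq H; rewrite mulrC.
by apply: has_sum_ext (has_sumZ b Hf) => i; rewrite mulrC.
Qed.

(* The boxes s^J are cofinal among the finite subsets of I^J. *)
Definition box (I : eqType) (J : finType) (s : seq I) (x0 : I) : seq {ffun J -> I} :=
  [seq [ffun j => nth x0 s (nat_of_ord (k j))] |
    k : {ffun J -> 'I_(size s)} <- index_enum {ffun J -> 'I_(size s)}].

Lemma sum_box (I : eqType) (J : finType) (K : comNzRingType) (F : J -> I -> K) (s : seq I) x0 :
  uniq s ->
  \sum_(N <- (box J s x0))
     \prod_j F j (N j) = \prod_j \sum_(i <- s) F j i.
Proof.
move=> us; rewrite big_map.
under [RHS]eq_bigr do rewrite (big_nth x0) big_mkord.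
rewrite bigA_distr_bigA /=; apply: eq_bigr => k _; apply: eq_bigr => j _.
by rewrite ffunE.
Qed.

Lemma uniq_box (I : eqType) (J : finType) (s : seq I) x0 : uniq s ->
  uniq (box J s x0).
Proof.
move=> us; rewrite map_inj_uniq ?index_enum_uniq // => k k' /ffunP H.
apply/ffunP => j; have := H j; rewrite !ffunE => /eqP.
by rewrite nth_uniq // => /eqP/val_inj.
Qed.

Lemma mem_box (I : eqType) (J : finType) (s : seq I) x0 (N : {ffun J -> I}) :
  (forall j, N j \in s) ->
  N \in (box J s x0).
Proof.
move=> H.
have Hs j : (index (N j) s < size s)%N by rewrite index_mem.
apply/mapP; exists [ffun j => Ordinal (Hs j)]; first by rewrite mem_index_enum.
by apply/ffunP => j; rewrite !ffunE /= nth_index.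
Qed.

Lemma box_cover (I : eqType) (J : finType) (t : seq {ffun J -> I}) (s : seq I) :
  exists s', [/\ uniq s', {subset s <= s'} & forall N, N \in t -> forall j, N j \in s'].
Proof.
exists (undup (s ++ flatten [seq [seq N j | j <- enum J] | N : {ffun J -> I} <- t])).
split; first exact: undup_uniq.
  by move=> x xs; rewrite mem_undup mem_cat xs.
move=> N Nt j; rewrite mem_undup mem_cat; apply/orP; right; apply/flattenP.
exists [seq N j | j <- enum J]; first by apply/mapP; exists N.
by apply/mapP; exists j; rewrite ?mem_enum.
Qed.

Lemma summable_ffun (I : eqType) (J : finType) (f : J -> I -> C) (x0 : I) :
  (forall j, summable (f j)) ->
  summable (fun N : {ffun J -> I} => \prod_j f j (N j)).
Proof.
move=> sf; have [M HM] := boolp.choice sf.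
have M0 j : 0 <= M j by have := HM j [::] erefl; rewrite big_nil.
exists (\prod_j M j) => t ut.
have [s [us _ ts]] := box_cover t [::].
apply: (@le_trans _ _ (\prod_j \sum_(i <- s) nrm (f j i))); last first.
  by apply: ler_prod => j _; rewrite HM // sumr_ge0 // => ? _; exact: nrm_ge0.
rewrite -(sum_box _ x0 us).
set T := box _ _ _.
have P : perm_eq t [seq x <- T | x \in t].
  apply: uniq_perm => //; first by rewrite filter_uniq // uniq_box.
  move=> y; rewrite mem_filter /=; case: (boolP (y \in t)) => //= yt.
  by apply/esym/mem_box; exact: ts.
rewrite (perm_big _ P) big_filter /= [leRHS](bigID (mem t)) /= -[leLHS]addr0.
rewrite lerD //; first by rewrite le_eqVlt; apply/orP; left; apply/eqP;
  apply: eq_bigr => N _; rewrite nrm_prod.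
by apply: sumr_ge0 => ? _; apply: prodr_ge0 => ? _; exact: nrm_ge0.
Qed.

Lemma nrm_continuousM (a b x y : C) :
  nrm (a * b - x * y) <= nrm (a - x) * nrm (b - y) + nrm x * nrm (b - y) + nrm y * nrm (a - x).
Proof.
have -> : a * b - x * y = (a - x) * (b - y) + x * (b - y) + y * (a - x) by ring.
rewrite -!Normc.normcM; apply: le_trans (le_normcD _ _) _; rewrite lerD2r.
exact: le_normcD.
Qed.

Lemma prod_approx (J : Type) (s : seq J) (l : J -> C) (e : R) : 0 < e ->
  exists2 d : R, 0 < d & forall a : J -> C, (forall j, nrm (a j - l j) < d) ->
    nrm (\prod_(j <- s) a j - \prod_(j <- s) l j) < e.
Proof.
elim: s e => [|j s IH] e e0.
  by exists 1 => // a _; rewrite !big_nil subrr Normc.normc0.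
set L := \prod_(j <- s) l j in IH *.
pose c := 1 + nrm (l j) + nrm L.
have c0 : 0 < c by rewrite /c -addrA ltr_wpDr ?addr_ge0 ?nrm_ge0.
have ec : 0 < Num.min (e / c) 1 / 2 by rewrite divr_gt0 // lt_min divr_gt0 // ltr01.
have [d d0 H] := IH _ ec.
exists (Num.min d (Num.min (e / c) 1 / 2)); first by rewrite lt_min d0.
move=> a Ha; rewrite !big_cons -/L.
have h1 : nrm (\prod_(j <- s) a j - L) < Num.min (e / c) 1 / 2.
  by apply: H => i; have := Ha i; rewrite lt_min => /andP[].
have h2 : nrm (a j - l j) < Num.min (e / c) 1 / 2.
  by have := Ha j; rewrite lt_min => /andP[].
apply: le_lt_trans (nrm_continuousM _ _ _ _) _.
have m1 : Num.min (e / c) 1 <= 1 by rewrite ge_min lexx orbT.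
have m2 : Num.min (e / c) 1 <= e / c by rewrite ge_min lexx.
move: (Num.min (e / c) 1) m1 m2 ec h1 h2 => m m1 m2 ec h1 h2.
have mc : m * c <= e by rewrite -ler_pdivlMr.
move: (nrm_ge0 (a j - l j)) (nrm_ge0 (\prod_(j <- s) a j - L)) h1 h2 mc.
rewrite /c; move: (nrm_ge0 (l j)) (nrm_ge0 L).
move: (nrm (a j - l j)) (nrm (\prod_(j <- s) a j - L)) (nrm (l j)) (nrm L) => x y u v.
by move=> u0 v0 x0 y0 h1 h2 mc; nra.
Qed.

(** Summability of the product family provides some sum L; the boxes, over which the sum factors,
    identify it with the product of the sums. *)
Lemma has_sum_ffun (I : eqType) (J : finType) (f : J -> I -> C) (l : J -> C) (x0 : I) :
  (forall j, summable (f j)) -> (forall j, has_sum (f j) (l j)) ->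
  has_sum (fun N : {ffun J -> I} => \prod_j f j (N j)) (\prod_j l j).
Proof.
move=> sf Hl; have sF := summable_ffun x0 sf.
have [L HL] := summable_has_sum sF; suff -> : \prod_j l j = L by [].
apply/eqP; rewrite -subr_eq0; apply/eqP/nrm_eq0_small => e e0.
have e2 : 0 < e / 2 by rewrite divr_gt0.
have [t Ht] := HL _ e2.
have [d d0 Hd] := prod_approx (index_enum J) l e2.
have [s0 Hs0] := boolp.choice (fun j => Hl j d d0).
have [s [us s0s ts]] := box_cover t (flatten [seq s0 j | j <- enum J]).
have h1 : nrm (\prod_j (\sum_(i <- s) f j i) - \prod_j l j) < e / 2.
  apply: Hd => j; apply: Hs0 => // x xj; apply: s0s; apply/flattenP.
  by exists (s0 j) => //; apply: map_f; rewrite mem_enum.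
have := Ht _ (uniq_box J x0 us) (fun N Nt => mem_box x0 (ts N Nt)).
rewrite sum_box // => h2.
set P := \prod_j \sum_(i <- s) f j i in h1 h2.
have -> : \prod_j l j - L = (P - L) - (P - \prod_j l j) by ring.
by apply: le_trans (le_nrmB _ _) _; rewrite [e]splitr lerD // ltW.
Qed.

End UnorderedSums.

(** * Power series *)

Section PowerSeries.
Variable R : realType.
Local Notation C := R[i].

Lemma cauchy_product (a b : nat -> C) la lb :
  summable a -> summable b -> has_sum a la -> has_sum b lb ->
  summable (fun n => \sum_(j < n.+1) a j * b (n - j)%N) /\
  has_sum (fun n => \sum_(j < n.+1) a j * b (n - j)%N) (la * lb).
Proof.
move=> sa sb ha hb.
have sab := summable_pair sa sb; have hab := has_sum_pair sa sb ha hb.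
have H n : has_sum (fun x : nat * nat => if (x.1 + x.2 == n)%N then a x.1 * b x.2 else 0)
   (\sum_(j < n.+1) a j * b (n - j)%N).
  pose s := [seq (nat_of_ord j, n - j)%N | j <- index_enum 'I_n.+1].
  have us : uniq s.
    by rewrite map_inj_uniq ?index_enum_uniq // => i j [] /val_inj.
  have hs i : i \notin s -> (if (i.1 + i.2 == n)%N then a i.1 * b i.2 else 0) = 0.
    case: i => i j /=; case: eqP => // ij; case/negP.
    have lt : (i < n.+1)%N by rewrite ltnS -ij leq_addr.
    apply/mapP; exists (Ordinal lt); first by rewrite mem_index_enum.
    by rewrite /= -ij addKn.
  have := has_sum_fin us hs; rewrite big_map /=.
  congr (has_sum _ _); apply: eq_bigr => j _.
  by rewrite subnKC ?eqxx // -ltnS.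
split; first exact: (summable_fiber (p := fun x : nat * nat => (x.1 + x.2)%N) sab H).
exact: (has_sum_fiber (p := fun x : nat * nat => (x.1 + x.2)%N) sab H hab).
Qed.

Lemma has_sum_series (a : nat -> C) l : summable a ->
  (forall e : R, 0 < e -> exists N, forall n, (N <= n)%N -> nrm (\sum_(k < n) a k - l) < e) ->
  has_sum a l.
Proof.
move=> sa H; have [l' Hl'] := summable_has_sum sa; suff -> : l = l' by [].
apply/eqP; rewrite -subr_eq0; apply/eqP/nrm_eq0_small => e e0.
have e2 : 0 < e / 2 by rewrite divr_gt0.
have [N HN] := H _ e2; have [s0 Hs0] := Hl' _ e2.
pose n := (N + \max_(i <- s0) i.+1)%N.
have h1 := HN n (leq_addr _ _).
have sub : {subset s0 <= iota 0 n}.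
  move=> x xs; rewrite mem_iota add0n /=.
  apply: leq_trans (leq_addl _ _); rewrite -[leqLHS]/((fun i => i.+1) x).
  exact: (leq_bigmax_seq (F := fun i => i.+1)).
have := Hs0 _ (iota_uniq 0 n) sub.
have -> : \sum_(i <- iota 0 n) a i = \sum_(k < n) a k by rewrite -(big_mkord predT) /index_iota subn0.
move=> h2; have -> : l - l' = (\sum_(k < n) a k - l') - (\sum_(k < n) a k - l) by ring.
by apply: le_trans (le_nrmB _ _) _; rewrite [e]splitr lerD // ltW.
Qed.

Lemma summable_nat (a : nat -> C) (M : R) :
  (forall n, \sum_(k < n) nrm (a k) <= M) -> summable a.
Proof.
move=> H; exists M => s us.
pose n := (\max_(i <- s) i.+1)%N.
have P : perm_eq s [seq x <- iota 0 n | x \in s].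
  apply: uniq_perm => //; first by rewrite filter_uniq // iota_uniq.
  move=> y; rewrite mem_filter mem_iota /= add0n; case: (boolP (y \in s)) => //= ys.
  by apply/esym; exact: (leq_bigmax_seq (F := fun i => i.+1)).
apply: le_trans (H n); rewrite (perm_big _ P) big_filter /=.
have -> : \sum_(k < n) nrm (a k) = \sum_(i <- iota 0 n) nrm (a i).
  by rewrite -(big_mkord predT (fun k => nrm (a k))) /index_iota subn0.
rewrite [leRHS](bigID (mem s)) /= lerDl.
by apply: sumr_ge0 => ? _; exact: nrm_ge0.
Qed.

Lemma has_sum_series_cvg (a : nat -> R) (l : R) : summable (fun n => toC (a n)) ->
  series a @ \oo --> l -> has_sum (fun n => toC (a n)) (toC l).
Proof.
move=> sa /cvgrPdist_lt Hc; apply: has_sum_series => // e e0.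
have [N _ HN] := Hc e e0; exists N => n Nn.
have := HN n Nn; rewrite /= distrC; apply: le_lt_trans.
rewrite -nrm_toC /toC rmorphB rmorph_sum /=.
by rewrite /series /= big_mkord.
Qed.

Lemma summable_exp (x : R) : summable (fun k => toC (exp_coeff x k)).
Proof.
have [M HM] : exists M : R, forall n, \sum_(k < n) exp_coeff `|x| k <= M.
  exists (expR `|x|) => n.
  have := nondecreasing_cvgn_le _ (is_cvg_series_exp_coeff `|x|) n.
  rewrite /series /= big_mkord; apply.
  apply: nondecreasing_series => i _ _; exact: exp_coeff_ge0.
apply: (@summable_nat _ M) => n; apply: le_trans (HM n).
apply: ler_sum => i _; rewrite nrm_toC /exp_coeff /= normrM normrX.
by rewrite normfV normr_nat.
Qed.

Lemma summable_cexp (w : C) : summable (fun k => w ^+ k / k`!%:R).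
Proof.
apply: summable_le (summable_exp (nrm w)) => k.
rewrite Normc.normcM nrmX nrm_toC /exp_coeff /= normrM normrX.
rewrite Normc.normcV [`|nrm w|]ger0_norm ?nrm_ge0 //.
have -> : (k`!%:R : C) = toC k`!%:R by rewrite /toC rmorph_nat.
by rewrite nrm_toC normfV.
Qed.

Lemma iC2 : iC R ^+ 2 = -1.
Proof. by rewrite /iC expr2; simpc. Qed.

Lemma iC_exp k : iC R ^+ k = (-1) ^+ k./2 * (if odd k then iC R else 1).
Proof.
rewrite -{1}[k]odd_double_half exprD -mul2n exprM iC2 mulrC; congr (_ * _).
by case: (odd k); rewrite ?expr1 ?expr0.
Qed.

Lemma has_sum_cexp (w : C) : has_sum (fun k => w ^+ k / k`!%:R) (cexp w).
Proof.
have fE k : (k`!%:R : C) = toC k`!%:R by rewrite /toC rmorph_nat.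
have H1 : has_sum (fun k => toC (re w) ^+ k / k`!%:R) (toC (expR (re w))).
  have := has_sum_series_cvg (summable_exp (re w)) (@is_cvg_series_exp_coeff R (re w)).
  apply: has_sum_ext => k; rewrite /exp_coeff /= fE.
  by rewrite /toC rmorphM rmorphXn fmorphV.
have [S1 S2] : summable (fun k => toC (cos_coeff (im w) k)) /\
               summable (fun k => toC (sin_coeff (im w) k)).
  have E k : toC (im w) ^+ k / k`!%:R = toC (im w ^+ k / k`!%:R).
    by rewrite fE /toC rmorphM rmorphXn fmorphV.
  split; apply: summable_le (summable_cexp (toC (im w))) => k; rewrite E !nrm_toC;
  rewrite /cos_coeff /sin_coeff /= -mulrA normrM ler_piMl //;
  by rewrite normrM normrX normrN1 expr1n mulr1 normr_nat; case: odd.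
have C1 : has_sum (fun k => toC (cos_coeff (im w) k)) (toC (cos (im w))).
  apply: has_sum_series_cvg => //; rewrite unlock; exact: is_cvg_series_cos_coeff.
have C2 : has_sum (fun k => toC (sin_coeff (im w) k)) (toC (sin (im w))).
  apply: has_sum_series_cvg => //; rewrite unlock; exact: is_cvg_series_sin_coeff.
have H2 : has_sum (fun k => (iC R * toC (im w)) ^+ k / k`!%:R)
            (Complex (cos (im w)) (sin (im w))).
  rewrite [Complex _ _]toCE /=.
  apply: has_sum_ext (has_sumD C1 (has_sumZ (iC R) C2)) => k.
  rewrite exprMn iC_exp /cos_coeff /sin_coeff /= fE.
  have -> : ((-1) ^+ k.-1./2 : R) = (if odd k then (-1) ^+ k./2 else (-1) ^+ k.-1./2).
    by case: (boolP (odd k)) => // ok; rewrite -[in RHS](@prednK k) ?odd_gt0 //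
      -uphalfE uphalf_half (_ : odd k.-1 = false) // -(negbK (odd k.-1)) -oddS
      prednK ?odd_gt0 // ok.
  case: (odd k) => /=.
    rewrite !mul0r /toC rmorph0 add0r mul1r !rmorphM !rmorphXn fmorphV rmorphN1.
    by ring.
  rewrite !mul0r mulr0 addr0 mul1r /toC !rmorphM !rmorphXn fmorphV rmorphN1.
  by ring.
have [_ H] := cauchy_product (summable_cexp (toC (re w))) (summable_cexp (iC R * toC (im w))) H1 H2.
apply: has_sum_ext H => n.
rewrite [w in RHS]toCE addrC exprDn mulr_suml; apply: eq_bigr => j _.
have jn : (j <= n)%N by rewrite -ltnS.
have fn0 k : (k`!%:R : C) != 0 by rewrite pnatr_eq0 -lt0n fact_gt0.
have E : (n`!%:R : C) = 'C(n, j)%:R * (j`!%:R * (n - j)`!%:R).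
  by rewrite -!natrM bin_fact.
have b0 : ('C(n, j)%:R : C) != 0 by rewrite pnatr_eq0 -lt0n bin_gt0.
rewrite -(mulr_natr _ 'C(n, j)) E.
move: (fn0 j) (fn0 (n - j)%N) b0; move: (j`!%:R) ((n - j)`!%:R) ('C(n, j)%:R).
move: (toC (re w) ^+ j) ((iC R * toC (im w)) ^+ (n - j)) => x y u v c u0 v0 c0.
by field; rewrite u0 v0 c0.
Qed.

Lemma cexp0 : cexp (0 : C) = 1.
Proof. by rewrite /cexp /= expR0 cos0 sin0 /toC rmorph1 mul1r. Qed.

Lemma cexpD (x y : C) : cexp (x + y) = cexp x * cexp y.
Proof.
case: x y => [a b] [c d]; rewrite /cexp /= expRD cosD sinD /toC; simpc.
by congr Complex; ring.
Qed.

Lemma nrm_cexp (z : C) : nrm (cexp z) = expR (re z).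
Proof.
rewrite /cexp Normc.normcM nrm_toC ger0_norm ?expR_ge0 //= cos2Dsin2 sqrtr1.
by rewrite mulr1.
Qed.

Lemma cexp_neq0 (z : C) : cexp z != 0.
Proof. by rewrite -nrm_gt0 nrm_cexp expR_gt0. Qed.

Lemma cexp_sum (I : Type) (s : seq I) (F : I -> C) :
  cexp (\sum_(i <- s) F i) = \prod_(i <- s) cexp (F i).
Proof. by elim: s => [|i s IH]; rewrite ?big_nil ?cexp0 // !big_cons cexpD IH. Qed.

(* [f] is the sum of the power series of coefficients [a] on the disc of radius
   [rho], on which the series converges absolutely. *)
Definition pserc (rho : R) (a : nat -> C) (f : C -> C) : Prop :=
  summable (fun k => a k * toC rho ^+ k) /\
  forall z, nrm z <= rho -> has_sum (fun k => a k * z ^+ k) (f z).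
Definition pser (rho : R) (f : C -> C) : Prop := exists a, pserc rho a f.

Lemma pser_ext rho (f h : C -> C) : f =1 h -> pser rho f -> pser rho h.
Proof.
move=> fh [a [sa Ha]]; exists a; split => // z zr.
by rewrite -fh; exact: Ha.
Qed.

Lemma pser_summable rho (a : nat -> C) (z : C) :
  summable (fun k => a k * toC rho ^+ k) -> nrm z <= rho -> summable (fun k => a k * z ^+ k).
Proof.
move=> sa zr; apply: summable_le sa => k; rewrite !Normc.normcM !nrmX nrm_toC.
rewrite ler_wpM2l ?nrm_ge0 // lerXn2r ?nnegrE ?nrm_ge0 //.
exact: le_trans zr (ler_norm _).
Qed.

Lemma summable_fin (I : eqType) (f : I -> C) (s : seq I) :
  uniq s -> (forall i, i \notin s -> f i = 0) -> summable f.
Proof.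
move=> us H; exists (\sum_(i <- s) nrm (f i)) => t ut.
rewrite (bigID (mem s)) /= [X in _ + X]big1 ?addr0; last first.
  by move=> i /H ->; rewrite Normc.normc0.
rewrite [leRHS](bigID (mem t)) /= -[leLHS]addr0 lerD ?sumr_ge0 //; last first.
  by move=> ? _; exact: nrm_ge0.
rewrite -big_filter -[leRHS]big_filter le_eqVlt; apply/orP; left; apply/eqP.
apply: perm_big; apply: uniq_perm; rewrite ?filter_uniq // => x.
by rewrite !mem_filter andbC.
Qed.

Lemma pser_poly rho (p : {poly C}) : pser rho (fun z => p.[z]).
Proof.
exists (fun k => p`_k); split=> [|z _].
  apply: (@summable_fin _ _ (iota 0 (size p))); first exact: iota_uniq.
  by move=> i; rewrite mem_iota add0n /= -leqNgt => /leq_sizeP/(_ _ (leqnn _)) ->; rewrite mul0r.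
rewrite horner_coef -(big_mkord predT (fun k => p`_k * z ^+ k)) /index_iota subn0.
apply: has_sum_fin; first exact: iota_uniq.
by move=> i; rewrite mem_iota add0n /= -leqNgt => /leq_sizeP/(_ _ (leqnn _)) ->; rewrite mul0r.
Qed.

Lemma pser_cst rho c : pser rho (fun=> c).
Proof. by apply: pser_ext (pser_poly rho c%:P) => z; rewrite hornerC. Qed.

Lemma pser_id rho : pser rho id.
Proof. by apply: pser_ext (pser_poly rho 'X) => z; rewrite hornerX. Qed.

Lemma pserD rho f h : pser rho f -> pser rho h -> pser rho (fun z => f z + h z).
Proof.
move=> [a [sa Ha]] [b [sb Hb]]; exists (fun k => a k + b k); split.
  by apply: summable_ext (summableD sa sb) => k; rewrite mulrDl.
by move=> z zr; apply: has_sum_ext (has_sumD (Ha z zr) (Hb z zr)) => k; rewrite mulrDl.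
Qed.

Lemma pserM rho f h : pser rho f -> pser rho h -> pser rho (fun z => f z * h z).
Proof.
move=> [a [sa Ha]] [b [sb Hb]]; exists (fun n => \sum_(j < n.+1) a j * b (n - j)%N).
have E z n : (\sum_(j < n.+1) a j * b (n - j)%N) * z ^+ n
   = \sum_(j < n.+1) (a j * z ^+ j) * (b (n - j)%N * z ^+ (n - j)).
  rewrite mulr_suml; apply: eq_bigr => j _; rewrite mulrACA -exprD subnKC //.
  by rewrite -ltnS.
split=> [|z zr].
  have [la hla] := summable_has_sum sa; have [lb hlb] := summable_has_sum sb.
  have [H _] := cauchy_product sa sb hla hlb.
  by apply: summable_ext H => n; rewrite E.
have [_ H] := cauchy_product (pser_summable sa zr) (pser_summable sb zr) (Ha z zr) (Hb z zr).
by apply: has_sum_ext H => n; rewrite E.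
Qed.

Lemma pserZ rho c f : pser rho f -> pser rho (fun z => c * f z).
Proof. exact: pserM (pser_cst rho c). Qed.

Lemma pserN rho f : pser rho f -> pser rho (fun z => - f z).
Proof. by move=> /(pserZ (-1)); apply: pser_ext => z; rewrite mulN1r. Qed.

Lemma pserB rho f h : pser rho f -> pser rho h -> pser rho (fun z => f z - h z).
Proof. by move=> pf /pserN; exact: pserD. Qed.

Lemma pser_sum rho (I : Type) (s : seq I) (P : pred I) (f : I -> C -> C) :
  (forall i, pser rho (f i)) -> pser rho (fun z => \sum_(i <- s | P i) f i z).
Proof.
move=> H; elim: s => [|i s IH].
  by apply: pser_ext (pser_cst rho 0) => z; rewrite big_nil.
case Pi : (P i); last by apply: pser_ext IH => z; rewrite big_cons Pi.
by apply: pser_ext (pserD (H i) IH) => z; rewrite big_cons Pi.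
Qed.

Lemma pser_prod rho (I : Type) (s : seq I) (P : pred I) (f : I -> C -> C) :
  (forall i, pser rho (f i)) -> pser rho (fun z => \prod_(i <- s | P i) f i z).
Proof.
move=> H; elim: s => [|i s IH].
  by apply: pser_ext (pser_cst rho 1) => z; rewrite big_nil.
case Pi : (P i); last by apply: pser_ext IH => z; rewrite big_cons Pi.
by apply: pser_ext (pserM (H i) IH) => z; rewrite big_cons Pi.
Qed.

Lemma pserX rho f n : pser rho f -> pser rho (fun z => f z ^+ n).
Proof.
move=> H; apply: pser_ext (@pser_prod rho _ (index_enum 'I_n) predT (fun _ => f) (fun _ => H)) => z.
by rewrite prodr_const card_ord.
Qed.

(** M bounds the sums of norms of the series shifted by n, at radius rho. *)
Lemma pserc_head rho (a : nat -> C) f n : 0 < rho -> pserc rho a f ->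
  exists2 M : R, 0 <= M & forall z, nrm z <= rho ->
   nrm (f z - \sum_(k < n) a k * z ^+ k) <= M * nrm z ^+ n.
Proof.
move=> r0 [sa Ha].
have sh : summable (fun k => a (k + n)%N * toC rho ^+ k).
  have := summableZ (toC rho ^- n) (summable_inj (q := fun k => (k + n)%N) (@addIn n) sa).
  apply: summable_ext => k /=; rewrite exprD.
  have : toC rho ^+ n != 0 by rewrite expf_neq0 // -nrm_gt0 nrm_toC normr_gt0 gt_eqF.
  by move=> h; field.
have [M HM] := sh.
have M0 : 0 <= M by have := HM [::] erefl; rewrite big_nil.
exists M => // z zr.
have H1 : has_sum (fun k => if (k < n)%N then a k * z ^+ k else 0) (\sum_(k < n) a k * z ^+ k).
  have := @has_sum_fin _ _ (fun k => if (k < n)%N then a k * z ^+ k else 0) (iota 0 n) (iota_uniq 0 n).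
  rewrite -{2}[n in iota 0 n]subn0 -/(index_iota 0 n) big_mkord.
  under eq_bigr do rewrite ltn_ord.
  apply => i; rewrite mem_iota add0n /=; by case: ifP.
have H2 := has_sumD (Ha z zr) (has_sumN H1).
apply: has_sum_nrm_le H2 => s us.
have sz : forall t : seq nat, uniq t -> \sum_(k <- t) nrm (a (k + n)%N * z ^+ k) <= M.
  move=> t ut; apply: le_trans (HM t ut); apply: ler_sum => k _.
  rewrite !Normc.normcM ler_wpM2l ?nrm_ge0 // !nrmX lerXn2r ?nnegrE ?nrm_ge0 //.
  by rewrite nrm_toC (le_trans zr) // ler_norm.
pose t := [seq (k - n)%N | k <- s & (n <= k)%N].
have ut : uniq t.
  rewrite map_inj_in_uniq ?filter_uniq // => x y.
  by rewrite !mem_filter => /andP[nx _] /andP[ny _] E; rewrite -(subnK nx) E subnK.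
have -> : \sum_(i <- s) nrm (a i * z ^+ i - (if (i < n)%N then a i * z ^+ i else 0))
   = nrm z ^+ n * \sum_(k <- t) nrm (a (k + n)%N * z ^+ k).
  rewrite big_map big_filter mulr_sumr [LHS](bigID (fun i => n <= i)%N) /=.
  rewrite [X in _ + X]big1 ?addr0; last first.
    by move=> i; rewrite -ltnNge => ->; rewrite subrr Normc.normc0.
  apply: eq_bigr => i ni; rewrite ltnNge ni subr0 subnK // -nrmX -Normc.normcM.
  by rewrite mulrCA -exprD subnKC.
by rewrite mulrC ler_wpM2r ?exprn_ge0 ?nrm_ge0 ?sz.
Qed.

(** Near 0 the term of the first nonzero coefficient dominates the remainder, which [pserc_head]
    bounds. *)
Lemma pser_isolated rho f : 0 < rho -> pser rho f ->
  (forall z, nrm z <= rho -> f z = 0) \/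
  exists2 d : R, 0 < d & forall z, z != 0 -> nrm z < d -> f z != 0.
Proof.
move=> r0 [a Ha].
case: (pselect (exists k, a k != 0)) => [ex|nex]; last first.
  left=> z zr; apply: has_sum_uniq (Ha.2 z zr) _.
  have := @has_sum0 R nat; apply: has_sum_ext => k.
  case: (eqVneq (a k) 0) => [->|ak]; first by rewrite mul0r.
  by case: nex; exists k.
right; case: (ex_minnP ex) => k ak mk.
have [M M0 HM] := pserc_head k.+1 r0 Ha.
have M1 : 0 < M + 1 by rewrite ltr_wpDl.
exists (Num.min rho (nrm (a k) / (M + 1))).
  by rewrite lt_min r0 divr_gt0 // nrm_gt0.
move=> z z0; rewrite lt_min => /andP[zr]; rewrite ltr_pdivlMr // => zk.
apply/eqP => fz0; have := HM z (ltW zr).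
rewrite fz0 sub0r normcN big_ord_recr /= big1 ?add0r; last first.
  move=> i _; suff -> : a i = 0 by rewrite mul0r.
  apply/eqP/contraT => /mk; by rewrite leqNgt ltn_ord.
rewrite Normc.normcM nrmX exprS mulrA ler_pM2r ?exprn_gt0 ?nrm_gt0 // leNgt => /negP; apply.
apply: le_lt_trans zk; rewrite mulrC ler_wpM2l ?nrm_ge0 //.
by rewrite lerDl.
Qed.

Lemma pser_mul_eq0 rho f h : 0 < rho -> pser rho f -> pser rho h ->
  (forall z, nrm z <= rho -> f z * h z = 0) ->
  (forall z, nrm z <= rho -> f z = 0) \/ (forall z, nrm z <= rho -> h z = 0).
Proof.
move=> r0 pf ph H.
have [?|[d d0 Hd]] := pser_isolated r0 pf; first by left.
have [?|[d' d'0 Hd']] := pser_isolated r0 ph; first by right.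
pose e := Num.min rho (Num.min d d') / 2.
have m0 : 0 < Num.min rho (Num.min d d') by rewrite !lt_min r0 d0.
have e0 : 0 < e by rewrite divr_gt0.
have : e < Num.min rho (Num.min d d').
  by rewrite ltr_pdivrMr // ltr_pMr // ltr1n.
rewrite !lt_min => /and3P[er ed ed'].
have ne : nrm (toC e) = e by rewrite nrm_toC gtr0_norm.
have z0 : toC e != 0 by rewrite -nrm_gt0 ne.
have := H (toC e) ltac:(by rewrite ne ltW).
move=> /eqP; rewrite mulf_eq0 => /orP[|] /eqP h0.
  by have := Hd _ z0; rewrite ne h0 eqxx => /(_ ed).
by have := Hd' _ z0; rewrite ne h0 eqxx => /(_ ed').
Qed.

(** Analytic continuation in steps of rho / 2: the discs around two parameters at this distance
    overlap, and a power series that vanishes near the centre of its disc vanishes on all of it. A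
    radius common to the whole segment makes the number of steps finite. *)
Lemma segment_identity rho (h : C -> C) : 0 < rho ->
  (forall t : R, 0 <= t <= 1 -> pser rho (fun z => h (toC t + z))) ->
  (exists2 d : R, 0 < d & forall t : R, 0 <= t < d -> h (toC t) = 0) ->
  forall t : R, 0 <= t <= 1 -> h (toC t) = 0.
Proof.
move=> r0 Hp [d d0 Hd].
have r2 : 0 < rho / 2 by rewrite divr_gt0.
have Hz : forall n (t : R), 0 <= t <= 1 -> t <= (rho / 2) *+ n ->
    forall z, nrm z <= rho -> h (toC t + z) = 0.
  elim=> [|n IH] t t01 tn.
    have t0 : t = 0 by apply/le_anti; rewrite tn; case/andP: t01.
    have [//|[e e0 He]] := pser_isolated r0 (Hp t t01).
    pose s := Num.min d e / 2.
    have s0 : 0 < s by rewrite divr_gt0 // lt_min d0.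
    have : s < Num.min d e by rewrite ltr_pdivrMr // ltr_pMr ?ltr1n // lt_min d0.
    rewrite lt_min => /andP[sd se].
    have ns : nrm (toC s) = s by rewrite nrm_toC gtr0_norm.
    have zs : toC s != 0 by rewrite -nrm_gt0 ns.
    have := He (toC s) zs; rewrite ns => /(_ se).
    by rewrite t0 /toC rmorph0 add0r -/(toC s) Hd ?eqxx ?sd ?(ltW s0).
  pose t' := Num.max 0 (t - rho / 2).
  have t'0 : 0 <= t' by rewrite le_max lexx.
  have t'1 : 0 <= t' <= 1.
    by rewrite t'0 ge_max ler01 /= lerBlDr (le_trans (proj2 (andP t01))) // lerDl ltW.
  have t'n : t' <= rho / 2 *+ n.
    by rewrite ge_max mulrn_wge0 ?(ltW r2) //= lerBlDr -mulrSr.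
  have tt' : 0 <= t - t' <= rho / 2.
    have h1 : t - rho / 2 <= t' by rewrite le_max lexx orbT.
    have h2 : t' <= t by rewrite ge_max (proj1 (andP t01)) /= lerBlDr lerDl ltW.
    by rewrite subr_ge0 h2 lerBlDl -lerBlDr.
  have [//|[e e0 He]] := pser_isolated r0 (Hp t t01).
  pose s := Num.min (rho / 2) e / 2.
  have s0 : 0 < s by rewrite divr_gt0 // lt_min r2.
  have : s < Num.min (rho / 2) e by rewrite ltr_pdivrMr // ltr_pMr ?ltr1n // lt_min r2.
  rewrite lt_min => /andP[sd se].
  have ns : nrm (toC s) = s by rewrite nrm_toC gtr0_norm.
  have zs : toC s != 0 by rewrite -nrm_gt0 ns.
  have := He (toC s) zs; rewrite ns => /(_ se).
  have -> : toC t + toC s = toC t' + toC (t - t' + s).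
    by rewrite /toC -!rmorphD; congr (_%:C)%C; ring.
  rewrite (IH t' t'1 t'n) ?eqxx //.
  case/andP: tt' => a b; rewrite nrm_toC ger0_norm; last exact: addr_ge0 a (ltW s0).
  by rewrite [rho]splitr lerD // ltW.
move=> t t01; have [n tn] : exists n, t <= rho / 2 *+ n.
  exists (Num.truncn (t / (rho / 2))).+1; rewrite -mulr_natr mulrC -ler_pdivrMr //.
  by rewrite ltW // truncnS_gt.
have := Hz n t t01 tn 0; rewrite Normc.normc0 addr0; apply; exact: ltW.
Qed.

Lemma summable_rect (I J : eqType) (f : I * J -> C) (B : I -> R) :
  (forall i s, uniq s -> \sum_(j <- s) nrm (f (i, j)) <= B i) ->
  summable (fun i => toC (B i)) -> summable f.
Proof.
move=> HB [M HM]; exists M => s us.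
pose s1 := undup (map fst s); pose s2 := undup (map snd s).
apply: (@le_trans _ _ (\sum_(x <- [seq (a, b) | a <- s1, b <- s2]) nrm (f x))).
  set t := [seq _ | _ <- _, _ <- _].
  have st : {subset s <= t}.
    move=> [a b] xs; apply/allpairsP; exists (a, b) => /=; split => //.
      by rewrite mem_undup; apply/mapP; exists (a, b).
    by rewrite mem_undup; apply/mapP; exists (a, b).
  have P : perm_eq s [seq x <- t | x \in s].
    apply: uniq_perm => //.
      rewrite filter_uniq // allpairs_uniq ?undup_uniq //.
      by move=> [a b] [a' b'] _ _ [-> ->].
    by move=> y; rewrite mem_filter /=; case: (boolP (y \in s)) => //= /st ->.
  rewrite (perm_big _ P) big_filter [leRHS](bigID (mem s)) /= lerDl.
  by apply: sumr_ge0 => ? _; exact: nrm_ge0.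
rewrite big_allpairs_dep /=; apply: le_trans (HM s1 (undup_uniq _)).
apply: ler_sum => i _; apply: le_trans (HB i s2 (undup_uniq _)) _.
by rewrite nrm_toC ler_norm.
Qed.

Lemma sum_cexp_le (w : C) (s : seq nat) : uniq s ->
  \sum_(k <- s) nrm (w ^+ k / k`!%:R) <= expR (nrm w).
Proof.
move=> us.
have H := has_sum_cexp (toC (nrm w)); apply/ler_addgt0Pr => e e0.
have [s0 Hs0] := H e e0; pose t := undup (s ++ s0).
have := Hs0 t (undup_uniq _) (fun x xs => ltac:(by rewrite mem_undup mem_cat xs orbT)).
have E k : toC (nrm w) ^+ k / k`!%:R = toC (nrm (w ^+ k / k`!%:R)).
  rewrite Normc.normcM nrmX Normc.normcV /toC rmorphM rmorphXn fmorphV; congr (_ / _).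
  have -> : (k`!%:R : C) = toC k`!%:R by rewrite /toC rmorph_nat.
  by rewrite nrm_toC normr_nat.
under eq_bigr do rewrite E.
have -> : cexp (toC (nrm w)) = toC (expR (nrm w)).
  by rewrite /cexp /= cos0 sin0 mulr1.
rewrite -rmorph_sum -rmorphB nrm_toC => /(le_lt_trans (ler_norm _)).
rewrite ltrBlDl => /ltW; apply: le_trans.
have P : perm_eq s [seq x <- t | x \in s].
  apply: uniq_perm => //; first by rewrite filter_uniq // undup_uniq.
  by move=> y; rewrite mem_filter mem_undup mem_cat; case: (boolP (y \in s)).
rewrite (perm_big _ P) big_filter [leRHS](bigID (mem s)) /= lerDl.
by apply: sumr_ge0 => ? _; exact: nrm_ge0.
Qed.

(** Expand every exponential and exchange the sums. The factor [expR (nrm (lam i) * rho)] bounds the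
    exponential series of index i, which makes the double family summable. *)
Lemma pserc_expsum (I : eqType) (A lam : I -> C) rho f : 0 < rho ->
  summable (fun i => A i * toC (expR (nrm (lam i) * rho))) ->
  (forall z, nrm z <= rho -> has_sum (fun i => A i * cexp (lam i * z)) (f z)) ->
  exists2 a, pserc rho a f & forall k, has_sum (fun i => A i * lam i ^+ k / k`!%:R) (a k).
Proof.
move=> r0 sA Hf.
have nr z : nrm z <= rho -> forall i s, uniq s ->
  \sum_(k <- s) nrm (A i * (lam i * z) ^+ k / k`!%:R) <= nrm (A i * toC (expR (nrm (lam i) * rho))).
  move=> zr i s us; under eq_bigr do rewrite -mulrA Normc.normcM.
  rewrite -mulr_sumr Normc.normcM ler_wpM2l ?nrm_ge0 //.
  apply: le_trans (sum_cexp_le _ us) _; rewrite nrm_toC ger0_norm ?expR_ge0 //.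
  by rewrite ler_expR Normc.normcM ler_wpM2l ?nrm_ge0.
have sB : summable (fun i => toC (nrm (A i * toC (expR (nrm (lam i) * rho))))).
  by apply: summable_le sA => i; rewrite [leLHS]nrm_toC ger0_norm ?nrm_ge0.
have sF z : nrm z <= rho ->
    summable (fun x : nat * I => A x.2 * (lam x.2 * z) ^+ x.1 / x.1`!%:R).
  move=> zr; have := summable_rect (f := fun x : I * nat => A x.1 * (lam x.1 * z) ^+ x.2 / x.2`!%:R) (nr z zr) sB.
  by apply: (summable_inj (q := fun x : nat * I => (x.2, x.1))) => -[? ?] [? ?] [-> ->].
have rr : nrm (toC rho) <= rho by rewrite nrm_toC gtr0_norm.
have rC0 : toC rho != 0 by rewrite -nrm_gt0 nrm_toC normr_gt0 gt_eqF.
have sk k : summable (fun i => A i * lam i ^+ k / k`!%:R).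
  have := summableZ (toC rho ^- k) (summable_inj (q := fun i : I => (k, i)) (fun x y => ltac:(by case)) (sF _ rr)).
  apply: summable_ext => i /=; rewrite exprMn.
  have := expf_neq0 k rC0; move: (k`!%:R) => F; move: (toC rho ^+ k) => r h.
  have -> : r^-1 * (A i * (lam i ^+ k * r) / F) = (r^-1 * r) * (A i * lam i ^+ k / F) by ring.
  by rewrite mulVf // mul1r.
have [a Ha] := boolp.choice (fun k => summable_has_sum (sk k)).
have row z k : has_sum (fun i => A i * (lam i * z) ^+ k / k`!%:R) (a k * z ^+ k).
  have := has_sumZ (z ^+ k) (Ha k); rewrite mulrC.
  by apply: has_sum_ext => i; rewrite exprMn; ring.
exists a => //; split.
  have [l Hl] := summable_has_sum (sF _ rr).
  by have [] := summable_pair_row (sF _ rr) (row _) Hl.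
move=> z zr; have [l Hl] := summable_has_sum (sF _ zr).
have [_ H] := summable_pair_row (sF _ zr) (row _) Hl.
suff -> : f z = l by [].
have Hl' : has_sum (fun x : I * nat => A x.1 * (lam x.1 * z) ^+ x.2 / x.2`!%:R) l.
  apply: (has_sum_inj (q := fun x : nat * I => (x.2, x.1))) Hl; first by move=> -[? ?] [? ?] [-> ->].
  by move=> [i k] /(_ (k, i)); rewrite eqxx.
have sF' := summable_rect (f := fun x : I * nat => A x.1 * (lam x.1 * z) ^+ x.2 / x.2`!%:R) (nr z zr) sB.
have [_ H2] := summable_pair_row sF' (fun i => has_sum_ext
   (fun k => mulrA (A i) ((lam i * z) ^+ k) (k`!%:R)^-1) (has_sumZ (A i) (has_sum_cexp (lam i * z)))) Hl'.
exact: has_sum_uniq (Hf z zr) H2.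
Qed.

(** [rderive] is made of real derivatives of real and imaginary parts; the second-order bound of
    [pserc_head] treats both at once, through a real-linear p bounded by the norm. *)
Lemma pserc_derive rho (a : nat -> C) f : 0 < rho -> pserc rho a f ->
  derive1 (fun t : R => re (f (toC t))) 0 = re (a 1%N) /\
  derive1 (fun t : R => im (f (toC t))) 0 = im (a 1%N).
Proof.
move=> r0 Ha; have [M M0 HM] := pserc_head 2 r0 Ha.
have f0 : f 0 = a 0%N.
  apply: has_sum_uniq (Ha.2 0 _) _; first by rewrite Normc.normc0 ltW.
  have := @has_sum_fin _ nat (fun k => a k * 0 ^+ k) [:: 0%N] erefl.
  rewrite big_seq1 expr0 mulr1; apply => i; rewrite inE => i0.
  by rewrite expr0n (negbTE i0) mulr0.
have key (p : C -> R) : (forall z w, p (z - w) = p z - p w) ->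
    (forall (t : R) z, p (toC t * z) = t * p z) -> (forall z, `|p z| <= nrm z) ->
    derive1 (fun t : R => p (f (toC t))) 0 = p (a 1%N).
  move=> pB pZ pN; rewrite /derive1; apply: cvg_lim => //.
  apply/cvgrPdist_le => e e0.
  pose d := Num.min rho (e / (M + 1)).
  have M1 : 0 < M + 1 by rewrite ltr_wpDl.
  have d0 : 0 < d by rewrite lt_min r0 divr_gt0.
  near=> t.
  have t0 : t != 0 by near: t; exact: nbhs_dnbhs_neq.
  have td : `|t| < d.
    near: t; apply: dnbhs0_lt => //.
  move: td; rewrite lt_min => /andP[tr]; rewrite ltr_pdivlMr // => te.
  have := HM (toC t); rewrite nrm_toC => /(_ (ltW tr)).
  rewrite !big_ord_recl big_ord0 /= expr0 expr1 mulr1 addr0 /bump /= => h.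
  rewrite /= addr0 {2}/toC rmorph0 f0.
  have -> : p (a 1%N) - t^-1 *: (p (f (toC t)) - p (a 0%N))
          = - (t^-1 * p (f (toC t) - (a 0%N + a 1%N * toC t))).
    rewrite opprD addrA !pB [a 1%N * _]mulrC pZ /GRing.scale /=.
    by field.
  rewrite normrN normrM normfV.
  rewrite ler_pdivrMl ?normr_gt0 //; apply: le_trans (pN _) _; apply: le_trans h _.
  rewrite expr2 mulrA mulrC ler_wpM2l //; apply: le_trans (ltW te).
  by rewrite mulrC ler_wpM2l // lerDl.
by split; apply: key => [[? ?] [? ?]|? [? ?]|z] //=; rewrite ?mul0r ?subr0 ?addr0 ?nrm_Re ?nrm_Im.
Unshelve. all: by end_near. Qed.

End PowerSeries.

(** * Gaussian sums over integer vectors *)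

Notation Zg g := {ffun 'I_g -> int}.

Section Gaussian.
Variable R : realType.
Local Notation C := R[i].

Lemma summable_int (f : int -> C) :
  summable (fun n : nat => f (Posz n)) -> summable (fun n : nat => f (Negz n)) -> summable f.
Proof.
move=> [M HM] [M' HM']; exists (M + M') => s us.
pose s1 := pmap (fun x : int => if x is Posz n then Some n else None) s.
pose s2 := pmap (fun x : int => if x is Negz n then Some n else None) s.
have u1 : uniq s1 by apply: (@pmap_uniq _ _ _ Posz) => // -[].
have u2 : uniq s2 by apply: (@pmap_uniq _ _ _ Negz) => // -[].
apply: le_trans (lerD (HM _ u1) (HM' _ u2)); rewrite /s1 /s2 {us u1 u2 s1 s2}.
rewrite le_eqVlt; apply/orP; left; apply/eqP.
elim: s => [|[n|n] s IH]; first by rewrite !big_nil addr0.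
  by rewrite /= !big_cons IH addrA.
by rewrite /= !big_cons IH addrCA.
Qed.

Lemma summable_geom (r : R) : 0 <= r < 1 -> summable (fun n => toC (r ^+ n)).
Proof.
move=> /andP[r0 r1]; apply: (@summable_nat _ _ (1 - r)^-1) => n.
rewrite -[leRHS]mul1r ler_pdivlMr ?subr_gt0 // mulrC.
have -> : \sum_(k < n) nrm (toC (r ^+ k)) = \sum_(k < n) r ^+ k.
  by apply: eq_bigr => k _; rewrite nrm_toC ger0_norm // exprn_ge0.
rewrite -opprB mulNr -subrX1 opprB lerBlDr lerDl exprn_ge0 //.
Qed.

(** Completing the square; the bound compares a Gaussian with the geometric series of ratio exp
    (-1). *)
Lemma gauss_int_bound (c b : R) (n : R) : 0 < c -> 0 <= n ->
  - c * n ^+ 2 + b * n <= (b + 1) ^+ 2 / (4 * c) - n.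
Proof.
move=> c0 n0; rewrite -subr_ge0.
have -> : (b + 1) ^+ 2 / (4 * c) - n - (- c * n ^+ 2 + b * n) = (2 * c * n - (b + 1)) ^+ 2 / (4 * c).
  by field; rewrite gt_eqF.
by rewrite divr_ge0 ?sqr_ge0 // mulr_ge0 // ltW.
Qed.

Lemma summable_gauss_int (c b : R) : 0 < c ->
  summable (fun n : int => toC (expR (- c * (n%:~R) ^+ 2 + b * `|n%:~R|))).
Proof.
move=> c0.
have E1 : 0 <= expR (-1 : R) < 1 by rewrite expR_ge0 expR_lt1 ltrN10.
have H : summable (fun n : int => toC (expR ((b + 1) ^+ 2 / (4 * c)) * expR (-1) ^+ `|n|%N)).
  apply: summable_int.
    have := summableZ (toC (expR ((b + 1) ^+ 2 / (4 * c)))) (summable_geom E1).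
    by apply: summable_ext => n; rewrite /toC rmorphM.
  have := summableZ (toC (expR ((b + 1) ^+ 2 / (4 * c)))) (summable_inj (q := succn) succn_inj (summable_geom E1)).
  by apply: summable_ext => n /=; rewrite /toC rmorphM.
apply: summable_le H => n; rewrite !nrm_toC [leLHS]ger0_norm ?expR_ge0 //.
rewrite [leRHS]ger0_norm ?mulr_ge0 ?exprn_ge0 ?expR_ge0 //.
rewrite -expRM_natl -expRD ler_expR mulrN mulr1 natr_absz -intr_norm.
by rewrite -(real_normK (num_real (n%:~R : R))) intr_norm gauss_int_bound // ler0z.
Qed.

Variable g : nat.

Definition zsq (N : Zg g) : R := \sum_i (N i)%:~R ^+ 2.
Definition zab (N : Zg g) : R := \sum_i `|(N i)%:~R|.

Lemma zsq_ge0 N : 0 <= zsq N. Proof. by apply: sumr_ge0 => i _; rewrite sqr_ge0. Qed.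
Lemma zab_ge0 N : 0 <= zab N. Proof. by apply: sumr_ge0. Qed.

Lemma summable_gauss (c b : R) : 0 < c ->
  summable (fun N : Zg g => toC (expR (- c * zsq N + b * zab N))).
Proof.
move=> c0; have := summable_ffun (J := 'I_g) (0 : int) (fun _ => summable_gauss_int b c0).
apply: summable_ext => N; rewrite -rmorph_prod -expR_sum big_split /=.
by rewrite -!mulr_sumr.
Qed.

Lemma summable_gaussW d (c b : R) : 0 < c ->
  summable (fun N : {ffun 'I_d -> Zg g} =>
    toC (expR (- c * (\sum_j zsq (N j)) + b * (\sum_j zab (N j))))).
Proof.
move=> c0; have := summable_ffun (J := 'I_d) (0 : Zg g) (fun _ => summable_gauss b c0).
apply: summable_ext => N; rewrite -rmorph_prod -expR_sum big_split /=.
by rewrite -!mulr_sumr.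
Qed.

(* By Cauchy-Schwarz, x_i = <x, Y^-1 e_i>_Y has square at most (x Y x) (Y^-1)_ii;
   this bounds a positive definite form below by a multiple of the standard one. *)
Definition bil (Y : 'M[R]_g) (x y : 'rV[R]_g) : R := (x *m Y *m y^T) ord0 ord0.

Lemma bilDl Y x x' y : bil Y (x + x') y = bil Y x y + bil Y x' y.
Proof. by rewrite /bil !mulmxDl mxE. Qed.
Lemma bilDr Y x y y' : bil Y x (y + y') = bil Y x y + bil Y x y'.
Proof. by rewrite /bil linearD mulmxDr mxE. Qed.
Lemma bilZl Y a x y : bil Y (a *: x) y = a * bil Y x y.
Proof. by rewrite /bil -!scalemxAl mxE. Qed.
Lemma bilZr Y a x y : bil Y x (a *: y) = a * bil Y x y.
Proof. by rewrite /bil linearZ -scalemxAr mxE. Qed.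
Lemma bilC Y x y : Y^T = Y -> bil Y x y = bil Y y x.
Proof.
move=> YT; rewrite /bil -[in LHS](trmxK (x *m Y *m y^T)) [LHS]mxE.
by rewrite !trmx_mul trmxK YT mulmxA.
Qed.

Lemma bil_lower_bound (Y : 'M[R]_g) : Y^T = Y ->
  (forall x : 'rV[R]_g, x != 0 -> 0 < bil Y x x) ->
  exists2 c : R, 0 < c & forall x : 'rV[R]_g, c * (\sum_i x ord0 i ^+ 2) <= bil Y x x.
Proof.
move=> YT Ypos.
have Y0 x : 0 <= bil Y x x.
  have [->|/Ypos/ltW //] := eqVneq x 0.
  by rewrite /bil !mul0mx mxE.
have Yu : Y \in unitmx.
  rewrite -row_free_unit -kermx_eq0; apply/eqP/row_matrixP => i; rewrite row0.
  apply/eqP; apply: contraT => /Ypos; rewrite /bil.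
  have -> : row i (kermx Y) *m Y = 0 by apply/eqP; rewrite -sub_kermx row_sub.
  by rewrite mul0mx mxE ltxx.
have CS x y : bil Y x y ^+ 2 <= bil Y x x * bil Y y y.
  have := Y0 (bil Y y y *: x - bil Y x y *: y).
  rewrite -scaleNr !bilDl !bilDr !bilZl !bilZr (bilC y x YT).
  have [->|yn] := eqVneq y 0.
    by rewrite /bil trmx0 !mulmx0 !mxE expr2 !mulr0.
  have := Ypos y yn; move: (bil Y x x) (bil Y x y) (bil Y y y) => p q r r0 H.
  have : 0 <= r * (p * r - q ^+ 2).
    by apply: le_trans H _; rewrite le_eqVlt; apply/orP; left; apply/eqP; ring.
  by rewrite pmulr_rge0 // subr_ge0.
pose e i : 'rV[R]_g := delta_mx ord0 i *m invmx Y.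
have He i x : bil Y x (e i) = x ord0 i.
  rewrite bilC // /bil /e mulmxKV // -[RHS]/(x ord0 i) mxE (bigD1 i) //=.
  rewrite !mxE !eqxx mul1r big1 ?addr0 // => j /negbTE ji.
  by rewrite !mxE ji andbF mul0r.
pose K := 1 + \sum_i bil Y (e i) (e i).
have K0 : 0 < K by rewrite ltr_pwDl // sumr_ge0.
exists K^-1; first by rewrite invr_gt0.
move=> x; rewrite ler_pdivrMl //.
apply: (@le_trans _ _ (\sum_i bil Y x x * bil Y (e i) (e i))).
  by apply: ler_sum => i _; rewrite -[X in X ^+ 2]He CS.
rewrite -mulr_sumr mulrC ler_wpM2r ?Y0 //.
by rewrite /K lerDr.
Qed.

Definition qd (M : 'M[C]_g) (x : Zg g) : C :=
  \sum_i \sum_j (x i)%:~R * M i j * (x j)%:~R.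
Definition dt (x : Zg g) (z : 'rV[C]_g) : C := \sum_i (x i)%:~R * z ord0 i.
Definition zv (x : Zg g) : 'rV[C]_g := \row_i (x i)%:~R.

Lemma qdE M x : (zv x *m M *m (zv x)^T) ord0 ord0 = qd M x.
Proof.
rewrite mxE /qd exchange_big /=; apply: eq_bigr => j _; rewrite !mxE mulr_suml.
by apply: eq_bigr => i _; rewrite !mxE.
Qed.

Lemma dtE x z : (zv x *m z^T) ord0 ord0 = dt x z.
Proof. by rewrite mxE; apply: eq_bigr => i _; rewrite !mxE. Qed.

Lemma qdD M M' x : qd (M + M') x = qd M x + qd M' x.
Proof.
rewrite /qd -big_split; apply: eq_bigr => i _; rewrite -big_split.
by apply: eq_bigr => j _ /=; rewrite mxE; ring.
Qed.

Lemma qdZ c M x : qd (c *: M) x = c * qd M x.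
Proof.
rewrite /qd mulr_sumr; apply: eq_bigr => i _; rewrite mulr_sumr.
by apply: eq_bigr => j _ /=; rewrite mxE; ring.
Qed.

Lemma dtD x z z' : dt x (z + z') = dt x z + dt x z'.
Proof. by rewrite /dt -big_split; apply: eq_bigr => i _ /=; rewrite mxE; ring. Qed.

Lemma dtZ x c z : dt x (c *: z) = c * dt x z.
Proof. by rewrite /dt mulr_sumr; apply: eq_bigr => i _ /=; rewrite mxE; ring. Qed.

Lemma dt0 x : dt x 0 = 0.
Proof. by rewrite /dt big1 // => i _; rewrite mxE mulr0. Qed.

Lemma dtDl x y z : dt (x + y) z = dt x z + dt y z.
Proof. by rewrite /dt -big_split; apply: eq_bigr => i _ /=; rewrite ffunE intrD; ring. Qed.

Lemma dtNl x z : dt (- x) z = - dt x z.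
Proof. by rewrite /dt -sumrN; apply: eq_bigr => i _ /=; rewrite ffunE mulrNz mulNr. Qed.

Lemma im_sumC (I : Type) (s : seq I) (F : I -> C) :
  im (\sum_(i <- s) F i) = \sum_(i <- s) im (F i).
Proof. exact: Im_sum. Qed.

Lemma im_intM (a b : int) (z : C) : im (a%:~R * z * b%:~R) = a%:~R * im z * b%:~R.
Proof.
have toCz (x : int) : (x%:~R : C) = toC x%:~R by rewrite /toC rmorph_int.
by rewrite !toCz; case: z => p q; rewrite /toC; simpc; rewrite /= ?(mulr0, addr0, add0r, mul0r) //.
Qed.

Lemma im_qd M x : im (qd M x) = bil (Defs.ImM M) (\row_i (x i)%:~R) (\row_i (x i)%:~R).
Proof.
rewrite /qd im_sumC; under eq_bigr do rewrite im_sumC.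
rewrite exchange_big /bil mxE; apply: eq_bigr => j _; rewrite !mxE mulr_suml.
by apply: eq_bigr => i _; rewrite !mxE im_intM.
Qed.

Lemma siegel_ImT (tau : 'M[C]_g) : siegel tau -> (Defs.ImM tau)^T = Defs.ImM tau.
Proof. by move=> [tT _]; apply/matrixP => i j; rewrite !mxE -{2}tT mxE. Qed.

Lemma siegel_lower_bound (tau : 'M[C]_g) : siegel tau ->
  exists2 c : R, 0 < c & forall x, c * zsq x <= im (qd tau x).
Proof.
move=> ts; have [c c0 H] := bil_lower_bound (siegel_ImT ts) ts.2.
exists c => // x; rewrite im_qd; apply: le_trans (H _).
by rewrite /zsq; under [in leRHS]eq_bigr do rewrite mxE.
Qed.

Lemma sq_le_zsq (x : Zg g) i : (x i)%:~R ^+ 2 <= zsq x.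
Proof.
rewrite /zsq (bigD1 i) //= lerDl; apply: sumr_ge0 => j _.
by rewrite sqr_ge0.
Qed.

Lemma qd_upper_bound (M : 'M[C]_g) :
  exists2 K : R, 0 < K & forall x, nrm (qd M x) <= K * zsq x.
Proof.
exists (1 + \sum_i \sum_j nrm (M i j)).
  by rewrite ltr_pwDl // sumr_ge0 // => i _; rewrite sumr_ge0 // => j _; exact: nrm_ge0.
move=> x; apply: (@le_trans _ _ ((\sum_i \sum_j nrm (M i j)) * zsq x)); last first.
  by rewrite ler_wpM2r ?zsq_ge0 // lerDr.
rewrite mulr_suml; apply: le_trans (nrm_sum _ _ _) _; apply: ler_sum => i _.
rewrite mulr_suml; apply: le_trans (nrm_sum _ _ _) _; apply: ler_sum => j _.
rewrite !Normc.normcM mulrAC mulrC ler_wpM2l ?nrm_ge0 //.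
have nz (a : int) : nrm (a%:~R : C) = `|a%:~R|.
  by rewrite -(rmorph_int (real_complex R)) nrm_toC.
rewrite !nz; have := sq_le_zsq x i; have := sq_le_zsq x j.
rewrite -(real_normK (num_real ((x i)%:~R : R))) -(real_normK (num_real ((x j)%:~R : R))).
move: (normr_ge0 ((x i)%:~R : R)) (normr_ge0 ((x j)%:~R : R)).
move: `|(x i)%:~R : R| `|(x j)%:~R : R| (zsq x) => a b s a0 b0 h1 h2; nra.
Qed.

Lemma dt_upper_bound (z : 'rV[C]_g) :
  exists2 K : R, 0 < K & forall x, nrm (dt x z) <= K * zab x.
Proof.
exists (1 + \sum_i nrm (z ord0 i)).
  by rewrite ltr_pwDl // sumr_ge0 // => i _; exact: nrm_ge0.
move=> x; rewrite /zab mulr_sumr; apply: le_trans (nrm_sum _ _ _) _; apply: ler_sum => i _.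
rewrite Normc.normcM mulrC.
have -> : ((x i)%:~R : C) = toC (x i)%:~R by rewrite /toC rmorph_int.
rewrite nrm_toC ler_wpM2r // (bigD1 i) //= addrCA lerDl addr_ge0 //.
by rewrite sumr_ge0 // => j _; exact: nrm_ge0.
Qed.

End Gaussian.

(** * Theta series *)

Section ThetaSeries.
Variables (R : realType) (g m : nat).
Hypothesis m1 : (1 < m)%N.
Local Notation C := R[i].
Local Notation Cg := 'rV[C]_g.
Local Notation B := (Bm g m).

Definition tsum (I : eqType) (f : I -> C) : C := xget 0 [set l | has_sum f l].

Lemma tsumP (I : eqType) (f : I -> C) : summable f -> has_sum f (tsum f).
Proof.
move=> /summable_has_sum[l Hl]; rewrite /tsum.
by case: xgetP => [x -> //|/(_ l)].
Qed.

Lemma tsum_eq (I : eqType) (f : I -> C) l : has_sum f l -> tsum f = l.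
Proof.
move=> H; rewrite /tsum; case: xgetP => [x _ Hx|/(_ l)//].
exact: has_sum_uniq Hx H.
Qed.

(** [theta] is a limit along the boxes [-K, K]^g; every finite set of indices lies in such a box, so
    the limit is the unconditional sum. *)
Lemma cvg_has_sum_box (f : Zg g -> C) l : has_sum f l ->
  limn ((fun K : nat => \sum_(n : {ffun 'I_g -> 'I_(K.*2).+1})
    f [ffun i => (n i : nat)%:Z - K%:Z]) : nat -> C^o) = l.
Proof.
move=> H; apply: cvg_lim => //; apply/cvgrPdist_lt => e e0.
have re0 : 0 < re e by move: e0; rewrite ltcE /= => /andP[].
have eE : e = toC (re e).
  by move: e0; case: (e) => a b; rewrite ltcE /= => /andP[/eqP -> _].
have [s0 Hs0] := H _ re0.
pose K0 := \max_(N <- s0) \max_i `|(N : Zg g) i|%N.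
exists K0 => // K /= K0K; rewrite distrC nrmE eE.
have -> : (toC (nrm (\sum_(n : {ffun 'I_g -> 'I_(K.*2).+1})
    f [ffun i => (n i : nat)%:Z - K%:Z] - l)) < toC (re e)) = (nrm (\sum_(n : {ffun 'I_g -> 'I_(K.*2).+1})
    f [ffun i => (n i : nat)%:Z - K%:Z] - l) < re e) by exact: ltcR.
have := Hs0 [seq [ffun i => (n i : nat)%:Z - K%:Z] | n : {ffun 'I_g -> 'I_(K.*2).+1} <- index_enum _].
rewrite big_map; apply.
  rewrite map_inj_uniq ?index_enum_uniq // => n n' /ffunP E; apply/ffunP => i.
  have := E i; rewrite !ffunE => /(addIr _) [] h; exact: val_inj.
move=> N Ns0.
have NK i : (`|N i| <= K)%N.
  apply: leq_trans K0K; apply: leq_trans (leq_bigmax_seq (F := fun N : Zg g => \max_i `|N i|%N) _ Ns0 isT).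
  exact: (leq_bigmax (F := fun i => `|N i|%N) i).
have lt i : (`|(N i + K%:Z)%R|%N < (K.*2).+1)%N by have := NK i; lia.
apply/mapP; exists [ffun i => Ordinal (lt i)]; first by rewrite mem_index_enum.
apply/ffunP => i; rewrite !ffunE /=; move: (NK i); move: (N i) => x xK.
have x0 : 0 <= x + K%:Z by lia.
by rewrite gez0_abs // addrK.
Qed.

(** With N = m (n + a), the term of index n of theta_{a,0}(mz, m tau) depends on N alone and is this
    one. All the theta_{a,0} become parts of one series over Z^g, sorted by the class of N modulo
    m. *)
Definition ex (tau : 'M[C]_g) (z : Cg) (N : Zg g) : C :=
  cexp (toC pi * iC R * (qd tau N / m%:R) + 2%:R * toC pi * iC R * dt N z).

Lemma pi0 : 0 < (pi : R). Proof. exact: pi_gt0. Qed.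

Lemma mC0 : (m%:R : C) != 0.
Proof. by rewrite pnatr_eq0 -lt0n (ltn_trans _ m1). Qed.

Lemma mR0 : 0 < (m%:R : R).
Proof. by rewrite ltr0n (ltn_trans _ m1). Qed.

Lemma re_piI (x : R) (w : C) : re (toC x * iC R * w) = - (x * im w).
Proof. by case: w => a b; rewrite /toC /iC; simpc; rewrite /= ?mulr0 ?add0r ?mul0r ?sub0r ?subr0 ?addr0 ?mulr1. Qed.

Lemma im_divm (w : C) (k : nat) : im (w / k%:R) = im w / k%:R.
Proof.
have -> : (k%:R : C)^-1 = toC k%:R^-1 by rewrite /toC fmorphV rmorph_nat.
by case: w => a b; rewrite /toC; simpc.
Qed.

Lemma nrm_ex tau z N : nrm (ex tau z N) = expR (- (pi * im (qd tau N) / m%:R) - 2 * pi * im (dt N z)).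
Proof.
rewrite /ex nrm_cexp; congr expR.
have reD (x y : C) : re (x + y) = re x + re y by case: x; case: y.
have -> : 2%:R * toC (pi : R) = toC (2 * pi) by rewrite /toC rmorphM rmorph_nat.
by rewrite reD !re_piI im_divm mulrA.
Qed.

(** The weights allowed in a theta series: exponential growth is absorbed by the Gaussian decay.
    Functions of the residue class and linear forms qualify, and products too, which covers
    derivatives. *)
Definition bdd (p : Zg g -> C) : Prop :=
  exists M b : R, 0 <= M /\ forall N, nrm (p N) <= M * expR (b * zab R N).

Lemma bddM (p q : Zg g -> C) : bdd p -> bdd q -> bdd (fun N => p N * q N).
Proof.
move=> [M [b [M0 Hb]]] [L [c [L0 Hc]]]; exists (M * L), (b + c).
split=> [|N]; first exact: mulr_ge0.
by rewrite Normc.normcM mulrDl expRD mulrACA; apply: ler_pM; rewrite ?nrm_ge0.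
Qed.

Lemma bdd_cst (p : Zg g -> C) (K : R) : (forall N, nrm (p N) <= K) -> bdd p.
Proof.
move=> H; exists K, 0; split=> [|N]; first exact: le_trans (nrm_ge0 _) (H 0).
by rewrite mul0r expR0 mulr1.
Qed.

Lemma bdd_B (T : finType) (u : T -> C) (h : Zg g -> T) : bdd (fun N => u (h N)).
Proof.
apply: (@bdd_cst _ (\sum_a nrm (u a))) => N.
by rewrite (bigD1 (h N)) //= lerDl sumr_ge0 // => a _; exact: nrm_ge0.
Qed.

Lemma bdd_dt z : bdd (fun N => dt N z).
Proof.
have [K K0 HK] := dt_upper_bound z; exists K, 1; split=> [|N]; first exact: ltW.
apply: le_trans (HK N) _; rewrite ler_wpM2l ?(ltW K0) // mul1r.
by apply: le_trans (expR_ge1Dx _); rewrite lerDr.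
Qed.

Lemma ex_bound tau z : siegel tau -> exists c b : R, 0 < c /\
  forall N, nrm (ex tau z N) <= expR (- c * zsq R N + b * zab R N).
Proof.
move=> ts; have [c c0 Hc] := siegel_lower_bound ts; have [K K0 HK] := dt_upper_bound z.
exists (pi * c / m%:R), (2 * pi * K); split=> [|N].
  by rewrite divr_gt0 ?mR0 // mulr_gt0 ?pi0.
rewrite nrm_ex ler_expR lerD //.
  rewrite mulNr lerN2 mulrAC ler_wpM2r ?invr_ge0 ?(ltW mR0) // -mulrA.
  by rewrite ler_wpM2l ?(ltW pi0).
rewrite -mulrN -[leRHS]mulrA ler_wpM2l ?mulr_ge0 ?(ltW pi0) //.
apply: le_trans (HK N); apply: le_trans (ler_norm _) _.
by rewrite normrN nrm_Im.
Qed.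

Definition S (p : Zg g -> C) (tau : 'M[C]_g) (z : Cg) : C := tsum (fun N => p N * ex tau z N).

(** The additional exponential is what [pserc_expsum] demands; it only adds a multiple of [zab] to
    the exponent, still dominated by the quadratic part. *)
Lemma S_summable_exp p tau z v (rho : R) : siegel tau -> bdd p ->
  summable (fun N => p N * ex tau z N * toC (expR (nrm (2%:R * toC pi * iC R * dt N v) * rho))).
Proof.
move=> ts [M [b [M0 Hb]]]; have [c [d [c0 Hc]]] := ex_bound z ts.
have [K K0 HK] := dt_upper_bound v.
have := summableZ (toC M) (summable_gauss g (b + d + 2 * pi * K * `|rho|) c0).
apply: summable_le => N.
rewrite [nrm (_ * toC _)]Normc.normcM [nrm (p N * _)]Normc.normcM [nrm (toC M * _)]Normc.normcM.
rewrite !nrm_toC (ger0_norm M0) !(ger0_norm (expR_ge0 _)).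
apply: (@le_trans _ _ (M * expR (b * zab R N) * expR (- c * zsq R N + d * zab R N) *
    expR (2 * pi * K * `|rho| * zab R N))).
  rewrite ler_pM ?mulr_ge0 ?nrm_ge0 ?expR_ge0 //.
    by rewrite ler_pM ?nrm_ge0.
  rewrite ler_expR; apply: le_trans (ler_norm _) _; rewrite normrM ger0_norm; last first.
    exact: nrm_ge0.
  rewrite [leRHS]mulrAC ler_wpM2r //.
  rewrite !Normc.normcM.
  have -> : nrm (2%:R : C) = 2.
    by rewrite -(rmorph_nat (real_complex R)) nrm_toC normr_nat.
  have -> : nrm (iC R) = 1 by rewrite /iC /= expr0n expr1n add0r sqrtr1.
  rewrite nrm_toC (ger0_norm (ltW pi0)) mulr1 -[leRHS]mulrA; apply: ler_wpM2l => //.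
  by rewrite mulr_ge0 // ltW // pi0.
rewrite -!mulrA -!expRD ler_wpM2l // ler_expR le_eqVlt; apply/orP; left; apply/eqP.
by ring.
Qed.

Lemma S_summable p tau z : siegel tau -> bdd p -> summable (fun N => p N * ex tau z N).
Proof.
move=> ts bp; have := S_summable_exp z 0 0 ts bp; apply: summable_ext => N.
by rewrite mulr0 expR0 /toC rmorph1 mulr1.
Qed.

Lemma S_has_sum p tau z : siegel tau -> bdd p ->
  has_sum (fun N => p N * ex tau z N) (S p tau z).
Proof. by move=> ts bp; apply/tsumP/S_summable. Qed.

Lemma S_eq p tau z l : has_sum (fun N => p N * ex tau z N) l -> S p tau z = l.
Proof. exact: tsum_eq. Qed.

Lemma ex_line tau z v t N :
  ex tau (z + t *: v) N = ex tau z N * cexp (2%:R * toC pi * iC R * dt N v * t).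
Proof. by rewrite /ex -cexpD dtD dtZ; congr cexp; ring. Qed.

Lemma S_line p tau z v (rho : R) : siegel tau -> bdd p -> 0 < rho ->
  exists2 a, pserc rho a (fun t => S p tau (z + t *: v)) &
    a 1%N = 2%:R * toC pi * iC R * S (fun N => p N * dt N v) tau z.
Proof.
move=> ts bp r0.
have H t : nrm t <= rho -> has_sum (fun N => p N * ex tau z N *
   cexp (2%:R * toC pi * iC R * dt N v * t)) (S p tau (z + t *: v)).
  move=> _; apply: has_sum_ext (S_has_sum _ ts bp) => N.
  by rewrite ex_line mulrA.
have [a pa Ha] := pserc_expsum r0 (S_summable_exp z v rho ts bp) H.
exists a => //; apply: has_sum_uniq (Ha 1%N) _.
have := has_sumZ (2%:R * toC pi * iC R) (S_has_sum z ts (bddM bp (bdd_dt v))).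
by apply: has_sum_ext => N; rewrite expr1 /= invr1; ring.
Qed.

Lemma S_pser p tau z v (rho : R) : siegel tau -> bdd p -> 0 < rho ->
  pser rho (fun t => S p tau (z + t *: v)).
Proof. by move=> ts bp r0; have [a pa _] := S_line z v ts bp r0; exists a. Qed.

Lemma rderive_S p tau z v : siegel tau -> bdd p ->
  rderive v (S p tau) z = 2%:R * toC pi * iC R * S (fun N => p N * dt N v) tau z.
Proof.
move=> ts bp; have [a pa <-] := S_line z v ts bp (@ltr01 R).
have [h1 h2] := pserc_derive ltr01 pa.
by rewrite /rderive h1 h2; case: (a 1%N).
Qed.

Lemma S_ext p q tau z : p =1 q -> S p tau z = S q tau z.
Proof. by move=> pq; congr tsum; apply/funext => N; rewrite pq. Qed.

Lemma S_scale p c tau z : siegel tau -> bdd p -> S (fun N => c * p N) tau z = c * S p tau z.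
Proof.
move=> ts bp; apply: S_eq; apply: has_sum_ext (has_sumZ c (S_has_sum z ts bp)) => N.
by rewrite mulrA.
Qed.

Lemma S_sum (I : Type) (s : seq I) (p : I -> Zg g -> C) tau z : siegel tau ->
  (forall i, bdd (p i)) -> S (fun N => \sum_(i <- s) p i N) tau z = \sum_(i <- s) S (p i) tau z.
Proof.
move=> ts bp; apply: S_eq; have := has_sum_sum s (fun i => S_has_sum z ts (bp i)).
by apply: has_sum_ext => N; rewrite mulr_suml.
Qed.

Lemma dz_S p tau z j : siegel tau -> bdd p ->
  dz_ j (S p tau) z = 2%:R * toC pi * iC R * S (fun N => p N * (N j)%:~R) tau z.
Proof.
move=> ts bp; rewrite /dz_ !rderive_S //.
have dte N : dt N (e_ R j) = (N j)%:~R.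
  rewrite /dt (bigD1 j) //= big1 ?addr0 => [|i /negbTE ij]; rewrite /e_ !mxE.
    by rewrite !eqxx mulr1.
  by rewrite ij andbF mulr0.
have E1 : S (fun N => p N * dt N (e_ R j)) tau z = S (fun N => p N * (N j)%:~R) tau z.
  by apply: S_ext => N; rewrite dte.
have bj : bdd (fun N => p N * (N j)%:~R).
  have [M [b [M0 H]]] := bddM bp (bdd_dt (e_ R j)); exists M, b; split=> // N.
  by rewrite -dte.
have E2 : S (fun N => p N * dt N (iC R *: e_ R j)) tau z = iC R * S (fun N => p N * (N j)%:~R) tau z.
  rewrite -(S_scale (iC R) z ts bj); apply: S_ext => N; rewrite dtZ dte; ring.
rewrite E1 E2; set w := S _ _ _; set c := 2%:R * _ * _.
have -> : c * w - iC R * (c * (iC R * w)) = c * w - iC R ^+ 2 * (c * w) by ring.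
have -> : c * w - iC R ^+ 2 * (c * w) = (c * w) * 2%:R by rewrite iC2; ring.
by rewrite mulfK // pnatr_eq0.
Qed.

Definition cl (N : Zg g) : B := [ffun i => (N i)%:~R].

Lemma Zmod_val (x : int) : (nat_of_ord (x%:~R : 'Z_m))%:Z = (x %% m%:Z)%Z.
Proof.
have m0 : (m%:Z != 0) by rewrite -lt0n (ltn_trans _ m1).
have r0 := modz_ge0 x m0; have rm : (x %% m%:Z)%Z < m%:Z by rewrite ltz_pmod // ltz_nat (ltn_trans _ m1).
have {1}-> := divz_eq x m%:Z.
rewrite intrD intrM -[m%:Z%:~R]/(m%:R) pchar_Zp // mulr0 add0r.
case: (x %% m%:Z)%Z r0 rm => // r _; rewrite ltz_nat => rm.
by rewrite -[r%:~R]/(r%:R) val_Zp_nat // modn_small.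
Qed.

Lemma Zmod_eq (x y : int) : ((x%:~R : 'Z_m) == y%:~R) = (m%:Z %| x - y)%Z.
Proof.
rewrite -eqz_mod_dvd -!Zmod_val; apply/eqP/eqP => [-> //|[] h].
exact: val_inj.
Qed.

Lemma clD N N' : cl (N + N') = cl N + cl N'.
Proof. by apply/ffunP => i; rewrite !ffunE intrD. Qed.

Lemma clN N : cl (- N) = - cl N.
Proof. by apply/ffunP => i; rewrite !ffunE mulrNz. Qed.

Definition lft (a : B) : Zg g := [ffun i => (a i : nat)%:Z].

Lemma lftK a : cl (lft a) = a.
Proof. by apply/ffunP => i; rewrite !ffunE -[LHS]/((a i : nat)%:R) natr_Zp. Qed.

Definition mulm (n : Zg g) : Zg g := [ffun i => m%:Z * n i].

Lemma mulm_inj : injective mulm.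
Proof.
move=> n n' /ffunP H; apply/ffunP => i; have := H i; rewrite !ffunE; apply: mulfI.
by rewrite -lt0n (ltn_trans _ m1).
Qed.

Lemma cl_mulm n : cl (mulm n) = 0.
Proof. by apply/ffunP => i; rewrite !ffunE intrM -[m%:Z%:~R]/(m%:R) pchar_Zp // mul0r. Qed.

Lemma cl_eqP N N' : cl N = cl N' -> exists n, N = mulm n + N'.
Proof.
move=> /ffunP H; exists [ffun i => ((N i - N' i) %/ m%:Z)%Z]; apply/ffunP => i.
have := H i; rewrite !ffunE => /eqP; rewrite Zmod_eq => /divzK E.
by rewrite mulrC E subrK.
Qed.

Definition clind (a : B) (N : Zg g) : C := (cl N == a)%:R.

Lemma bdd_clind a : bdd (clind a).
Proof. exact: (@bdd_B _ (fun b : B => (b == a)%:R) cl). Qed.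

Lemma scale00 (c : C) (M : 'M[C]_1) : (c *: M) ord0 ord0 = c * M ord0 ord0.
Proof. by rewrite mxE. Qed.

(** Reindexing by N = mulm n + lft a, which enumerates the class of a. *)
Lemma th_S (a : B) tau z : siegel tau -> th a tau z = S (clind a) tau z.
Proof.
move=> ts.
pose q (n : Zg g) := mulm n + lft a.
have qi : injective q by move=> n n' /addIr/mulm_inj.
have clq n : cl (q n) = a by rewrite clD cl_mulm add0r lftK.
have sq := summable_inj qi (S_summable z ts (bdd_clind a)).
have Hq := tsumP sq.
have <- : tsum ((fun N => clind a N * ex tau z N) \o q) = S (clind a) tau z.
  symmetry; apply: S_eq; apply: has_sum_inj qi _ Hq => N HN.
  rewrite /clind; case: eqP => [E|_]; last by rewrite mul0r.
  have [n nE] : exists n, N = mulm n + lft a by apply: cl_eqP; rewrite lftK.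
  by have := HN n; rewrite nE eqxx.
rewrite -(cvg_has_sum_box Hq) /th /theta.
apply: (f_equal (fun u : nat -> C^o => limn u)); apply/funext => K.
apply: eq_bigr => n _ /=; rewrite /clind clq eqxx mul1r /ex.
set p : Cg := (\row_i _ + char R a); set N := q _.
have pE : p = (m%:R)^-1 *: zv R N.
  apply/rowP => i; rewrite !mxE !ffunE intrD intrM rmorphB /= mulrDr.
  by rewrite mulrA [m%:Z%:~R]/(m%:R) mulVf ?mC0 // mul1r mulrC.
rewrite pE; congr cexp; congr (_ + _).
  have -> : m%:R^-1 *: zv R N *m (m%:R *: tau) *m (m%:R^-1 *: zv R N)^T =
      (m%:R^-1 * m%:R * m%:R^-1) *: (zv R N *m tau *m (zv R N)^T).
    have -> : (m%:R^-1 *: zv R N)^T = m%:R^-1 *: (zv R N)^T by apply/matrixP => ? ?; rewrite !mxE.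
    by rewrite -scalemxAr -scalemxAr -!scalemxAl !scalerA; congr (_ *: _); ring.
  congr (_ * _); rewrite scale00 qdE.
  by move: mC0 (qd tau N) => m0 w; field.
have -> : (m%:R *: z + 0)^T = m%:R *: z^T by apply/matrixP => ? ?; rewrite !mxE addr0.
congr (_ * _); rewrite -scalemxAr -scalemxAl !scale00 dtE.
by rewrite mulrA mulfV ?mC0 // mul1r.
Qed.

Lemma Th_S (u : B -> C) tau z : siegel tau -> Th u tau z = S (fun N => u (cl N)) tau z.
Proof.
move=> ts; rewrite /Th.
have b a : bdd (fun N => u a * clind a N).
  exact: (@bdd_B _ (fun b : B => u a * (b == a)%:R) cl).
rewrite (eq_bigr (fun a => S (fun N => u a * clind a N) tau z)) => [|a _]; last first.
  by rewrite S_scale ?th_S //; exact: bdd_clind.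
rewrite -S_sum //; apply: S_ext => N; rewrite (bigD1 (cl N)) //= /clind eqxx mulr1.
by rewrite big1 ?addr0 // => a /negbTE na; rewrite eq_sym na mulr0.
Qed.

Lemma bdd_cl (u : B -> C) : bdd (fun N => u (cl N)).
Proof. exact: bdd_B. Qed.

End ThetaSeries.

(** * Fourier uniqueness and analyticity in tau *)

Section Fourier.
Variables (R : realType) (g : nat).
Local Notation C := R[i].

Definition e1 (x : R) : C := cexp (2%:R * toC pi * iC R * toC x).

Lemma e1D x y : e1 (x + y) = e1 x * e1 y.
Proof. by rewrite /e1 -cexpD -mulrDr; congr (cexp (_ * _)); exact: rmorphD. Qed.

Lemma e1E x : e1 x = Complex (cos (2 * pi * x)) (sin (2 * pi * x)).
Proof.
rewrite /e1.
have -> : 2%:R * toC pi * iC R * toC x = Complex 0 (2 * pi * x).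
  have -> : (2%:R : C) = toC 2 by rewrite /toC rmorph_nat.
  by rewrite /toC /iC; simpc; congr Complex; ring.
by rewrite /cexp /= expR0 /toC rmorph1 mul1r.
Qed.

Lemma e1_0 : e1 0 = 1.
Proof. by rewrite /e1 /toC rmorph0 mulr0 cexp0. Qed.

Lemma e1_1 : e1 1 = 1.
Proof.
have -> : (1 : R) = 2^-1 + 2^-1 by field.
rewrite e1D e1E.
have -> : 2 * pi * 2^-1 = pi :> R by field.
by rewrite cospi sinpi; apply/eqP; rewrite eq_complex /=; apply/andP; split; apply/eqP; ring.
Qed.

Lemma e1_nat n : e1 n%:R = 1.
Proof. by elim: n => [|n IH]; rewrite ?e1_0 // -natr1 e1D IH e1_1 mulr1. Qed.

Lemma e1N x : e1 (- x) * e1 x = 1.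
Proof. by rewrite -e1D addNr e1_0. Qed.

Lemma e1_int (n : int) : e1 n%:~R = 1.
Proof.
case: n => n; first exact: e1_nat.
have := e1N n.+1%:R; rewrite e1_nat mulr1 => <-.
by rewrite NegzE mulrNz.
Qed.

Lemma e1X x k : e1 x ^+ k = e1 (x * k%:R).
Proof. by elim: k => [|k IH]; rewrite ?mulr0 ?expr0 ?e1_0 // exprS IH -e1D -natr1 mulrDr mulr1 addrC. Qed.

Lemma nrm_e1 x : nrm (e1 x) = 1.
Proof. by rewrite e1E /= cos2Dsin2 sqrtr1. Qed.

Lemma e1_eq1 x : 0 < x < 1 -> e1 x != 1.
Proof.
move=> /andP[x0 x1]; rewrite e1E; apply/eqP => -[h _].
have s0 : 0 < sin (pi * x).
  by apply: sin_gt0_pi; rewrite mulr_gt0 ?pi_gt0 //= gtr_pMr ?pi_gt0.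
move: h; have -> : 2 * pi * x = (pi * x) *+ 2 by ring.
rewrite cos_mulr2n => h; have := cos2Dsin2 (pi * x).
have : 0 < sin (pi * x) ^+ 2 by rewrite exprn_gt0.
by rewrite -mulr_natr in h; lra.
Qed.

Lemma sum_e1 (d : int) K : (0 < K)%N ->
  \sum_(j < K) e1 (d%:~R / K%:R * j%:R) = if (K%:Z %| d)%Z then K%:R else 0.
Proof.
move=> K0; have K0R : 0 < K%:R :> R by rewrite ltr0n.
case: ifPn => [/dvdzP[q ->]|nd].
  rewrite (eq_bigr (fun=> 1)) ?sumr_const ?card_ord // => j _.
  rewrite intrM mulfK ?gt_eqF //.
  by rewrite -[j%:R]/(j%:Z%:~R) -intrM e1_int.
pose w := e1 (d%:~R / K%:R).
have wK : w ^+ K = 1 by rewrite /w e1X mulrVK ?unitfE ?gt_eqF // e1_int.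
have w1 : w != 1.
  have K0Z : K%:Z != 0 by rewrite -lt0n.
  have -> : w = e1 ((d %% K%:Z)%Z%:~R / K%:R).
    rewrite /w {1}(divz_eq d K%:Z) intrD intrM mulrDl mulfK ?gt_eqF //.
    by rewrite e1D e1_int mul1r.
  apply: e1_eq1; rewrite divr_gt0 ?ltr0z //=.
    by rewrite ltr_pdivrMr // mul1r -[K%:R]/(K%:Z%:~R) ltr_int ltz_pmod // ltz_nat.
  by rewrite lt_def modz_ge0 // andbT; apply: contra nd => /eqP h; apply/dvdz_mod0P.
have H := subrX1 w K; rewrite wK subrr in H.
move/esym/eqP: H; rewrite mulf_eq0 subr_eq0 (negbTE w1) /= => /eqP E.
by rewrite -[RHS]E; apply: eq_bigr => j _; rewrite e1X.
Qed.

Lemma sum_e1_vec (N : Zg g) K : (0 < K)%N ->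
  \sum_(j : {ffun 'I_g -> 'I_K}) e1 (\sum_i (N i)%:~R * ((j i)%:R / K%:R))
  = if [forall i, (K%:Z %| N i)%Z] then K%:R ^+ g else 0.
Proof.
move=> K0.
transitivity (\prod_i \sum_(j < K) e1 ((N i)%:~R / K%:R * j%:R)).
  rewrite bigA_distr_bigA; apply: eq_bigr => j _.
  rewrite (big_morph e1 e1D e1_0); apply: eq_bigr => i _; congr e1.
  by rewrite mulrA mulrAC.
under eq_bigr do rewrite sum_e1 //.
case: (boolP [forall i, _]) => [/forallP H|/forallPn[i ni]].
  by rewrite (eq_bigr (fun=> K%:R)) => [|i _]; rewrite ?H // prodr_const card_ord.
by rewrite (bigD1 i) //= (negbTE ni) mul0r.
Qed.

(* Averaging over the points of K^-1 Z^g modulo Z^g keeps the frequencies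
   congruent to M modulo K; for large K the others contribute less than any
   given amount. *)
Lemma fourier_uniq (c : Zg g -> C) : summable c ->
  (forall x : 'I_g -> R, has_sum (fun N => c N * e1 (\sum_i (N i)%:~R * x i)) 0) ->
  forall M, c M = 0.
Proof.
move=> sc H M; apply: nrm_eq0_small => e e0.
have [s0 [us0 Hs0]] := summable_tail sc e0.
pose K := (\max_(N <- s0) \max_i `|((N : Zg g) i - M i)%R|%N).+1.
have K0 : (0 < K)%N by [].
have KC : (K%:R ^+ g : C) != 0 by rewrite expf_neq0 // pnatr_eq0.
have H1 : has_sum (fun N => if [forall i, (K%:Z %| (N - M) i)%Z] then c N else 0) 0.
  have h (j : {ffun 'I_g -> 'I_K}) := has_sumZ
    ((K%:R ^+ g)^-1 * e1 (- \sum_i (M i)%:~R * ((j i)%:R / K%:R))) (H (fun i => (j i)%:R / K%:R)).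
  have := has_sum_sum (index_enum _) h; rewrite big1 => [|j _]; last by rewrite mulr0.
  apply: has_sum_ext => N.
  transitivity ((K%:R ^+ g)^-1 * (c N * \sum_(j : {ffun 'I_g -> 'I_K}) e1 (\sum_i ((N - M) i)%:~R * ((j i)%:R / K%:R)))).
    rewrite !mulr_sumr; apply: eq_bigr => j _; rewrite -mulrA; congr (_ * _).
    rewrite mulrCA; congr (_ * _); rewrite -e1D; congr e1; rewrite -sumrN -big_split.
    by apply: eq_bigr => i _ /=; rewrite !ffunE rmorphB; ring.
  rewrite sum_e1_vec //; case: ifP => _; last by rewrite !mulr0.
  by rewrite mulrCA mulVf ?mulr1.
have H2 := has_sumD H1 (has_sumN (has_sum_fin (f := fun N => if N == M then c M else 0) (s := [:: M]) erefl
  (fun i => ltac:(by rewrite inE => /negbTE ->)))).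
rewrite big_seq1 eqxx sub0r in H2.
rewrite -normcN; apply: has_sum_nrm_le H2 => s us.
pose P (N : Zg g) := [forall i, (K%:Z %| (N - M) i)%Z] && (N != M).
rewrite (eq_bigr (fun N => if P N then nrm (c N) else 0)) => [|N _]; last first.
  rewrite /P; case: (eqVneq N M) => [->|_]; rewrite ?andbF ?andbT.
    case: ifP => [_|/negP[]]; first by rewrite subrr Normc.normc0.
    by apply/forallP => i; rewrite subrr ffunE dvdz0.
  by case: ifP => _; rewrite subr0 ?Normc.normc0.
rewrite -big_mkcond -big_filter /=; apply/ltW/Hs0; first exact: filter_uniq.
move=> N; rewrite mem_filter /P => /andP[/andP[/forallP HN NM] _].
apply/negP => Ns0; case/eqP: NM; apply/ffunP => i.
have := HN i; rewrite !ffunE => /dvdzP[q hq].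
have : (`|(N i - M i)%R| < K)%N.
  rewrite ltnS; apply: leq_trans (leq_bigmax_seq (F := fun N : Zg g => \max_i `|(N i - M i)%R|%N) _ Ns0 isT).
  exact: (leq_bigmax (F := fun i => `|(N i - M i)%R|%N) i).
rewrite hq abszM absz_nat; case: (eqVneq q 0) => [q0 _|q0].
  by apply/eqP; rewrite -subr_eq0 hq q0 mul0r.
by rewrite ltnNge leq_pmull // absz_gt0.
Qed.

End Fourier.

Section ThetaUniqueness.
Variables (R : realType) (g m : nat).
Hypothesis m1 : (1 < m)%N.
Local Notation C := R[i].

Lemma ex_real (tau : 'M[C]_g) (x : 'I_g -> R) N :
  ex m tau (\row_i toC (x i)) N = ex m tau 0 N * e1 (\sum_i (N i)%:~R * x i).
Proof.
rewrite /ex dt0 mulr0 addr0 cexpD; congr (_ * cexp (_ * _)).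
rewrite /dt /toC rmorph_sum; apply: eq_bigr => i _.
by rewrite mxE rmorphM rmorph_int.
Qed.

(** On real z this is a Fourier series with coefficients [p N * ex m tau 0 N], and the exponential
    has no zero. *)
Lemma S_uniq p (tau : 'M[C]_g) : siegel tau -> bdd p ->
  (forall z, S m p tau z = 0) -> forall N, p N = 0.
Proof.
move=> ts bp H N.
have := fourier_uniq (c := fun N => p N * ex m tau 0 N) (S_summable m1 0 ts bp) _ N.
have h x : has_sum (fun N => p N * ex m tau 0 N * e1 (\sum_i (N i)%:~R * x i)) 0.
  rewrite -(H (\row_i toC (x i))); apply: has_sum_ext (S_has_sum m1 _ ts bp) => M.
  by rewrite ex_real mulrA.
move=> /(_ h)/eqP; rewrite mulf_eq0 (negbTE (cexp_neq0 _)) orbF.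
by move/eqP.
Qed.

End ThetaUniqueness.

Section TauAnalytic.
Variables (R : realType) (g : nat).
Local Notation C := R[i].

(* Real analyticity along the segments of the Siegel space, with a uniform radius
   of convergence on each segment. *)
Definition tau_an (f : 'M[C]_g -> C) : Prop :=
  forall tau0 tau1, siegel tau0 -> siegel tau1 -> exists2 rho : R, 0 < rho &
  forall t : R, 0 <= t <= 1 ->
    pser rho (fun z => f (tau0 + (toC t + z) *: (tau1 - tau0))).

Lemma pser_sub (rho rho' : R) f : 0 < rho' <= rho -> pser rho f -> pser rho' f.
Proof.
move=> /andP[r0 rr] [a [sa Ha]]; exists a; split.
  by apply: pser_summable sa _; rewrite nrm_toC gtr0_norm.
by move=> z zr; apply: Ha; exact: le_trans zr rr.
Qed.

Lemma tau_an_ext f h : f =1 h -> tau_an f -> tau_an h.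
Proof.
move=> fh H t0 t1 s0 s1; have [r r0 Hr] := H t0 t1 s0 s1; exists r => // t t01.
by apply: pser_ext (Hr t t01) => z; rewrite fh.
Qed.

Lemma tau_an_cst c : tau_an (fun=> c).
Proof. by move=> *; exists 1 => // *; exact: pser_cst. Qed.

Lemma tau_an_op2 (op : C -> C -> C) :
  (forall rho f h, pser rho f -> pser rho h -> pser rho (fun z => op (f z) (h z))) ->
  forall f h, tau_an f -> tau_an h -> tau_an (fun tau => op (f tau) (h tau)).
Proof.
move=> Hop f h Hf Hh t0 t1 s0 s1.
have [r r0 Hr] := Hf t0 t1 s0 s1; have [r' r'0 Hr'] := Hh t0 t1 s0 s1.
have m0 : 0 < Num.min r r' by rewrite lt_min r0.
exists (Num.min r r') => // t t01; apply: Hop.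
  by apply: pser_sub (Hr t t01); rewrite m0 ge_min lexx.
by apply: pser_sub (Hr' t t01); rewrite m0 ge_min lexx orbT.
Qed.

Lemma tau_anD f h : tau_an f -> tau_an h -> tau_an (fun tau => f tau + h tau).
Proof. by apply: (tau_an_op2 (op := +%R)) => *; exact: pserD. Qed.

Lemma tau_anM f h : tau_an f -> tau_an h -> tau_an (fun tau => f tau * h tau).
Proof. by apply: (tau_an_op2 (op := *%R)) => *; exact: pserM. Qed.

Lemma tau_an_sum (I : Type) (s : seq I) (P : pred I) (f : I -> 'M[C]_g -> C) :
  (forall i, tau_an (f i)) -> tau_an (fun tau => \sum_(i <- s | P i) f i tau).
Proof.
move=> H; elim: s => [|i s IH].
  by apply: tau_an_ext (tau_an_cst 0) => z; rewrite big_nil.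
case Pi : (P i); last by apply: tau_an_ext IH => z; rewrite big_cons Pi.
by apply: tau_an_ext (tau_anD (H i) IH) => z; rewrite big_cons Pi.
Qed.

Lemma tau_an_prod (I : Type) (s : seq I) (P : pred I) (f : I -> 'M[C]_g -> C) :
  (forall i, tau_an (f i)) -> tau_an (fun tau => \prod_(i <- s | P i) f i tau).
Proof.
move=> H; elim: s => [|i s IH].
  by apply: tau_an_ext (tau_an_cst 1) => z; rewrite big_nil.
case Pi : (P i); last by apply: tau_an_ext IH => z; rewrite big_cons Pi.
by apply: tau_an_ext (tau_anM (H i) IH) => z; rewrite big_cons Pi.
Qed.

Lemma tau_anX f k : tau_an f -> tau_an (fun tau => f tau ^+ k).
Proof.
move=> H; apply: tau_an_ext (@tau_an_prod _ (index_enum 'I_k) predT (fun _ => f) (fun _ => H)) => z.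
by rewrite prodr_const card_ord.
Qed.

Lemma tau_an_det n (f : 'I_n -> 'I_n -> 'M[C]_g -> C) : (forall i j, tau_an (f i j)) ->
  tau_an (fun tau => \det (\matrix_(i, j) f i j tau)).
Proof.
move=> H; apply: tau_an_ext (@tau_an_sum _ (index_enum {perm 'I_n}) predT
   (fun s tau => (-1) ^+ s * \prod_i f i (s i) tau) _) => [tau|s].
  by apply: eq_bigr => s _; congr (_ * _); apply: eq_bigr => i _; rewrite mxE.
by apply: tau_anM (tau_an_cst _) _; apply: tau_an_prod => i; exact: H.
Qed.

Lemma siegel_convex (tau0 tau1 : 'M[C]_g) (t : R) : siegel tau0 -> siegel tau1 ->
  0 <= t <= 1 -> siegel (tau0 + toC t *: (tau1 - tau0)).
Proof.
move=> [T0 P0] [T1 P1] /andP[t0 t1]; split.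
  by rewrite linearD linearZ linearB /= T0 T1.
move=> x x0.
have -> : Defs.ImM (tau0 + toC t *: (tau1 - tau0)) = (1 - t) *: Defs.ImM tau0 + t *: Defs.ImM tau1.
  apply/matrixP => i j; rewrite !mxE; case: (tau0 i j) (tau1 i j) => a b [c d].
  by rewrite /toC; simpc; rewrite /=; ring.
rewrite mulmxDr mulmxDl mxE -!scalemxAr -!scalemxAl [X in X + _]mxE [X in _ + X]mxE.
have := P0 x x0; have := P1 x x0; move: (_ ord0 ord0) (_ ord0 ord0) => p q p0 q0.
have [->|tn] := eqVneq t 0; first by rewrite subr0 mul1r mul0r addr0.
by rewrite ltr_wpDl ?mulr_ge0 ?subr_ge0 ?(ltW q0) // mulr_gt0 // lt_def tn.
Qed.

(** Restrict to the segment from tau0 to tau; K bounds the entries of tau - tau0 and converts the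
    distance d into a length of parameter. *)
Lemma tau_identity f (tau0 : 'M[C]_g) : tau_an f -> siegel tau0 ->
  (exists2 d : R, 0 < d & forall tau, siegel tau ->
     (forall i j, nrm (tau i j - tau0 i j) < d) -> f tau = 0) ->
  forall tau, siegel tau -> f tau = 0.
Proof.
move=> fan s0 [d d0 Hd] tau s1.
have [rho r0 Hr] := fan _ _ s0 s1.
pose K := 1 + \sum_i \sum_j nrm ((tau - tau0) i j).
have K1 : 1 <= K by rewrite lerDl sumr_ge0 // => i _; rewrite sumr_ge0 // => j _; exact: nrm_ge0.
have K0 : 0 < K by apply: lt_le_trans K1.
have := segment_identity (h := fun z => f (tau0 + z *: (tau - tau0))) r0 Hr _ (t := 1).
rewrite /toC rmorph1 scale1r addrCA subrr addr0; apply; last by rewrite ler01 lexx.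
exists (Num.min 1 (d / K)); first by rewrite lt_min ltr01 divr_gt0.
move=> t /andP[t0]; rewrite lt_min => /andP[t1]; rewrite ltr_pdivlMr // => tK.
apply: Hd; first by apply: siegel_convex => //; rewrite t0 ltW.
move=> i j; rewrite !mxE addrAC subrr add0r Normc.normcM nrm_toC ger0_norm //.
apply: le_lt_trans tK; rewrite ler_wpM2l //.
have le1 (F : 'I_g -> R) l : (forall l, 0 <= F l) -> F l <= \sum_l F l.
  by move=> F0; rewrite (bigD1 l) //= lerDl sumr_ge0.
have n0 i' : 0 <= \sum_j nrm ((tau - tau0) i' j) by apply: sumr_ge0 => ? _; exact: nrm_ge0.
have h1 := le1 (fun j => nrm ((tau - tau0) i j)) j (fun=> nrm_ge0 _).
have h2 := le1 (fun i => \sum_j nrm ((tau - tau0) i j)) i n0.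
rewrite !mxE in h1; apply: le_trans h1 _; apply: le_trans h2 _.
by rewrite /K lerDr.
Qed.

Section Series.
Variables (m : nat) (m1 : (1 < m)%N).
Variables (T : eqType) (p : T -> C) (q : 'M[C]_g -> T -> C) (w : T -> R).
Hypothesis qD : forall M s H i, q (M + s *: H) i = q M i + s * q H i.
Hypothesis w0 : forall i, 0 <= w i.
Hypothesis q_lower : forall tau, siegel tau ->
  exists2 c : R, 0 < c & forall i, c * w i <= im (q tau i).
Hypothesis q_upper : forall H, exists2 K : R, 0 < K & forall i, nrm (q H i) <= K * w i.
Hypothesis sp : forall e : R, 0 < e -> summable (fun i => p i * toC (expR (- e * w i))).

Let te tau i := cexp (toC pi * iC R * (q tau i / m%:R)).

Lemma nrm_te tau i : nrm (te tau i) = expR (- (pi * im (q tau i) / m%:R)).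
Proof. by rewrite nrm_cexp re_piI im_divm mulrA. Qed.

Lemma tau_series_summable tau : siegel tau -> summable (fun i => p i * te tau i).
Proof.
move=> ts; have [c c0 Hc] := q_lower ts.
have e0 : 0 < pi * c / m%:R by rewrite divr_gt0 ?mR0 // mulr_gt0 ?pi_gt0.
apply: summable_le (sp e0) => i.
rewrite [nrm (p i * te _ _)]Normc.normcM [leRHS]Normc.normcM ler_wpM2l ?nrm_ge0 // nrm_te nrm_toC.
rewrite ger0_norm ?expR_ge0 // ler_expR mulNr lerN2 mulrAC.
by rewrite ler_wpM2r ?invr_ge0 ?ler0n // -mulrA ler_wpM2l ?pi_ge0.
Qed.

(** Along a segment the exponent is affine in the parameter, so this is an exponential sum. The
    decay constant c is valid on the whole segment by convexity, and rho = c / (2 K) spares half of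
    the decay at every t, whence a uniform radius. *)
Lemma tau_series_an : tau_an (fun tau => tsum (fun i => p i * te tau i)).
Proof.
move=> t0 t1 s0 s1.
have [c0 c00 Hc0] := q_lower s0; have [c1 c10 Hc1] := q_lower s1.
have [K K0 HK] := q_upper (t1 - t0).
pose c := Num.min c0 c1; have c_0 : 0 < c by rewrite lt_min c00.
pose rho := c / (2 * K); have r0 : 0 < rho by rewrite divr_gt0 // mulr_gt0.
exists rho => // t t01.
pose A i := p i * te (t0 + toC t *: (t1 - t0)) i.
pose lam i := toC pi * iC R * (q (t1 - t0) i / m%:R).
have mR : 0 < m%:R :> R by rewrite mR0.
have imq i : c * w i <= im (q (t0 + toC t *: (t1 - t0)) i).
  have qB : q (t1 - t0) i = q t1 i - q t0 i.
    by have := qD t1 (-1) t0 i; rewrite scaleN1r mulN1r.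
  rewrite qD qB.
  have -> : im (q t0 i + toC t * (q t1 i - q t0 i)) = (1 - t) * im (q t0 i) + t * im (q t1 i).
    by case: (q t0 i) (q t1 i) => a b [a' b']; rewrite /toC; simpc; rewrite /=; ring.
  case/andP: t01 => h0 h1.
  have -> : c * w i = (1 - t) * (c * w i) + t * (c * w i) by ring.
  apply: lerD; rewrite ler_wpM2l ?subr_ge0 //.
    by apply: le_trans (Hc0 i); rewrite ler_wpM2r // ge_min lexx.
  by apply: le_trans (Hc1 i); rewrite ler_wpM2r // ge_min lexx orbT.
have laml i : nrm (lam i) * rho <= pi * (c / 2) / m%:R * w i.
  have -> : nrm (lam i) = pi / m%:R * nrm (q (t1 - t0) i).
    rewrite /lam !Normc.normcM Normc.normcV nrm_toC (ger0_norm (pi_ge0 R)).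
    have -> : nrm (iC R) = 1 by rewrite /iC /= expr0n expr1n add0r sqrtr1.
    have -> : nrm (m%:R : C) = m%:R.
      by rewrite -(rmorph_nat (real_complex R)) nrm_toC normr_nat.
    by rewrite mulr1 mulrA mulrAC.
  apply: (@le_trans _ _ (pi / m%:R * (K * w i) * rho)).
    by rewrite ler_wpM2r ?(ltW r0) // ler_wpM2l // divr_ge0 ?pi_ge0 // ltW.
  rewrite le_eqVlt; apply/orP; left; apply/eqP; rewrite /rho.
  by field; rewrite !gt_eqF.
have sA : summable (fun i => A i * toC (expR (nrm (lam i) * rho))).
  have e0 : 0 < pi * (c / 2) / m%:R by rewrite divr_gt0 // mulr_gt0 ?pi_gt0 // divr_gt0.
  apply: summable_le (sp e0) => i.
  rewrite [nrm (A i * _)]Normc.normcM [nrm (A i)]Normc.normcM [leRHS]Normc.normcM -mulrA.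
  rewrite ler_wpM2l ?nrm_ge0 // nrm_te !nrm_toC !(ger0_norm (expR_ge0 _)) -expRD ler_expR.
  apply: (@le_trans _ _ (- (pi * (c * w i) / m%:R) + pi * (c / 2) / m%:R * w i)).
    apply: lerD => //; rewrite lerN2 ler_wpM2r ?invr_ge0 ?(ltW mR) //.
    by rewrite ler_wpM2l ?pi_ge0.
  by rewrite le_eqVlt; apply/orP; left; apply/eqP; field; rewrite gt_eqF.
have H z : nrm z <= rho -> has_sum (fun i => A i * cexp (lam i * z))
    (tsum (fun i => p i * te (t0 + (toC t + z) *: (t1 - t0)) i)).
  move=> zr.
  have E i : A i * cexp (lam i * z) = p i * te (t0 + (toC t + z) *: (t1 - t0)) i.
    rewrite /A /te -mulrA -cexpD scalerDl addrA (qD _ z).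
    by congr (_ * cexp _); rewrite /lam; ring.
  apply: (has_sum_ext (fun i => esym (E i))); apply/tsumP.
  apply: (summable_ext E); apply: summable_le sA => i.
  rewrite [leLHS]Normc.normcM [leRHS]Normc.normcM ler_wpM2l ?nrm_ge0 // nrm_cexp nrm_toC.
  rewrite ger0_norm ?expR_ge0 // ler_expR; apply: le_trans (ler_norm _) _.
  apply: le_trans (nrm_Re _) _; rewrite Normc.normcM ler_wpM2l ?nrm_ge0 //.
have [a pa _] := pserc_expsum r0 sA H.
by exists a.
Qed.
End Series.

End TauAnalytic.

(** * Riemann's bilinear relation *)

Section Riemann.
Variables (R : realType) (g m : nat).
Hypotheses (m1 : (1 < m)%N) (m2 : ~~ odd m).
Local Notation C := R[i].
Local Notation Cg := 'rV[C]_g.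
Local Notation B := (Bm g m).
Local Notation S := (@S R g m).
Local Notation cl := (@cl g m).
Local Notation hc := (@half_class g m).

(** Several indices may share a frequency; their terms are collected into one coefficient, to which
    [fourier_uniq] applies. *)
Lemma fourier_group (I : eqType) (a : I -> C) (kap : I -> Zg g) : summable a ->
  (forall x : 'I_g -> R, has_sum (fun i => a i * e1 (\sum_j (kap i j)%:~R * x j)) 0) ->
  forall M, has_sum (fun i => if kap i == M then a i else 0) 0.
Proof.
move=> sa H.
have [h Hh] := fiber_sums kap sa.
have sh := summable_fiber sa Hh.
suff h0 : forall M, h M = 0 by move=> M; rewrite -[X in has_sum _ X](h0 M).
apply: fourier_uniq sh _ => x.
have sx : summable (fun i => a i * e1 (\sum_j (kap i j)%:~R * x j)).
  by apply: summable_le sa => i; rewrite Normc.normcM nrm_e1 mulr1.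
apply: (has_sum_fiber (p := kap) sx _ (H x)) => M.
have := has_sumZ (e1 (\sum_i (M i)%:~R * x i)) (Hh M); rewrite mulrC.
apply: has_sum_ext => i; have [->|_] := eqVneq (kap i) M; first by rewrite mulrC.
by rewrite mulr0.
Qed.

Lemma m_half : (m = m./2 + m./2)%N.
Proof. by rewrite addnn -[LHS]odd_double_half (negbTE m2). Qed.

Definition sgp (c : half_chars g) (P : Zg g) : C := \prod_i (-1) ^+ (c i && odd `|P i|%N).
Definition quo (x b : Zg g) : Zg g := [ffun i => ((x i - b i) %/ m%:Z)%Z].
(* coefficients of the theta function of characteristic (b, c) *)
Definition pc (b : Zg g) (c : half_chars g) (x : Zg g) : C :=
  if cl x == cl b then sgp c (quo x b) else 0.

Lemma nrm_sgp c P : nrm (sgp c P) = 1.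
Proof.
rewrite /sgp nrm_prod big1 // => i _; rewrite nrmX normcN Normc.normc1.
by rewrite expr1n.
Qed.

Lemma bdd_pc b c : bdd (pc b c).
Proof.
apply: (@bdd_cst _ _ _ 1) => N; rewrite /pc; case: ifP => _; rewrite ?nrm_sgp //.
by rewrite Normc.normc0.
Qed.

Lemma siegel_half (tau : 'M[C]_g) : siegel tau -> siegel (2^-1 *: tau).
Proof.
move=> [T P]; split; first by rewrite linearZ /= T.
move=> x /P h.
have -> : Defs.ImM (2^-1 *: tau) = 2^-1 *: Defs.ImM tau.
  apply/matrixP => i j; rewrite !mxE.
  have -> : (2^-1 : C) = toC 2^-1 by rewrite /toC fmorphV rmorph_nat.
  by case: (tau i j) => a b; rewrite /toC; simpc.
by rewrite -scalemxAr -scalemxAl mxE mulr_gt0 // invr_gt0.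
Qed.

Lemma qd_parallelogram (tau : 'M[C]_g) N N' :
  qd tau (N + N') + qd tau (N - N') = 2%:R * (qd tau N + qd tau N').
Proof.
rewrite /qd -!big_split mulr_sumr; apply: eq_bigr => i _ /=.
rewrite -!big_split mulr_sumr; apply: eq_bigr => j _ /=.
by rewrite !ffunE !rmorphD !rmorphN /=; ring.
Qed.

(** By the parallelogram law, passing to N + N' and N - N' turns a product of two theta terms into
    another such product, for tau / 2. *)
Lemma ex_pair (tau : 'M[C]_g) z1 z2 N N' :
  ex m (2^-1 *: tau) (2^-1 *: (z1 + z2)) (N + N') * ex m (2^-1 *: tau) (2^-1 *: (z1 - z2)) (N - N')
  = ex m tau z1 N * ex m tau z2 N'.
Proof.
rewrite /ex -!cexpD; congr cexp; rewrite !qdZ !dtZ !dtD.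
have -> : dt (N - N') (- z2) = - dt N z2 + dt N' z2 by rewrite -scaleN1r dtZ dtDl dtNl; ring.
rewrite !dtDl !dtNl.
have m0 := mC0 R m1.
have -> : qd tau (N + N') = 2%:R * (qd tau N + qd tau N') - qd tau (N - N').
  by rewrite -qd_parallelogram; ring.
by field; do ?[exact: m0 | by rewrite pnatr_eq0 | apply/andP; split].
Qed.

Lemma half_class_inj : injective hc.
Proof.
have h0 : ((m./2)%:R : 'Z_m) != 0.
  rewrite -(inj_eq val_inj) /= val_Zp_nat // modn_small.
    by rewrite -lt0n half_gt0.
  by rewrite {2}m_half -[X in (X < _)%N]addn0 ltn_add2l half_gt0.
move=> e e' /ffunP H; apply/ffunP => i; have := H i; rewrite !ffunE.
by case: (e i); case: (e' i) => // /eqP; rewrite ?(negbTE h0) // eq_sym (negbTE h0).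
Qed.

Lemma half_classK e : hc e + hc e = 0 :> B.
Proof.
apply/ffunP => i; rewrite !ffunE; case: (e i); rewrite ?addr0 //.
by rewrite -natrD -m_half pchar_Zp.
Qed.

Lemma half_class_odd (P : Zg g) :
  cl [ffun i => (m./2)%:Z * P i] = hc [ffun i => odd `|P i|%N].
Proof.
apply/ffunP => i; rewrite !ffunE.
have [q [e hq]] : exists q : int, exists e : bool, P i = q * 2 + e%:Z.
  exists (P i %/ 2)%Z, (odd `|P i|%N); have := divz_eq (P i) 2.
  have : ((P i %% 2) = (odd `|P i|)%:Z)%Z by move: (P i) => x; lia.
  by move=> ->.
have -> : odd `|P i|%N = e by rewrite hq; case: e {hq} => /=; lia.
rewrite hq mulrDr mulrCA.
have -> : (m./2)%:Z * 2 = m%:Z by rewrite {2}m_half PoszD; ring.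
have qm0 : ((q * m%:Z)%:~R : 'Z_m) = 0.
  by apply/eqP; rewrite -[0]/(0%:~R) Zmod_eq // subr0 dvdz_mull.
rewrite intrD qm0 add0r.
by case: e {hq}; rewrite ?mulr1 ?mulr0.
Qed.

Lemma sgp_sgn c (P Q : Zg g) :
  sgp c P * sgp c Q = sgn C c [ffun i => odd `|(P i + Q i)%R|%N].
Proof.
rewrite /sgp -big_split /sgn -prodrXr; apply: eq_bigr => i _ /=; rewrite ffunE.
have -> : odd `|(P i + Q i)%R| = odd `|P i| (+) odd `|Q i| by move: (P i) (Q i) => x y; lia.
by rewrite -signr_addb; case: (c i); case: (odd `|P i|); case: (odd `|Q i|).
Qed.

(** If N + N' = A + A' + m P and N - N' = A - A' + m Q, then N = A + m/2 (P + Q) and N' = A' + m/2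
    (P - Q), where P + Q and P - Q have the same parities. These parities form the only half class e
    that contributes, and the two characters multiply to its sign. *)
Lemma pc_pair (A A' : Zg g) c N N' :
  pc (A + A') c (N + N') * pc (A - A') c (N - N') =
  \sum_(e : half_chars g) sgn C c e *
     (clind R (cl A + hc e) N * clind R (cl A' + hc e) N').
Proof.
rewrite /pc.
case: (boolP ((cl (N + N') == cl (A + A')) && (cl (N - N') == cl (A - A')))) => [/andP[/eqP h1 /eqP h2]|nh].
  rewrite h1 h2 !eqxx.
  have [P hP] := cl_eqP m1 h1; have [Q hQ] := cl_eqP m1 h2.
  have qP : quo (N + N') (A + A') = P.
    apply/ffunP => i; rewrite ffunE hP /mulm !ffunE addrK mulrC mulzK //.
    by rewrite -lt0n (ltn_trans _ m1).
  have qQ : quo (N - N') (A - A') = Q.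
    apply/ffunP => i; rewrite ffunE hQ /mulm !ffunE addrK mulrC mulzK //.
    by rewrite -lt0n (ltn_trans _ m1).
  have mZ : m%:Z = 2 * (m./2)%:Z by rewrite {1}m_half PoszD; ring.
  have NA : N = A + [ffun i => (m./2)%:Z * [ffun i => P i + Q i] i].
    apply/ffunP => i; move/ffunP/(_ i): hP; move/ffunP/(_ i): hQ.
    rewrite /mulm !ffunE mZ => e1' e2'.
    apply: (@mulfI _ (2 : int)) => //.
    have -> : 2 * N i = (N i + N' i) + (N i - N' i) by ring.
    by rewrite e1' e2'; ring.
  have NA' : N' = A' + [ffun i => (m./2)%:Z * [ffun i => P i - Q i] i].
    apply/ffunP => i; move/ffunP/(_ i): hP; move/ffunP/(_ i): hQ.
    rewrite /mulm !ffunE mZ => e1' e2'.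
    apply: (@mulfI _ (2 : int)) => //.
    have -> : 2 * N' i = (N i + N' i) - (N i - N' i) by ring.
    by rewrite e1' e2'; ring.
  pose eta := [ffun i => odd `|(P i + Q i)%R|%N] : half_chars g.
  have c1 : cl N = cl A + hc eta.
    rewrite {1}NA clD half_class_odd; congr (_ + hc _).
    by apply/ffunP => i; rewrite !ffunE.
  have c2 : cl N' = cl A' + hc eta.
    rewrite {1}NA' clD half_class_odd; congr (_ + hc _).
    by apply/ffunP => i; rewrite !ffunE; move: (P i) (Q i) => x y; lia.
  rewrite qP qQ sgp_sgn (bigD1 eta) //= /clind c1 c2 !eqxx !mulr1 big1 ?addr0 // => e ee.
  rewrite (inj_eq (addrI _)) (inj_eq half_class_inj) eq_sym (negbTE ee).
  by rewrite mul0r mulr0.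
rewrite big1 => [|e _].
  move: nh; rewrite negb_and; case: (cl (N + N') == _); last by rewrite mul0r.
  by rewrite /= => /negbTE ->; rewrite mulr0.
rewrite /clind; case: eqP => [h1|_]; last by rewrite mul0r mulr0.
case: eqP => [h2|_]; last by rewrite !mulr0.
case/negP: nh; rewrite !clD !clN h1 h2; apply/andP; split; apply/eqP.
  by rewrite addrACA half_classK addr0.
by rewrite opprD addrACA subrr addr0.
Qed.

(** Congruences modulo the even number m give x = A + A' + m P and y = A - A' + m Q equal parities,
    so that (x, y) comes from integral N and N'. *)
Lemma pair_image (x y : Zg g) (A A' : Zg g) c : (forall N N', (N + N', N - N') != (x, y)) ->
  pc (A + A') c x * pc (A - A') c y = 0.
Proof.
move=> H; rewrite /pc; case: eqP => [h1|_]; last by rewrite mul0r.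
case: eqP => [h2|_]; last by rewrite mulr0.
have [P hP] := cl_eqP m1 h1; have [Q hQ] := cl_eqP m1 h2.
have := H [ffun i => A i + (m./2)%:Z * (P i + Q i)] [ffun i => A' i + (m./2)%:Z * (P i - Q i)].
have mZ : m%:Z = 2 * (m./2)%:Z by rewrite {1}m_half PoszD; ring.
case/eqP; congr (_, _); apply/ffunP => i; rewrite ?hP ?hQ /mulm !ffunE mZ; ring.
Qed.

Definition TH (u : Zg g -> C) b c tau v := S (fun x => pc b c x * u x) (2^-1 *: tau) (2^-1 *: v).

(* Riemann's bilinear relation, with a weight so that it may be differentiated. *)
Lemma riemann (tau : 'M[C]_g) (A A' : Zg g) c z1 z2 (u v w : Zg g -> C) : siegel tau ->
  bdd u -> bdd v -> bdd w ->
  (forall N N', u N = v (N + N') + w (N - N')) ->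
  \sum_(e : half_chars g) sgn C c e *
    (S (fun N => clind R (cl A + hc e) N * u N) tau z1 * th (cl A' + hc e) tau z2)
  = TH v (A + A') c tau (z1 + z2) * TH (fun=> 1) (A - A') c tau (z1 - z2)
  + TH (fun=> 1) (A + A') c tau (z1 + z2) * TH w (A - A') c tau (z1 - z2).
Proof.
move=> ts bu bv bw E.
have b1 : bdd (fun _ : Zg g => 1 : C) by apply: (@bdd_cst _ _ _ 1) => N; rewrite Normc.normc1.
have th2 := siegel_half ts.
have bcu a := bddM (bdd_clind R a) bu.
pose T1 (u1 u2 : Zg g -> C) (x : Zg g * Zg g) :=
  (pc (A + A') c x.1 * u1 x.1 * ex m (2^-1 *: tau) (2^-1 *: (z1 + z2)) x.1) *
  (pc (A - A') c x.2 * u2 x.2 * ex m (2^-1 *: tau) (2^-1 *: (z1 - z2)) x.2).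
have HT u1 u2 : bdd u1 -> bdd u2 -> has_sum (T1 u1 u2)
   (TH u1 (A + A') c tau (z1 + z2) * TH u2 (A - A') c tau (z1 - z2)).
  move=> bu1 bu2; have := has_sum_pair (S_summable m1 (2^-1 *: (z1 + z2)) th2 (bddM (bdd_pc (A + A') c) bu1))
    (S_summable m1 (2^-1 *: (z1 - z2)) th2 (bddM (bdd_pc (A - A') c) bu2)).
  by apply; apply: S_has_sum => //; exact: bddM (bdd_pc _ _) _.
have H := has_sumD (HT v (fun=> 1) bv b1) (HT (fun=> 1) w b1 bw).
have HL : has_sum (fun x : Zg g * Zg g => \sum_(e : half_chars g) sgn C c e *
   ((clind R (cl A + hc e) x.1 * u x.1 * ex m tau z1 x.1) *
    (clind R (cl A' + hc e) x.2 * ex m tau z2 x.2)))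
   (\sum_(e : half_chars g) sgn C c e *
    (S (fun N => clind R (cl A + hc e) N * u N) tau z1 * th (cl A' + hc e) tau z2)).
  apply: has_sum_sum => e; apply: has_sumZ; rewrite th_S //.
  apply: (has_sum_pair (f := fun N => clind R (cl A + hc e) N * u N * ex m tau z1 N)
    (h := fun N => clind R (cl A' + hc e) N * ex m tau z2 N)).
  - exact: S_summable.
  - exact: S_summable (bdd_clind _ _).
  - exact: S_has_sum.
  - exact: S_has_sum (bdd_clind _ _).
pose q (x : Zg g * Zg g) := (x.1 + x.2, x.1 - x.2).
have qi : injective q.
  move=> [N N'] [M M'] [] /ffunP h1 /ffunP h2; congr (_, _); apply/ffunP => i;
  have := h1 i; have := h2 i; rewrite !ffunE; move: (N i) (N' i) (M i) (M' i) => ? ? ? ?; lia.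
have := has_sum_inj qi (f := fun x => T1 v (fun=> 1) x + T1 (fun=> 1) w x).
set L := \sum_(e : half_chars g) _; set Rh := (_ + _ : C) => HI.
apply: has_sum_uniq (HI L _ _) H.
  move=> [x y] Hxy; have h := @pair_image x y A A' c (fun N N' => Hxy (N, N')).
  rewrite /T1 /=.
  set a := pc _ _ x in h *; set b := pc _ _ y in h *.
  transitivity ((a * b) * (v x * ex m (2^-1 *: tau) (2^-1 *: (z1 + z2)) x * ex m (2^-1 *: tau) (2^-1 *: (z1 - z2)) y
    + ex m (2^-1 *: tau) (2^-1 *: (z1 + z2)) x * (w y * ex m (2^-1 *: tau) (2^-1 *: (z1 - z2)) y))).
    move: a b h (v x) (w y) (ex m _ _ x) (ex m _ _ y) => p1 p2 _ p3 p4 p5 p6.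
    by ring.
  by rewrite h mul0r.
apply: has_sum_ext HL => -[N N'] /=; rewrite /T1 /q /=.
transitivity ((\sum_(e : half_chars g) sgn C c e *
     (clind R (cl A + hc e) N * clind R (cl A' + hc e) N')) *
     (u N * (ex m tau z1 N * ex m tau z2 N'))).
  rewrite mulr_suml; apply: eq_bigr => e _.
  by move: (clind R _ _) (clind R _ _) (u _) (ex m _ _ _) (ex m _ _ _) => p1 p2 p3 p4 p5; ring.
rewrite -pc_pair -ex_pair (E N N').
move: (pc _ _ _) (pc _ _ _) (v _) (w _) (ex m _ _ (N + N')) (ex m _ _ (N - N')).
by move=> p1 p2 p3 p4 p5 p6; ring.
Qed.

(** The coefficient of index b has modulus one, and [S_uniq] recovers coefficients from the
    function. *)
Lemma TH_nonzero (tau : 'M[C]_g) b c : siegel tau -> exists v, TH (fun=> 1) b c tau v != 0.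
Proof.
move=> ts; apply: contrapT => H.
have : pc b c b = 0.
  have := S_uniq m1 (siegel_half ts) (bddM (bdd_pc b c) (@bdd_cst _ _ (fun=> 1) 1 _)).
  move=> /(_ (fun N => ltac:(by rewrite Normc.normc1))) h.
  have := h _ b; rewrite mulr1; apply => z.
  case: (eqVneq (S (fun x => pc b c x * 1) (2^-1 *: tau) z) 0) => // nz.
  case: H; exists (2%:R *: z).
  by rewrite /TH scalerA mulVf ?pnatr_eq0 // scale1r.
rewrite /pc eqxx => /eqP; rewrite -nrm_eq0 nrm_sgp.
by rewrite oner_eq0.
Qed.

(** Entire functions, seen only through their restrictions to complex lines. *)
Definition lent (F : Cg -> C) : Prop := forall z v (rho : R), 0 < rho ->
  pser rho (fun t => F (z + t *: v)).

(** If F is nonzero at z1 and G at z2, restrict both to the line through these points: the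
    parameters 0 and 1 lie in the disc of radius 1, where power series form a domain. *)
Lemma lent_eq0 F G : lent F -> lent G -> (forall z, F z * G z = 0) ->
  (forall z, F z = 0) \/ (forall z, G z = 0).
Proof.
move=> lF lG H; apply: contrapT => /not_orP[/existsNP[z1 /eqP h1] /existsNP[z2 /eqP h2]].
have r1 : 0 < 1 :> R by [].
have [h|h] := pser_mul_eq0 r1 (lF z1 (z2 - z1) 1 r1) (lG z1 (z2 - z1) 1 r1) (fun t _ => H _).
  have := h 0; rewrite Normc.normc0 scale0r addr0 => /(_ ler01) E.
  by rewrite E eqxx in h1.
have := h 1; rewrite Normc.normc1 scale1r addrC subrK lexx => /(_ isT) E.
by rewrite E eqxx in h2.
Qed.

Lemma lent_S p (tau : 'M[C]_g) (k : C) z0 : siegel tau -> bdd p -> lent (fun z => S p tau (z0 + k *: z)).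
Proof.
move=> ts bp z v rho r0; apply: pser_ext (S_pser m1 (z0 + k *: z) (k *: v) ts bp r0) => t.
by rewrite scalerDr addrA !scalerA mulrC.
Qed.

Lemma lentM F G : lent F -> lent G -> lent (fun z => F z * G z).
Proof. by move=> lF lG z v rho r0; apply: pserM; [exact: lF|exact: lG]. Qed.

Lemma lentD F G : lent F -> lent G -> lent (fun z => F z + G z).
Proof. by move=> lF lG z v rho r0; apply: pserD; [exact: lF|exact: lG]. Qed.

Lemma lentN F : lent F -> lent (fun z => - F z).
Proof. by move=> lF z v rho r0; apply: pserN; exact: lF. Qed.

Lemma bdd1 : bdd (fun _ : Zg g => 1 : C).
Proof. by apply: (@bdd_cst _ _ _ 1) => N; rewrite Normc.normc1. Qed.

Lemma bdd0 : bdd (fun _ : Zg g => 0 : C).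
Proof. by apply: (@bdd_cst _ _ _ 0) => N; rewrite Normc.normc0. Qed.

Lemma TH0 b c (tau : 'M[C]_g) v : TH (fun=> 0) b c tau v = 0.
Proof.
apply: S_eq; apply: has_sum_ext (@has_sum0 R (Zg g)) => N.
by rewrite mulr0 mul0r.
Qed.

Definition Qf c (a b : B) (tau : 'M[C]_g) z1 z2 : C :=
  \sum_(e : half_chars g) sgn C c e * (th (a + hc e) tau z1 * th (b + hc e) tau z2).

Lemma Qf_TH (tau : 'M[C]_g) (A A' : Zg g) c z1 z2 : siegel tau ->
  Qf c (cl A) (cl A') tau z1 z2 =
  TH (fun=> 1) (A + A') c tau (z1 + z2) * TH (fun=> 1) (A - A') c tau (z1 - z2).
Proof.
move=> ts; have := riemann A A' c z1 z2 ts bdd1 bdd1 bdd0 (fun N N' => ltac:(by rewrite addr0)).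
rewrite TH0 mulr0 addr0 => <-; apply: eq_bigr => e _; congr (_ * (_ * _)).
by rewrite th_S //; apply: S_ext => N; rewrite mulr1.
Qed.

(** Lift the classes to integral vectors with A + A' = A1 + A2. By [Qf_TH] each factor is a function
    of the sum times one of the difference; a shift of both vectors by D adds 2 D to the sum and
    keeps the difference, so both sides are the same product of four values of [TH]. *)
Lemma Qf_relation (tau : 'M[C]_g) (a b a' b' d : B) c z : siegel tau -> a + b = a' + b' ->
  Qf c (a' + d) (b' + d) tau 0 0 * Qf c a b tau z z =
  Qf c (a + d) (b + d) tau 0 0 * Qf c a' b' tau z z.
Proof.
move=> ts E.
pose A := lft a; pose A' := lft b; pose D := lft d; pose A1 := lft a'.
pose A2 := A + A' - A1.
have cb : cl A2 = b' by rewrite clD clN clD !lftK // E addrAC subrr add0r.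
have H1 := Qf_TH (A1 + D) (A2 + D) c 0 0 ts.
have H2 := Qf_TH (A + D) (A' + D) c 0 0 ts.
have H3 := Qf_TH A A' c z z ts.
have H4 := Qf_TH A1 A2 c z z ts.
rewrite !(clD m _ D) cb !lftK addr0 subr0 in H1; rewrite !(clD m _ D) !lftK addr0 subr0 in H2.
rewrite !lftK subrr in H3; rewrite cb lftK subrr in H4.
rewrite H1 H2 H3 H4.
have -> : A1 + D + (A2 + D) = A + A' + (D + D).
  by apply/ffunP => i; rewrite !ffunE; ring.
have -> : A + D + (A' + D) = A + A' + (D + D).
  by apply/ffunP => i; rewrite !ffunE; ring.
have -> : A1 + D - (A2 + D) = A1 - A2 by apply/ffunP => i; rewrite !ffunE; ring.
have -> : A + D - (A' + D) = A - A' by apply/ffunP => i; rewrite !ffunE; ring.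
have -> : A1 + A2 = A + A' by apply/ffunP => i; rewrite !ffunE; ring.
move: (TH _ _ _ _ 0) (TH _ (A1 - A2) _ _ 0) (TH _ (A - A') _ _ 0) (TH _ _ _ _ (z + z)).
by move=> p1 p2 p3 p4; ring.
Qed.

Lemma lent_TH u b c (tau : 'M[C]_g) (k : C) z0 : siegel tau -> bdd u ->
  lent (fun z => TH u b c tau (z0 + k *: z)).
Proof.
move=> ts bu z v rho r0.
have := lent_S (2^-1 * k) (2^-1 *: z0) (siegel_half ts) (bddM (bdd_pc b c) bu) z v r0.
by apply: pser_ext => t; rewrite /TH; congr (S _ _ _); rewrite [RHS]scalerDr scalerA.
Qed.

(* If all coordinates vanished at z0, the relation with z1 = z0 would exhibit a
   zero product of two nonzero entire functions. *)
Lemma th_nonzero (tau : 'M[C]_g) z0 : siegel tau -> exists a : B, th a tau z0 != 0.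
Proof.
move=> ts; apply: contrapT => H.
have t0 (a : B) : th a tau z0 = 0 by apply/eqP/contraT => h; case: H; exists a.
have E y : TH (fun=> 1) 0 [ffun=> false] tau (z0 + 1 *: y) *
           TH (fun=> 1) 0 [ffun=> false] tau (z0 + (-1) *: y) = 0.
  have := @Qf_TH tau 0 0 [ffun=> false] z0 y ts; rewrite addr0 subr0 scale1r scaleN1r => <-.
  by rewrite /Qf big1 // => e _; rewrite t0 mul0r mulr0.
have [v hv] := TH_nonzero 0 [ffun=> false] ts.
have [h|h] := lent_eq0 (lent_TH 0 [ffun=> false] 1 z0 ts bdd1)
  (lent_TH 0 [ffun=> false] (-1) z0 ts bdd1) E.
  by have := h (v - z0); rewrite scale1r addrC subrK => /eqP; rewrite (negbTE hv).
by have := h (z0 - v); rewrite scaleN1r opprB addrC subrK => /eqP; rewrite (negbTE hv).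
Qed.

End Riemann.

(** * Monomials in theta functions *)

Section TauSeries.
Variables (R : realType) (g m : nat).
Hypothesis m1 : (1 < m)%N.
Local Notation C := R[i].
Local Notation B := (Bm g m).

Lemma qd_lin (M : 'M[C]_g) s H N : qd (M + s *: H) N = qd M N + s * qd H N.
Proof. by rewrite qdD qdZ. Qed.

Lemma S0_an (p : Zg g -> C) : bdd p -> tau_an (fun tau => S m p tau 0).
Proof.
move=> [M [b [M0 Hb]]].
have sp (e : R) : 0 < e -> summable (fun N => p N * toC (expR (- e * zsq R N))).
  move=> e0; have := summableZ (toC M) (summable_gauss g b e0).
  apply: summable_le => N; rewrite !Normc.normcM !nrm_toC (ger0_norm M0) !(ger0_norm (expR_ge0 _)).
  by rewrite expRD mulrCA mulrC ler_wpM2l ?expR_ge0.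
have := tau_series_an m1 qd_lin (zsq_ge0 (g := g) R) (fun t => @siegel_lower_bound R g t)
  (@qd_upper_bound R g) sp.
apply: tau_an_ext => tau; rewrite /S; congr tsum; apply/funext => N.
by rewrite /ex dt0 mulr0 addr0.
Qed.

Variable d : nat.
Local Notation W := {ffun 'I_d -> Zg g}.
Local Notation Wd := {ffun 'I_d -> B}.

Definition wcond (w : Wd) (N : W) : bool := [forall j, cl m (N j) == w j].
(** The Fourier coefficient of frequency M of the product over j of [th (w j) tau], as a function of
    z. *)
Definition coef (w : Wd) (M : Zg g) (tau : 'M[C]_g) : C :=
  tsum (fun N : W => (wcond w N && (\sum_j N j == M))%:R * cexp (toC pi * iC R * ((\sum_j qd tau (N j)) / m%:R))).

Lemma sum_qd_lower (tau : 'M[C]_g) : siegel tau ->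
  exists2 c : R, 0 < c & forall N : W, c * (\sum_j zsq R (N j)) <= im (\sum_j qd tau (N j)).
Proof.
move=> ts; have [c c0 H] := siegel_lower_bound ts; exists c => // N.
by rewrite im_sumC mulr_sumr; apply: ler_sum => j _.
Qed.

Lemma sum_qd_upper (H : 'M[C]_g) :
  exists2 K : R, 0 < K & forall N : W, nrm (\sum_j qd H (N j)) <= K * (\sum_j zsq R (N j)).
Proof.
have [K K0 HK] := qd_upper_bound H; exists K => // N.
by rewrite mulr_sumr; apply: le_trans (nrm_sum _ _ _) _; apply: ler_sum => j _.
Qed.

Lemma sum_zsq_ge0 (N : W) : 0 <= \sum_j zsq R (N j).
Proof. by apply: sumr_ge0 => j _; exact: zsq_ge0. Qed.

Lemma sum_qd_lin (M : 'M[C]_g) s H (N : W) :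
  \sum_j qd (M + s *: H) (N j) = \sum_j qd M (N j) + s * \sum_j qd H (N j).
Proof. by rewrite mulr_sumr -big_split; apply: eq_bigr => j _; rewrite qd_lin. Qed.

Lemma summable_W (p : W -> C) (e : R) : (forall N, nrm (p N) <= 1) -> 0 < e ->
  summable (fun N : W => p N * toC (expR (- e * (\sum_j zsq R (N j))))).
Proof.
move=> Hp e0; have := summable_gaussW (R := R) g d 0 e0.
apply: summable_le => N; rewrite mul0r addr0 [leLHS]Normc.normcM.
by rewrite ler_piMl ?nrm_ge0.
Qed.

Lemma nrm_bool (b : bool) : nrm (b%:R : C) <= 1.
Proof. by case: b; rewrite ?Normc.normc1 ?Normc.normc0. Qed.

Lemma coef_an w M : tau_an (coef w M).
Proof.
exact: (tau_series_an m1 sum_qd_lin sum_zsq_ge0 sum_qd_lower sum_qd_upper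
  (fun e e0 => summable_W (fun N => nrm_bool _) e0)).
Qed.

Lemma coef_summable (p : W -> C) (tau : 'M[C]_g) : (forall N, nrm (p N) <= 1) -> siegel tau ->
  summable (fun N : W => p N * cexp (toC pi * iC R * ((\sum_j qd tau (N j)) / m%:R))).
Proof.
move=> Hp; exact: (tau_series_summable m1 sum_qd_lower
  (fun e e0 => summable_W Hp e0)).
Qed.

Lemma coef_has_sum w M (tau : 'M[C]_g) : siegel tau ->
  has_sum (fun N : W => (wcond w N && (\sum_j N j == M))%:R *
    cexp (toC pi * iC R * ((\sum_j qd tau (N j)) / m%:R))) (coef w M tau).
Proof. by move=> ts; apply/tsumP/coef_summable => // N; exact: nrm_bool. Qed.

Lemma monomials_fourier (K : finType) (c : K -> C) (w : K -> Wd) (tau : 'M[C]_g) : siegel tau ->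
  (forall z, \sum_k c k * \prod_j th (w k j) tau z = 0) ->
  forall M, \sum_k c k * coef (w k) M tau = 0.
Proof.
move=> ts H M.
pose E (N : W) : C := cexp (toC pi * iC R * ((\sum_j qd tau (N j)) / m%:R)).
pose a k (N : W) := (wcond (w k) N)%:R * E N.
have sa k : summable (a k) by apply: coef_summable => // N; exact: nrm_bool.
pose A N := \sum_k c k * a k N.
have sA : summable A by apply: summable_sum => k; exact: summableZ.
have HA (x : 'I_g -> R) : has_sum (fun N => A N * e1 (\sum_i ((\sum_j N j : Zg g) i)%:~R * x i)) 0.
  rewrite -(H (\row_i toC (x i))).
  have Hk k : has_sum (fun N : W => \prod_j (clind R (w k j) (N j) * ex m tau (\row_i toC (x i)) (N j)))
      (\prod_j th (w k j) tau (\row_i toC (x i))).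
    apply: (has_sum_ffun (f := fun j N => clind R (w k j) N * ex m tau (\row_i toC (x i)) N) (0 : Zg g)) => j.
      exact: S_summable (bdd_clind _ _).
    by rewrite th_S //; exact: S_has_sum (bdd_clind _ _).
  have := has_sum_sum (index_enum K) (fun k => has_sumZ (c k) (Hk k)).
  apply: has_sum_ext => N; rewrite mulr_suml; apply: eq_bigr => k _; rewrite -mulrA; congr (_ * _).
  rewrite big_split /= /a -mulrA; congr (_ * _).
    rewrite /wcond; case: forallP => [h|/forallP/forallPn[j hj]].
      by rewrite big1 // => j _; rewrite /clind h.
    by rewrite (bigD1 j) //= /clind (negbTE hj) mul0r.
  have -> : E N = \prod_j ex m tau 0 (N j).
    rewrite -cexp_sum; congr cexp; rewrite mulr_suml mulr_sumr.
    by apply: eq_bigr => j _; rewrite dt0 mulr0 addr0.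
  under eq_bigr do rewrite ex_real.
  rewrite big_split /=; congr (_ * _).
  rewrite -(big_morph (@e1 R) (@e1D R) (@e1_0 R)); congr e1.
  rewrite exchange_big; apply: eq_bigr => i _; rewrite -mulr_suml; congr (_ * _).
  by rewrite sum_ffunE rmorph_sum.
have := fourier_group sA HA M.
have Hc := has_sum_sum (index_enum K) (fun k => has_sumZ (c k) (coef_has_sum (w k) M ts)).
move=> h; apply: has_sum_uniq Hc _; apply: has_sum_ext h => N.
case: (boolP (\sum_j N j == M)) => _; last by rewrite big1 // => k _; rewrite andbF mul0r mulr0.
by apply: eq_bigr => k _; rewrite andbT.
Qed.

Lemma monomials_independent (K : finType) (c : K -> C) (w : K -> Wd) (M : K -> Zg g)
    (tau : 'M[C]_g) : siegel tau ->
  \det (\matrix_(k < #|K|, l < #|K|) coef (w (enum_val k)) (M (enum_val l)) tau) != 0 ->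
  (forall z, \sum_k c k * \prod_j th (w k j) tau z = 0) -> forall k, c k = 0.
Proof.
move=> ts dn0 H k.
pose A := \matrix_(k < #|K|, l < #|K|) coef (w (enum_val k)) (M (enum_val l)) tau.
pose v := \row_(k < #|K|) c (enum_val k).
have vA : v *m A = 0.
  apply/rowP => l; rewrite !mxE -[RHS](monomials_fourier ts H (M (enum_val l))).
  rewrite (reindex (@enum_val K predT)) /=; last by apply/onW_bij/enum_val_bij.
  by apply: eq_bigr => i _; rewrite !mxE.
have Au : A \in unitmx by rewrite unitmxE unitfE.
have v0 : v = 0 by rewrite -(mulmxK Au v) vA mul0mx.
by have := congr1 (fun u : 'rV_#|K| => u ord0 (enum_rank k)) v0; rewrite !mxE enum_rankK.
Qed.

End TauSeries.

(** * Limits of series and determinants at the cusp *)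

Section Cusp.
Variables (R : realType) (g m : nat).
Hypothesis m1 : (1 < m)%N.
Local Notation C := R[i].

(* At tau = i s, the theta series are power series in P = exp (- pi s / m); they
   are compared with their leading terms as P tends to 0. *)
Lemma leading_term (I : eqType) (p : I -> C) (h : I -> nat) (P1 : R) (L : C) : 0 < P1 ->
  summable (fun i => p i * toC (P1 ^+ h i)) ->
  has_sum (fun i => if h i == 0%N then p i else 0) L ->
  forall e : R, 0 < e -> exists2 d : R, 0 < d & forall P l, 0 < P < d ->
    has_sum (fun i => p i * toC (P ^+ h i)) l -> nrm (l - L) < e.
Proof.
move=> P10 [M HM] HL e e0.
have M0 : 0 <= M by have := HM [::] erefl; rewrite big_nil.
have M1 : 0 < M + 1 by rewrite ltr_wpDl.
pose d := Num.min P1 (e * P1 / (M + 1)).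
exists d; first by rewrite lt_min P10 divr_gt0 // mulr_gt0.
move=> P l /andP[P0]; rewrite lt_min => /andP[PP1]; rewrite ltr_pdivlMr // => PM Hl.
apply: (@le_lt_trans _ _ (P / P1 * M)); last first.
  rewrite mulrAC ltr_pdivrMr //; apply: le_lt_trans PM.
  by rewrite ler_wpM2l ?(ltW P0) // lerDl.
apply: has_sum_nrm_le (has_sumD Hl (has_sumN HL)) => s us.
apply: le_trans (_ : P / P1 * \sum_(i <- s) nrm (p i * toC (P1 ^+ h i)) <= _); last first.
  by rewrite ler_wpM2l ?HM // divr_ge0 ?ltW.
rewrite mulr_sumr; apply: ler_sum => i _.
case: eqP => [->|/eqP hi].
  rewrite !expr0 /toC rmorph1 !mulr1 subrr Normc.normc0.
  by rewrite mulr_ge0 ?nrm_ge0 // divr_ge0 ?ltW.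
rewrite subr0 !Normc.normcM !nrm_toC mulrCA ler_wpM2l ?nrm_ge0 //.
rewrite !ger0_norm ?exprn_ge0 ?(ltW P0) ?(ltW P10) //.
rewrite -lt0n in hi; rewrite -(prednK hi) !exprS.
have -> : P / P1 * (P1 * P1 ^+ (h i).-1) = P * P1 ^+ (h i).-1 by rewrite mulrA divfK ?gt_eqF.
by rewrite ler_wpM2l ?(ltW P0) // lerXn2r ?nnegrE ?(ltW P0) ?(ltW P10) ?(ltW PP1).
Qed.

Lemma fin_min (I : finType) (d : I -> R) : (forall i, 0 < d i) ->
  exists2 e : R, 0 < e & forall i, e <= d i.
Proof.
move=> d0; exists (\big[Num.min/1]_i d i).
  by elim/big_ind: _ => // x y x0 y0; rewrite lt_min x0.
move=> i; by rewrite (bigD1 i) //= ge_min lexx.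
Qed.

Lemma det_approx n (L : 'M[C]_n) (e : R) : 0 < e -> exists2 d : R, 0 < d &
  forall A : 'M[C]_n, (forall i j, nrm (A i j - L i j) < d) -> nrm (\det A - \det L) < e.
Proof.
move=> e0.
pose k := #|{: {perm 'I_n}}|.
have ek : 0 < e / k.+1%:R by rewrite divr_gt0.
have H (s : {perm 'I_n}) := prod_approx (index_enum 'I_n) (fun i => L i (s i)) ek.
have [D HD] : exists D : {perm 'I_n} -> R, forall s, 0 < D s /\ forall a : 'I_n -> C,
    (forall i, nrm (a i - L i (s i)) < D s) ->
    nrm (\prod_i a i - \prod_i L i (s i)) < e / k.+1%:R.
  have Q (s : {perm 'I_n}) : exists D : R, 0 < D /\ forall a : 'I_n -> C,
    (forall i, nrm (a i - L i (s i)) < D) ->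
    nrm (\prod_i a i - \prod_i L i (s i)) < e / k.+1%:R.
    by have [D D0 h] := H s; exists D.
  by have [D HD] := boolp.choice Q; exists D.
have [d d0 Hd] := fin_min (fun s => (HD s).1).
exists d => // A HA; rewrite /determinant -sumrB.
apply: le_lt_trans (nrm_sum _ _ _) _.
apply: le_lt_trans (_ : \sum_(s : {perm 'I_n}) e / k.+1%:R < _).
  apply: ler_sum => s _; rewrite -mulrBr Normc.normcM nrmX normcN Normc.normc1 expr1n mul1r.
  apply/ltW/(HD s).2 => i; exact: lt_le_trans (HA _ _) (Hd s).
by rewrite sumr_const mulrn_div_lt.
Qed.

(** Dividing column j by [f j P] leaves a matrix that tends to L. *)
Lemma det_leading n (L : 'M[C]_n) (A : R -> 'M[C]_n) (f : 'I_n -> R -> C) : \det L != 0 ->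
  (forall i j (e : R), 0 < e -> exists2 d : R, 0 < d & forall P : R, 0 < P < d ->
     exists2 l, A P i j = f j P * l & nrm (l - L i j) < e) ->
  (forall j P, 0 < P -> f j P != 0) ->
  exists2 d : R, 0 < d & forall P : R, 0 < P < d -> \det (A P) != 0.
Proof.
move=> L0 HA Hf.
have eL : 0 < nrm (\det L) by rewrite nrm_gt0.
have [e e0 He] := det_approx L eL.
have [D HD] : exists D : 'I_n * 'I_n -> R, forall x, 0 < D x /\ forall P : R, 0 < P < D x ->
     exists2 l, A P x.1 x.2 = f x.2 P * l & nrm (l - L x.1 x.2) < e.
  have Q x : exists D : R, 0 < D /\ forall P : R, 0 < P < D ->
     exists2 l, A P x.1 x.2 = f x.2 P * l & nrm (l - L x.1 x.2) < e.
    by have [D D0 h] := HA x.1 x.2 e e0; exists D.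
  by have [D HD] := boolp.choice Q; exists D.
have [d d0 Hd] := fin_min (fun x => (HD x).1).
exists d => // P /andP[P0 Pd].
have Q (i j : 'I_n) : exists l, A P i j = f j P * l /\ nrm (l - L i j) < e.
  have [l h1 h2] := (HD (i, j)).2 P ltac:(by rewrite P0 (lt_le_trans Pd)).
  by exists l.
have Q' i : exists M : 'I_n -> C, forall j, A P i j = f j P * M j /\ nrm (M j - L i j) < e.
  by have [M HM] := boolp.choice (Q i); exists M.
have [M HM] := boolp.choice Q'.
have -> : A P = (\matrix_(i, j) M i j) *m diag_mx (\row_j f j P).
  apply/matrixP => i j; rewrite mul_mx_diag !mxE.
  by have [-> _] := HM i j; rewrite mulrC.
rewrite det_mulmx det_diag mulf_neq0 //; last first.
  by apply/prodf_neq0 => j _; rewrite mxE Hf.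
have := He (\matrix_(i, j) M i j) (fun i j => ltac:(by rewrite mxE; case: (HM i j))).
by apply: contraTneq => ->; rewrite sub0r normcN ltxx.
Qed.

Definition nsq (N : Zg g) : nat := \sum_i `|N i|%N ^ 2.

Lemma zsq_nsq N : zsq R N = (nsq N)%:R.
Proof.
rewrite /zsq /nsq natr_sum; apply: eq_bigr => i _.
have -> : ((`|N i| ^ 2)%N%:R : R) = (((`|N i|%N : int) ^+ 2)%:~R) by rewrite rmorphXn natrX.
by rewrite abszE real_normK ?num_real // rmorphXn.
Qed.

Definition cusp (P : R) : 'M[C]_g := (iC R * toC (- (m%:R * ln P / pi)))%:M.

Lemma cusp_siegel P : 0 < P < 1 -> siegel (cusp P).
Proof.
move=> /andP[P0 P1]; split; first exact: tr_scalar_mx.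
move=> x x0.
have -> : Defs.ImM (cusp P) = (- (m%:R * ln P / pi))%:M.
  apply/matrixP => i j; rewrite !mxE; case: (i == j); last by rewrite !mulr0n.
  by rewrite !mulr1n /iC /toC; simpc.
rewrite mul_mx_scalar -scalemxAl mxE mulr_gt0 //.
  rewrite oppr_gt0 pmulr_llt0 ?invr_gt0 ?pi_gt0 // pmulr_rlt0 ?ltr0n ?(ltn_trans _ m1) //.
  by rewrite ln_lt0 // P0.
have [i xi] : exists i, x ord0 i != 0.
  by apply/existsP; apply: contraNT x0 => /existsPn h; apply/eqP/rowP => i; rewrite mxE; apply/eqP; have := h i; rewrite negbK.
rewrite mxE (bigD1 i) //= ltr_pwDl //.
  by rewrite mxE -expr2 exprn_even_gt0.
by apply: sumr_ge0 => j _; rewrite mxE -expr2 sqr_ge0.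
Qed.

Lemma qd_cusp P N : toC pi * iC R * (qd (cusp P) N / m%:R) = toC (ln P * (nsq N)%:R).
Proof.
have -> : qd (cusp P) N = iC R * toC (- (m%:R * ln P / pi)) * toC (zsq R N).
  rewrite /qd /zsq /toC rmorph_sum mulr_sumr; apply: eq_bigr => i _.
  rewrite (bigD1 i) //= big1 => [|j /negbTE ji]; last by rewrite mxE eq_sym ji mulr0n mulr0 mul0r.
  by rewrite mxE eqxx mulr1n addr0 rmorphXn rmorph_int; ring.
rewrite zsq_nsq.
have -> : toC pi * iC R * (iC R * toC (- (m%:R * ln P / pi)) * toC (nsq N)%:R / m%:R) =
   iC R ^+ 2 * (toC pi * toC (- (m%:R * ln P / pi)) * toC (nsq N)%:R / m%:R) by ring.
rewrite iC2 -(rmorph_nat (real_complex R) m) /toC -!rmorphM -fmorphV -rmorphM mulN1r -rmorphN.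
have m0 : (m%:R : R) != 0 by rewrite gt_eqF ?(mR0 R m1).
have p0 : (pi : R) != 0 by rewrite gt_eqF ?pi_gt0.
apply: (congr1 (real_complex R)); move: (m%:R : R) m0 (pi : R) p0 (ln P) ((nsq N)%:R : R) => M M0 p p0 l n.
by field; rewrite ?M0 ?p0.
Qed.

Lemma ex_cusp P N : 0 < P -> ex m (cusp P) 0 N = toC (P ^+ nsq N).
Proof.
move=> P0; rewrite /ex dt0 mulr0 addr0 qd_cusp /cexp /= cos0 sin0.
by rewrite expRM_natr lnK ?posrE // mulr1.
Qed.

Lemma sum_cusp d P (N : {ffun 'I_d -> Zg g}) : 0 < P ->
  cexp (toC pi * iC R * ((\sum_j qd (cusp P) (N j)) / m%:R)) = toC (P ^+ (\sum_j nsq (N j))).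
Proof.
move=> P0; rewrite mulr_suml mulr_sumr cexp_sum -prodrXr /toC rmorph_prod.
apply: eq_bigr => j _; have := ex_cusp (N j) P0.
by rewrite /ex dt0 mulr0 addr0 => ->.
Qed.

End Cusp.

(** * Leading terms at the cusp and normal words *)

Section Leading.
Variables (R : realType) (g m : nat).
Hypothesis m1 : (1 < m)%N.
Local Notation C := R[i].
Local Notation B := (Bm g m).
Local Notation cusp := (@cusp R g m).

(* f P ~ L P^e as P tends to 0 *)
Definition lead (e : nat) (f : R -> C) (L : C) : Prop := forall eps : R, 0 < eps ->
  exists2 d : R, 0 < d & forall P : R, 0 < P < d ->
    exists2 l, f P = toC (P ^+ e) * l & nrm (l - L) < eps.

Lemma lead_cst c : lead 0 (fun=> c) c.
Proof.
move=> e e0; exists 1 => // P _; exists c; last by rewrite subrr Normc.normc0.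
by rewrite expr0 /toC rmorph1 mul1r.
Qed.

Lemma leadD e f h L M : lead e f L -> lead e h M -> lead e (fun P => f P + h P) (L + M).
Proof.
move=> Hf Hh eps e0; have e2 : 0 < eps / 2 by rewrite divr_gt0.
have [d d0 Hd] := Hf _ e2; have [d' d'0 Hd'] := Hh _ e2.
exists (Num.min d d') => [|P /andP[P0]]; first by rewrite lt_min d0.
rewrite lt_min => /andP[Pd Pd'].
have [l E1 h1] := Hd P ltac:(by rewrite P0); have [l' E2 h2] := Hd' P ltac:(by rewrite P0).
exists (l + l'); first by rewrite E1 E2 mulrDr.
have -> : l + l' - (L + M) = (l - L) + (l' - M) by ring.
apply: le_lt_trans (le_normcD _ _) _.
have -> : eps = eps / 2 + eps / 2 by field.
exact: ltrD.
Qed.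

Lemma leadM e e' f h L M : lead e f L -> lead e' h M -> lead (e + e') (fun P => f P * h P) (L * M).
Proof.
move=> Hf Hh eps e0.
pose K := 1 + nrm L + nrm M.
have K0 : 0 < K by rewrite /K -addrA ltr_wpDr // addr_ge0 ?nrm_ge0.
pose a := Num.min 1 (eps / (2 * K)).
have a0 : 0 < a by rewrite lt_min ltr01 divr_gt0 // mulr_gt0.
have [d d0 Hd] := Hf _ a0; have [d' d'0 Hd'] := Hh _ a0.
exists (Num.min d d') => [|P /andP[P0]]; first by rewrite lt_min d0.
rewrite lt_min => /andP[Pd Pd'].
have [l E1 h1] := Hd P ltac:(by rewrite P0); have [l' E2 h2] := Hd' P ltac:(by rewrite P0).
exists (l * l'); first by rewrite E1 E2 exprD /toC rmorphM; ring.
apply: le_lt_trans (nrm_continuousM _ _ _ _) _.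
have a1 : a <= 1 by rewrite ge_min lexx.
have aK : a * (2 * K) <= eps.
  by rewrite -ler_pdivlMr ?mulr_gt0 // ge_min lexx orbT.
have b1 := ltW h1; have b2 := ltW h2.
apply: (@le_lt_trans _ _ (a * 1 + nrm L * a + nrm M * a)).
  apply: lerD; last by rewrite ler_wpM2l ?nrm_ge0.
  apply: lerD; last by rewrite ler_wpM2l ?nrm_ge0.
  by apply: ler_pM; rewrite ?nrm_ge0 // (le_trans b2).
have -> : a * 1 + nrm L * a + nrm M * a = a * K by rewrite /K; ring.
apply: lt_le_trans aK; rewrite ltr_pM2l //.
by rewrite mulrDl mul1r ltrDl.
Qed.

Lemma lead_ext e f h L : (exists2 d : R, 0 < d & forall P, 0 < P < d -> f P = h P) ->
  lead e f L -> lead e h L.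
Proof.
move=> [d0 d00 E] H eps /H[d dp Hd].
exists (Num.min d d0) => [|P /andP[P0]]; first by rewrite lt_min dp.
rewrite lt_min => /andP[Pd Pd0]; have [l E1 h1] := Hd P ltac:(by rewrite P0).
by exists l => //; rewrite -E // P0.
Qed.

Lemma lead_eq e f h L : f =1 h -> lead e f L -> lead e h L.
Proof. by move=> E; apply: lead_ext; exists 1. Qed.

Lemma lead0 e : lead e (fun=> 0) 0.
Proof. by move=> eps e0; exists 1 => // P _; exists 0; rewrite ?mulr0 // subrr Normc.normc0. Qed.

Lemma lead_sum (I : Type) (s : seq I) e (f : I -> R -> C) (L : I -> C) :
  (forall i, lead e (f i) (L i)) -> lead e (fun P => \sum_(i <- s) f i P) (\sum_(i <- s) L i).
Proof.
move=> H; elim: s => [|i s IH].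
  by rewrite big_nil; apply: lead_eq (lead0 e) => P; rewrite big_nil.
rewrite big_cons; apply: lead_eq (leadD (H i) IH) => P; by rewrite big_cons.
Qed.

Lemma lead_prod (I : Type) (s : seq I) (Q : pred I) e (f : I -> R -> C) (L : I -> C) :
  (forall i, lead e (f i) (L i)) ->
  lead (e * count Q s) (fun P => \prod_(i <- s | Q i) f i P) (\prod_(i <- s | Q i) L i).
Proof.
move=> H; elim: s => [|i s IH].
  by rewrite big_nil muln0; apply: lead_eq (lead_cst 1) => P; rewrite big_nil.
rewrite big_cons /=; case Qi : (Q i); last first.
  by rewrite add0n; apply: lead_eq IH => P; rewrite big_cons Qi.
by rewrite mulnDr muln1; apply: lead_eq (leadM (H i) IH) => P; rewrite big_cons Qi.
Qed.

Lemma leadZ e c f L : lead e f L -> lead e (fun P => c * f P) (c * L).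
Proof. exact: leadM (lead_cst c). Qed.

(** After division by P^e the exponents are E i - e >= 0, and [leading_term] applies with the
    reference value P1 = 1/2. *)
Lemma lead_series (I : eqType) (p : I -> C) (E : I -> nat) (e : nat) (F : R -> C) (L : C) :
  (forall i, p i != 0 -> (e <= E i)%N) ->
  (forall P : R, 0 < P < 1 -> summable (fun i => p i * toC (P ^+ E i)) /\
     has_sum (fun i => p i * toC (P ^+ E i)) (F P)) ->
  has_sum (fun i => if E i == e then p i else 0) L ->
  lead e F L.
Proof.
move=> HE HF HL.
have X (P : R) i : 0 < P -> toC (P ^+ e)^-1 * (p i * toC (P ^+ E i)) = p i * toC (P ^+ (E i - e)).
  move=> P0; have [->|/HE le] := eqVneq (p i) 0; first by rewrite !mul0r mulr0.
  rewrite -{1}(subnK le) exprD /toC rmorphM /= mulrCA; congr (_ * _).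
  by rewrite mulrCA -rmorphM /= mulVf ?mulr1 // expf_neq0 ?gt_eqF.
have h1 : (0 < (2^-1 : R)) && ((2^-1 : R) < 1) by apply/andP; split; lra.
have s1 : summable (fun i => p i * toC ((2^-1 : R) ^+ (E i - e))).
  apply: summable_ext (summableZ (toC (((2^-1 : R) ^+ e)^-1)) (HF _ h1).1) => i.
  by rewrite X //; case/andP: h1.
have HL' : has_sum (fun i => if (E i - e)%N == 0%N then p i else 0) L.
  apply: has_sum_ext HL => i; have [->|/HE le] := eqVneq (p i) 0; first by rewrite !if_same.
  by rewrite subn_eq0 eqn_leq le andbT.
move=> eps eps0.
have [d d0 Hd] := leading_term (proj1 (andP h1)) s1 HL' eps0.
exists (Num.min d 1) => [|P /andP[P0]]; first by rewrite lt_min d0 ltr01.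
rewrite lt_min => /andP[Pd P1].
have HP := (HF P ltac:(by rewrite P0)).2.
exists (toC (P ^+ e)^-1 * F P).
  by rewrite mulrA -rmorphM /= mulfV ?expf_neq0 ?gt_eqF // /toC rmorph1 mul1r.
apply: (Hd P); first by rewrite P0.
by apply: has_sum_ext (has_sumZ (toC (P ^+ e)^-1) HP) => i; rewrite X.
Qed.

Definition epsB (e : half_chars g) : B := [ffun i => (e i)%:R].
Definition wt (e : half_chars g) : nat := \sum_i e i.
(** In each coordinate one class is e_i and the other 0. Among the pairs with a + b = [epsB e],
    these are the ones whose theta product attains the least exponent [wt e]. *)
Definition bal (e : half_chars g) (a b : B) : bool :=
  [forall i, ((a i == (e i)%:R) && (b i == 0)) || ((a i == 0) && (b i == (e i)%:R))].

Hypothesis m4 : (4 <= m)%N.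

Lemma dvd_small (x : int) : (m%:Z %| x)%Z -> (`|x| < m)%N -> x = 0.
Proof.
rewrite dvdzE => h lt; apply/eqP; rewrite -absz_eq0; apply: contraTT h => x0.
by rewrite gtnNdvd // lt0n.
Qed.

(** When the sum of squares is least, |x| and |y| are at most 1, so that |x + y - b| <= 3 < m and
    the congruence is an equality. *)
Lemma pair_coord (x y : int) (b : bool) : (m%:Z %| x + y - b%:Z)%Z ->
  (b <= `|x| ^ 2 + `|y| ^ 2)%N /\
  ((`|x| ^ 2 + `|y| ^ 2)%N = b -> (x = b%:Z /\ y = 0) \/ (x = 0 /\ y = b%:Z)).
Proof.
move=> h; rewrite -!mulnn; split=> [|E].
  case: b h => // h; rewrite lt0n; apply/eqP => E.
  have [x0 y0] : x = 0 /\ y = 0 by split; nia.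
  by have := dvd_small h; rewrite x0 y0 => /(_ ltac:(lia)).
have [ax ay] : (`|x| <= 1)%N /\ (`|y| <= 1)%N by case: b {h} E => E; split; nia.
have := dvd_small h ltac:(lia); lia.
Qed.

(** The term of a pair of vectors has as exponent the sum of their squared lengths, which is at
    least [wt e] coordinate by coordinate; equality holds for exactly one pair if [bal] holds and
    for none otherwise. *)
Lemma thth_lead (e : half_chars g) (a b : B) : a + b = epsB e ->
  lead (wt e) (fun P => thth (cusp P) a b) (bal e a b)%:R.
Proof.
move=> ab.
pose p (x : Zg g * Zg g) : C := clind R a x.1 * clind R b x.2.
pose E (x : Zg g * Zg g) := (nsq x.1 + nsq x.2)%N.
have Hp x : p x != 0 -> cl m x.1 = a /\ cl m x.2 = b.
  rewrite /p /clind; have [<-|_] := eqVneq (cl m x.1) a; last by rewrite mul0r eqxx.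
  by have [<-|_] := eqVneq (cl m x.2) b; rewrite // mulr0 eqxx.
have Hc x i : p x != 0 -> (m%:Z %| x.1 i + x.2 i - (e i)%:Z)%Z.
  move=> /Hp[h1 h2]; rewrite -Zmod_eq //.
  move/ffunP/(_ i): ab; rewrite -h1 -h2 !ffunE intrD => ->.
  by rewrite -pmulrn.
have EE x : E x = (\sum_i (`|x.1 i| ^ 2 + `|x.2 i| ^ 2))%N by rewrite /E /nsq big_split.
have H1 x : p x != 0 -> (wt e <= E x)%N.
  by move=> px; rewrite EE; apply: leq_sum => i _; exact: (pair_coord (Hc x i px)).1.
have H2 x : p x != 0 -> E x = wt e -> forall i,
    (x.1 i = (e i)%:Z /\ x.2 i = 0) \/ (x.1 i = 0 /\ x.2 i = (e i)%:Z).
  move=> px Ex i; apply: (pair_coord (Hc x i px)).2.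
  apply/eqP; rewrite eqn_leq (pair_coord (Hc x i px)).1 andbT.
  rewrite leqNgt; apply/negP => lt; move/eqP: Ex; apply/negP.
  rewrite EE /wt gtn_eqF // (bigD1 i) //= [X in (_ < X)%N](bigD1 i) //= -addSn leq_add //.
  by apply: leq_sum => j _; exact: (pair_coord (Hc x j px)).1.
apply: (lead_series (p := p) (E := E)) => //.
  move=> P P1; have cs := cusp_siegel g m1 P1; have P0 : 0 < P by case/andP: P1.
  have X x : clind R a x.1 * ex m (cusp P) 0 x.1 * (clind R b x.2 * ex m (cusp P) 0 x.2) =
     p x * toC (P ^+ E x).
    by rewrite !ex_cusp // /p /E exprD /toC rmorphM; ring.
  have sa := S_summable m1 0 cs (bdd_clind R a).
  have sb := S_summable m1 0 cs (bdd_clind R b).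
  split; first by apply: summable_ext X (summable_pair sa sb).
  apply: has_sum_ext X _; rewrite /thth !th_S //.
  exact: has_sum_pair sa sb (S_has_sum m1 0 cs (bdd_clind R a)) (S_has_sum m1 0 cs (bdd_clind R b)).
case: (boolP (bal e a b)) => [/forallP hb|nb]; last first.
  apply: has_sum_ext (@has_sum0 R _) => x; case: eqP => // Ex.
  apply/esym/eqP/contraT => px; case/negP: nb; apply/forallP => i.
  have [h1 h2] := Hp x px; rewrite -h1 -h2 !ffunE.
  by case: (H2 x px Ex i) => -[-> ->]; rewrite -?pmulrn ?mulr0z !eqxx ?orbT.
have l0 (b' : bool) : (nat_of_ord (b'%:R : 'Z_m) = b')%N.
  by rewrite val_Zp_nat // modn_small // (leq_trans _ m1) //; case: b'.
pose x0 := (lft a, lft b).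
have px0 : p x0 = 1 by rewrite /p /clind !lftK !eqxx mulr1.
have Ex0 : E x0 == wt e.
  rewrite EE; apply/eqP/eq_bigr => i _; rewrite !ffunE /=.
  by case/orP: (hb i) => /andP[/eqP-> /eqP->]; rewrite ?l0 /=; case: (e i).
have := @has_sum_fin R _ (fun i => if E i == wt e then p i else 0) [:: x0] isT.
rewrite big_seq1 Ex0 px0; apply => x; rewrite inE => xx0.
case: eqP => // Ex; apply/eqP/contraT => px; case/negP: xx0; apply/eqP.
have [h1 h2] := Hp x px.
rewrite [x]surjective_pairing /x0; congr (_, _); apply/ffunP => i; rewrite ffunE.
  by rewrite -h1 ffunE; case: (H2 x px Ex i) => -[-> _]; rewrite -?pmulrn ?l0.
by rewrite -h2 ffunE; case: (H2 x px Ex i) => -[_ ->]; rewrite -?pmulrn ?l0.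
Qed.

Variable d : nat.
Local Notation W := {ffun 'I_d -> Zg g}.
Local Notation Wd := {ffun 'I_d -> B}.
Local Notation K := {ffun 'I_g -> 'I_m * 'I_d}.

(* The normal words: coordinate i of the letters takes the values e + 1 (on the
   first r letters) and e; the pair (e, r) stands for d e + r mod d m. *)
Definition nuZ (k : K) : W :=
  [ffun j : 'I_d => [ffun i : 'I_g => ((k i).1 + (j < (k i).2))%N%:Z]].
Definition nu (k : K) : Wd := [ffun j => cl m (nuZ k j)].
Definition tot (k : K) : Zg g := \sum_j nuZ k j.
Definition ht (k : K) : nat := \sum_j nsq (nuZ k j).

(** Among families with a given total, the sum of squares is least when each coordinate takes two
    consecutive values e and e + 1 only. The product (N - e)(N - e - 1) equals N^2 up to terms that
    depend on the total alone, and it vanishes at the minimum. *)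
Definition excess (k : K) (N : W) : int :=
  \sum_j \sum_i (N j i - (k i).1%:Z) * (N j i - (k i).1%:Z - 1).

Lemma excess_term (x : int) : 0 <= x * (x - 1) /\ (x * (x - 1) = 0 -> x = 0 \/ x = 1).
Proof. by split=> *; nia. Qed.

Lemma excessE (k : K) (N : W) : \sum_j N j = tot k ->
  (\sum_j nsq (N j))%N%:Z = (ht k)%:Z + excess k N.
Proof.
move=> HN.
have E (M : W) : \sum_j M j = tot k -> (\sum_j nsq (M j))%N%:Z =
   excess k M + \sum_i (tot k i * (2 * (k i).1%:Z + 1) - d%:Z * ((k i).1%:Z * ((k i).1%:Z + 1))).
  move=> hM; rewrite /excess [X in _ = X + _]exchange_big -big_split /=.
  have -> : (\sum_j nsq (M j))%N%:Z = \sum_i \sum_j M j i ^+ 2.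
    rewrite exchange_big /= (big_morph _ PoszD (erefl 0%:Z)); apply: eq_bigr => j _.
    rewrite /nsq (big_morph _ PoszD (erefl 0%:Z)); apply: eq_bigr => i _.
    by rewrite -[LHS]natz natrX natz abszE real_normK ?num_real.
  apply: eq_bigr => i _.
  have -> : tot k i = \sum_j M j i by rewrite -hM sum_ffunE.
  have -> : d%:Z * ((k i).1%:Z * ((k i).1%:Z + 1)) = \sum_(j < d) ((k i).1%:Z * ((k i).1%:Z + 1)).
    by rewrite sumr_const card_ord -mulr_natl natz.
  rewrite mulr_suml -sumrB -big_split; apply: eq_bigr => j _ /=.
  by ring.
have h1 := E N HN; have h2 : (ht k)%:Z = _ := E (nuZ k) erefl.
have e0 : excess k (nuZ k) = 0.
  rewrite /excess big1 // => j _; rewrite big1 // => i _; rewrite !ffunE PoszD.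
  by case: (j < (k i).2)%N => /=; ring.
by rewrite h1 h2 e0 add0r addrC.
Qed.

Lemma excess_ge0 k N : 0 <= excess k N.
Proof. by apply: sumr_ge0 => j _; apply: sumr_ge0 => i _; exact: (excess_term _).1. Qed.

Lemma excess_eq0 k N : excess k N = 0 -> forall j i, N j i = (k i).1%:Z \/ N j i = (k i).1%:Z + 1.
Proof.
move=> /eqP; rewrite psumr_eq0 => [/allP h j i|j _]; last first.
  by apply: sumr_ge0 => i _; exact: (excess_term _).1.
have := h j (mem_index_enum _); rewrite /= psumr_eq0 => [/allP h'|i' _]; last exact: (excess_term _).1.
have /eqP/(excess_term _).2 := h' i (mem_index_enum _).
by case; lia.
Qed.

Lemma sum_step (r : nat) : (r <= d)%N -> (\sum_(j < d) ((j < r)%N : nat) = r)%N.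
Proof.
move=> rd; rewrite -big_mkcond /= -(big_ord_widen d (fun=> 1%N) rd).
by rewrite sum_nat_const card_ord muln1.
Qed.

(** Excess 0 confines each coordinate to the two consecutive integers given by l; the residues
    prescribed by k then tell which of them each letter has. *)
Lemma nuZ_unique (k l : K) (N : W) : (forall j, cl m (N j) = nu k j) ->
  \sum_j N j = tot l -> excess l N = 0 -> k = l /\ N = nuZ l.
Proof.
move=> Hc Ht /excess_eq0 He.
have Hcong j i : (m%:Z %| N j i - (k i).1%:Z - (j < (k i).2)%N%:Z)%Z.
  have := Hc j; rewrite /nu ffunE => /ffunP/(_ i); rewrite !ffunE => /eqP.
  by rewrite Zmod_eq // PoszD opprD addrA.
have Hsum i : \sum_j N j i = d%:Z * (l i).1%:Z + (l i).2%:Z.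
  have := congr1 (fun f : Zg g => f i) Ht; rewrite /tot !sum_ffunE => ->.
  transitivity (\sum_(j < d) ((l i).1%:Z + (j < (l i).2)%N%:Z)).
    by apply: eq_bigr => j _; rewrite !ffunE PoszD.
  rewrite big_split /= sumr_const card_ord -mulr_natl natz; congr (_ + _).
  by rewrite -(big_morph _ PoszD (erefl 0%:Z)) sum_step // ltnW.
have d0 (i : 'I_g) : (0 < d)%N by case: (k i).2 => r; case: d.
have key i : k i = l i /\ forall j, N j i = nuZ l j i.
  have dp := d0 i; 
  (* The last letter is never among the first r, since r < d; so it has the residue e of k itself,
     which must be that of e or e + 1 for l. *)
  have lt : (d.-1 < d)%N by rewrite prednK.
  have h1 := Hcong (Ordinal lt) i; have h2 := He (Ordinal lt) i.
  have kl : ((k i).2 <= d.-1)%N by rewrite -ltnS prednK.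
  have r0 : ((Ordinal lt < (k i).2)%N = false) by rewrite /= ltnNge kl.
  rewrite r0 subr0 in h1.
  have [ek el] := (ltn_ord (k i).1, ltn_ord (l i).1).
  have [E|E] : (k i).1 = (l i).1 :> nat \/ (m%:Z %| (k i).1%:Z - (l i).1%:Z - 1)%Z.
    case: h2 => h2; rewrite h2 in h1; [left|right].
      by have := dvd_small h1 ltac:(lia); lia.
    by rewrite -rpredN; have -> : - ((k i).1%:Z - (l i).1%:Z - 1) = (l i).1%:Z + 1 - (k i).1%:Z by ring.
  - have hN j : N j i = (l i).1%:Z + (j < (k i).2)%N%:Z.
      have h := Hcong j i; rewrite E in h.
      have := dvd_small h; case: (He j i) => -> h'; case: (j < _)%N h' => h'; have := h' ltac:(lia); lia.
    have r : (k i).2 = (l i).2 :> nat.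
      have := Hsum i; rewrite (eq_bigr _ (fun j _ => hN j)) big_split /= sumr_const card_ord.
      rewrite -mulr_natl natz -(big_morph _ PoszD (erefl 0%:Z)) sum_step ?(ltnW (ltn_ord _)) //.
      by move=> /addrI [].
    split; last by move=> j; rewrite hN !ffunE PoszD r.
    by rewrite [k i]surjective_pairing [l i]surjective_pairing; congr (_, _); exact: val_inj.
  (* Here every letter would have the value e + 1 of l, making the total d (e + 1), whereas the
     remainder of l is less than d. *)
  - exfalso.
    have hN j : N j i = (l i).1%:Z + 1.
      case: (He j i) => // h.
      have := rpredD E (Hcong j i); rewrite h => /dvd_small.
      by case: (j < _)%N => h'; have := h' ltac:(lia); lia.
    have := Hsum i; rewrite (eq_bigr _ (fun j _ => hN j)) sumr_const card_ord -mulr_natl natz.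
    by rewrite mulrDr mulr1 => /addrI [] E'; have := ltn_ord (l i).2; rewrite -E' ltnn.
split; first by apply/ffunP => i; case: (key i).
by apply/ffunP => j; apply/ffunP => i; case: (key i).
Qed.

(** By [nuZ_unique], at the frequency [tot l] the least height [ht l] is reached by [nuZ l] alone,
    and only for the word of l. Up to a power of P in each column, the matrix of these coefficients
    thus tends to the identity. *)
Lemma coef_lead (k l : K) :
  lead (ht l) (fun P => coef (nu k) (tot l) (cusp P)) (k == l)%:R.
Proof.
pose p (N : W) : C := (wcond (nu k) N && (\sum_j N j == tot l))%:R.
have Hp N : p N != 0 -> (forall j, cl m (N j) = nu k j) /\ \sum_j N j = tot l.
  rewrite /p; case: andP => [[/forallP h1 /eqP h2] _|_]; last by rewrite eqxx.
  by split=> // j; apply/eqP.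
have HE N : p N != 0 -> (\sum_j nsq (N j))%N%:Z = (ht l)%:Z + excess l N.
  by move=> /Hp[_ h]; exact: excessE.
apply: (lead_series (p := p) (E := fun N => (\sum_j nsq (N j))%N)) => [N /HE h|P P1|].
- by rewrite -lez_nat h lerDl excess_ge0.
- have cs := cusp_siegel g m1 P1; have P0 : 0 < P by case/andP: P1.
  split.
    have := coef_summable m1 (p := p) (fun N => @nrm_bool R _) cs.
    by apply: summable_ext => N; rewrite sum_cusp.
  have := coef_has_sum m1 (nu k) (tot l) cs.
  by apply: has_sum_ext => N; rewrite sum_cusp.
case: (eqVneq k l) => [kl|kl]; last first.
  apply: has_sum_ext (@has_sum0 R _) => N; case: eqP => // EN.
  apply/esym/eqP/contraT => pN; case/eqP: kl.
  have [h1 h2] := Hp N pN; case: (nuZ_unique h1 h2) => //.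
  by have := HE N pN; rewrite EN; lia.
have px0 : p (nuZ l) = 1.
  have h : wcond (nu k) (nuZ l) by rewrite kl; apply/forallP => j; apply/eqP; rewrite [RHS]ffunE.
  by rewrite /p h eqxx.
have := @has_sum_fin R _ (fun N : W => if (\sum_j nsq (N j))%N == ht l then p N else 0) [:: nuZ l] isT.
rewrite big_seq1 eqxx px0; apply => N; rewrite inE => xx0.
case: eqP => // EN; apply/eqP/contraT => pN; case/negP: xx0; apply/eqP.
have [h1 h2] := Hp N pN; case: (nuZ_unique h1 h2) => //.
by have := HE N pN; rewrite EN; lia.
Qed.

Lemma coef_cusp_det : exists2 tau : 'M[C]_g, siegel tau &
  \det (\matrix_(k < #|{: K}|, l < #|{: K}|) coef (nu (enum_val k)) (tot (enum_val l)) tau) != 0.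
Proof.
pose A P := \matrix_(k < #|{: K}|, l < #|{: K}|) coef (nu (enum_val k)) (tot (enum_val l)) (cusp P).
have [|||d0 d00 H] := @det_leading R _ 1%:M A (fun l P => toC (P ^+ ht (enum_val l))).
- by rewrite det1 oner_neq0.
- move=> k l eps e0; have [d1 d10 H] := coef_lead (enum_val k) (enum_val l) e0.
  exists d1 => // P /H[x E h]; exists x; rewrite mxE // -?E //.
  by rewrite -(inj_eq enum_val_inj).
- by move=> l P P0; rewrite -nrm_gt0 nrm_toC normr_gt0 expf_neq0 ?gt_eqF.
have h : 0 < Num.min d0 1 / 2 < Num.min d0 1.
  have q : 0 < Num.min d0 1 by rewrite lt_min d00 ltr01.
  by apply/andP; split; lra.
case/andP: h => h0; rewrite lt_min => /andP[h1 h2].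
exists (cusp (Num.min d0 1 / 2)); first by apply: (cusp_siegel g m1); rewrite h0.
by apply: H; rewrite h0.
Qed.

End Leading.

(** * Normal forms of monomials over k *)

Section Relations.
Variables (g m : nat).
Hypothesis m1 : (1 < m)%N.
Local Notation B := (Bm g m).
Local Notation hc := (@half_class g m).

(** Halving the representative of a i + b i in [0, m) gives [lo], with remainder [ep]; [hi] and [lo]
    form the balanced pair with the same sum as a and b. *)
Definition lo (a b : B) : B := [ffun i => (((a i + b i)%R : nat)./2)%:R].
Definition ep (a b : B) : half_chars g := [ffun i => odd (a i + b i)%R].
Definition hi (a b : B) : B := lo a b + epsB m (ep a b).

Lemma hi_lo a b : hi a b + lo a b = a + b.
Proof.
apply/ffunP => i; rewrite !ffunE addrAC -!natrD addnn addnC odd_double_half.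
exact: natr_Zp.
Qed.

Lemma hc0 : hc [ffun=> false] = 0.
Proof. by apply/ffunP => i; rewrite !ffunE. Qed.

Section Ring.
Variables (A : comNzRingType) (T : B -> B -> A).

Definition nS (c : half_chars g) (a b : B) : A := \sum_(e : half_chars g) sgn A c e * T (a + hc e) (b + hc e).
Definition Dn (e : half_chars g) : A := 2 ^+ g * \prod_(c : half_chars g) nS c (epsB m e) 0.
Definition Kn (e : half_chars g) (a b : B) (h : half_chars g) : A :=
  \sum_(c : half_chars g) sgn A c h * nS c a b * \prod_(c' : half_chars g | c' != c) nS c' (epsB m e) 0.
Definition QS (X : B -> A) (c : half_chars g) (a b : B) : A :=
  \sum_(e : half_chars g) sgn A c e * (X (a + hc e) * X (b + hc e)).

Lemma sgn_ortho (e : half_chars g) :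
  \sum_(c : half_chars g) sgn A c e = if e == [ffun=> false] then 2 ^+ g else 0.
Proof.
transitivity (\prod_(i < g) \sum_(b : bool) (-1 : A) ^+ (b && e i)).
  rewrite bigA_distr_bigA; apply: eq_bigr => c _.
  by rewrite /sgn -prodrXr.
have [->|ne] := eqVneq e [ffun=> false].
  rewrite (eq_bigr (fun=> 2)) ?prodr_const ?card_ord // => i _.
  by rewrite big_bool ffunE !andbF !expr0.
have [i ei] : exists i, e i.
  apply/existsP; apply: contraNT ne => /existsPn h; apply/eqP/ffunP => i.
  by rewrite ffunE; apply/negbTE.
by rewrite (bigD1 i) //= big_bool ei /= expr1 expr0 addNr mul0r.
Qed.

Lemma sum_QS X a b : \sum_c QS X c a b = 2 ^+ g * (X a * X b).
Proof.
rewrite /QS exchange_big (bigD1 [ffun=> false]) //= [X in _ + X]big1 => [|e ne].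
  by rewrite -mulr_suml sgn_ortho eqxx hc0 !addr0.
by rewrite -mulr_suml sgn_ortho (negbTE ne) mul0r.
Qed.

Definition mumford (X : B -> A) : Prop := forall (a b a' b' d : B) (c : half_chars g),
  a + b = a' + b' -> nS c (a' + d) (b' + d) * QS X c a b = nS c (a + d) (b + d) * QS X c a' b'.

(** With the shift - lo a b, Mumford's relation between (a, b) and (hi, lo) carries on the left the
    factor [nS c (epsB m (ep a b)) 0], which depends only on the parities. Clear these factors for
    all characters c; summing over c then isolates [X a * X b] by [sgn_ortho], with [Dn] as
    denominator. *)
Lemma mumford_pair X a b : mumford X ->
  Dn (ep a b) * (X a * X b) =
  \sum_(h : half_chars g) Kn (ep a b) (a - lo a b) (b - lo a b) h * (X (hi a b + hc h) * X (lo a b + hc h)).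
Proof.
move=> HX; pose n c := nS c (epsB m (ep a b)) 0.
have E c : n c * QS X c a b = nS c (a - lo a b) (b - lo a b) * QS X c (hi a b) (lo a b).
  have := HX a b (hi a b) (lo a b) (- lo a b) c; rewrite hi_lo => /(_ erefl) <-.
  by rewrite subrr /hi addrAC subrr add0r.
rewrite /Dn mulrAC -sum_QS mulr_suml.
have -> : \sum_i QS X i a b * \prod_c n c = \sum_c (\prod_(c' | c' != c) n c') *
    (nS c (a - lo a b) (b - lo a b) * QS X c (hi a b) (lo a b)).
  by apply: eq_bigr => c _; rewrite -E (bigD1 c) //= mulrCA [RHS]mulrC mulrA mulrC; congr (_ * _); rewrite mulrC.
rewrite /Kn; under [RHS]eq_bigr do rewrite mulr_suml.
rewrite exchange_big; apply: eq_bigr => c _.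
rewrite /QS !mulr_sumr; apply: eq_bigr => h _; rewrite /n.
by move: (sgn A c h) (nS _ _ _) (\prod_(_ | _) _) (X _) (X _) => *; ring.
Qed.

Variable d : nat.
Local Notation Wd := {ffun 'I_d -> B}.
Local Notation K := {ffun 'I_g -> 'I_m * 'I_d}.

Definition upd (w : Wd) (j k : 'I_d) (a b : B) : Wd :=
  [ffun l => if l == j then a else if l == k then b else w l].

(* Rows of a linear system satisfied by the monomials of degree d: multiples of
   the relations of degree two, and normal monomials. *)
Definition Mrow (i : (Wd * ('I_d * 'I_d)) + K) (v : Wd) : A :=
  match i with
  | inl (w, (j, k)) => if j == k then 0 else
      Dn (ep (w j) (w k)) * (v == w)%:R - \sum_(h : half_chars g)
        Kn (ep (w j) (w k)) (w j - lo (w j) (w k)) (w k - lo (w j) (w k)) h *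
        (v == upd w j k (hi (w j) (w k) + hc h) (lo (w j) (w k) + hc h))%:R
  | inr n => (v == nu n)%:R
  end.

Lemma prod_upd (X : B -> A) w j k a b : j != k ->
  \prod_l X (upd w j k a b l) = X a * X b * \prod_(l | (l != j) && (l != k)) X (w l).
Proof.
move=> jk; have kj : k != j by rewrite eq_sym.
rewrite (bigD1 j) // (bigD1 k kj) /= mulrA !ffunE !eqxx (negbTE kj); congr (_ * _).
by apply: eq_bigr => l /andP[/negbTE h1 /negbTE h2]; rewrite ffunE h1 h2.
Qed.

Lemma sum_pick (F : Wd -> A) (v : Wd) : \sum_w (w == v)%:R * F w = F v.
Proof.
rewrite (bigD1 v) //= eqxx mul1r big1 ?addr0 // => w /negbTE ->.
by rewrite mul0r.
Qed.

Lemma Mrow_eval (X : B -> A) i : mumford X ->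
  \sum_v Mrow i v * \prod_j X (v j) = if i is inr n then \prod_j X (nu n j) else 0.
Proof.
move=> HX; case: i => [[w [j k]]|n] /=; last exact: (sum_pick (fun v => \prod_j X (v j))).
case: (eqVneq j k) => jk; first by rewrite big1 // => v _; rewrite mul0r.
under eq_bigr do rewrite mulrBl -mulrA.
rewrite big_split /= -mulr_sumr (sum_pick (fun v => \prod_j X (v j))).
rewrite sumrN; apply/eqP; rewrite subr_eq0; apply/eqP.
under [RHS]eq_bigr do rewrite mulr_suml.
rewrite exchange_big /=.
under [RHS]eq_bigr => h _.
  under eq_bigr do rewrite -mulrA.
  rewrite -mulr_sumr (sum_pick (fun v => \prod_j X (v j))) prod_upd // mulrA.
  over.
rewrite -mulr_suml -mumford_pair // -!mulrA; congr (_ * _).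
have kj : k != j by rewrite eq_sym.
by rewrite (bigD1 j) // (bigD1 k kj).
Qed.

End Ring.

Lemma Mrow_morph (A A' : comNzRingType) (f : {rmorphism A -> A'}) (T : B -> B -> A) d i (v : {ffun 'I_d -> B}) :
  f (Mrow T i v) = Mrow (fun a b => f (T a b)) i v.
Proof.
have fsgn c e : f (sgn A c e) = sgn A' c e by rewrite /sgn rmorphXn rmorphN1.
have fn c a b : f (nS T c a b) = nS (fun a b => f (T a b)) c a b.
  by rewrite rmorph_sum; apply: eq_bigr => e _; rewrite rmorphM fsgn.
case: i => [[w [j k]]|n] /=; last by rewrite rmorph_nat.
case: eqP => _; first exact: rmorph0.
rewrite rmorphB !rmorphM rmorphXn rmorph_prod !rmorph_nat.
congr (_ * _ * _ - _); first by apply: eq_bigr => c _; rewrite fn.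
rewrite rmorph_sum; apply: eq_bigr => h _; rewrite rmorphM rmorph_nat; congr (_ * _).
rewrite rmorph_sum; apply: eq_bigr => c _; rewrite !rmorphM fsgn fn rmorph_prod; congr (_ * _).
by apply: eq_bigr => c' _; rewrite fn.
Qed.

End Relations.

Section NormalForm.
Variables (R : realType) (g m : nat).
Hypotheses (m2 : ~~ odd m) (m4 : (4 <= m)%N).
Local Notation C := R[i].
Local Notation B := (Bm g m).
Local Notation hc := (@half_class g m).
Local Notation cusp := (@cusp R g m).

Let m1 : (1 < m)%N. Proof. exact: leq_trans m4. Qed.

Lemma nS_lead c (e : half_chars g) (a b : B) : a + b = epsB m e ->
  lead (wt e) (fun P => nS (thth (cusp P)) c a b)
    (\sum_(h : half_chars g) sgn C c h * (bal e (a + hc h) (b + hc h))%:R).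
Proof.
move=> ab; apply: lead_sum => h; apply: leadZ; apply: thth_lead => //.
by rewrite addrACA half_classK // addr0.
Qed.

(** Neither m/2 nor m/2 + 1 is 0 modulo m, as m >= 4, so a half shift destroys the balance. Hence
    [nS c (epsB m e) 0], the factor that is inverted, has leading coefficient 1. *)
Lemma bal_eps (e h : half_chars g) : bal e (epsB m e + hc h) (0 + hc h) = (h == [ffun=> false]).
Proof.
have k2 : (2 <= m./2)%N by have := half_leq m4.
have km : (m./2.+1 < m)%N by have := m_half m2; lia.
have v (n : nat) : (n < m)%N -> nat_of_ord (n%:R : 'Z_m) = n.
  by move=> nm; rewrite val_Zp_nat // modn_small.
have vi (x y : 'Z_m) : (x == y) = (x == y :> nat) by [].
apply/forallP/eqP => [H|->].
  apply/ffunP => i; have := H i; rewrite !ffunE add0r; case: (h i) => //.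
  have E0 : ((m./2)%:R == 0 :> 'Z_m) = false by rewrite -[0]/(0%:R) vi !v ?gtn_eqF; lia.
  rewrite E0 andbF /=.
  have E1 (b : bool) : (b%:R + (m./2)%:R == 0 :> 'Z_m) = false.
    by rewrite -natrD -[0]/(0%:R) vi !v; case: b => /=; lia.
  by rewrite E1.
by move=> i; rewrite hc0 !ffunE !addr0 !eqxx.
Qed.

Lemma size_index_enum (T : finType) : size (index_enum T) = #|T|.
Proof. by rewrite -sum1_size -sum1_card; apply: eq_bigl => x; rewrite inE. Qed.

Lemma Dn_lead (e : half_chars g) :
  lead (wt e * #|{: half_chars g}|) (fun P => @Dn g m C (thth (cusp P)) e) (2 ^+ g).
Proof.
have H (c : half_chars g) : lead (wt e) (fun P => nS (thth (cusp P)) c (epsB m e) 0) (1 : C).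
  have -> : (1 : C) = \sum_(h : half_chars g) sgn C c h * (bal e (epsB m e + hc h) (0 + hc h))%:R.
    rewrite (bigD1 [ffun=> false]) //= bal_eps eqxx mulr1 [X in _ + X]big1 ?addr0 => [|h /negbTE nh].
      by rewrite /sgn big1 // => i _; rewrite ffunE andbF.
    by rewrite bal_eps nh mulr0.
  by apply: nS_lead; rewrite addr0.
have := leadZ (2 ^+ g) (lead_prod (index_enum {: half_chars g}) predT H).
by rewrite big1 // mulr1 count_predT size_index_enum.
Qed.

(** The factors indexed by c' have leading coefficient 1, and orthogonality of the signs reduces the
    double sum over c and h' to h' = h. *)
Lemma Kn_lead (e h : half_chars g) (a b : B) : a + b = epsB m e ->
  lead (wt e * #|{: half_chars g}|) (fun P => Kn (thth (cusp P)) e a b h : C)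
    (2 ^+ g * (bal e (a + hc h) (b + hc h))%:R).
Proof.
move=> ab.
have H (c : half_chars g) : lead (wt e) (fun P => nS (thth (cusp P)) c (epsB m e) 0) (1 : C).
  have -> : (1 : C) = \sum_(h : half_chars g) sgn C c h * (bal e (epsB m e + hc h) (0 + hc h))%:R.
    rewrite (bigD1 [ffun=> false]) //= bal_eps eqxx mulr1 [X in _ + X]big1 ?addr0 => [|h' /negbTE nh].
      by rewrite /sgn big1 // => i _; rewrite ffunE andbF.
    by rewrite bal_eps nh mulr0.
  by apply: nS_lead; rewrite addr0.
have sgnM c (h1 h2 : half_chars g) : sgn C c h1 * sgn C c h2 = sgn C c [ffun i => h1 i (+) h2 i].
  rewrite /sgn -!prodrXr -big_split; apply: eq_bigr => i _; rewrite /= ffunE.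
  by case: (c i); case: (h1 i); case: (h2 i); rewrite /= ?expr0 ?expr1 ?mulr1 ?mul1r ?mulrNN ?mulr1.
have EL : 2 ^+ g * (bal e (a + hc h) (b + hc h))%:R = \sum_(c : half_chars g)
    sgn C c h * (\sum_(h' : half_chars g) sgn C c h' * (bal e (a + hc h') (b + hc h'))%:R) * 1.
  under eq_bigr do rewrite mulr1 mulr_sumr.
  rewrite exchange_big (bigD1 h) //=; rewrite [X in _ = _ + X]big1 => [|h' hh].
    under eq_bigr do rewrite mulrA sgnM.
    rewrite -mulr_suml sgn_ortho ifT ?addr0 //.
    by apply/eqP/ffunP => i; rewrite !ffunE addbb.
  under eq_bigr do rewrite mulrA sgnM.
  rewrite -mulr_suml sgn_ortho ifF ?mul0r //; apply: contraNF hh => /eqP/ffunP E.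
  apply/eqP/ffunP => i; have := E i; rewrite !ffunE.
  by case: (h i); case: (h' i).
rewrite EL; apply: lead_sum => c.
have hn : #|{: half_chars g}| = (1 + count (predC1 c) (index_enum {: half_chars g}))%N.
  rewrite -size_index_enum -(count_predC (pred1 c)) count_uniq_mem ?index_enum_uniq // mem_index_enum.
  by congr addn; apply: eq_count => x; rewrite /= !inE.
have := leadM (leadZ (sgn C c h) (nS_lead c ab)) (lead_prod (index_enum {: half_chars g}) (predC1 c) H).
rewrite [X in lead _ _ (_ * X)]big1 // hn mulnDr muln1.
exact.
Qed.

Variable d : nat.
Local Notation Wd := {ffun 'I_d -> B}.
Local Notation K := {ffun 'I_g -> 'I_m * 'I_d}.
Local Notation I := ((Wd * ('I_d * 'I_d)) + K)%type.

(** The leading coefficients of [Mrow] at the cusp; the corresponding power of P, [Mexp], depends on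
    the row only. *)
Definition Mlim (i : I) (v : Wd) : C :=
  match i with
  | inl (w, (j, k)) => if j == k then 0 else
      2 ^+ g * (v == w)%:R - \sum_(h : half_chars g)
        2 ^+ g * (bal (ep (w j) (w k)) (w j - lo (w j) (w k) + hc h) (w k - lo (w j) (w k) + hc h))%:R *
        (v == upd w j k (hi (w j) (w k) + hc h) (lo (w j) (w k) + hc h))%:R
  | inr n => (v == nu n)%:R
  end.

Definition Mexp (i : I) : nat :=
  if i is inl (w, (j, k)) then (wt (ep (w j) (w k)) * #|{: half_chars g}|)%N else 0.

Lemma Mrow_lead i v : lead (Mexp i) (fun P => Mrow (thth (cusp P)) i v) (Mlim i v).
Proof.
case: i => [[w [j k]]|n] /=; last exact: lead_cst.
case: eqP => _; first exact: lead0.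
have lc e f (L c : C) : lead e f L -> lead e (fun P => f P * c) (L * c).
  by move=> H; have := leadM H (lead_cst c); rewrite addn0.
have lN e f (L : C) : lead e f L -> lead e (fun P => - f P) (- L).
  move=> H; have := leadZ (-1) H; rewrite mulN1r.
  by apply: lead_eq => P; rewrite mulN1r.
apply: leadD; first exact: lc (Dn_lead _).
apply: lN; apply: lead_sum => h; apply: lc; apply: Kn_lead.
apply/ffunP => i; have /ffunP/(_ i) := hi_lo (w j) (w k); rewrite /hi.
move: (lo _ _) (epsB _ _) => l e; rewrite !ffunE => E.
transitivity (w j i + w k i - l i - l i); first by ring.
by rewrite -E; ring.
Qed.

Section Kernel.
Variable x : Wd -> C.
Hypothesis Hx : forall i, \sum_v Mlim i v * x v = 0.

Lemma ker_rel (w : Wd) j k : j != k -> x w = \sum_(h : half_chars g)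
   (bal (ep (w j) (w k)) (w j - lo (w j) (w k) + hc h) (w k - lo (w j) (w k) + hc h))%:R *
   x (upd w j k (hi (w j) (w k) + hc h) (lo (w j) (w k) + hc h)).
Proof.
move=> jk; have := Hx (inl (w, (j, k))); rewrite /= (negbTE jk).
under eq_bigr do rewrite mulrBl -mulrA.
rewrite big_split /= -mulr_sumr (sum_pick x) sumrN.
under [X in _ - X]eq_bigr do rewrite mulr_suml.
rewrite exchange_big /= => /eqP; rewrite subr_eq0 => /eqP E.
have t0 : (2 ^+ g : C) != 0 by rewrite expf_neq0 // pnatr_eq0.
apply: (mulfI t0); rewrite E mulr_sumr; apply: eq_bigr => h _.
under eq_bigr do rewrite -!mulrA.
by rewrite -!mulr_sumr (sum_pick x).
Qed.

(** A balanced half shift of the two letters would make their coordinates differ by 0, 1 or -1;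
    without one, every term of [ker_rel] is 0. *)
Lemma ker_unbal (w : Wd) j k (i : 'I_g) : j != k ->
  ~~ [|| w j i - w k i == 0, w j i - w k i == 1 | w j i - w k i == -1] -> x w = 0.
Proof.
move=> jk nb; rewrite (ker_rel w jk) big1 // => h _.
case: (boolP (bal _ _ _)) => [/forallP/(_ i)|_]; last by rewrite mul0r.
rewrite !ffunE; set u := half_class _ _; move=> H; case/negP: nb; move: H.
set l := (_./2)%:R; set e := odd _; set uh := (if _ then _ else _).
have -> : w j i - w k i = (w j i - l + uh) - (w k i - l + uh) by ring.
case/orP => /andP[/eqP -> /eqP ->]; rewrite ?subr0 ?sub0r; case: e; rewrite ?eqxx ?orbT // ?oppr0 eqxx //.
Qed.

Definition colp (w : Wd) (i : 'I_g) (s : {perm 'I_d}) : Wd :=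
  [ffun l => [ffun i' => if i' == i then w (s l) i' else w l i']].

(** The right-hand side of [ker_rel] involves the two letters through their sum and through [bal],
    which is symmetric in each coordinate; exchanging a single coordinate of the letters changes
    neither. *)
Lemma ker_swap (w : Wd) i j k : x (colp w i (tperm j k)) = x w.
Proof.
case: (eqVneq j k) => [->|jk].
  congr x; apply/ffunP => l; apply/ffunP => i'; rewrite !ffunE tperm1 perm1.
  by case: eqP.
set w' := colp _ _ _.
have wj : w' j = [ffun i' => if i' == i then w k i' else w j i'].
  by apply/ffunP => i'; rewrite !ffunE tpermL.
have wk : w' k = [ffun i' => if i' == i then w j i' else w k i'].
  by apply/ffunP => i'; rewrite !ffunE tpermR.
have E : w' j + w' k = w j + w k.
  by rewrite wj wk; apply/ffunP => i'; rewrite !ffunE; case: eqP => // _; rewrite addrC.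
have Ei i' : w' j i' + w' k i' = w j i' + w k i' by have /ffunP/(_ i') := E; rewrite !ffunE.
have El : lo (w' j) (w' k) = lo (w j) (w k) by apply/ffunP => i'; rewrite ffunE [in RHS]ffunE Ei.
have Ee : ep (w' j) (w' k) = ep (w j) (w k) by apply/ffunP => i'; rewrite ffunE [in RHS]ffunE Ei.
have Eh : hi (w' j) (w' k) = hi (w j) (w k) by rewrite /hi El Ee.
rewrite (ker_rel w jk) (ker_rel w' jk) El Ee Eh; apply: eq_bigr => h _; congr (_%:R * x _).
  congr nat_of_bool; apply: eq_forallb => i'; rewrite wj wk !ffunE.
  by case: (i' == i) => //; rewrite orbC; congr (_ || _); rewrite andbC.
apply/ffunP => l; rewrite [in LHS]ffunE [in RHS]ffunE.
case: (eqVneq l j) => // lj; case: (eqVneq l k) => // lk.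
by apply/ffunP => i'; rewrite !ffunE tpermD 1?eq_sym //; case: eqP.
Qed.

Lemma ker_perm (w : Wd) i s : x (colp w i s) = x w.
Proof.
have [ts -> _] := prod_tpermP s.
elim: ts w => [|t ts IH] w.
  rewrite big_nil; congr x; apply/ffunP => l; apply/ffunP => i'; rewrite !ffunE perm1.
  by case: eqP.
rewrite big_cons -[RHS](IH w) -[RHS](ker_swap (colp w i _) i t.1 t.2); congr x.
apply/ffunP => l; apply/ffunP => i'; rewrite !ffunE; case: eqP => // _.
by rewrite permM.
Qed.

Lemma ker_perms (w : Wd) (s : 'I_g -> {perm 'I_d}) :
  x [ffun l => [ffun i => w (s i l) i]] = x w.
Proof.
suff H (L : seq 'I_g) : uniq L ->
    x [ffun l => [ffun i => if i \in L then w (s i l) i else w l i]] = x w.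
  rewrite -(H (index_enum _) (index_enum_uniq _)); congr x.
  by apply/ffunP => l; apply/ffunP => i; rewrite !ffunE mem_index_enum.
elim: L => [|i L IH] /=.
  by move=> _; congr x; apply/ffunP => l; apply/ffunP => i; rewrite !ffunE.
case/andP=> iL /IH <-; rewrite -[RHS](ker_perm _ i (s i)); congr x.
apply/ffunP => l; apply/ffunP => i'; rewrite !ffunE inE.
by case: eqP => // ->; rewrite (negbTE iL).
Qed.

End Kernel.

Lemma bool_perm (f h : 'I_d -> bool) : (\sum_j f j = \sum_j h j)%N ->
  exists s : {perm 'I_d}, forall j, f (s j) = h j.
Proof.
move=> E.
have cnt (u : 'I_d -> bool) (a : pred bool) : count a [tuple u j | j < d] =
   (a true * (\sum_j u j) + a false * (d - \sum_j u j))%N.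
  have -> : (d - \sum_j u j = \sum_j ~~ u j)%N.
    apply/eqP; rewrite -(eqn_add2l (\sum_j u j)) subnKC -?big_split /=; last first.
      by rewrite -[X in (_ <= X)%N](card_ord d) -sum1_card; apply: leq_sum => j _; case: (u j).
    rewrite (eq_bigr (fun=> 1%N)) ?sum1_card ?card_ord // => j _; by case: (u j).
  rewrite -sum1_count big_map big_enum_cond /= big_mkcond !big_distrr -big_split /=.
  by apply: eq_bigr => j _; case: (u j); case: (a true); case: (a false).
have : perm_eq [tuple h j | j < d] [tuple f j | j < d].
  by apply/seq.permP => a; rewrite !cnt E.
case/tuple_permP => s hs; exists s => j.
by have := congr1 (fun t => nth false t j) hs; rewrite -!tnth_nth !tnth_mktuple.
Qed.

Hypothesis d0 : (0 < d)%N.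

(** Where x is nonzero, the values of each coordinate differ pairwise by 0, 1 or -1; since 1, 2 and
    3 are not 0 modulo m, they lie in two consecutive classes. Sorting each coordinate by itself
    does not change x and gives a normal word, where the rows [inr] impose 0. *)
Lemma Mlim_kernel (x : Wd -> C) : (forall i, \sum_v Mlim i v * x v = 0) -> forall w, x w = 0.
Proof.
move=> Hx w.
case: (boolP [exists j, exists k, exists i, (j != k) &&
   ~~ [|| w j i - w k i == 0, w j i - w k i == 1 | w j i - w k i == -1]]).
  by case/existsP => j /existsP[k /existsP[i /andP[jk nb]]]; exact: (ker_unbal Hx jk nb).
move=> nex.
have Hb j k i : [|| w j i - w k i == 0, w j i - w k i == 1 | w j i - w k i == -1].
  apply: contraR nex => nb; apply/existsP; exists j; apply/existsP; exists k; apply/existsP; exists i.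
  by rewrite nb andbT; apply: contraNneq nb => ->; rewrite subrr eqxx.
have v (n : nat) : (n < m)%N -> nat_of_ord (n%:R : 'Z_m) = n.
  by move=> nm; rewrite val_Zp_nat // modn_small.
have nz n : (0 < n < 4)%N -> (n%:R : 'Z_m) != 0.
  move=> /andP[n0 n4]; apply/eqP => /(congr1 (@nat_of_ord _)); rewrite v ?(leq_trans n4) //.
  by rewrite /=; lia.
have Hn (i : 'I_g) : exists n : 'I_m * 'I_d, exists f : 'I_d -> bool,
   (forall j, w j i = (n.1 + f j)%N%:R) /\ (\sum_j f j)%N = n.2 :> nat.
  (* The lower of the two classes: that of a letter one below the letter jj if there is one, that of
     jj otherwise. *)
  have [j0 Hj] : exists j0 : 'I_d, forall j, w j i - w j0 i \in [:: 0; 1 : 'Z_m].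
    pose jj := Ordinal d0.
    case: (boolP [exists j1, w j1 i - w jj i == -1]) => [/existsP[j1 /eqP h1]|/existsPn h].
      exists j1 => j; rewrite !inE; case/or3P: (Hb j j1 i) => /eqP E.
      - by rewrite E eqxx.
      - by rewrite E eqxx orbT.
      - have E2 : w j i - w jj i = -2%:R.
          have -> : w j i - w jj i = (w j i - w j1 i) + (w j1 i - w jj i) by ring.
          by rewrite E h1; ring.
        have := Hb j jj i; rewrite E2 => /or3P[] /eqP E3; exfalso.
        + by have := nz 2%N isT; rewrite -oppr_eq0 E3 eqxx.
        + have := nz 3%N isT; rewrite -oppr_eq0; have -> : - 3%:R = - 2%:R - 1 :> 'Z_m by ring.
          by rewrite E3 subrr eqxx.
        + move: (oner_neq0 'Z_m); apply/negP; rewrite negbK; apply/eqP.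
          by transitivity (-1 - (- 2%:R) : 'Z_m); [ring | rewrite E3 subrr].
    exists jj => j; rewrite !inE; have := Hb j jj i; rewrite (negbTE (h j)) orbF.
    by [].
  have em : (w j0 i < m)%N by have := ltn_ord (w j0 i); rewrite [X in (_ < X)%N]Zp_cast.
  (* The base letter j0 is not counted, so the count is a remainder less than d. *)
  have fd : (\sum_j (w j i != w j0 i) < d)%N.
    rewrite -[X in (_ < X)%N](card_ord d) -sum1_card (bigD1 j0) //= [X in (_ < X)%N](bigD1 j0) //=.
    by rewrite eqxx add0n add1n ltnS; apply: leq_sum => j _; case: (_ != _).
  exists (Ordinal em, Ordinal fd), (fun j => w j i != w j0 i); split; last exact: erefl.
  move=> j /=.
  rewrite natrD natr_Zp; have := Hj j; rewrite !inE.
  case/orP => /eqP E; first by move/eqP: E; rewrite subr_eq0 => /eqP ->; rewrite eqxx addr0.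
  by rewrite -subr_eq0 E oner_neq0 addrC -E subrK.
have [n Hn'] := boolp.choice Hn; have [f Hf] := boolp.choice Hn'.
have Hs i : exists s : {perm 'I_d}, forall j, f i (s j) = (j < (n i).2)%N.
  by apply: bool_perm; rewrite (Hf i).2 sum_step // ltnW.
have [s Hs'] := boolp.choice Hs.
rewrite -(ker_perms Hx w s); have := Hx (inr [ffun i => n i]).
rewrite /= (sum_pick x) => <-; congr x.
apply/ffunP => l; apply/ffunP => i; rewrite !ffunE (Hf i).1 Hs'.
by rewrite -pmulrn.
Qed.

Lemma mumford_on_Am (k : fieldType) (t : B -> B -> k) (Omega : closedFieldType)
    (iota : {rmorphism k -> Omega}) (X : B -> Omega) :
  on_Am t iota X -> mumford (fun a b => iota (t a b)) X.
Proof.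
move=> [_ H] a b a' b' e c E.
have h c' p q : nS (fun a b => iota (t a b)) c' p q = iota (null_sum t c' p q).
  rewrite rmorph_sum; apply: eq_bigr => h _.
  by rewrite rmorphM /sgn rmorphXn rmorphN1.
by rewrite !h; exact: H.
Qed.

(** Choose rows whose limit matrix is invertible. Their determinant is an integral polynomial in the
    theta products, nonzero near the cusp and hence nonzero in k, so the system is solved over k. *)
Lemma normal_form (k : fieldType) (t : B -> B -> k) : @is_theta_field R g m k t ->
  exists nf : Wd -> K -> k, forall (Omega : closedFieldType) (iota : {rmorphism k -> Omega})
    (X : B -> Omega), on_Am t iota X -> forall w : Wd,
    \prod_j X (w j) = \sum_(n : K) iota (nf w n) * \prod_j X (nu n j).
Proof.
move=> [hk1 hk2].
pose ML : 'M[C]_(#|{: I}|, #|{: Wd}|) := \matrix_(i, v) Mlim (enum_val i) (enum_val v).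
have MLf : row_full ML.
  suff : row_free ML^T by rewrite /row_free /row_full mxrank_tr.
  apply: inj_row_free => v vM; apply/rowP => j; rewrite mxE.
  have := @Mlim_kernel (fun w => v ord0 (enum_rank w)) _ (enum_val j).
  rewrite enum_valK; apply => i.
  have E0 := congr1 (fun M : 'rV_(#|{: I}|) => M ord0 (enum_rank i)) vM; rewrite !mxE in E0.
  rewrite -[RHS]E0.
  rewrite (reindex (@enum_val {: Wd} predT)) /=; last by apply/onW_bij/enum_val_bij.
  by apply: eq_bigr => w _; rewrite !mxE enum_rankK enum_valK mulrC.
pose f := fullrankfun MLf.
have Lu : \det (rowsub f ML) != 0 by rewrite -unitfE -unitmxE fullrowsub_unit.
pose MM (A : comNzRingType) (T : B -> B -> A) : 'M[A]_(#|{: Wd}|) :=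
  \matrix_(i, v) Mrow T (enum_val (f i)) (enum_val v).
have [|||e e0 He] := @det_leading R _ (rowsub f ML)^T (fun P => (MM _ (thth (cusp P)))^T)
   (fun j P => toC (P ^+ Mexp (enum_val (f j)))).
- by rewrite det_tr.
- move=> i j eps eps0; have [e1 e10 H] := Mrow_lead (enum_val (f j)) (enum_val i) eps0.
  by exists e1 => // P /H[l E hl]; exists l; rewrite !mxE.
- by move=> l P P0; rewrite -nrm_gt0 nrm_toC normr_gt0 expf_neq0 ?gt_eqF.
have [P [Pe P1]] : exists P : R, 0 < P < e /\ 0 < P < 1.
  have h : 0 < Num.min e 1 by rewrite lt_min e0 ltr01.
  have [h1 h2] : Num.min e 1 <= e /\ Num.min e 1 <= 1 by rewrite !ge_min !lexx orbT.
  by exists (Num.min e 1 / 2); split; apply/andP; split; lra.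
have dC := He P Pe; rewrite det_tr in dC.
(* The determinant is formed once, over the polynomial ring in the T_{a,b}, and specialises to C and
   to k alike. *)
pose T0 (a b : B) : Defs.ipoly g m := mpolyX _ (mnm1 (enum_rank (a, b))).
have iev (A : comNzRingType) (T : B -> B -> A) :
    ieval T (\det (MM _ T0)) = \det (MM _ T).
  have -> : ieval T (\det (MM _ T0)) =
     \det (map_mx (mmap intr (fun i => let ab : B * B := enum_val i in T ab.1 ab.2)) (MM _ T0)).
    by rewrite det_map_mx.
  congr (\det _); apply/matrixP => i v; rewrite !mxE Mrow_morph.
  apply: (congr1 (fun T' => Mrow T' (enum_val (f i)) (enum_val v))); apply/funext => a; apply/funext => b.
  by rewrite /= mmapX mmap1U enum_rankK.
have dk : \det (MM k t) != 0.
  apply/eqP => d0'; have [h _] := hk1 (\det (MM _ T0)).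
  have := h ltac:(by rewrite iev) (cusp P) (cusp_siegel g m1 P1); rewrite iev => /eqP.
  by rewrite (negbTE dC).
have uk : MM k t \in unitmx by rewrite unitmxE unitfE.
pose X := invmx (MM k t).
(* Rows coming from Mumford's relations evaluate to 0 on A_m; only the columns of the inverse that
   belong to rows [inr n] remain. *)
exists (fun w n => \sum_(l | enum_val (f l) == inr n) X (enum_rank w) l) => Om iota Y HY w.
have HM := mumford_on_Am HY.
pose y : 'cV[Om]_#|{: Wd}| := \col_v \prod_(j < d) Y ((enum_val v : Wd) j).
pose r : 'cV[Om]_#|{: Wd}| := \col_l (if (enum_val (f l) : I) is inr n then \prod_(j < d) Y (nu n j) else 0).
have E : map_mx iota (MM k t) *m y = r.
  apply/colP => l; rewrite !mxE -(Mrow_eval _ HM).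
  rewrite [RHS](reindex (@enum_val {: Wd} predT)) /=; last by apply/onW_bij/enum_val_bij.
  by apply: eq_bigr => v _; rewrite !mxE Mrow_morph.
have E2 : y = map_mx iota X *m r.
  by rewrite -E mulmxA -map_mxM mulVmx // map_mx1 mul1mx.
have := congr1 (fun M : 'cV_#|{: Wd}| => M (enum_rank w) ord0) E2.
rewrite !mxE enum_rankK => ->.
under [RHS]eq_bigr do rewrite rmorph_sum mulr_suml.
rewrite (exchange_big_dep predT) //=; apply: eq_bigr => l _; rewrite !mxE.
case: (enum_val (f l)) => [z|n]; first by rewrite mulr0 big1.
by rewrite (big_pred1 n) // => n'; rewrite eq_sym.
Qed.

End NormalForm.

(** * Immersion *)

Section Immersion.
Variables (R : realType) (g m : nat).
Hypotheses (m2 : ~~ odd m) (m4 : (4 <= m)%N).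
Local Notation C := R[i].
Local Notation B := (Bm g m).
Local Notation S := (@S R g m).
Local Notation clind := (@clind R g m).

Let m1 : (1 < m)%N. Proof. exact: leq_trans m4. Qed.

Lemma bddD (p q : Zg g -> C) : bdd p -> bdd q -> bdd (fun N => p N + q N).
Proof.
move=> [M [b [M0 Hb]]] [L [c [L0 Hc]]]; exists (M + L), (Num.max b c); split.
  exact: addr_ge0.
have z0 N : 0 <= zab R N by exact: zab_ge0.
move=> N; apply: le_trans (le_normcD _ _) _; rewrite mulrDl; apply: lerD.
  by apply: le_trans (Hb N) _; rewrite ler_wpM2l // ler_expR ler_wpM2r // le_max lexx.
by apply: le_trans (Hc N) _; rewrite ler_wpM2l // ler_expR ler_wpM2r // le_max lexx orbT.
Qed.

Definition ej (j : 'I_g) : Zg g := [ffun i => (i == j)%:Z].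
(** Up to the factor 2 pi i, the derivative in direction i at z = 0 of the theta function whose
    class is e_j. *)
Definition gam (tau : 'M[C]_g) (j i : 'I_g) : C :=
  S (fun N => clind (cl m (ej j)) N * (N i)%:~R) tau 0.

Lemma bdd_coord i : bdd (fun N : Zg g => (N i)%:~R : C).
Proof.
have := bdd_dt (delta_mx ord0 i : 'rV[C]_g); case=> M [b [M0 H]]; exists M, b; split=> // N.
have <- // : dt N (delta_mx ord0 i : 'rV[C]_g) = (N i)%:~R.
rewrite /dt (bigD1 i) //= big1 ?addr0 => [|l /negbTE li]; rewrite !mxE ?li ?andbF ?mulr0 //.
by rewrite !eqxx mulr1.
Qed.

Lemma bdd_gam j i : bdd (fun N : Zg g => clind (cl m (ej j)) N * (N i)%:~R).
Proof. exact: bddM (bdd_clind _ _) (bdd_coord i). Qed.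

Lemma gam_an j i : tau_an (fun tau => gam tau j i).
Proof. exact: S0_an (bdd_gam j i). Qed.

Lemma nsq_eq0 (N : Zg g) : nsq N = 0%N -> N = 0.
Proof.
move=> /eqP; rewrite sum_nat_eq0 => /forallP h; apply/ffunP => i; rewrite ffunE.
by apply/eqP; have := h i; rewrite /= expn_eq0 andbT absz_eq0.
Qed.

Lemma ej_unique (N : Zg g) j : cl m N = cl m (ej j) -> (1 <= nsq N)%N /\ (nsq N = 1%N -> N = ej j).
Proof.
move=> /ffunP H.
have Hd i : (m%:Z %| N i - (i == j)%:Z)%Z.
  by rewrite -Zmod_eq //; apply/eqP; have := H i; rewrite !ffunE.
split.
  rewrite lt0n; apply/eqP => /nsq_eq0 N0; have := dvd_small (Hd j).
  by rewrite N0 ffunE eqxx => h; have := h ltac:(rewrite /=; lia); rewrite /=; lia.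
move=> N1; apply/ffunP => i; rewrite ffunE.
have Ni : (`|N i| <= 1)%N.
  rewrite -(@leq_exp2r _ _ 2) // exp1n; apply: (@leq_trans (nsq N)); last by rewrite N1.
  by rewrite /nsq (bigD1 i) //=; apply: leq_addr.
have := dvd_small (Hd i); move: (N i) Ni (i == j) => x xi b.
by case: b => /= h; have := h ltac:(lia); lia.
Qed.

(** e_j is the only vector of squared length 1 in its class, and no vector of the class is
    shorter. *)
Lemma gam_lead j i : lead 1 (fun P => gam (@cusp R g m P) j i) (j == i)%:R.
Proof.
pose p (N : Zg g) : C := clind (cl m (ej j)) N * (N i)%:~R.
have Hp N : p N != 0 -> cl m N = cl m (ej j).
  by rewrite /p /clind; have [->|_] := eqVneq (cl m N) (cl m (ej j)); rewrite // mul0r eqxx.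
apply: (lead_series (p := p) (E := @nsq g)) => [N /Hp/ej_unique[]//|P P1|].
  have cs := cusp_siegel g m1 P1; have P0 : 0 < P by case/andP: P1.
  have h := S_summable m1 0 cs (bdd_gam j i); have h' := S_has_sum m1 0 cs (bdd_gam j i).
  by split; [apply: summable_ext h | apply: has_sum_ext h'] => N; rewrite ex_cusp.
have := @has_sum_fin R _ (fun N : Zg g => if nsq N == 1%N then p N else 0) [:: ej j] isT.
rewrite big_seq1 (_ : nsq (ej j) = 1%N); last first.
  by rewrite /nsq (bigD1 j) //= big1 => [|l /negbTE lj]; rewrite ffunE ?lj ?eqxx.
rewrite eqxx /p /clind eqxx mul1r ffunE eq_sym -pmulrn; apply => N; rewrite inE => NN.
case: eqP => // N1; apply/eqP/contraT; rewrite -/(clind _ _) -/(p N) => /Hp/ej_unique[_ /(_ N1)] E.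
by rewrite E eqxx in NN.
Qed.

Lemma gam_cusp_det : exists2 tau : 'M[C]_g, siegel tau & \det (\matrix_(j, i) gam tau j i) != 0.
Proof.
pose A P := \matrix_(j, i) gam (@cusp R g m P) j i.
have [|||d0 d00 H] := @det_leading R _ 1%:M A (fun l P => toC (P ^+ 1)).
- by rewrite det1 oner_neq0.
- move=> k l eps e0; have [d1 d10 H] := gam_lead k l e0.
  by exists d1 => // P /H[x E h]; exists x; rewrite mxE // -?E.
- by move=> l P P0; rewrite -nrm_gt0 nrm_toC normr_gt0 expf_neq0 ?gt_eqF.
have h : 0 < Num.min d0 1 by rewrite lt_min d00 ltr01.
have [h1 h2] : Num.min d0 1 <= d0 /\ Num.min d0 1 <= 1 by rewrite !ge_min !lexx orbT.
exists (cusp g m (Num.min d0 1 / 2)); first by apply: (cusp_siegel g m1); apply/andP; split; lra.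
by apply: H; apply/andP; split; lra.
Qed.

Lemma S_add p q (tau : 'M[C]_g) z : siegel tau -> bdd p -> bdd q ->
  S (fun N => p N + q N) tau z = S p tau z + S q tau z.
Proof.
move=> ts bp bq; apply: S_eq.
have := has_sumD (S_has_sum m1 z ts bp) (S_has_sum m1 z ts bq).
by apply: has_sum_ext => N; rewrite mulrDl.
Qed.

Lemma qdN (M : 'M[C]_g) x : qd M (- x) = qd M x.
Proof.
by apply: eq_bigr => i _; apply: eq_bigr => l _; rewrite !ffunE !mulrNz mulrN !mulNr opprK.
Qed.

(* The theta coordinates and their first derivatives are independent at every
   point: a dependency at z0, inserted in the differentiated Riemann relations with
   two different characteristics, produces an identity between products of theta
   functions in which z0 has disappeared. *)
Lemma immersion (tau : 'M[C]_g) z0 (c0 : C) (c : 'I_g -> C) : siegel tau ->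
  \det (\matrix_(j, i) gam tau j i) != 0 ->
  (forall a : B, c0 * th a tau z0 + \sum_j c j * dz_ j (th a tau) z0 = 0) ->
  c0 = 0 /\ forall j, c j = 0.
Proof.
move=> ts dg H.
pose pii : C := toC pi * iC R.
pose cd (N : Zg g) : C := \sum_j c j * (N j)%:~R.
have bcd : bdd cd.
  rewrite /cd; elim: (index_enum _) => [|j s IH].
    by apply: (@bdd_cst _ _ _ 0) => N; rewrite big_nil Normc.normc0.
  have := bddD (bddM (@bdd_cst _ _ (fun=> c j) _ (fun=> lexx _)) (bdd_coord j)) IH.
  by case=> M [b [M0 Hb]]; exists M, b; split=> // N; rewrite big_cons.
have bK (K : C) : bdd (fun _ : Zg g => K) by exact: (@bdd_cst _ _ _ (nrm K)).
(* The weight of the operator c0 + sum_j c_j d/dz_j. As 2 N = (N + N') + (N - N'), it is a function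
   of N + N' plus one of N - N', which is the shape [riemann] wants. *)
pose u N := c0 + 2%:R * pii * cd N.
pose v N := c0 + pii * cd N.
pose w N := pii * cd N.
have bu : bdd u by apply: bddD => //; exact: bddM.
have bv : bdd v by apply: bddD => //; exact: bddM.
have bw : bdd w by exact: bddM.
have cdD N N' : cd (N + N') = cd N + cd N'.
  by rewrite -big_split; apply: eq_bigr => j _; rewrite ffunE intrD mulrDr.
have cdN N : cd (- N) = - cd N.
  by rewrite -sumrN; apply: eq_bigr => j _; rewrite ffunE mulrNz mulrN.
have E N N' : u N = v (N + N') + w (N - N').
  by rewrite /u /v /w !cdD cdN; ring.
have Hu a : S (fun N => clind a N * u N) tau z0 = 0.
  rewrite -(H a) th_S //.
  have -> : th a tau = S (clind a) tau by apply/funext => z; exact: th_S.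
  have ba := bdd_clind R a.
  have -> : \sum_j c j * dz_ j (S (clind a) tau) z0 =
     S (fun N => clind a N * (2%:R * pii * cd N)) tau z0.
    transitivity (\sum_j S (fun N => c j * (2%:R * pii) * (clind a N * (N j)%:~R)) tau z0).
      apply: eq_bigr => j _; rewrite dz_S // S_scale //; last exact: bddM (bdd_coord j).
      by rewrite /pii !mulrA.
    rewrite -S_sum // => [|j]; last by apply: bddM => //; exact: bddM (bdd_coord j).
    apply: S_ext => N; rewrite /cd !mulr_sumr; apply: eq_bigr => j _.
    by move: (clind a N) => x; ring.
  rewrite -S_scale // -S_add //; first last.
  - by apply: bddM => //; exact: bddM.
  - exact: bddM.
  by apply: S_ext => N; rewrite mulrDr [c0 * _]mulrC.
pose chi : half_chars g := [ffun=> false].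
(* The dependency at z0 kills the left-hand side of Riemann's relation, for every z2. Both vectors
   are taken equal to A, so the characteristic of the difference is always 0. *)
have RR (A : Zg g) z2 :
    TH m v (A + A) chi tau (z0 + z2) * TH m (fun=> 1) 0 chi tau (z0 - z2) +
    TH m (fun=> 1) (A + A) chi tau (z0 + z2) * TH m w 0 chi tau (z0 - z2) = 0.
  have := riemann m1 m2 A A chi z0 z2 ts bu bv bw E; rewrite subrr => <-.
  by rewrite big1 // => e _; rewrite Hu mul0r mulr0.
(* Eliminate the term with w between the relations for A and for 0. The remaining factor at z0 - z2
   is not the zero function, so [lent_eq0] removes it, and z0 with it. *)
have key (A : Zg g) z : TH m v 0 chi tau z * TH m (fun=> 1) (A + A) chi tau z
   - TH m (fun=> 1) 0 chi tau z * TH m v (A + A) chi tau z = 0.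
  have b1 := bdd1 R g.
  pose f z2 := TH m v 0 chi tau (z0 + 1 *: z2) * TH m (fun=> 1) (A + A) chi tau (z0 + 1 *: z2)
     + - (TH m (fun=> 1) 0 chi tau (z0 + 1 *: z2) * TH m v (A + A) chi tau (z0 + 1 *: z2)).
  have lf : lent f.
    have l1 u' b' : bdd u' -> lent (fun z2 => TH m u' b' chi tau (z0 + 1 *: z2)).
      by move=> bu'; exact: lent_TH.
    by apply: lentD; [|apply: lentN]; apply: lentM; apply: l1.
  have lG : lent (fun z2 => TH m (fun=> 1) 0 chi tau (z0 + (-1) *: z2)) by exact: lent_TH.
  have fG z2 : f z2 * TH m (fun=> 1) 0 chi tau (z0 + (-1) *: z2) = 0.
    rewrite /f scale1r scaleN1r; have e1 := RR 0 z2; have e2 := RR A z2; rewrite addr0 in e1.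
    move: (TH m v 0 chi tau (z0 + z2)) (TH m v (A + A) chi tau (z0 + z2)) (TH m (fun=> 1) 0 chi tau (z0 - z2))
      (TH m w 0 chi tau (z0 - z2)) (TH m (fun=> 1) 0 chi tau (z0 + z2)) (TH m (fun=> 1) (A + A) chi tau (z0 + z2))
      e1 e2 => D0 DA G W F0 FA e1 e2.
    transitivity (FA * (D0 * G + F0 * W) - F0 * (DA * G + FA * W)); first by ring.
    by rewrite e1 e2 !mulr0 subrr.
  have [h|h] := lent_eq0 lf lG fG.
    by have := h (z - z0); rewrite /f scale1r [z0 + _]addrC subrK.
  have [x hx] := TH_nonzero m1 0 chi ts.
  have := h (z0 - x); rewrite scaleN1r opprB addrC subrK => h0.
  by rewrite h0 eqxx in hx.
have sh := siegel_half ts.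
(* Take the Fourier coefficient of frequency 2 A = - 2 e_j in [key]: the pairs with this total are
   (N + A, A - N), the characteristics select N in the class of e_j, and the weight becomes a
   multiple of sum_i c_i N_i. *)
have cg j : \sum_i c i * gam tau j i = 0.
  pose A : Zg g := - ej j.
  pose a (x : Zg g * Zg g) : C := (pc R m 0 chi x.1 * pc R m (A + A) chi x.2) * (v x.1 - v x.2) *
     (ex m (2^-1 *: tau) 0 x.1 * ex m (2^-1 *: tau) 0 x.2).
  have b1 := bdd1 R g.
  have smm (p q : Zg g -> C) z : bdd p -> bdd q ->
     summable (fun x : Zg g * Zg g => (p x.1 * ex m (2^-1 *: tau) z x.1) * (q x.2 * ex m (2^-1 *: tau) z x.2)) /\
     has_sum (fun x : Zg g * Zg g => (p x.1 * ex m (2^-1 *: tau) z x.1) * (q x.2 * ex m (2^-1 *: tau) z x.2))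
       (S p (2^-1 *: tau) z * S q (2^-1 *: tau) z).
    move=> bp bq; split.
      exact: summable_pair (S_summable m1 z sh bp) (S_summable m1 z sh bq).
    exact: has_sum_pair (S_summable m1 z sh bp) (S_summable m1 z sh bq)
      (S_has_sum m1 z sh bp) (S_has_sum m1 z sh bq).
  pose p1 (w : Zg g -> C) x := pc R m 0 chi x * w x.
  pose p2 (w : Zg g -> C) x := pc R m (A + A) chi x * w x.
  have bp1 w' : bdd w' -> bdd (p1 w') by move=> ?; exact: bddM (bdd_pc _ _ _ _) _.
  have bp2 w' : bdd w' -> bdd (p2 w') by move=> ?; exact: bddM (bdd_pc _ _ _ _) _.
  have [s1 h1] := smm _ _ 0 (bp1 _ bv) (bp2 _ b1).
  have [s2 h2] := smm _ _ 0 (bp1 _ b1) (bp2 _ bv).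
  have sa : summable a.
    have := summableD s1 (summableZ (-1) s2); apply: summable_ext => x.
    rewrite /a /p1 /p2; move: (ex _ _ _ _) (ex _ _ _ x.2) (pc _ _ _ _ _) (pc _ _ _ _ x.2) => *.
    by ring.
  have HA (x : 'I_g -> R) : has_sum (fun i => a i * e1 (\sum_l ((i.1 + i.2) l)%:~R * x l)) 0.
    pose z : 'rV[C]_g := \row_l toC (x l).
    have [_ h1'] := smm _ _ z (bp1 _ bv) (bp2 _ b1).
    have [_ h2'] := smm _ _ z (bp1 _ b1) (bp2 _ bv).
    have := key A (2%:R *: z); rewrite /TH !scalerA mulVf ?pnatr_eq0 // scale1r.
    move=> K; have l0 : S (p1 v) (2^-1 *: tau) z * S (p2 (fun=> 1)) (2^-1 *: tau) z +
        -1 * (S (p1 (fun=> 1)) (2^-1 *: tau) z * S (p2 v) (2^-1 *: tau) z) = 0.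
      by rewrite mulN1r; exact: K.
    have := has_sumD h1' (has_sumZ (-1) h2'); rewrite l0; apply: has_sum_ext.
    move=> i; rewrite /a /p1 /p2 !ex_real.
    have -> : e1 (\sum_l ((i.1 + i.2) l)%:~R * x l) =
       e1 (\sum_l (i.1 l)%:~R * x l) * e1 (\sum_l (i.2 l)%:~R * x l).
      by rewrite -e1D -big_split; congr e1; apply: eq_bigr => l _; rewrite ffunE intrD mulrDl.
    move: (e1 _) (e1 _) (ex _ _ _ _) (ex _ _ _ i.2) (pc _ _ _ _ _) (pc _ _ _ _ i.2) => *.
    by ring.
  have F := fourier_group sa HA (A + A).
  pose q (N : Zg g) : Zg g * Zg g := (N + A, A - N).
  have qi : injective q by move=> N N' [] /addIr.
  pose e0 := ex m tau 0 (ej j).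
  have HL : has_sum ((fun i : Zg g * Zg g => if i.1 + i.2 == A + A then a i else 0) \o q)
     (e0 * (2%:R * pii) * \sum_i c i * gam tau j i).
    have := has_sumZ (e0 * (2%:R * pii)) (has_sum_sum (index_enum _)
      (fun i => has_sumZ (c i) (S_has_sum m1 0 ts (bdd_gam j i)))).
    apply: has_sum_ext => N; rewrite /= [X in if X + _ == _ then _ else _]addrC addrACA subrr addr0 eqxx /a /=.
    have -> : pc R m 0 chi (N + A) * pc R m (A + A) chi (A - N) = clind (cl m (ej j)) N.
      rewrite /pc /clind.
      have sg P : sgp R chi P = 1 by rewrite /sgp big1 // => i _; rewrite ffunE.
      have e1' : (cl m (N + A) == cl m 0) = (cl m N == cl m (ej j)).
        rewrite clD clN; have -> : cl m 0 = 0 :> B by apply/ffunP => i; rewrite !ffunE.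
        by rewrite subr_eq0.
      have e2' : (cl m (A - N) == cl m (A + A)) = (cl m N == cl m (ej j)).
        by rewrite !clD (inj_eq (addrI _)) !clN eqr_opp.
      by rewrite e1' e2'; case: eqP; rewrite ?mul0r // !sg mulr1.
    have -> : v (N + A) - v (A - N) = 2%:R * pii * cd N by rewrite /v !cdD cdN; ring.
    have -> : ex m (2^-1 *: tau) 0 (N + A) * ex m (2^-1 *: tau) 0 (A - N) = ex m tau 0 N * e0.
      have := ex_pair m1 tau 0 0 N A; rewrite addr0 subr0 scaler0.
      have exN x : ex m (2^-1 *: tau) 0 (- x) = ex m (2^-1 *: tau) 0 x.
        by rewrite /ex !dt0 qdN.
      have -> : A - N = - (N - A) by rewrite opprB.
      by rewrite exN => ->; rewrite /e0 /ex !dt0 /A qdN.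
    rewrite /cd !mulr_sumr mulr_suml; apply: eq_bigr => i _.
    move: (ex m tau 0 N) (clind _ _) (N i)%:~R e0 => *; by ring.
  have Fz := has_sum_inj qi _ HL.
  have l0 : e0 * (2%:R * pii) * (\sum_i c i * gam tau j i) = 0.
    apply: has_sum_uniq (Fz _) F => -[x y] Hxy /=; case: eqP => // Exy.
    case/eqP: (Hxy (x - A)); rewrite /q subrK; congr (_, _).
    by rewrite opprB addrA -Exy addrAC subrr add0r.
  have pi0 : pii != 0.
    rewrite mulf_neq0 // -nrm_gt0 ?nrm_toC ?normr_gt0 ?gt_eqF ?pi_gt0 //.
    by rewrite /iC /= expr0n expr1n add0r sqrtr1.
  apply/eqP; move/eqP: l0; rewrite mulf_eq0 => /orP[|//].
  apply: contraTT => _; apply: mulf_neq0; first exact: cexp_neq0.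
  by apply: mulf_neq0 => //; rewrite pnatr_eq0.
have c_0 j : c j = 0.
  pose G := \matrix_(j, i) gam tau j i; pose x := \col_i c i.
  have Gx : G *m x = 0.
    apply/colP => l; rewrite !mxE -[RHS](cg l); apply: eq_bigr => i _.
    by rewrite !mxE mulrC.
  have Gu : G \in unitmx by rewrite unitmxE unitfE.
  have x0 : x = 0 by rewrite -(mulKmx Gu x) Gx mulmx0.
  by have := congr1 (fun M : 'cV_g => M j ord0) x0; rewrite !mxE.
split=> //; have [b hb] := th_nonzero m1 m2 z0 ts.
have := H b; rewrite [X in _ + X]big1 ?addr0 => [/eqP|j _]; last by rewrite c_0 mul0r.
by rewrite mulf_eq0 (negbTE hb) orbF => /eqP.
Qed.

End Immersion.

(** * Generic period matrices *)

Section Generic.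
Variables (R : realType) (g : nat).
Local Notation C := R[i].

Lemma siegel_open (tau : 'M[C]_g) : siegel tau -> exists2 d : R, 0 < d &
  forall tau' : 'M[C]_g, tau'^T = tau' -> (forall i j, nrm (tau' i j - tau i j) < d) -> siegel tau'.
Proof.
move=> ts; have [c c0 Hc] := bil_lower_bound (siegel_ImT ts) ts.2.
have bilE (Y : 'M[R]_g) x : bil Y x x = \sum_i \sum_j x ord0 i * Y i j * x ord0 j.
  rewrite /bil mxE exchange_big; apply: eq_bigr => j _ /=.
  by rewrite !mxE mulr_suml.
(* Entries below d change the form by at most d g |x|^2, which is less than c |x|^2. *)
pose d := c / (g.+1)%:R; have d0 : 0 < d by rewrite divr_gt0.
exists d => // tau' sym H; split=> // x x0.
have h0 : 0 < \sum_i x ord0 i ^+ 2.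
  have [i xi] : exists i, x ord0 i != 0.
    by apply/existsP; apply: contraNT x0 => /existsPn h; apply/eqP/rowP => i; rewrite mxE; apply/eqP; have := h i; rewrite negbK.
  rewrite (bigD1 i) //= ltr_pwDl //; first by rewrite exprn_even_gt0.
  by apply: sumr_ge0 => j _; rewrite sqr_ge0.
pose s := \sum_i x ord0 i ^+ 2.
have E : bil (Defs.ImM tau') x x = bil (Defs.ImM tau) x x +
   \sum_i \sum_j x ord0 i * im (tau' i j - tau i j) * x ord0 j.
  rewrite !bilE -big_split; apply: eq_bigr => i _; rewrite -big_split; apply: eq_bigr => j _ /=.
  rewrite !mxE; have -> : im (tau' i j - tau i j) = im (tau' i j) - im (tau i j).
    by case: (tau' i j) (tau i j) => a b [a' b'].
  by ring.
have D : `|\sum_i \sum_j x ord0 i * im (tau' i j - tau i j) * x ord0 j| <= d * g%:R * s.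
  apply: (@le_trans _ _ (\sum_(i < g) \sum_(j < g) d * ((x ord0 i ^+ 2 + x ord0 j ^+ 2) / 2))).
    apply: le_trans (ler_norm_sum _ _ _) _; apply: ler_sum => i _.
    apply: le_trans (ler_norm_sum _ _ _) _; apply: ler_sum => j _.
    rewrite !normrM mulrAC mulrC.
    have h1 : `|im (tau' i j - tau i j)| <= d.
      by apply: le_trans (nrm_Im _) _; exact: ltW (H i j).
    apply: ler_pM; rewrite ?mulr_ge0 //.
    have := sqr_ge0 (`|x ord0 i| - `|x ord0 j|).
    rewrite -(real_normK (num_real (x ord0 i))) -(real_normK (num_real (x ord0 j))).
    by move: `|x ord0 i| `|x ord0 j| => p q; rewrite !expr2; lra.
  rewrite le_eqVlt; apply/orP; left; apply/eqP.
  transitivity (\sum_(i < g) (d / 2 * (x ord0 i ^+ 2 * g%:R) + d / 2 * s)).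
    apply: eq_bigr => i _; rewrite -mulr_sumr -mulr_suml big_split /= sumr_const card_ord -mulr_natr.
    by rewrite /s; field.
  rewrite big_split /= sumr_const card_ord -!mulr_sumr -mulr_suml -/s -mulr_natr.
  by field.
rewrite -/(bil _ x x) E; have := Hc x; rewrite -/s => Hx.
have dg : d * g%:R * s < c * s.
  rewrite ltr_pM2r //; rewrite /d -mulrA gtr_pMr // mulrC ltr_pdivrMr ?mul1r ?ltr0n //.
  by rewrite ltr_nat.
have := ler_norm (- (\sum_i \sum_j x ord0 i * im (tau' i j - tau i j) * x ord0 j)).
rewrite normrN => h1; have := le_trans h1 D => h2.
by lra.
Qed.

Definition seg (tau0 tau1 : 'M[C]_g) (t : R) : 'M[C]_g := tau0 + toC t *: (tau1 - tau0).

Lemma seg_siegel (tau0 tau1 : 'M[C]_g) t : siegel tau0 -> siegel tau1 -> 0 <= t <= 1 -> siegel (seg tau0 tau1 t).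
Proof. exact: siegel_convex. Qed.

(** If the zero at t were not isolated, the restriction would vanish near t, and continuation along
    the segment from t to x would make it vanish at x. *)
Lemma line_zeros f (tau0 tau1 : 'M[C]_g) : tau_an f -> siegel tau0 -> siegel tau1 ->
  (exists2 x, 0 <= x <= 1 & f (seg tau0 tau1 x) != 0) ->
  forall t, 0 <= t <= 1 -> exists2 d : R, 0 < d &
    forall t', 0 <= t' <= 1 -> t' != t -> `|t' - t| < d -> f (seg tau0 tau1 t') != 0.
Proof.
move=> fan s0 s1 [x x01 fx] t t01.
have [rho r0 Hr] := fan _ _ s0 s1.
have [h|[d d0 Hd]] := pser_isolated r0 (Hr t t01); last first.
  exists d => // t' t'01 tt' dt.
  have := Hd (toC (t' - t)); rewrite nrm_toC => /(_ _ dt).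
  rewrite /toC -rmorphD [t + _]addrC subrK; apply.
  by rewrite -nrm_eq0 nrm_toC normr_eq0 subr_eq0.
case/negP: fx; apply/eqP.
have sx := seg_siegel s0 s1 x01; have st := seg_siegel s0 s1 t01.
have [rho' r'0 Hr'] := fan _ _ st sx.
have := segment_identity (h := fun z => f (seg tau0 tau1 t + z *: (seg tau0 tau1 x - seg tau0 tau1 t)))
  r'0 Hr' _ (t := 1).
rewrite /toC rmorph1 scale1r [seg _ _ t + _]addrC subrK; apply; last by rewrite ler01 lexx.
exists rho => // s /andP[s_0 sr].
have -> : seg tau0 tau1 t + (s%:C)%C *: (seg tau0 tau1 x - seg tau0 tau1 t) =
   tau0 + (toC t + toC (s * (x - t))) *: (tau1 - tau0).
  rewrite /seg opprD addrACA subrr add0r -scalerBl scalerA -addrA -scalerDl.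
  by rewrite /toC rmorphM rmorphB.
apply: h; rewrite nrm_toC normrM ger0_norm //.
apply: le_trans (ltW sr); rewrite ler_piMr //.
by case/andP: x01 => ? ?; case/andP: t01 => ? ?; rewrite ler_norml; lra.
Qed.

(* Baire's theorem on a segment *)
Lemma line_generic (F : nat -> 'M[C]_g -> C) (a b : nat -> 'M[C]_g) :
  (forall i, tau_an (F i)) -> (forall i, siegel (a i)) -> (forall i, siegel (b i)) ->
  (forall i, exists2 x, 0 <= x <= 1 & F i (seg (a i) (b i) x) != 0) ->
  exists2 t, 0 <= t <= 1 & forall i, F i (seg (a i) (b i) t) != 0.
Proof.
move=> Fan sa sb Fx.
(* The points outside [0, 1] are put into every [O i], so that these sets are open and dense in the
   whole line. *)
pose O i : set R^o := [set t : R | ~ (0 <= t <= 1 /\ F i (seg (a i) (b i) t) = 0)].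
have D : dense (\bigcap_i (O i)).
  apply: Baire => i; have HZ := line_zeros (Fan i) (sa i) (sb i) (Fx i).
  split.
    rewrite openE => t Ot; apply/nbhs_ballP.
    case: (boolP (0 <= t <= 1)) => t01.
      have [d d0 Hd] := HZ t t01; exists d => // t' /=; rewrite /ball /= => dt [t'01 h].
      have [E|tt'] := eqVneq t' t; first by apply: Ot; rewrite -E.
      by have := Hd t' t'01 tt'; rewrite distrC h eqxx => /(_ dt).
    move: t01; rewrite negb_and -!ltNge => /orP[t0|t1].
      by exists (- t) => [/=|t' /=]; [lra|rewrite /ball /= ltr_norml => dt [? _]; lra].
    by exists (t - 1) => [/=|t' /=]; [lra|rewrite /ball /= ltr_norml => dt [? _]; lra].
  move=> D [t Dt] oD.
  case: (pselect (O i t)) => Ot; first by exists t.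
  have [t01 ft] : 0 <= t <= 1 /\ F i (seg (a i) (b i) t) = 0 by apply: contrapT.
  have [d d0 Hd] := HZ t t01.
  move: oD; rewrite openE => /(_ t Dt)/nbhs_ballP[e /= e0 He].
  pose r := Num.min (Num.min d e) 2^-1 / 2.
  have m0 : 0 < Num.min (Num.min d e) 2^-1 by rewrite !lt_min d0 e0 invr_gt0 ltr0n.
  have [m1 [m2 m3]] : Num.min (Num.min d e) 2^-1 <= d /\ Num.min (Num.min d e) 2^-1 <= e /\
      Num.min (Num.min d e) 2^-1 <= 2^-1 by rewrite !ge_min !lexx !orbT.
  have [t' [t'01 [nt [d1 d2]]]] : exists t', 0 <= t' <= 1 /\ t' != t /\ `|t' - t| < d /\ `|t - t'| < e.
    case: (leP t 2^-1) => ht.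
      exists (t + r); rewrite (addrC t) addrK opprD addrCA subrr addr0 normrN.
      rewrite ger0_norm ?divr_ge0 ?(ltW m0) //; split; first by apply/andP; split; rewrite /r; lra.
      split; last by split; rewrite /r; lra.
      by rewrite -subr_eq0 addrK gt_eqF // divr_gt0.
    exists (t - r); rewrite addrAC subrr add0r normrN opprD opprK addrA subrr add0r.
    rewrite ger0_norm ?divr_ge0 ?(ltW m0) //; split; first by apply/andP; split; rewrite /r; lra.
    split; last by split; rewrite /r; lra.
    by rewrite -subr_eq0 addrAC subrr add0r oppr_eq0 gt_eqF // divr_gt0.
  exists t'; split; first exact: He.
  by case=> _ h; have := Hd t' t'01 nt d1; rewrite h eqxx.
have h2 : (0 : R) < 2^-1 by rewrite invr_gt0.
have [|t [/= Bt Ot]] := D (ball (2^-1 : R^o) 2^-1) _ (ball_open (2^-1 : R^o) 2^-1).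
  by exists 2^-1; exact: ballxx.
have t01 : 0 <= t <= 1.
  by move: Bt; rewrite /ball /= ltr_norml => h; lra.
exists t => // i; apply/eqP => h.
by have := Ot i I; rewrite /O /=; apply.
Qed.

Lemma toC0 : toC (0 : R) = 0. Proof. exact: rmorph0. Qed.
Lemma toC1 : toC (1 : R) = 1. Proof. exact: rmorph1. Qed.

Section Box.
Variables (P : eqType) (tau0 : 'M[C]_g) (H : P -> 'M[C]_g) (enumP : seq P).

Definition boxpt (s : P -> R) : 'M[C]_g := tau0 + \sum_(p <- enumP) toC (s p) *: H p.
Definition unit_box (s : P -> R) : Prop := forall p, 0 <= s p <= 1.
Definition setp (s : P -> R) p (x : R) : P -> R := fun q => if q == p then x else s q.

Lemma setp_box s p x : unit_box s -> 0 <= x <= 1 -> unit_box (setp s p x).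
Proof. by move=> sb x01 q; rewrite /setp; case: eqP. Qed.

Lemma boxpt_seg s p x : uniq enumP -> p \in enumP ->
  boxpt (setp s p x) = seg (boxpt (setp s p 0)) (boxpt (setp s p 1)) x.
Proof.
move=> ue pe.
have E y : boxpt (setp s p y) = boxpt (setp s p 0) + toC y *: H p.
  rewrite /boxpt !(big_rem p pe) /= -!addrA; congr (_ + _).
  rewrite /setp eqxx toC0 scale0r add0r addrC; congr (_ + _).
  apply: eq_big_seq => q; rewrite mem_rem_uniq // inE => /andP[/negbTE -> _].
  by [].
rewrite (E x) /seg (E 1) [_ + toC 1 *: _]addrC addrK.
by rewrite toC1 scale1r.
Qed.

(** Coordinates are fixed one at a time. Each function has its own witness, hence its own segment in
    direction p, but all these segments share the parameter, and [line_generic] finds one value of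
    the coordinate p that is good for all of them. *)
Lemma box_generic (F : nat -> 'M[C]_g -> C) : uniq enumP -> (forall i, tau_an (F i)) ->
  (forall s, unit_box s -> siegel (boxpt s)) ->
  (forall i, exists2 s, unit_box s & F i (boxpt s) != 0) ->
  exists2 s, unit_box s & forall i, F i (boxpt s) != 0.
Proof.
move=> ue Fan sb Hs.
suff G (L : seq P) (s0 : P -> R) : {subset L <= enumP} -> unit_box s0 ->
    (forall i, exists s, [/\ unit_box s, forall q, q \notin L -> s q = s0 q & F i (boxpt s) != 0]) ->
    exists s, [/\ unit_box s, forall q, q \notin L -> s q = s0 q & forall i, F i (boxpt s) != 0].
  have [|||s [s1 _ s2]] := G enumP (fun p => if p \in enumP then 0 else 0).
  - by [].
  - by move=> p; rewrite if_same; apply/andP; split; lra.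
  - move=> i; have [s s1 s2] := Hs i.
    exists (fun p => if p \in enumP then s p else 0); split.
    + by move=> p; case: ifP => _ //; apply/andP; split; lra.
    + by move=> q /negbTE ->.
    + move: s2; congr (F i _ != 0); rewrite /boxpt; congr (_ + _).
      by apply: eq_big_seq => q ->.
  by exists s.
elim: L s0 => [|p L IH] s0 sub b0 Hi.
  exists s0; split=> // i; have [s [_ h1 h2]] := Hi i.
  by have -> : s0 = s by apply/funext => q; rewrite h1.
have [S HS] := boolp.choice Hi.
have pe : p \in enumP by apply: sub; rewrite inE eqxx.
have u0 : 0 <= (0 : R) <= 1 by apply/andP; split; lra.
have u1 : 0 <= (1 : R) <= 1 by apply/andP; split; lra.
have [i|i|i|u uu Hu] := line_generic (F := F) (a := fun i => boxpt (setp (S i) p 0))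
    (b := fun i => boxpt (setp (S i) p 1)) Fan.
- by apply: sb; apply: setp_box => //; case: (HS i).
- by apply: sb; apply: setp_box => //; case: (HS i).
- have [h1 h2 h3] := HS i; exists (S i p) => //; rewrite -boxpt_seg //.
  by have -> : setp (S i) p (S i p) = S i by apply/funext => q; rewrite /setp; case: eqP => [->|].
have [||s [h1 h2 h3]] := IH (setp s0 p u) _ (setp_box _ b0 uu).
- by move=> q qL; apply: sub; rewrite inE qL orbT.
- move=> i; have [h1 h2 h3] := HS i; exists (setp (S i) p u); split.
  + exact: setp_box.
  + move=> q qL; rewrite /setp; case: (eqVneq q p) => // qp.
    by apply: h2; rewrite inE (negbTE qp).
  + by rewrite boxpt_seg.
exists s; split=> // q; rewrite inE negb_or => /andP[qp qL].
by rewrite h2 // /setp (negbTE qp).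
Qed.

End Box.

(** Apply [box_generic] to a small box around tau0 in the real vector space of symmetric matrices;
    by [tau_identity] none of the functions vanishes on the whole box. *)
Lemma generic_dense (F : nat -> 'M[C]_g -> C) : (forall i, tau_an (F i)) ->
  (forall i, exists2 tau, siegel tau & F i tau != 0) ->
  forall (tau0 : 'M[C]_g) (e : R), siegel tau0 -> 0 < e ->
  exists tau, [/\ siegel tau, (forall i j, nrm (tau i j - tau0 i j) < e) & forall i, F i tau != 0].
Proof.
move=> Fan Fn0 tau0 e ts e0.
have [rho r0 Hr] := siegel_open ts.
pose P := ('I_g * 'I_g * bool)%type.
pose N := #|{: P}|.
pose r := Num.min e rho; have rp : 0 < r by rewrite lt_min e0.
pose dl := r / (2 * N.+1%:R); have dl0 : 0 < dl by rewrite divr_gt0 // mulr_gt0.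
pose sy (i j : 'I_g) : 'M[C]_g := delta_mx i j + delta_mx j i.
pose H (p : P) : 'M[C]_g := ((if p.2 then iC R else 1) * toC dl) *: sy p.1.1 p.1.2.
(* Shifted so that tau0 is the centre of the box. *)
pose base := tau0 + \sum_(p <- index_enum {: P}) toC (- 2^-1) *: H p.
have HT p : (H p)^T = H p.
  by rewrite /H linearZ /= /sy linearD /= !trmx_delta addrC.
have nH p i j : nrm (H p i j) <= 2 * dl.
  rewrite /H /sy !mxE Normc.normcM mulrC; apply: ler_pM; rewrite ?nrm_ge0 //.
    apply: le_trans (le_normcD _ _) _; have -> : (2 : R) = 1 + 1 by [].
    by apply: lerD; exact: nrm_bool.
  rewrite Normc.normcM nrm_toC gtr0_norm // ler_piMl ?(ltW dl0) //.
  by case: (p.2); rewrite ?Normc.normc1 // /iC /= expr0n expr1n add0r sqrtr1.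
have bE s : boxpt base H (index_enum {: P}) s = tau0 + \sum_p toC (s p - 2^-1) *: H p.
  rewrite /boxpt /base -addrA -big_split; congr (_ + _); apply: eq_bigr => p _ /=.
  by rewrite -scalerDl addrC /toC -rmorphD.
have bn s : unit_box s -> forall i j, nrm (boxpt base H (index_enum {: P}) s i j - tau0 i j) < r.
  move=> us i j; rewrite bE !mxE addrAC subrr add0r summxE.
  apply: le_lt_trans (nrm_sum _ _ _) _.
  apply: (@le_lt_trans _ _ (\sum_(p : P) dl)).
    apply: ler_sum => p _; rewrite mxE Normc.normcM nrm_toC.
    have -> : dl = 2^-1 * (2 * dl) by field.
    apply: ler_pM => //; first exact: nrm_ge0.
    by have := us p; rewrite ler_norml => /andP[? ?]; lra.
  rewrite sumr_const -/N -mulr_natr /dl mulrAC ltr_pdivrMr ?mulr_gt0 // ltr_pM2l //.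
  by rewrite -natrM ltr_nat; lia.
have bs s : unit_box s -> siegel (boxpt base H (index_enum {: P}) s).
  move=> us; apply: Hr => [|i j].
    rewrite bE linearD /= ts.1; congr (_ + _); rewrite linear_sum; apply: eq_bigr => p _ /=.
    by rewrite linearZ /= HT.
  by apply: lt_le_trans (bn s us i j) _; rewrite ge_min lexx orbT.
have [i|s us Hs] := @box_generic P base H (index_enum {: P}) F (index_enum_uniq _) Fan bs.
  apply: contrapT => nz; have [tau1 s1 /negP] := Fn0 i; apply; apply/eqP.
  apply: (tau_identity (Fan i) ts) s1; exists dl => // tau st Ht.
  apply/eqP/contraT => h; case: nz.
  pose co (p : P) := tau p.1.1 p.1.2 - tau0 p.1.1 p.1.2.
  (* The entry (i, j) is reached through both (i, j) and (j, i), so each of them takes half of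
     it. *)
  pose s (p : P) : R := 2^-1 + (if p.2 then im (co p) else re (co p)) / (2 * dl).
  exists s.
    move=> p; have h1 : `|if p.2 then im (co p) else re (co p)| < dl.
      by case: (p.2); [apply: le_lt_trans (nrm_Im _) _|apply: le_lt_trans (nrm_Re _) _]; exact: Ht.
    pose w := (if p.2 then im (co p) else re (co p)) / (2 * dl).
    have : `|w| <= 2^-1.
      have d2 : 0 < 2 * dl by rewrite mulr_gt0.
      rewrite /w normrM [X in _ * X]ger0_norm ?invr_ge0 ?(ltW d2) //.
      by rewrite ler_pdivrMr // mulrA mulVf ?pnatr_eq0 // mul1r ltW.
    have -> : s p = 2^-1 + w by [].
    by case/ler_normlP=> ? ?; apply/andP; split; lra.
  rewrite bE (_ : tau0 + _ = tau) //.
  have E p : toC (s p - 2^-1) *: H p = (toC ((if p.2 then im (co p) else re (co p)) / 2) *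
     (if p.2 then iC R else 1)) *: sy p.1.1 p.1.2.
    rewrite /s addrC addKr /H scalerA; congr (_ *: _).
    rewrite mulrCA mulrC; congr (_ * _); rewrite /toC -rmorphM; congr (_%:C)%C.
    by field; rewrite gt_eqF.
  rewrite (eq_bigr _ (fun p _ => E p)).
  have -> : \sum_p (toC ((if p.2 then im (co p) else re (co p)) / 2) *
     (if p.2 then iC R else 1)) *: sy p.1.1 p.1.2 = \sum_i \sum_j ((tau i j - tau0 i j) / 2) *: sy i j.
    rewrite -(pair_bigA _ (fun (q : 'I_g * 'I_g) (b : bool) =>
      (toC ((if b then im (co (q, b)) else re (co (q, b))) / 2) * (if b then iC R else 1)) *: sy q.1 q.2)) /=.
    rewrite -(pair_bigA _ (fun i j => \sum_(b : bool) (toC ((if b then im (co (i, j, b)) else re (co (i, j, b))) / 2) * (if b then iC R else 1)) *: sy i j)) /=.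
    apply: eq_bigr => a _; apply: eq_bigr => b _; rewrite big_bool /= -scalerDl; congr (_ *: _).
    rewrite /co /= {3}(toCE (tau a b - tau0 a b)) mulr1.
    have -> : (2^-1 : C) = toC 2^-1 by rewrite /toC fmorphV rmorph_nat.
    by rewrite /toC !rmorphM /=; ring.
  apply/matrixP => a b; rewrite !mxE summxE.
  have -> : \sum_i0 (\sum_j ((tau i0 j - tau0 i0 j) / 2) *: sy i0 j) a b =
     \sum_i0 \sum_j ((tau i0 j - tau0 i0 j) / 2) * (((a == i0) && (b == j))%:R + ((a == j) && (b == i0))%:R).
    by apply: eq_bigr => c _; rewrite summxE; apply: eq_bigr => d _; rewrite !mxE.
  have pick (G : 'I_g -> 'I_g -> C) c d : \sum_i0 \sum_j G i0 j * ((c == i0) && (d == j))%:R = G c d.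
    rewrite (bigD1 c) //= (bigD1 d) //= !eqxx mulr1 !big1 ?addr0 // => [i0 /negbTE ic|j /negbTE jd].
      by rewrite big1 // => j _; rewrite eq_sym ic mulr0.
    by rewrite [d == _]eq_sym jd mulr0.
  under eq_bigr do (under eq_bigr do rewrite mulrDr; rewrite big_split /=).
  rewrite big_split /= pick.
  under [X in _ + (_ + X)]eq_bigr do under eq_bigr do rewrite andbC.
  rewrite pick.
  have sm (M : 'M[C]_g) : siegel M -> M b a = M a b by case=> T _; rewrite -[in LHS]T mxE.
  by rewrite (sm tau) // (sm tau0) //; field.
exists (boxpt base H (index_enum {: P}) s); split=> //; first exact: bs.
by move=> i j; apply: lt_le_trans (bn s us i j) _; rewrite ge_min lexx.
Qed.

End Generic.

(** * Specialisation and descent of polynomials *)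

Section PolyTools.

Lemma poly_min (A : nzRingType) (Q : {poly A} -> Prop) : (exists p, Q p) ->
  exists2 p, Q p & forall q, Q q -> (size p <= size q)%N.
Proof.
move=> [p0 Q0]; pose P n := `[< exists2 p, Q p & size p = n >].
have ex : exists n, P n by exists (size p0); apply/asboolP; exists p0.
case: (ex_minnP ex) => n /asboolP[p Qp <-] H; exists p => // q Qq.
by apply: H; apply/asboolP; exists q.
Qed.

Definition subring_pred (A : nzRingType) (Q : A -> Prop) : Prop :=
  [/\ Q 1, forall a b, Q a -> Q b -> Q (a - b) & forall a b, Q a -> Q b -> Q (a * b)].
Definition coefs_in (A : nzRingType) (Q : A -> Prop) (p : {poly A}) : Prop := forall i, Q p`_i.

Section SubringPred.
Variables (A : nzRingType) (Q : A -> Prop) (HQ : subring_pred Q).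

Lemma sub0 : Q 0. Proof. by case: HQ => h1 hB _; rewrite -(subrr 1); exact: hB. Qed.
Lemma subB a b : Q a -> Q b -> Q (a - b). Proof. by case: HQ => _ h _; exact: h. Qed.
Lemma subM a b : Q a -> Q b -> Q (a * b). Proof. by case: HQ => _ _; exact. Qed.
Lemma subD a b : Q a -> Q b -> Q (a + b).
Proof. by move=> ha hb; rewrite -[b]opprK; apply: subB => //; rewrite -sub0r; exact: (subB sub0). Qed.
Lemma sub_sum (I : Type) (s : seq I) (P : pred I) (F : I -> A) : (forall i, P i -> Q (F i)) -> Q (\sum_(i <- s | P i) F i).
Proof. by move=> H; elim/big_ind: _ => //; [exact: sub0|exact: subD]. Qed.
Lemma subX a n : Q a -> Q (a ^+ n).
Proof. by move=> ha; elim: n => [|n IH]; [case: HQ|rewrite exprS; exact: subM]. Qed.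

Lemma coefs_in_sub : subring_pred (coefs_in Q).
Proof.
split=> [i|p q hp hq i|p q hp hq i].
- by rewrite coef1; case: eqP => _; [case: HQ|exact: sub0].
- by rewrite coefB; exact: subB.
- by rewrite coefM; apply: sub_sum => j _; exact: subM.
Qed.
Lemma coefs_inZ c p : Q c -> coefs_in Q p -> coefs_in Q (c *: p).
Proof. by move=> hc hp i; rewrite coefZ; exact: subM. Qed.
Lemma coefs_inXn n : coefs_in Q 'X^n.
Proof. by move=> i; rewrite coefXn; case: eqP => _; [case: HQ|exact: sub0]. Qed.
End SubringPred.

(* pseudo-division, keeping track of a subring containing the coefficients *)
Lemma pdiv (A : comNzRingType) (Q : A -> Prop) (p s : {poly A}) : subring_pred Q ->
  coefs_in Q p -> coefs_in Q s -> s != 0 ->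
  exists N q r, [/\ lead_coef s ^+ N *: p = q * s + r, (size r < size s)%N,
    coefs_in Q q & coefs_in Q r].
Proof.
move=> HQ + hs s0; have [n] := ubnP (size p); elim: n p => // n IH p pn hp.
case: (ltnP (size p) (size s)) => ps.
  exists 0%N, 0, p; split; rewrite ?expr0 ?scale1r ?mul0r ?add0r // => i.
  by rewrite coef0; exact: sub0.
have ss : (0 < size s)%N by rewrite size_poly_gt0.
pose k := (size p - size s)%N.
pose p' := lead_coef s *: p - (lead_coef p *: 'X^k) * s.
have hp' : coefs_in Q p'.
  apply: (subB (coefs_in_sub HQ)); first by apply: coefs_inZ => //; exact: hs.
  apply: (subM (coefs_in_sub HQ)) => //; apply: coefs_inZ => //; [exact: hp|exact: coefs_inXn].
have sp' : (size p' < size p)%N.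
  have sp : (0 < size p)%N by exact: leq_trans ps.
  rewrite -(prednK sp) ltnS; apply/leq_sizeP => j hj.
  rewrite coefB coefZ -scalerAl coefZ coefXnM.
  have kj : (k <= j)%N by rewrite /k; lia.
  rewrite ltnNge kj /=; case: (ltnP j (size p)) => jp.
    have -> : j = (size p).-1 by lia.
    by rewrite (_ : ((size p).-1 - k)%N = (size s).-1) /k ?lead_coefE 1?mulrC ?subrr //; lia.
  have sj : (size s <= j - k)%N by apply: leq_trans (leq_sub2r k jp); rewrite /k subKn.
  by rewrite (nth_default _ jp) (nth_default _ sj) !mulr0 subr0.
have [N [q [r [E hr hq hr']]]] := IH p' (leq_trans sp' pn) hp'.
have hl : Q (lead_coef s ^+ N * lead_coef p).
  by apply: subM => //; [apply: subX => //; exact: hs|exact: hp].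
exists N.+1, (q + (lead_coef s ^+ N * lead_coef p) *: 'X^k), r; split=> //; last first.
  by apply: (subD (coefs_in_sub HQ)) => //; apply: coefs_inZ => //; exact: coefs_inXn.
rewrite exprSr -scalerA mulrDl -addrA addrCA -E /p' scalerBr addrC -scalerA.
by rewrite -[(_ *: (_ *: _)) * _]scalerAl subrK.
Qed.

Section SpecializeOne.
Variables (A : comNzRingType) (E : fieldType) (phi : {rmorphism A -> E}) (x : E).

Let im (e : E) : Prop := exists a, e = phi a.

Lemma im_sub : subring_pred im.
Proof.
split=> [|_ _ [a ->] [b ->]|_ _ [a ->] [b ->]]; first by exists 1; rewrite rmorph1.
  by exists (a - b); rewrite rmorphB.
by exists (a * b); rewrite rmorphM.
Qed.

Lemma im_lift F : coefs_in im F -> exists p, F = map_poly phi p.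
Proof.
move=> /boolp.choice[c hc]; exists (\poly_(i < size F) c i); apply/polyP => i.
rewrite coef_map coef_poly; case: ltnP => h; first exact: hc.
by rewrite nth_default //; symmetry; exact: rmorph0.
Qed.

Lemma im_map p : coefs_in im (map_poly phi p).
Proof. by move=> i; rewrite coef_map; exists p`_i. Qed.

(** If x is transcendental over the image of phi, any y where f stays nonzero will do. Otherwise let
    q0 be a relation of least degree: a Bezout combination of f and q0 is a nonzero constant, and y
    is a root of the specialised q0. The element a is the product of this constant and the leading
    coefficient of q0, which both have to survive. *)
Lemma specialize_one (f : {poly A}) : (map_poly phi f).[x] != 0 ->
  exists2 a, phi a != 0 & forall (Om : closedFieldType) (psi : {rmorphism A -> Om}),
    (forall b, phi b = 0 -> psi b = 0) -> psi a != 0 ->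
    exists2 y, (map_poly psi f).[y] != 0 &
      forall p : {poly A}, (map_poly phi p).[x] = 0 -> (map_poly psi p).[y] = 0.
Proof.
move=> fx; have f0 : map_poly phi f != 0 by apply: contraNneq fx => ->; rewrite horner0.
have trans (Om : closedFieldType) (psi : {rmorphism A -> Om}) p q :
    (forall b, phi b = 0 -> psi b = 0) -> map_poly phi p = map_poly phi q -> map_poly psi p = map_poly psi q.
  move=> K e; apply/polyP => i; rewrite !coef_map; apply/eqP; rewrite -subr_eq0 -rmorphB.
  have ei := congr1 (fun s : {poly E} => s`_i) e; rewrite !coef_map in ei.
  by apply/eqP/K; rewrite rmorphB ei subrr.
case: (pselect (exists2 q, map_poly phi q != 0 & (map_poly phi q).[x] = 0)) => [alg|tr]; last first.
  have [i ci] : exists i, phi f`_i != 0.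
    apply: contrapT => nex; case/eqP: f0; apply/polyP => i; rewrite coef_map coef0.
    by apply: contrapT => /eqP h; apply: nex; exists i.
  exists f`_i => // Om psi K hi.
  have fp : map_poly psi f != 0.
    by apply: contraNneq hi => e; rewrite -coef_map e coef0.
  have [y hy] := closed_nonrootP _ fp.
  exists y => // p px; have -> : map_poly psi p = map_poly psi 0; last by rewrite rmorph0 horner0.
  apply: trans => //; rewrite rmorph0; apply/eqP; apply: contrapT => /negP h.
  by apply: tr; exists p.
pose Q0 F := [/\ coefs_in im F, F != 0 & F.[x] = 0].
have [q0 [q0i q00 q0x] q0m] : exists2 p, Q0 p & forall q, Q0 q -> (size p <= size q)%N.
  apply: poly_min; have [q q1 q2] := alg; exists (map_poly phi q); split=> //.
  exact: im_map.
pose Q1 F := exists u v, [/\ coefs_in im u, coefs_in im v, F != 0 & F = u * map_poly phi f + v * q0].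
have ims := coefs_in_sub im_sub.
have i1 : coefs_in im 1 by case: ims.
have [s [u [v [ui vi s0 sE]]] sm] : exists2 p, Q1 p & forall q, Q1 q -> (size p <= size q)%N.
  apply: poly_min; exists q0, 0, 1; split=> //; last by rewrite mul0r mul1r add0r.
  exact: sub0 ims.
have si : coefs_in im s.
  by rewrite sE; apply: (subD ims); apply: (subM ims) => //; exact: im_map.
have div_s F u' v' : coefs_in im u' -> coefs_in im v' -> F = u' * map_poly phi f + v' * q0 ->
    exists N q, coefs_in im q /\ lead_coef s ^+ N *: F = q * s.
  move=> u'i v'i FE.
  have Fi : coefs_in im F by rewrite FE; apply: (subD ims); apply: (subM ims) => //; exact: im_map.
  have [N [q [r [e hr qi ri]]]] := pdiv im_sub Fi si s0.
  exists N, q; split=> //; rewrite e; have [->|r0] := eqVneq r 0; first by rewrite addr0.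
  have lN : im (lead_coef s ^+ N) by apply: (subX im_sub); exact: si.
  suff h : Q1 r by have := sm r h; rewrite leqNgt hr.
  exists (lead_coef s ^+ N *: u' - q * u), (lead_coef s ^+ N *: v' - q * v); split=> //.
  - by apply: (subB ims); [apply: (coefs_inZ im_sub)|apply: (subM ims)].
  - by apply: (subB ims); [apply: (coefs_inZ im_sub)|apply: (subM ims)].
  - have -> : r = lead_coef s ^+ N *: F - q * s by rewrite e addrC addKr.
    by rewrite FE sE -!mul_polyC; ring.
have ls : lead_coef s != 0 by rewrite lead_coef_eq0.
have [N1 [q1 [q1i e1]]] := div_s q0 0 1 (sub0 ims) i1 ltac:(by rewrite mul0r mul1r add0r).
have [N2 [q2 [q2i e2]]] := div_s (map_poly phi f) 1 0 i1 (sub0 ims) ltac:(by rewrite mul0r mul1r addr0).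
have sx : s.[x] != 0.
  apply: contraNneq fx => h; have := congr1 (horner^~ x) e2.
  rewrite hornerZ hornerM h mulr0 => /eqP; rewrite mulf_eq0 expf_eq0 (negbTE ls) andbF.
  by [].
have q1x : q1.[x] = 0.
  have := congr1 (horner^~ x) e1; rewrite hornerZ hornerM q0x mulr0 => /esym/eqP.
  by rewrite mulf_eq0 (negbTE sx) orbF => /eqP.
have q10 : q1 != 0.
  apply: contraNneq q00 => h; move/eqP: e1; rewrite h mul0r scaler_eq0 expf_eq0 (negbTE ls) andbF.
  by [].
(* Up to constants q0 = q1 s. As s is nonzero at x, q1 vanishes there, and the minimality of q0
   leaves no positive degree for s. *)
have ss : size s = 1%N.
  have h := q0m q1 ltac:(by split).
  have := congr1 (fun p : {poly E} => size p) e1; rewrite size_scale ?expf_neq0 // size_mul //.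
  have aux (a b c : nat) : (a <= b)%N -> (0 < c)%N -> (0 < b)%N -> a = (b + c).-1 -> c = 1%N by lia.
  by apply: aux h _ _; rewrite size_poly_gt0.
have [c cE] : exists c, s = (phi c)%:P.
  by have := size1_polyC (eq_leq ss) => ->; have [c ->] := si 0%N; exists c.
have [l lE] : exists l, lead_coef q0 = phi l by exact: q0i.
have l0 : phi l != 0 by rewrite -lE lead_coef_eq0.
have c0 : phi c != 0 by apply: contraNneq s0; rewrite cE => ->.
exists (l * c); first by rewrite rmorphM mulf_neq0.
move=> Om psi K; rewrite rmorphM mulf_eq0 negb_or => /andP[pl pc].
have [Q0' Q0E] := im_lift q0i; have [U UE] := im_lift ui; have [V VE] := im_lift vi.
have sQ : size q0 != 1%N.
  apply/eqP => /eq_leq/size1_polyC h; move: q0x q00; rewrite h hornerC => ->.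
  by rewrite eqxx.
have [y hy] : exists y, root (map_poly psi Q0') y.
  apply/closed_rootP; apply/negP => /eqP h1.
  have n1 : (1 <= (size q0).-1)%N.
    have : (0 < size q0)%N by rewrite size_poly_gt0.
    by lia.
  have : (map_poly psi Q0')`_(size q0).-1 = psi l.
    rewrite coef_map; apply/eqP; rewrite -subr_eq0 -rmorphB; apply/eqP/K.
    by rewrite rmorphB -coef_map -Q0E -lead_coefE lE subrr.
  rewrite nth_default ?h1 // => /esym/eqP; by rewrite (negbTE pl).
exists y.
  have : map_poly psi (U * f + V * Q0') = map_poly psi c%:P.
    by apply: trans => //; rewrite rmorphD !rmorphM /= -UE -VE -Q0E -sE cE map_polyC.
  rewrite rmorphD !rmorphM /= map_polyC => /(congr1 (horner^~ y)).
  rewrite hornerD !hornerM (rootP hy) mulr0 addr0 hornerC => h.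
  by apply: contraNneq pc => h'; rewrite -h h' mulr0.
move=> p px.
have [N [q [r [e hr qi ri]]]] := pdiv im_sub (@im_map p) q0i q00.
have r0 : r = 0.
  apply/eqP; apply: contraLR hr => r0; rewrite -leqNgt; apply: q0m; split=> //.
  have := congr1 (horner^~ x) e; rewrite hornerZ hornerD hornerM px q0x !mulr0 add0r.
  by move=> <-.
have [q' q'E] := im_lift qi.
have : map_poly psi ((l ^+ N)%:P * p) = map_poly psi (q' * Q0').
  apply: trans => //; rewrite !rmorphM /= map_polyC /= rmorphXn -lE mul_polyC e r0 addr0.
  by rewrite q'E Q0E.
rewrite !rmorphM /= map_polyC /= => /(congr1 (horner^~ y)).
rewrite !hornerM (rootP hy) mulr0 hornerC rmorphXn => /eqP.
by rewrite mulf_eq0 expf_eq0 (negbTE pl) andbF => /eqP.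
Qed.

End SpecializeOne.

(* Finitely many elements x of a field E can be specialised to any algebraically
   closed field, keeping their polynomial relations and f <> 0. *)
Lemma specialize (E : fieldType) (s : seq E) : forall (A : comNzRingType) (phi : {rmorphism A -> E}),
  exists (A' : comNzRingType) (j : {rmorphism A -> A'}) (X : nat -> A') (phi' : {rmorphism A' -> E}),
  [/\ forall a, phi' (j a) = phi a, forall i, (i < size s)%N -> phi' (X i) = nth 0 s i
    & forall f, phi' f != 0 -> exists2 a, phi a != 0 &
      forall (Om : closedFieldType) (psi : {rmorphism A -> Om}),
        (forall b, phi b = 0 -> psi b = 0) -> psi a != 0 ->
      exists psi' : {rmorphism A' -> Om},
        [/\ forall a, psi' (j a) = psi a, forall b, phi' b = 0 -> psi' b = 0 & psi' f != 0]].
Proof.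
elim: s => [|x s IH] A phi.
  exists A, idfun, (fun=> 0), phi; split=> // f f0; exists f => // Om psi K pf.
  by exists psi.
have cx : commr_rmorph phi x by move=> a; exact: mulrC.
pose phi1 : {rmorphism {poly A} -> E} := horner_morph cx.
have [A' [j [X [phi' [h1 h2 h3]]]]] := IH _ phi1.
exists A', (j \o polyC), (fun i => if i is i'.+1 then X i' else j 'X), phi'; split.
- by move=> a /=; rewrite h1 /phi1 /= horner_morphC.
- by case=> [_|i /h2 //]; rewrite h1 /phi1 /= horner_morphX.
move=> f f0; have [a1 a10 Ha1] := h3 f f0.
have [a a0 Ha] := specialize_one a10.
exists a => // Om psi K pa; have [y y1 y2] := Ha Om psi K pa.
have cy : commr_rmorph psi y by move=> b; exact: mulrC.
have [psi' [k1 k2 k3]] := Ha1 Om (horner_morph cy) y2 y1.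
exists psi'; split=> // b; rewrite /= k1; exact: horner_morphC.
Qed.

Lemma ksplit (k L : fieldType) (iota : {rmorphism k -> L}) (I : finType) (v : I -> L) :
  exists (r : nat) (y : 'I_r -> L) (a : I -> 'I_r -> k),
  (forall i, v i = \sum_j iota (a i j) * y j) /\
  (forall c : 'I_r -> k, \sum_j iota (c j) * y j = 0 -> forall j, c j = 0).
Proof.
pose P r := `[< exists (y : 'I_r -> L) (a : I -> 'I_r -> k), forall i, v i = \sum_j iota (a i j) * y j >].
have ex : exists r, P r.
  exists #|I|; apply/asboolP; exists (fun j => v (enum_val j)), (fun i j => (enum_val j == i)%:R) => i.
  rewrite (bigD1 (enum_rank i)) //= enum_rankK eqxx rmorph1 mul1r big1 ?addr0 // => j ji.
  by rewrite -(inj_eq enum_rank_inj) enum_valK (negbTE ji) rmorph0 mul0r.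
case: (ex_minnP ex) => r /asboolP[y [a H]] rmin; exists r, y, a; split=> // c hc j0.
apply/eqP/contraT => c0.
case: r y a H rmin c hc j0 c0 => [|r] y a H rmin c hc j0 c0; first by case: j0 c0.
have yE : y j0 = - \sum_(j < r) iota (c (lift j0 j) / c j0) * y (lift j0 j).
  move: hc; rewrite (bigD1_ord j0) //= => /eqP; rewrite addr_eq0 => /eqP h.
  have i0 : iota (c j0) != 0 by rewrite fmorph_eq0.
  apply: (mulfI i0); rewrite h mulrN; congr (- _); rewrite mulr_sumr; apply: eq_bigr => j _.
  by rewrite mulrA -rmorphM mulrCA divff // mulr1.
have : P r.
  apply/asboolP; exists (fun j => y (lift j0 j)), (fun i j => a i (lift j0 j) - a i j0 * (c (lift j0 j) / c j0)) => i.
  rewrite H (bigD1_ord j0) //= yE mulrN mulr_sumr addrC -sumrB; apply: eq_bigr => j _.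
  by rewrite [in RHS]rmorphB mulrBl; congr (_ - _); rewrite [in RHS]rmorphM mulrA.
by move/rmin; rewrite ltnn.
Qed.

(** Induction: expanded along its last column, the determinant is a combination of the f i at the
    new point, with last coefficient a minor that is already nonzero. *)
Lemma indep_points (F : fieldType) (Z : Type) n (f : 'I_n -> Z -> F) :
  (forall c : 'I_n -> F, (forall z, \sum_i c i * f i z = 0) -> forall i, c i = 0) ->
  exists z : 'I_n -> Z, \det (\matrix_(i, j) f i (z j)) != 0.
Proof.
elim: n f => [|n IH] f H.
  have z0 : 'I_0 -> Z by case.
  by exists z0; rewrite det_mx00 oner_neq0.
have [|z hz] := IH (fun i => f (lift ord_max i)).
  move=> c hc i; have := H (fun i => if unlift ord_max i is Some j then c j else 0) _ (lift ord_max i).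
  rewrite liftK; apply => w; rewrite (bigD1_ord ord_max) //= unlift_none mul0r add0r -[RHS](hc w).
  by apply: eq_bigr => j _; rewrite liftK.
pose co (i : 'I_n.+1) : F := (-1) ^+ (i + n) * \det (\matrix_(a, b) f (lift i a) (z b)).
have [w hw] : exists w, \sum_i co i * f i w != 0.
  apply: contrapT => nex; have := H co _ ord_max.
  move=> /(_ (fun w => ltac:(by apply: contrapT => /eqP h; apply: nex; exists w))) /eqP.
  by rewrite mulf_eq0 signr_eq0 (negbTE hz).
exists (fun j => if unlift ord_max j is Some j' then z j' else w).
rewrite (expand_det_col _ ord_max); congr (_ != 0): hw; apply: eq_bigr => i _.
rewrite mxE unlift_none mulrC; congr (_ * _); rewrite /cofactor /co; congr (_ * \det _).
by apply/matrixP => a b; rewrite !mxE liftK.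
Qed.

Lemma poly_nat_eq0 (F : fieldType) (q : {poly F}) : injective (fun n : nat => n%:R : F) ->
  (forall n : nat, q.[n%:R] = 0) -> q = 0.
Proof.
move=> inj H; apply/eqP/contraT => q0.
have := max_poly_roots (rs := [seq i%:R | i <- iota 0 (size q)]) q0.
rewrite size_map size_iota ltnn => h; apply: h; last by rewrite map_inj_uniq ?iota_uniq.
by apply/allP => _ /mapP[i _ ->]; apply/rootP.
Qed.

Lemma meval_line n (F : fieldType) (p : mpoly n F) (a b : 'I_n -> F) :
  exists q : {poly F}, forall t, q.[t] = meval (fun i => a i + t * b i) p.
Proof.
exists (mmap polyC (fun i => (a i)%:P + b i *: 'X) p) => t.
rewrite mevalE /mmap horner_sum; apply: eq_bigr => J _.
rewrite hornerM hornerC; congr (_ * _); rewrite /mmap1 horner_prod; apply: eq_bigr => i _.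
by rewrite horner_exp hornerD hornerC hornerZ hornerX mulrC.
Qed.

End PolyTools.

(** * Characteristic sets of prime ideals *)

Section CharSet.
Variables (F : fieldType) (n : nat).
Hypothesis char0 : forall l : nat, (l.+1%:R : F) != 0.
Local Notation Rx := (mpoly n F).
Local Notation Xv i := (mpolyX F (mnm1 i) : Rx).
Local Notation hom := (pihomog (@mdeg n)).

Lemma mcoeff_pihomog d (p : Rx) J : mcoeff J (hom d p) = if mdeg J == d then mcoeff J p else 0.
Proof.
rewrite pihomogE raddf_sum /=.
under eq_bigr do rewrite mcoeffZ mcoeffX.
case: (boolP (J \in msupp p)) => [Jp|Jp].
  rewrite big_mkcond (bigD1_seq J) //= ?msupp_uniq // eqxx mulr1 big1 ?addr0 // => J' /negbTE JJ.
  by rewrite JJ mulr0 if_same.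
rewrite big1_seq => [|J' /andP[_ J'p]]; last first.
  have [E|_] := eqVneq J' J; last by rewrite mulr0.
  by rewrite -E J'p in Jp.
by rewrite memN_msupp_eq0 ?if_same.
Qed.

Lemma sum_pihomog (p : Rx) : p = \sum_(d < msize p) hom d p.
Proof.
apply/mpolyP => J; rewrite raddf_sum /=; under eq_bigr do rewrite mcoeff_pihomog.
case: (boolP (J \in msupp p)) => Jp; last by rewrite memN_msupp_eq0 // big1 // => d _; rewrite if_same.
have lt := msize_mdeg_lt Jp; rewrite (bigD1 (Ordinal lt)) //= eqxx big1 ?addr0 // => d dJ.
by case: eqP => // E; case/eqP: dJ; apply: val_inj.
Qed.

Lemma pihomogMXn d (c : Rx) i l : (l <= d)%N -> hom d (c * Xv i ^+ l) = hom (d - l) c * Xv i ^+ l.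
Proof.
move=> ld; apply: (mpolyind (P := fun c => hom d (c * Xv i ^+ l) = hom (d - l) c * Xv i ^+ l)).
  by rewrite mul0r !raddf0 mul0r.
move=> a J p _ _ IH; rewrite mulrDl !raddfD /= mulrDl IH; congr (_ + _).
rewrite -scalerAl !linearZ /= -scalerAl; congr (_ *: _).
rewrite mpolyXn -mpolyXD !pihomogX /= mdegD mdegMn mdeg1 mul1n.
have -> : (mdeg J + l == d)%N = (mdeg J == d - l)%N by lia.
by case: eqP; rewrite ?mul0r // -mpolyXD.
Qed.

Definition low (i : nat) (p : Rx) : Prop :=
  forall J, mcoeff J p != 0 -> forall j : 'I_n, (i <= j)%N -> J j = 0%N.

Lemma low_sub i : subring_pred (low i).
Proof.
split=> [J|p q hp hq J|p q hp hq J].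
- rewrite mcoeff1; case: (eqVneq J mnm0) => [->|_]; last by rewrite eqxx.
  by move=> _ j _; rewrite mnm0E.
- rewrite mcoeffB => h j ij; have [p0|p0] := eqVneq (mcoeff J p) 0; last exact: hp p0 j ij.
  by apply: hq ij; apply: contraNneq h => ->; rewrite p0 subrr.
- rewrite -mcoeff_msupp => /msuppM_le/allpairsP[[J1 J2] /= [h1 h2 ->]] j ij.
  by rewrite mnmDE (hp J1) -?mcoeff_msupp // (hq J2) -?mcoeff_msupp.
Qed.

Lemma mderiv_low i p (j : 'I_n) : low i p -> (i <= j)%N -> mderiv j p = 0.
Proof.
move=> hp ij; apply/mpolyP => J; rewrite mcoeff_mderiv mcoeff0.
have [->|h] := eqVneq (mcoeff (mnm_add J (mnm1 j)) p) 0; first by rewrite mul0rn.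
by have := hp _ h j ij; rewrite mnmDE mnm1E eqxx addn1.
Qed.

(** Expansion in powers of the variable i. The exponents of the coefficients are traced back to p so
    that restrictions on its support pass to them. *)
Lemma low_split (i : 'I_n) p : low i.+1 p -> exists G : {poly Rx},
  p = G.[Xv i] /\ forall l J, mcoeff J G`_l != 0 -> J i = 0%N /\
    exists2 J', mcoeff J' p != 0 & forall j, j != i -> J j = J' j.
Proof.
move=> hp.
pose dr (J : multinom n) : multinom n := Multinom [tuple (if j == i then 0%N else J j) | j < n].
have drE (J : multinom n) : mpolyX F J = mpolyX F (dr J) * Xv i ^+ J i.
  rewrite mpolyXn -mpolyXD; congr mpolyX; apply/mnmP => j; rewrite mnmDE mulmnE mnm1E mnmE.
  by rewrite eq_sym; case: eqP => [->|_]; rewrite ?mul1n ?mul0n ?addn0.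
exists (\sum_(J <- msupp p) (mcoeff J p *: mpolyX F (dr J))%:P * 'X^(J i)); split.
  rewrite {1}[p]mpolyE horner_sum; apply: eq_bigr => J _.
  by rewrite hornerM hornerC hornerXn -scalerAl -drE.
move=> l J; rewrite coef_sum raddf_sum /= => h.
have [J' Jp] : exists2 J', J' \in msupp p & mcoeff J (((mcoeff J' p *: mpolyX F (dr J'))%:P * 'X^(J' i))`_l) != 0.
  apply: contrapT => nex; case/eqP: h; apply: big1_seq => J' /andP[_ J'p].
  by apply: contrapT => /eqP h; apply: nex; exists J'.
rewrite coefCM coefXn; case: (l == J' i); last by rewrite mulr0 mcoeff0 eqxx.
rewrite mulr1 mcoeffZ mcoeffX; have [<- _|_] := eqVneq (dr J') J; last by rewrite mulr0 eqxx.
split; first by rewrite mnmE eqxx.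
exists J'; first by rewrite -mcoeff_msupp.
by move=> j /negbTE ji; rewrite mnmE ji.
Qed.

Lemma mderiv_horner (i : 'I_n) (G : {poly Rx}) : coefs_in (low i) G ->
  mderiv i G.[Xv i] = (G^`()).[Xv i].
Proof.
elim/poly_ind: G => [|G c IH] H; first by rewrite deriv0 !horner0 raddf0.
have HG : coefs_in (low i) G.
  by move=> l; have := H l.+1; rewrite coefD coefMX coefC /= addr0.
have Hc : low i c by have := H 0%N; rewrite coefD coefMX coefC /= add0r.
rewrite hornerMXaddC derivMXaddC hornerD hornerMX mderivD mderivM IH //.
rewrite (mderiv_low Hc) // addr0 addrC; congr (_ + _); rewrite mderivX mnm1E eqxx scale1r.
rewrite (_ : mnm_sub _ _ = mnm0) ?mpolyX0 ?mulr1 //.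
by apply/mnmP => j; rewrite mnmBE mnm0E subnn.
Qed.

Lemma low_pihomog i d p : low i p -> low i (hom d p).
Proof.
by move=> hp J; rewrite mcoeff_pihomog; case: (mdeg J == d); [exact: hp|rewrite eqxx].
Qed.

Variable q : Rx -> Prop.
Hypotheses (qB : forall a b, q a -> q b -> q (a - b)) (qM : forall a b, q b -> q (a * b))
  (q1 : ~ q 1) (qprime : forall a b, q (a * b) -> q a \/ q b)
  (qhom : forall d p, q p -> q (hom d p)) (q0 : q 0).

Lemma qD a b : q a -> q b -> q (a + b).
Proof. by move=> ha hb; rewrite -[b]opprK; apply: qB => //; rewrite -sub0r; exact: qB. Qed.
Lemma q_sum (I : Type) (s : seq I) (f : I -> Rx) : (forall i, q (f i)) -> q (\sum_(i <- s) f i).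
Proof. by move=> H; elim/big_ind: _ => //; exact: qD. Qed.

(** A relation showing that, modulo q, the variable i is algebraic over the preceding ones. *)
Definition piv (i : 'I_n) (G : {poly Rx}) : Prop :=
  [/\ coefs_in (low i) G, q G.[Xv i] & exists l, ~ q G`_l].

(** Least degree in the variable i keeps the leading coefficient and, in characteristic 0, the
    derivative out of q. A homogeneous component whose leading coefficient is still outside q
    inherits these properties. *)
Lemma pivot_poly (i : 'I_n) : (exists G, piv i G) -> exists G : {poly Rx},
  [/\ coefs_in (low i) G, q G.[Xv i],
      ~ q (lead_coef G) /\ ~ q (mderiv i G.[Xv i]),
      forall H, coefs_in (low i) H -> q H.[Xv i] -> (size H < size G)%N -> forall l, q H`_l
    & (exists d, homogeneous d G.[Xv i]) /\ (exists d, homogeneous d (lead_coef G))].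
Proof.
move=> /poly_min[G [Gl Gq [l0 Gl0]] Gm].
have lq : ~ q (lead_coef G).
  move=> h; pose s := (size G).-1.
  pose H := G - (lead_coef G)%:P * 'X^s.
  have HE l : H`_l = if l == s then 0 else G`_l.
    rewrite coefB coefCM coefXn; case: eqP => [->|_]; last by rewrite mulr0 subr0.
    by rewrite mulr1 lead_coefE subrr.
  have G0 : G != 0 by apply/eqP => G0; apply: Gl0; rewrite G0 coef0.
  have sG : (0 < size G)%N by rewrite size_poly_gt0.
  have : (size G <= size H)%N.
    apply: Gm; split.
    - by move=> l; rewrite HE; case: eqP => _ //; apply: sub0; exact: low_sub.
    - by rewrite hornerD hornerN; apply: qB => //; rewrite hornerM hornerC mulrC; exact: qM.
    - exists l0; rewrite HE; case: eqP => // E; case: Gl0; rewrite E; exact: h.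
  rewrite leqNgt; case/negP; rewrite -(prednK sG) ltnS; apply/leq_sizeP => l hl.
  rewrite HE; case: eqP => // /eqP ls; rewrite nth_default //.
  by rewrite -(prednK sG) ltn_neqAle eq_sym ls.
have G0 : G != 0 by apply/eqP => G0; apply: lq; rewrite G0 lead_coef0.
have sG : (0 < size G)%N by rewrite size_poly_gt0.
have [e he] : exists e, ~ q (hom e (lead_coef G)).
  apply: contrapT => nex; apply: lq; rewrite [lead_coef G]sum_pihomog; apply: q_sum => d.
  by apply: contrapT => h; apply: nex; exists (nat_of_ord d).
pose s := (size G).-1.
pose G' := \poly_(l < size G) hom (e + s - l) G`_l.
have GE l : G'`_l = if (l < size G)%N then hom (e + s - l) G`_l else 0 by rewrite coef_poly.
have Gs : G'`_s = hom e (lead_coef G) by rewrite GE /s prednK // leqnn addnK.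
have h0 : hom e (lead_coef G) != 0 by apply/eqP => h; apply: he; rewrite h.
have sz : size G' = size G.
  apply/eqP; rewrite eqn_leq size_poly /=.
  rewrite leqNgt; apply/negP => h; case/eqP: h0; rewrite -Gs nth_default //.
  by rewrite /s -ltnS prednK.
have lG : lead_coef G' = hom e (lead_coef G) by rewrite lead_coefE sz -/s Gs.
have G'l : coefs_in (low i) G'.
  move=> l; rewrite GE; case: ifP => _; last by apply: sub0; exact: low_sub.
  exact: low_pihomog.
have G'q : G'.[Xv i] = hom (e + s) G.[Xv i].
  rewrite horner_poly horner_coef raddf_sum /=; apply: eq_bigr => l _.
  by rewrite pihomogMXn // (leq_trans _ (leq_addl _ _)) // /s -ltnS prednK.
have qG' : q G'.[Xv i] by rewrite G'q; exact: qhom.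
have mn H : coefs_in (low i) H -> q H.[Xv i] -> (size H < size G')%N -> forall l, q H`_l.
  move=> Hl Hq Hs l; apply: contrapT => nq; move: Hs; rewrite sz ltnNge; case/negP.
  by apply: Gm; split=> //; exists l.
exists G'; split=> //; last first.
  by split; [exists (e + s)%N; rewrite G'q|exists e; rewrite lG]; exact: pihomogP.
split; first by rewrite lG.
rewrite mderiv_horner // => hq.
have G'0 : G' != 0 by rewrite -size_poly_gt0 sz.
have s1 : (1 < size G')%N.
  rewrite ltnNge; apply/negP => /size1_polyC E; apply: he; rewrite -lG E lead_coefC.
  by have hh := qG'; rewrite E hornerC in hh.
have := mn _ _ hq (lt_size_deriv G'0) s.-1.
have -> : G'^`()`_s.-1 = lead_coef G' *+ s.
  rewrite coef_deriv lead_coefE sz -/s prednK //.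
  by rewrite sz in s1; rewrite /s; case: (size G) s1 => [|[]].
move=> K; apply: he; rewrite -lG.
have dl : coefs_in (low i) G'^`().
  move=> l; rewrite coef_deriv; move: (G'`_l.+1) (G'l l.+1) => a ha.
  elim: (l.+1) => [|z IH]; first by rewrite mulr0n; exact: sub0 (low_sub _).
  by rewrite mulrS; exact: (subD (low_sub _)).
have := K dl; rewrite -mulr_natl => h.
have s0 : (s%:R : F) != 0.
  by rewrite sz in s1; rewrite /s; case: (size G) s1 => [|[|z]] // _; exact: char0.
have -> : lead_coef G' = (mpolyC n (s%:R^-1)) * (s%:R * lead_coef G').
  by rewrite mulrA -(rmorph_nat (@mpolyC n F)) -rmorphM mulVf // rmorph1 mul1r.
exact: qM.
Qed.

(** D collects the variables algebraic over the preceding ones, p i is the pivot of the variable i,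
    and h is the product of the leading coefficients and derivatives of the pivots. Where h is
    nonzero, pseudo-division reduces the elements of q to the pivots, and the Jacobian of the pivots
    is triangular. The variables outside D are algebraically independent modulo q. *)
Lemma char_set : exists (D : 'I_n -> bool) (p : 'I_n -> Rx) (h : Rx),
  [/\ forall i, D i -> q (p i) /\ (exists d, homogeneous d (p i)),
      (exists d, homogeneous d h) /\ ~ q h,
      forall X : 'I_n -> F, meval X h != 0 -> (forall i, D i -> meval X (p i) = 0) ->
        forall f, q f -> meval X f = 0,
      forall X : 'I_n -> F, meval X h != 0 -> forall i, D i -> meval X (mderiv i (p i)) != 0 /\
        forall j : 'I_n, (i < j)%N -> mderiv j (p i) = 0
    & forall f, q f -> (forall J, mcoeff J f != 0 -> forall i, D i -> J i = 0%N) -> f = 0].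
Proof.
pose D (i : 'I_n) := `[< exists G, piv i G >].
have [G HG] : exists G : 'I_n -> {poly Rx}, forall i, D i ->
  [/\ coefs_in (low i) (G i), q (G i).[Xv i],
      ~ q (lead_coef (G i)) /\ ~ q (mderiv i (G i).[Xv i]),
      forall H, coefs_in (low i) H -> q H.[Xv i] -> (size H < size (G i))%N -> forall l, q H`_l
    & (exists d, homogeneous d (G i).[Xv i]) /\ (exists d, homogeneous d (lead_coef (G i)))].
  have Q (i : 'I_n) : exists G : {poly Rx}, D i ->
  [/\ coefs_in (low i) G, q G.[Xv i],
      ~ q (lead_coef G) /\ ~ q (mderiv i G.[Xv i]),
      forall H, coefs_in (low i) H -> q H.[Xv i] -> (size H < size G)%N -> forall l, q H`_l
    & (exists d, homogeneous d G.[Xv i]) /\ (exists d, homogeneous d (lead_coef G))].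
    case: (boolP (D i)) => [/asboolP/pivot_poly[G hG]|_]; last by exists 0.
    by exists G.
  by have [G hG] := boolp.choice Q; exists G.
pose p i := (G i).[Xv i].
pose h := \prod_(i | D i) (lead_coef (G i) * mderiv i (p i)).
have homM (a b : Rx) : (exists d, homogeneous d a) -> (exists d, homogeneous d b) -> exists d, homogeneous d (a * b).
  by move=> [d ha] [e hb]; exists (d + e)%N; exact: dhomogM.
have homder i d (a : Rx) : homogeneous d a -> homogeneous d.-1 (mderiv i a).
  move=> /dhomogP ha; apply/dhomogP => J; rewrite mcoeff_msupp mcoeff_mderiv => hJ.
  have : mnm_add J (mnm1 i) \in msupp a.
    by rewrite mcoeff_msupp; apply: contraNneq hJ => ->; rewrite mul0rn.
  by move/ha; rewrite /= mdegD mdeg1 addn1 => <-.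
have pzero (X : 'I_n -> F) (hX : meval X h != 0) i : D i ->
   meval X (lead_coef (G i)) != 0 /\ meval X (mderiv i (p i)) != 0.
  move=> Di; move: hX; rewrite /h (bigD1 i) //= !mevalM !mulf_eq0 !negb_or.
  by case/andP => /andP[].
have nonpiv i H : ~~ D i -> coefs_in (low i) H -> q H.[Xv i] -> forall l, q H`_l.
  move=> nD Hl Hq l; apply: contrapT => nq; case/negP: nD; apply/asboolP; exists H.
  by split=> //; exists l.
have low0 f : low 0 f -> f = mpolyC n (mcoeff mnm0 f).
  move=> hf; apply/mpolyP => J; rewrite mcoeffC; case: (eqVneq J mnm0) => [->|J0].
    by rewrite mulr1.
  rewrite mulr0; apply/eqP/contraT => /hf hJ; case/eqP: J0; apply/mnmP => j.
  by rewrite mnm0E; exact: hJ.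
have low0q f : low 0 f -> q f -> f = 0.
  move=> /low0 ->; have [->|c0] := eqVneq (mcoeff mnm0 f) 0; first by rewrite raddf0.
  move=> hq; case: q1; have -> : 1 = mpolyC n (mcoeff mnm0 f)^-1 * mpolyC n (mcoeff mnm0 f) :> Rx.
    by rewrite -rmorphM mulVf // rmorph1.
  exact: qM.
have lown f : low n f by move=> J _ j; rewrite leqNgt ltn_ord.
exists D, p, h; split.
- by move=> i /HG[_ h1 _ _ [h2 _]].
- split.
    rewrite /h; elim/big_ind: _ => //; first by exists 0%N; exact: dhomog1.
    move=> i /HG[_ _ _ _ [[d h2] h3]]; apply: homM => //; exists d.-1; exact: homder.
  rewrite /h; elim/big_ind: _ => // [a b ha hb /qprime[]//|i /HG[_ _ [h1 h2] _ _] /qprime[]//].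
- move=> X hX pX f; have [i le] : exists i, (i <= n)%N /\ low i f by exists n.
  case: le => le; elim: i f le => [|i IH] f le lf qf.
    by rewrite (low0q f lf qf) raddf0.
  pose i' := Ordinal le; have [H [E HE]] := @low_split i' f lf.
  have Hl : coefs_in (low i) H.
    move=> l J hJ j ij; have [h1 [J' h2 h3]] := HE l J hJ.
    have [->|ji] := eqVneq j i'; first exact: h1.
    rewrite h3 //; apply: (lf J' h2); rewrite ltn_neqAle ij andbT.
    by apply: contraNneq ji => e; apply/eqP/val_inj.
  have le' := ltnW le.
  case: (boolP (D i')) => Di; last first.
    rewrite E horner_coef raddf_sum big1 // => l _ /=.
    by rewrite mevalM (IH _ le' (Hl l)) ?mul0r //; apply: (nonpiv i') => //; rewrite -E.
  have [Gl Gq [lq _] mn _] := HG i' Di.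
  have G0 : G i' != 0 by apply/eqP => g0; apply: lq; rewrite g0 lead_coef0.
  have [N [u [r [e hr ul rl]]]] := pdiv (low_sub i) Hl Gl G0.
  have rE : r.[Xv i'] = lead_coef (G i') ^+ N * f - u.[Xv i'] * p i'.
    by rewrite E -[_ * H.[_]]hornerZ e hornerD hornerM addrC addKr.
  have qr l : q r`_l by apply: (mn r rl) => //; rewrite rE; apply: qB; exact: qM.
  have r0 : meval X r.[Xv i'] = 0.
    rewrite horner_coef raddf_sum big1 // => l _ /=.
    by rewrite mevalM (IH _ le' (rl l)) ?mul0r.
  move: r0; rewrite rE mevalB !mevalM pX // mulr0 subr0 rmorphXn /= => /eqP.
  by rewrite mulf_eq0 expf_eq0 (negbTE (pzero X hX i' Di).1) andbF => /eqP.
- move=> X hX i Di; split; first by case: (pzero X hX i Di).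
  move=> j ij; have [Gl _ _ _ _] := HG i Di.
  apply: (@mderiv_low i.+1) => //; rewrite /p horner_coef; apply: sub_sum; first exact: low_sub.
  have lm a : low i a -> low i.+1 a by move=> ha J /ha hJ l il; apply: hJ; exact: ltnW.
  move=> l _; apply: (subM (low_sub _)); first exact: lm (Gl l).
  apply: (subX (low_sub _)).
  move=> J; rewrite mcoeffX; case: (eqVneq (mnm1 i) J) => [<- _ l' il|_]; last by rewrite eqxx.
  by rewrite mnm1E; case: eqP => // E; rewrite E ltnn in il.
- move=> f; have [i le] : exists i, (i <= n)%N /\ low i f by exists n.
  case: le => le; elim: i f le => [|i IH] f le lf qf fr; first exact: low0q.
  pose i' := Ordinal le; have le' := ltnW le.
  case: (boolP (D i')) => Di.
    apply: IH => // J hJ j ij; have [->|ji] := eqVneq j i'; first exact: fr hJ _ Di.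
    apply: (lf J hJ); rewrite ltn_neqAle ij andbT.
    by apply: contraNneq ji => e; apply/eqP/val_inj.
  have [H [E HE]] := @low_split i' f lf.
  have Hl : coefs_in (low i) H.
    move=> l J hJ j ij; have [h1 [J' h2 h3]] := HE l J hJ.
    have [->|ji] := eqVneq j i'; first exact: h1.
    rewrite h3 //; apply: (lf J' h2); rewrite ltn_neqAle ij andbT.
    by apply: contraNneq ji => e; apply/eqP/val_inj.
  rewrite E horner_coef big1 // => l _; rewrite (IH _ le' (Hl l)) ?mul0r //.
    by apply: (nonpiv i') => //; rewrite -E.
  move=> J hJ j Dj; have [h1 [J' h2 h3]] := HE l J hJ.
  have [->//|ji] := eqVneq j i'; rewrite h3 //; exact: fr h2 _ Dj.
Qed.

End CharSet.

(** * Ideals of irreducible hypersurfaces *)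

Section Principal.
Variables (F : closedFieldType) (n : nat).
Hypothesis char0 : forall l : nat, (l.+1%:R : F) != 0.
Local Notation Rx := (mpoly n F).
Local Notation Xv i := (mpolyX F (mnm1 i) : Rx).

Lemma nat_inj_char0 : injective (fun l : nat => l%:R : F).
Proof.
suff H a b : (a < b)%N -> (a%:R : F) != b%:R.
  by move=> a b /eqP E; case: (ltngtP a b) => // /H; rewrite ?E // eq_sym E.
move=> ab; rewrite -(subnK (ltnW ab)) natrD -subr_eq0 opprD addrCA subrr addr0 oppr_eq0.
by rewrite -(prednK (_ : 0 < b - a)%N) ?subn_gt0 // char0.
Qed.

Lemma poly_nonroot (p : {poly F}) : p != 0 -> exists t, p.[t] != 0.
Proof.
move=> p0; apply: contrapT => nex; case/eqP: p0.
apply: poly_nat_eq0 nat_inj_char0 _ => l.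
by apply: contrapT => /eqP h; apply: nex; exists l%:R.
Qed.

Lemma meval_low i (p : Rx) (u v : 'I_n -> F) : low i p ->
  (forall j : 'I_n, (j < i)%N -> u j = v j) -> meval u p = meval v p.
Proof.
move=> lp uv; rewrite !mevalE; apply: eq_big_seq => J; rewrite mcoeff_msupp => hJ.
congr (_ * _); apply: eq_bigr => j _; case: (ltnP j i) => ji; first by rewrite uv.
by rewrite (lp J hJ j ji) !expr0.
Qed.

Lemma mpoly_nonzero (f : Rx) : f != 0 -> exists u : 'I_n -> F, meval u f != 0.
Proof.
have lown : low n f by move=> J _ j; rewrite leqNgt ltn_ord.
move=> f0; suff H i : (i <= n)%N -> forall f, low i f -> f != 0 -> exists u : 'I_n -> F, meval u f != 0.
  exact: (H n (leqnn n) f lown f0).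
clear f lown f0; elim: i => [|i IH] le f lf f0.
  exists (fun=> 0); apply: contraNneq f0 => h; apply/eqP.
  have fE : f = mpolyC n (mcoeff mnm0 f).
    apply/mpolyP => J; rewrite mcoeffC; case: (eqVneq J mnm0) => [->|J0]; first by rewrite mulr1.
    rewrite mulr0; apply/eqP/contraT => /lf hJ; case/eqP: J0; apply/mnmP => j.
    by rewrite mnm0E; exact: hJ.
  by move: h; rewrite fE mevalC => ->; rewrite raddf0.
pose i' := Ordinal le; have [H [E HE]] := @low_split F n i' f lf.
have Hl l : low i H`_l.
  move=> J hJ j ij; have [h1 [J' h2 h3]] := HE l J hJ.
  have [->|ji] := eqVneq j i'; first exact: h1.
  rewrite h3 //; apply: (lf J' h2); rewrite ltn_neqAle ij andbT.
  by apply: contraNneq ji => e; apply/eqP/val_inj.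
have [l hl] : exists l, H`_l != 0.
  apply: contrapT => nex; case/eqP: f0; rewrite E horner_coef big1 // => l _.
  have -> : H`_l = 0 by apply: contrapT => /eqP h; apply: nex; exists (nat_of_ord l).
  by rewrite mul0r.
have [u hu] := IH (ltnW le) _ (Hl l) hl.
pose P := map_poly (meval u) H.
have P0 : P != 0.
  by apply: contraNneq hu => h; rewrite -[meval u _]coef_map -/P h coef0.
have [s hs] := poly_nonroot P0.
exists (fun j => if j == i' then s else u j).
have <- // : P.[s] = meval (fun j => if j == i' then s else u j) f.
rewrite [in RHS]E [in RHS]horner_coef rmorph_sum /P /= horner_coef.
rewrite (@big_ord_widen _ _ _ _ (size H) (fun l => (map_poly (meval u) H)`_l * s ^+ l)) ?size_poly //.
rewrite big_mkcond /=; apply: eq_bigr => a _.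
rewrite mevalM rmorphXn /= mevalXU eqxx coef_map /=.
rewrite (meval_low (v := fun j => if j == i' then s else u j) (Hl a)); last first.
  by move=> j ji; case: eqP => // e; rewrite e ltnn in ji.
case: ltnP => // h; rewrite -(meval_low (u := u) (Hl a)) => [|j ji]; last first.
  by case: eqP => // e; rewrite e ltnn in ji.
by rewrite -[meval u _]coef_map nth_default ?mul0r.
Qed.

Variable p : 'I_n -> F.

(* the polynomial G (u + s p) in s *)
Definition lin (G : Rx) : {poly Rx} :=
  mmap (polyC \o @mpolyC n F) (fun i => (Xv i)%:P + (mpolyC n (p i)) *: 'X) G.
Definition ev (H : {poly Rx}) (u : 'I_n -> F) (s : F) : F := (map_poly (meval u) H).[s].

Lemma evM H1 H2 u s : ev (H1 * H2) u s = ev H1 u s * ev H2 u s.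
Proof. by rewrite /ev rmorphM hornerM. Qed.
Lemma evD H1 H2 u s : ev (H1 + H2) u s = ev H1 u s + ev H2 u s.
Proof. by rewrite /ev rmorphD hornerD. Qed.
Lemma evB H1 H2 u s : ev (H1 - H2) u s = ev H1 u s - ev H2 u s.
Proof. by rewrite /ev rmorphB hornerD hornerN. Qed.
Lemma evZ c H u s : ev (c *: H) u s = meval u c * ev H u s.
Proof. by rewrite -mul_polyC evM /ev map_polyC hornerC. Qed.
Lemma evC c u s : ev c%:P u s = meval u c.
Proof. by rewrite /ev map_polyC hornerC. Qed.

Lemma lin_ev G u s : ev (lin G) u s = meval (fun i => u i + s * p i) G.
Proof.
rewrite mevalE /ev /lin /mmap rmorph_sum horner_sum; apply: eq_bigr => J _.
rewrite rmorphM hornerM /= map_polyC hornerC /= mevalC; congr (_ * _).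
rewrite rmorph_prod horner_prod; apply: eq_bigr => i _.
rewrite rmorphXn horner_exp rmorphD hornerD /= map_polyC hornerC /= mevalXU.
by rewrite map_polyZ hornerZ map_polyX hornerX /= mevalC [p i * s]mulrC.
Qed.

Lemma lin_at0 G : (lin G).[0] = G.
Proof.
rewrite /lin /mmap horner_sum [RHS]mpolyE; apply: eq_bigr => J _.
rewrite hornerM hornerC mul_mpolyC; congr (_ *: _).
rewrite horner_prod [RHS]mpolyXE_id; apply: eq_bigr => i _.
by rewrite horner_exp hornerD hornerC hornerZ hornerX mulr0 addr0.
Qed.

Lemma horner0_eq (a c e : Rx) (x y z : {poly Rx}) :
  c *: x = y * z -> x.[0] = a -> z.[0] = e -> c * a = y.[0] * e.
Proof. by move=> h <- <-; have := congr1 (fun H => H.[0]) h; rewrite hornerZ hornerM. Qed.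

Definition topco (d : nat) (f : {poly Rx}) (c : Rx) : Prop := (size f <= d.+1)%N /\ f`_d = c.

Lemma topcoM d e f h a b : topco d f a -> topco e h b -> topco (d + e) (f * h) (a * b).
Proof.
move=> [sf fa] [sh hb]; split.
  apply: leq_trans (size_polyMleq _ _) _.
  by move: (size f) (size h) sf sh => a' b'; lia.
rewrite coefM (bigD1 (inord d)) //= inordK ?ltnS ?leq_addr // addKn fa hb big1 ?addr0 // => i id.
case: (ltngtP i d) => h0.
- by rewrite [h`_(_)]nth_default ?mulr0 //; apply: leq_trans sh _; lia.
- by rewrite nth_default ?mul0r //; apply: leq_trans sf _.
- by case/eqP: id; apply: val_inj; rewrite /= inordK ?ltnS ?leq_addr.
Qed.

Lemma topcoX d f a k : topco d f a -> topco (d * k) (f ^+ k) (a ^+ k).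
Proof.
move=> H; elim: k => [|k IH]; last by rewrite mulnS !exprS; exact: topcoM.
by rewrite muln0 !expr0; split; rewrite ?size_poly1 // coef1.
Qed.

Lemma lin_topco d G : homogeneous d G -> topco d (lin G) (mpolyC n (meval p G)).
Proof.
move=> /dhomogP hG.
have H : topco d (\sum_(J <- msupp G) (mpolyC n (mcoeff J G))%:P * mmap1 (fun i => (Xv i)%:P + (mpolyC n (p i)) *: 'X) J)
   (\sum_(J <- msupp G) mpolyC n (mcoeff J G) * \prod_i mpolyC n (p i) ^+ J i).
  rewrite !big_seq; elim/big_rec2: _ => [|J c f JG [h1 h2]].
    by split; rewrite ?size_poly0 // coef0.
  suff : topco (0 + d) ((mpolyC n (mcoeff J G))%:P * mmap1 (fun i => (Xv i)%:P + (mpolyC n (p i)) *: 'X) J)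
     (mpolyC n (mcoeff J G) * \prod_i mpolyC n (p i) ^+ J i).
    move=> [k1 k2]; split; last by rewrite coefD k2 h2.
    by apply: leq_trans (size_polyD _ _) _; rewrite geq_max k1.
  apply: topcoM; first by split; rewrite ?size_polyC_leq1 // coefC.
  rewrite -(hG J JG) /= mdegE /mmap1.
  elim/big_rec3: _ => [|i a b c' _ IH]; first by split; rewrite ?size_poly1 // coef1.
  apply: topcoM IH; rewrite -{1}[J i]mul1n; apply: topcoX; split.
    apply: leq_trans (size_polyD _ _) _; rewrite geq_max (leq_trans (size_polyC_leq1 _)) //.
    by apply: leq_trans (size_scale_leq _ _) _; rewrite size_polyX.
  by rewrite coefD coefC coefZ coefX mulr1 add0r.
case: H => h1 h2; split=> //; rewrite h2 mevalE rmorph_sum; apply: eq_bigr => J _.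
by rewrite rmorphM rmorph_prod; congr (_ * _); apply: eq_bigr => i _; rewrite rmorphXn.
Qed.

Lemma mpoly_deriv_hom (L : Rx -> {poly Rx}) : L 0 = 0 -> L 1 = 1 ->
  (forall i, L (Xv i) = (Xv i)%:P + mpolyC n (p i) *: 'X) ->
  {morph L : a b / a * b} -> {morph L : a b / a + b} ->
  (forall c, L (mpolyC n c) = (mpolyC n c)%:P) ->
  forall G, (L G)^`() = \sum_i mpolyC n (p i) *: L (mderiv i G).
Proof.
move=> L0 L1 LX LM LD LC.
pose ok (a : Rx) := (L a)^`() = \sum_i mpolyC n (p i) *: L (mderiv i a).
have okC c : ok (mpolyC n c).
  rewrite /ok LC derivC big1 // => i _; rewrite mderivC.
  by rewrite L0 scaler0.
have okM a b : ok a -> ok b -> ok (a * b).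
  rewrite /ok => ha hb; rewrite LM derivM ha hb mulr_suml mulr_sumr -big_split.
  apply: eq_bigr => i _ /=; rewrite mderivM LD !LM scalerDr.
  by rewrite -scalerAl -scalerAr.
have okD a b : ok a -> ok b -> ok (a + b).
  rewrite /ok => ha hb; rewrite LD derivD ha hb -big_split.
  by apply: eq_bigr => i _ /=; rewrite mderivD LD scalerDr.
have okX i : ok (Xv i).
  rewrite /ok LX derivD derivC derivZ derivX add0r (bigD1 i) //= big1 ?addr0.
    rewrite mderivX mnm1E eqxx scale1r (_ : mnm_sub _ _ = mnm0); last first.
      by apply/mnmP => j; rewrite mnmBE mnm0E subnn.
    by rewrite mpolyX0 L1 -mul_polyC mulr1.
  move=> j /negbTE ji; rewrite mderivX mnm1E eq_sym ji scale0r.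
  by rewrite L0 scaler0.
have ok0 : ok 0 by rewrite -(mpolyC0 n F); exact: okC.
have ok1 : ok 1 by rewrite -(mpolyC1 n F); exact: okC.
move=> G; suff : ok G by [].
rewrite [G]mpolyE; elim/big_ind: _ => // J _.
rewrite -mul_mpolyC; apply: (okM _ _ (okC _)).
rewrite mpolyXE_id; apply: (big_ind ok) => // i _.
elim: (J i) => [|l IH]; first by rewrite expr0.
by rewrite exprS; exact: okM.
Qed.

Lemma lin_deriv G : (lin G)^`() = \sum_i mpolyC n (p i) *: lin (mderiv i G).
Proof.
apply: mpoly_deriv_hom => [||i|a b|a b|c].
- by rewrite /lin raddf0.
- by rewrite /lin rmorph1.
- by rewrite /lin mmapX mmap1U.
- by rewrite /lin rmorphM.
- by rewrite /lin rmorphD.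
- by rewrite /lin mmapC.
Qed.

(* Let b be a polynomial in s of minimal degree vanishing on the hypersurface; a
   pseudo-division gives c Dl(u + s p) = q b.  By primality and because of the smooth
   point u, q does not vanish on the hypersurface.  If q has a root in s for some u
   where b and q are coprime, this root lies on the hypersurface and b vanishes
   there, a contradiction; and a common factor would lower the degree of b. *)
Lemma principal_prime (d : nat) (Dl : Rx) : (0 < d)%N -> homogeneous d Dl -> meval p Dl != 0 ->
  (exists2 u, meval u Dl = 0 & \sum_i p i * meval u (mderiv i Dl) != 0) ->
  (forall H1 H2 : {poly Rx},
    (forall u s, meval (fun i => u i + s * p i) Dl = 0 -> ev (H1 * H2) u s = 0) ->
    (forall u s, meval (fun i => u i + s * p i) Dl = 0 -> ev H1 u s = 0) \/
    (forall u s, meval (fun i => u i + s * p i) Dl = 0 -> ev H2 u s = 0)) ->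
  forall G, (forall u, meval u Dl = 0 -> meval u G = 0) -> exists H, G = Dl * H.
Proof.
move=> d0 hD Dp [u0 u0D u0der] prim G HG.
pose P H := forall u s, meval (fun i => u i + s * p i) Dl = 0 -> ev H u s = 0.
have PM a b : P b -> P (a * b) by move=> hb u s h; rewrite evM hb ?mulr0.
have PB a b : P a -> P b -> P (a - b) by move=> ha hb u s h; rewrite evB ha ?hb ?subr0.
have PZ c a : P a -> P (c *: a) by move=> ha u s h; rewrite evZ ha ?mulr0.
pose Dt := lin Dl.
have PD : P Dt by move=> u s h; rewrite lin_ev.
have [sD cD] := lin_topco hD; rewrite -/Dt in sD cD.
have D0 : mpolyC n (meval p Dl) != 0.
  by apply: contraNneq Dp => /(congr1 (mcoeff mnm0)); rewrite mcoeffC mcoeff0 eqxx mulr1 => ->.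
have szD : size Dt = d.+1.
  apply/eqP; rewrite eqn_leq sD /= ltnNge; apply/negP => h; case/eqP: D0.
  by rewrite -cD nth_default.
have lD : lead_coef Dt = mpolyC n (meval p Dl) by rewrite lead_coefE szD.
have sub1 : subring_pred (fun _ : Rx => True) by [].
have rt (H : {poly Rx}) u : (1 < size H)%N -> meval u (lead_coef H) != 0 -> exists s, ev H u s = 0.
  move=> sH hu; have sz : size (map_poly (meval u) H) = size H.
    by rewrite size_poly_eq.
  have /closed_rootP[s /rootP hs] : size (map_poly (meval u) H) != 1%N by rewrite sz; lia.
  by exists s.
have Pc (c : Rx) : c != 0 -> ~ P c%:P.
  move=> c0 Pc; have [u hu] := mpoly_nonzero c0.
  have [s hs] := rt Dt u ltac:(by rewrite szD) ltac:(by rewrite lD mevalC).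
  by case/eqP: hu; rewrite -(evC c u s); apply: Pc; rewrite -lin_ev.
have nder : ~ P Dt^`().
  move=> h; case/eqP: u0der; have := h u0 0.
  have E : meval (fun i => u0 i + 0 * p i) Dl = meval u0 Dl.
    by apply: meval_eq => i; rewrite mul0r addr0.
  rewrite E => /(_ u0D) h0; rewrite -[RHS]h0 lin_deriv /ev rmorph_sum horner_sum; apply: eq_bigr => i _.
  rewrite -/(ev _ _ _) evZ mevalC lin_ev; congr (_ * _).
  by apply: meval_eq => j; rewrite mul0r addr0.
have [b [Pb b0] bm] : exists2 b, P b /\ b != 0 & forall q, P q /\ q != 0 -> (size b <= size q)%N.
  by apply: poly_min; exists Dt; split=> //; rewrite -size_poly_gt0 szD.
have bm' r : P r -> (size r < size b)%N -> r = 0.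
  by move=> Pr; apply: contraTeq => r0; rewrite -leqNgt; exact: bm.
have [N [q [r [e hr _ _]]]] := pdiv (p := Dt) (s := b) sub1 (fun=> I) (fun=> I) b0.
have r0 : r = 0.
  apply: bm' hr; have -> : r = lead_coef b ^+ N *: Dt - q * b by rewrite e addrC addKr.
  by apply: PB; [exact: PZ|exact: PM].
rewrite r0 addr0 in e.
have l0 : lead_coef b ^+ N != 0 by rewrite expf_neq0 // lead_coef_eq0.
have sb : (1 < size b)%N.
  rewrite ltnNge; apply/negP => /size1_polyC E; apply: (Pc b`_0) => //; last by rewrite -E.
  by have [h|//] := eqVneq b`_0 0; move: b0; rewrite E h eqxx.
(* If b is not shorter than Dt, then Dt has least degree as well: division of [lin G] by it leaves
   no remainder, its leading coefficient is the nonzero constant Dl (p), and s = 0 gives the claim.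
   The other case is contradictory. *)
case: (leqP (size Dt) (size b)) => sDb.
  have [N' [q' [r' [e' hr' _ _]]]] := pdiv (p := lin G) (s := Dt) sub1 (fun=> I) (fun=> I)
    ltac:(by rewrite -size_poly_gt0 szD).
  have r'0 : r' = 0.
    apply: bm'; last exact: leq_trans hr' sDb.
    have -> : r' = lead_coef Dt ^+ N' *: lin G - q' * Dt by rewrite e' addrC addKr.
    apply: PB; last exact: PM.
    by apply: PZ => u s h; rewrite lin_ev; exact: HG.
  have E : mpolyC n (meval p Dl ^+ N') * G = q'.[0] * Dl.
    have -> : mpolyC n (meval p Dl ^+ N') = lead_coef Dt ^+ N' by rewrite lD; exact: rmorphXn.
    by apply: (horner0_eq (x := lin G) (z := Dt)); [rewrite e' r'0 addr0|exact: lin_at0|exact: lin_at0].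
  exists (mpolyC n (meval p Dl ^+ N')^-1 * q'.[0]).
  have c0 : meval p Dl ^+ N' != 0 by rewrite expf_neq0.
  rewrite mulrCA [Dl * _]mulrC -E mulrA.
  have -> : mpolyC n (meval p Dl ^+ N')^-1 * mpolyC n (meval p Dl ^+ N') = 1.
    by rewrite -mpolyCM mulVf // mpolyC1.
  by rewrite mul1r.
have q0 : q != 0.
  apply: contraTneq isT => h; move/eqP: e; rewrite h mul0r -mul_polyC mulf_eq0 polyC_eq0 (negbTE l0) /=.
  by rewrite -size_poly_eq0 szD.
have sq : (1 < size q)%N.
  have := congr1 (fun H : {poly Rx} => size H) e; rewrite size_scale // size_mul // => h.
  move: h sDb; case: (size q) (size_poly_gt0 q) => [|[|k]] //; rewrite ?q0 // add1n /= => _ ->.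
  by rewrite !ltnn.
(* Differentiate c Dt = q b: if q vanished on the hypersurface, the derivative of Dt would too,
   against the smooth point u0. *)
have nq : ~ P q.
  move=> Pq; have := congr1 (@deriv Rx) e; rewrite derivZ derivM => E.
  have : P ((lead_coef b ^+ N)%:P * Dt^`()).
    rewrite mul_polyC E -[q * _]opprK; apply: PB; first exact: PM.
    by rewrite -mulrN mulrC; exact: PM.
  by move/prim => [/(Pc _ l0)|].
(* d1 plays the role of the greatest common divisor of b and q over the field of fractions in u. *)
pose Q H := H != 0 /\ exists x y, H = x * b + y * q.
have [d1 [d10 [x0 [y0 d1E]]] d1m] : exists2 H, Q H & forall H', Q H' -> (size H <= size H')%N.
  by apply: poly_min; exists b; split=> //; exists 1, 0; rewrite mul1r mul0r addr0.
have dv H : (exists x y, H = x * b + y * q) -> exists M z, lead_coef d1 ^+ M *: H = z * d1.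
  move=> [x [y HE]]; have [M [z [w [ew hw _ _]]]] := pdiv (p := H) (s := d1) sub1 (fun=> I) (fun=> I) d10.
  exists M, z; rewrite ew; have [->|w0] := eqVneq w 0; first by rewrite addr0.
  suff : Q w by move/d1m; rewrite leqNgt hw.
  split=> //; exists (lead_coef d1 ^+ M *: x - z * x0), (lead_coef d1 ^+ M *: y - z * y0).
  have -> : w = lead_coef d1 ^+ M *: H - z * d1 by rewrite ew addrC addKr.
  by rewrite HE d1E -!mul_polyC; ring.
have ld1 : lead_coef d1 != 0 by rewrite lead_coef_eq0.
have [M1 [z1 e1]] := dv b ltac:(by exists 1, 0; rewrite mul1r mul0r addr0).
have [M2 [z2 e2]] := dv q ltac:(by exists 0, 1; rewrite mul1r mul0r add0r).
case: (leqP (size d1) 1) => sd1.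
  have d1C := size1_polyC sd1.
  have g0 : d1`_0 != 0 by have [h|//] := eqVneq d1`_0 0; move: d10; rewrite d1C h eqxx.
  have lq0 : lead_coef q != 0 by rewrite lead_coef_eq0.
  have [u hu] := mpoly_nonzero (mulf_neq0 (mulf_neq0 g0 lq0) l0).
  move: hu; rewrite !mevalM !mulf_eq0 !negb_or => /andP[/andP[hu1 hu2] hu3].
  have [s hs] := rt q u sq hu2.
  have hD0 : meval (fun i => u i + s * p i) Dl = 0.
    have := congr1 (fun H => ev H u s) e; rewrite evZ evM hs mul0r => /eqP.
    by rewrite mulf_eq0 (negbTE hu3) lin_ev => /eqP.
  case/eqP: hu1; rewrite -(evC d1`_0 u s) -d1C d1E evD !evM hs (Pb u s hD0) !mulr0.
  exact: addr0.
have z10 : z1 != 0.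
  apply: contraTneq isT => h; move/eqP: e1; rewrite h mul0r -mul_polyC mulf_eq0 polyC_eq0 (negbTE b0) orbF.
  by rewrite expf_eq0 (negbTE ld1) andbF.
(* Up to factors free of s, b = z1 d1 and q = z2 d1, so z1 q is a multiple of b. By primality z1
   vanishes on the hypersurface, although it is shorter than b. *)
have : P (z1 * ((lead_coef d1 ^+ M2)%:P * q)).
  rewrite mul_polyC e2 mulrCA -e1 -mul_polyC mulrA; exact: PM.
move/prim => [Pz|/prim[/Pc|//]]; last first.
  by move=> h; exfalso; apply: h; rewrite expf_neq0.
have : (size b <= size z1)%N by apply: bm.
have := congr1 (fun H : {poly Rx} => size H) e1; rewrite size_scale ?expf_neq0 // size_mul // => ->.
by move: sd1; have := z10; rewrite -size_poly_gt0; move: (size z1) (size d1) => a' b'; lia.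
Qed.

End Principal.

(** * Linear description of the ideal of A_m *)

Section Words.
Variables (g m d : nat).
Local Notation B := (Bm g m).
Local Notation n := (nB g m).

Definition mseq (J : multinom n) : seq B := flatten [seq nseq (J i) (enum_val i) | i <- enum 'I_n].
Definition mword (J : multinom n) : {ffun 'I_d -> B} := [ffun j : 'I_d => nth 0 (mseq J) j].

Lemma size_mseq J : size (mseq J) = mdeg J.
Proof.
rewrite size_flatten /shape -map_comp sumnE big_map big_enum mdegE /=.
by apply: eq_bigr => i _; rewrite size_nseq.
Qed.

Lemma prod_mword (A : comNzRingType) (X : B -> A) J : mdeg J = d ->
  \prod_j X (mword J j) = \prod_i pt X i ^+ J i.
Proof.
move=> dJ; have -> : \prod_j X (mword J j) = \prod_(b <- mseq J) X b.
  rewrite (big_nth 0) size_mseq dJ big_mkord; apply: eq_bigr => i _.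
  by rewrite ffunE.
rewrite /mseq big_flatten big_map big_enum /=; apply: eq_bigr => i _.
by rewrite big_nseq iter_mulr_1.
Qed.
End Words.

Lemma meval_scale (F : fieldType) n (p : mpoly n F) (x : 'I_n -> F) c :
  meval (fun i => c * x i) p = \sum_(d < msize p) c ^+ d * meval x (pihomog (@mdeg n) d p).
Proof.
transitivity (\sum_(d < msize p) meval (fun i => c * x i) (pihomog (@mdeg n) d p)).
  by rewrite {1}[p]sum_pihomog; exact: raddf_sum.
apply: eq_bigr => d _.
rewrite !mevalE big_distrr /=; apply: eq_big_seq => J.
rewrite mcoeff_msupp mcoeff_pihomog; have [<-|_] := eqVneq (mdeg J) d; last by rewrite eqxx.
by move=> _; rewrite mulrCA mdegE -prodrXr -big_split; congr (_ * _); apply: eq_bigr => i _; rewrite exprMn.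
Qed.

Lemma pihomog_large (F : fieldType) n (p : mpoly n F) d : (msize p <= d)%N ->
  pihomog (@mdeg n) d p = 0.
Proof.
move=> h; apply/mpolyP => J; rewrite mcoeff_pihomog mcoeff0; case: eqP => // e.
by rewrite memN_msupp_eq0 //; apply: contraL h => /msize_mdeg_lt; rewrite e -ltnNge.
Qed.

(** Along the line through x, p is a polynomial in c whose coefficients are the values of the
    homogeneous components, and it has infinitely many roots. *)
Lemma cone_hom (F : closedFieldType) n (p : mpoly n F) (x : 'I_n -> F) :
  (forall l, (l.+1%:R : F) != 0) ->
  (forall c, c != 0 -> meval (fun i => c * x i) p = 0) ->
  forall d, meval x (pihomog (@mdeg n) d p) = 0.
Proof.
move=> ch H d; pose q := \poly_(e < msize p) meval x (pihomog (@mdeg n) e p).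
have q0 : q = 0.
  suff : 'X * q = 0 by move/eqP; rewrite mulf_eq0 polyX_eq0 => /eqP.
  apply: poly_nat_eq0 (nat_inj_char0 ch) _ => l; rewrite hornerM hornerX.
  case: l => [|l]; first by rewrite mul0r.
  rewrite /q horner_poly; have := H l.+1%:R (ch l); rewrite meval_scale.
  by under eq_bigr do rewrite mulrC; move=> ->; rewrite mulr0.
have := congr1 (fun q : {poly F} => q`_d) q0; rewrite coef_poly coef0.
by case: ltnP => // h _; rewrite pihomog_large // meval0.
Qed.

Section ThetaPoints.
Variables (R : realType) (g m : nat).
Hypotheses (m2 : ~~ odd m) (m4 : (4 <= m)%N).
Let m1 : (1 < m)%N. Proof. exact: leq_trans m4. Qed.
Local Notation C := R[i].
Local Notation B := (Bm g m).
Local Notation n := (nB g m).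
Local Notation KK d := {ffun 'I_g -> 'I_m * 'I_d}.

Definition cdet d (tau : 'M[C]_g) : C :=
  \det (\matrix_(k < #|{: KK d}|, l < #|{: KK d}|)
     coef (@nu g m d (enum_val k)) (@tot g m d (enum_val l)) tau).
Definition gdet (tau : 'M[C]_g) : C := \det (\matrix_(j < g, i < g) gam m tau j i).

(** Countably many conditions: they make evaluation at tau injective on the theta ring, the normal
    monomials independent in each degree, and [immersion] applicable. *)
Definition generic (tau : 'M[C]_g) : Prop :=
  [/\ siegel tau, forall p : Defs.ipoly g m, ~ vanishes_on_siegel R p -> ieval (thth tau) p != 0,
      forall d, cdet d tau != 0 & gdet tau != 0].

(** Equal to [thth] on the Siegel space; but [tau_an] also evaluates at complex parameters of a
    segment, where the analytic expression is the one through [S]. *)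
Definition thS (tau : 'M[C]_g) (a b : B) : C := S m (clind R a) tau 0 * S m (clind R b) tau 0.

Lemma ieval_thS tau (p : Defs.ipoly g m) : siegel tau -> ieval (thth tau) p = ieval (thS tau) p.
Proof.
move=> ts; suff -> : thth tau = thS tau by [].
by apply/funext => a; apply/funext => b; rewrite /thth !th_S.
Qed.

Lemma ieval_an (p : Defs.ipoly g m) : tau_an (fun tau : 'M[C]_g => ieval (thS tau) p).
Proof.
apply: (@tau_an_sum R g _ (msupp p) xpredT (fun J tau => (mcoeff J p)%:~R *
  mmap1 (fun i => let ab : B * B := enum_val i in thS tau ab.1 ab.2) J)) => J.
apply: (@tau_anM R g (fun=> (mcoeff J p)%:~R) (fun tau =>
  mmap1 (fun i => let ab : B * B := enum_val i in thS tau ab.1 ab.2) J)); first exact: tau_an_cst.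
apply: (@tau_an_prod R g _ _ xpredT (fun i tau => let ab : B * B := enum_val i in thS tau ab.1 ab.2 ^+ J i)) => i /=.
apply: (@tau_anX R g (fun tau => thS tau (enum_val i : B * B).1 (enum_val i : B * B).2)).
apply: (@tau_anM R g (fun tau => S m (clind R (enum_val i : B * B).1) tau 0)
   (fun tau => S m (clind R (enum_val i : B * B).2) tau 0)); apply: S0_an => //; exact: bdd_clind.
Qed.

Lemma generic_family : exists F : nat -> 'M[C]_g -> C,
  [/\ forall i, tau_an (F i), forall i, exists2 tau, siegel tau & F i tau != 0
    & forall tau, siegel tau -> (forall i, F i tau != 0) -> generic tau].
Proof.
pose N := #|{: B * B}|.
pose pol (L : seq (multinom N * int)) : Defs.ipoly g m := \sum_(x <- L) x.2 *: mpolyX int x.1.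
pose T : countType := (seq (multinom N * int) + nat + unit)%type.
pose F (i : nat) (tau : 'M[C]_g) : C := match unpickle i : option T with
  | Some (inl (inl L)) => if `[< vanishes_on_siegel R (pol L) >] then 1 else ieval (thS tau) (pol L)
  | Some (inl (inr d)) => cdet d tau
  | Some (inr _) => gdet tau
  | None => 1 end.
have [tau0 tau0s _] := gam_cusp_det R g m2 m4.
exists F; split => [i|i|tau ts H].
- rewrite /F; case: (unpickle i : option T) => [[[L|d]|_]|].
  + case: asboolP => _; [exact: tau_an_cst|exact: ieval_an].
  + by apply: (tau_an_det (f := fun k l tau => coef (@nu g m d (enum_val k)) (@tot g m d (enum_val l)) tau)) => k l; exact: coef_an.
  + by apply: (tau_an_det (f := fun j i tau => gam m tau j i)) => k l; exact: gam_an.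
  + exact: tau_an_cst.
- rewrite /F; case: (unpickle i : option T) => [[[L|d]|_]|].
  + case: asboolP => [_|h]; first by exists tau0 => //; exact: oner_neq0.
    apply: contrapT => nex; apply: h => tau ts; apply: contrapT => /eqP h; apply: nex.
    by exists tau; rewrite // -ieval_thS.
  + exact: coef_cusp_det.
  + exact: gam_cusp_det.
  + by exists tau0 => //; exact: oner_neq0.
- split=> //.
  + move=> p hp; pose L : seq (multinom N * int) := [seq (J, mcoeff J p) | J <- msupp p].
    have pL : pol L = p by rewrite /pol big_map -mpolyE.
    have := H (pickle (inl (inl L) : T)); rewrite /F pickleK.
    by rewrite pL ieval_thS //; case: asboolP.
  + by move=> d; have := H (pickle (inl (inr d) : T)); rewrite /F pickleK.
  + by have := H (pickle (inr tt : T)); rewrite /F pickleK.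
Qed.

(** For tauG generic, no condition vanishes identically on an initial piece of the segment from
    tau0, and Baire's theorem gives a generic point on each such piece. Continuity of Delta will be
    used along this segment. *)
Lemma generic_near tau0 : siegel tau0 -> exists2 tauG, siegel tauG &
  forall e : R, 0 < e -> exists2 t : R, (0 <= t) && (t <= e) && (t <= 1) & generic (seg tau0 tauG t).
Proof.
move=> s0; have [F [Fan Fne FG]] := generic_family.
have [tauG [sG _ HG]] := generic_dense Fan Fne s0 ltr01.
exists tauG => // e e0; pose e' := Num.min e 1.
have e'0 : 0 < e' by rewrite lt_min e0 ltr01.
have [e'e e'1] : e' <= e /\ e' <= 1 by rewrite /e' !ge_min !lexx orbT.
have ssub x : seg tau0 (seg tau0 tauG e') x = seg tau0 tauG (x * e').
  by rewrite /seg [tau0 + _ - tau0]addrC addKr scalerA /toC rmorphM.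
have s1 : siegel (seg tau0 tauG e') by apply: seg_siegel => //; rewrite ltW.
have [|t /andP[t0 t1] Ht] := @line_generic R g F (fun=> tau0) (fun=> seg tau0 tauG e') Fan (fun=> s0) (fun=> s1).
  move=> i; have h1 : exists2 x, 0 <= x <= 1 & F i (seg tau0 tauG x) != 0.
    exists 1; first by rewrite ler01 lexx.
    by rewrite /seg toC1 scale1r addrC subrK.
  have h0 : 0 <= (0 : R) <= 1 by rewrite lexx ler01.
  have [d d0 Hd] := line_zeros (Fan i) s0 sG h1 h0.
  pose x := Num.min 1 (d / 2).
  have x0 : 0 < x by rewrite lt_min ltr01 divr_gt0.
  have [x1 xd] : x <= 1 /\ x <= d / 2 by rewrite /x !ge_min !lexx orbT.
  have xe0 : 0 < x * e' by rewrite mulr_gt0.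
  have xe1 : x * e' <= x by rewrite ler_piMr // ltW.
  exists x; first by rewrite ltW.
  rewrite ssub; apply: Hd; first by rewrite ltW //= (le_trans xe1).
    by rewrite gt_eqF.
  by rewrite subr0 gtr0_norm //; lra.
have te : 0 <= t * e' by rewrite mulr_ge0 // ltW.
have te1 : t * e' <= e' by rewrite ler_piMl // ltW.
exists (t * e'); first by rewrite te (le_trans te1 e'e) (le_trans te1 e'1).
apply: FG => [|i]; first by apply: seg_siegel; rewrite // te (le_trans te1 e'1).
by rewrite -ssub; exact: Ht.
Qed.

Variables (k : fieldType) (t : B -> B -> k).
Hypothesis hk : @is_theta_field R g m k t.

Lemma ievalB (A : comNzRingType) (T : B -> B -> A) p q : ieval T (p - q) = ieval T p - ieval T q.
Proof. exact: raddfB. Qed.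
Lemma ievalM (A : comNzRingType) (T : B -> B -> A) p q : ieval T (p * q) = ieval T p * ieval T q.
Proof. exact: rmorphM. Qed.
Lemma ieval1 (A : comNzRingType) (T : B -> B -> A) : ieval T 1 = 1.
Proof. exact: rmorph1. Qed.

Lemma char0_theta (l : nat) : (l.+1%:R : k) != 0.
Proof.
have [h _] := hk; have [tau ts _] := gam_cusp_det R g m2 m4.
apply/eqP => e; have := (h l.+1%:R).1 ltac:(by rewrite -[RHS]e; exact: rmorph_nat) tau ts.
rewrite (_ : ieval _ _ = l.+1%:R); last exact: rmorph_nat.
by move/eqP; rewrite pnatr_eq0.
Qed.

Lemma char0_ext (Om : closedFieldType) (iota : {rmorphism k -> Om}) (l : nat) : (l.+1%:R : Om) != 0.
Proof. by rewrite -(rmorph_nat iota) fmorph_eq0 char0_theta. Qed.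

Lemma ieval_var (A : comNzRingType) (T : B -> B -> A) a b :
  ieval T (mpolyX _ (mnm1 (enum_rank (a, b)))) = T a b.
Proof. by rewrite /ieval mmapX mmap1U enum_rankK. Qed.

Definition theta_pt (tau : 'M[C]_g) (iota : {rmorphism k -> C}) : Prop :=
  forall p, iota (ieval t p) = ieval (thth tau) p.

(** A relation in k holds at every tau, and a denominator that is nonzero in k stays nonzero at a
    generic tau; so fractions can be evaluated. *)
Lemma generic_iota tau : generic tau -> exists iota : {rmorphism k -> C}, theta_pt tau iota.
Proof.
move=> [ts G _ _]; have [h1 h2] := hk.
have gz p : ieval t p != 0 -> ieval (thth tau) p != 0.
  by move=> p0; apply: G => v; case/eqP: p0; apply/h1.
have [N HN] := choice h2; have [D HD] := choice HN.
pose f x := ieval (thth tau) (N x) / ieval (thth tau) (D x).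
have fE x p q : ieval t q != 0 -> x = ieval t p / ieval t q ->
    f x = ieval (thth tau) p / ieval (thth tau) q.
  move=> q0 xE; have [d0 xD] := HD x.
  apply/eqP; rewrite eqr_div ?gz // -subr_eq0 -!ievalM -ievalB; apply/eqP.
  apply: (h1 _).1 ts; rewrite ievalB !ievalM; apply/eqP; rewrite subr_eq0.
  by rewrite -eqr_div // -xD -xE.
have fB : {morph f : x y / x - y}.
  move=> x y; have [dx xE] := HD x; have [dy yE] := HD y.
  rewrite (@fE _ (N x * D y - N y * D x) (D x * D y)).
  - rewrite ievalB !ievalM /f; have := gz _ dx; have := gz _ dy.
    move: (ieval (thth tau) (N x)) (ieval (thth tau) (N y)) (ieval (thth tau) (D x)) (ieval (thth tau) (D y)).
    by move=> a b c d d0 c0; field; rewrite c0 d0.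
  - by rewrite ievalM mulf_neq0.
  - rewrite ievalB !ievalM {1}xE {1}yE; move: dx dy.
    move: (ieval t (N x)) (ieval t (N y)) (ieval t (D x)) (ieval t (D y)).
    by move=> a b c d d0 c0; field; rewrite c0 d0.
have f1 : f 1 = 1.
  by rewrite (@fE _ 1 1) ?ieval1 ?divr1 // oner_neq0.
have fM : {morph f : x y / x * y}.
  move=> x y; have [dx xE] := HD x; have [dy yE] := HD y.
  rewrite (@fE _ (N x * N y) (D x * D y)).
  - by rewrite !ievalM /f -mulf_div.
  - by rewrite ievalM mulf_neq0.
  - by rewrite !ievalM {1}xE {1}yE mulf_div.
pose h : {rmorphism k -> C} :=
  HB.pack f (GRing.isZmodMorphism.Build k C f fB) (GRing.isMonoidMorphism.Build k C f (conj f1 fM)).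
exists h => p; rewrite /h /= (@fE _ p 1) ?ieval1 ?divr1 ?oner_neq0 //.
Qed.

Lemma theta_pt_t tau iota : theta_pt tau iota -> forall a b, iota (t a b) = thth tau a b.
Proof. by move=> H a b; rewrite -(ieval_var t) H ieval_var. Qed.

Lemma theta_on_Am tau iota z (c : C) : siegel tau -> theta_pt tau iota -> c != 0 ->
  on_Am t iota (fun a => c * th a tau z).
Proof.
move=> ts H c0; split.
  by have [a ha] := th_nonzero m1 m2 z ts; exists a; rewrite mulf_neq0.
move=> a b a' b' d e E.
have h1 p q : iota (null_sum t e p q) = Qf e p q tau 0 0.
  rewrite rmorph_sum; apply: eq_bigr => h _.
  by rewrite rmorphM /sgn rmorphXn rmorphN1 (theta_pt_t H).
have h2 p q : quad_sum e (fun a => c * th a tau z) p q = c ^+ 2 * Qf e p q tau z z.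
  rewrite /quad_sum mulr_sumr; apply: eq_bigr => h _.
  by move: (sgn C e h) (th _ tau z) (th _ tau z) => x y w; ring.
have := Qf_relation m1 m2 d e z ts E; rewrite !h1 !h2.
move: (Qf e _ _ tau 0 0) (Qf e _ _ tau 0 0) (Qf e _ _ tau z z) (Qf e _ _ tau z z) => x y x' y' E'.
by rewrite mulrCA E' mulrCA.
Qed.

Lemma theta_on_Am1 tau iota z : siegel tau -> theta_pt tau iota -> on_Am t iota (fun a => th a tau z).
Proof.
move=> ts H; have := theta_on_Am z ts H (oner_neq0 _).
by congr (on_Am t iota); apply/funext => a; rewrite mul1r.
Qed.

Lemma generic_exists : exists tau, generic tau.
Proof.
have [tau ts _] := gam_cusp_det R g m2 m4.
by have [tG _ H] := generic_near ts; have [x _ Hx] := H 1 ltr01; exists (seg tau tG x).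
Qed.

(* A_m has points in general position over every Omega: specialise theta points. *)
Lemma points d (Om : closedFieldType) (iota : {rmorphism k -> Om}) :
  exists2 X : 'I_#|{: KK d.+1}| -> B -> Om, forall l, on_Am t iota (X l)
    & forall c : KK d.+1 -> Om, (forall l, \sum_N c N * \prod_j X l (nu N j) = 0) -> forall N, c N = 0.
Proof.
have [tau G] := generic_exists; have [ts _ cd _] := G; have [phi Hphi] := generic_iota G.
pose K := #|{: KK d.+1}|.
pose f (i : 'I_K) (z : 'rV[C]_g) : C := \prod_j th (nu (enum_val i) j) tau z.
have [|z Hz] := @indep_points _ _ _ f.
  move=> c Hc i0; rewrite -[i0]enum_valK.
  apply: (@monomials_independent R g m m1 d.+1 _ (fun N => c (enum_rank N)) (@nu g m d.+1) (@tot g m d.+1) tau ts (cd d.+1)) => z.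
  rewrite -[RHS](Hc z) (reindex (@enum_val {: KK d.+1} predT)) /=; last by apply/onW_bij/enum_val_bij.
  by apply: eq_bigr => l _; rewrite enum_valK.
pose I := ('I_K * B)%type.
pose s : seq C := [seq th (x : I).2 tau (z x.1) | x <- enum {: I}].
(* The finitely many coordinates of the theta points are carried over to Omega: Mumford's equations
   are among the relations that are kept, and the determinant is the element that stays nonzero. *)
have [A' [j [X [phi' [hj hX spec]]]]] := specialize s phi.
pose Y (l : 'I_K) (a : B) : A' := X (enum_rank (l, a)).
have hY l a : phi' (Y l a) = th a tau (z l).
  rewrite hX; last by rewrite size_map -cardE ltn_ord.
  rewrite (nth_map (l, a)); last by rewrite -cardE ltn_ord.
  by rewrite (nth_enum_rank (l, a)).
pose M := \matrix_(i < K, l < K) \prod_j Y l (nu (enum_val i) j).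
have hM : phi' (\det M) = \det (\matrix_(i, l) f i (z l)).
  rewrite -det_map_mx; congr (\det _); apply/matrixP => i l; rewrite !mxE rmorph_prod.
  by apply: eq_bigr => a _; exact: hY.
have [|a a0 Ha] := spec (\det M); first by rewrite hM.
have [b b0||psi [hp1 hp2 hp3]] := Ha Om iota.
  by move/eqP: b0; rewrite fmorph_eq0 => /eqP ->; rewrite rmorph0.
  by rewrite fmorph_eq0 -(fmorph_eq0 phi).
have hp : \det (\matrix_(i < K, l < K) \prod_j psi (Y l (nu (enum_val i) j))) != 0.
  apply: contraNneq hp3 => h; rewrite -det_map_mx -[X in _ == X]h; apply/eqP; congr (\det _).
  by apply/matrixP => i l; rewrite !mxE rmorph_prod.
exists (fun l b => psi (Y l b)) => [l|c Hc N].
  split.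
    apply: contrapT => nex; case/eqP: hp; rewrite (expand_det_col _ l) big1 // => i _.
    rewrite mxE big_ord_recl (_ : psi _ = 0) ?mul0r //.
    by apply: contrapT => /eqP h; apply: nex; eexists; exact: h.
  move=> b b' b1 b1' e c E.
  pose Q p q : A' := \sum_h sgn A' c h * (Y l (p + half_class m h) * Y l (q + half_class m h)).
  have hQ (O : comNzRingType) (F0 : {rmorphism A' -> O}) p q :
      F0 (Q p q) = \sum_h sgn O c h * (F0 (Y l (p + half_class m h)) * F0 (Y l (q + half_class m h))).
    by rewrite rmorph_sum; apply: eq_bigr => h _; rewrite !rmorphM /sgn rmorphXn rmorphN1.
  have h2 : phi' (j (null_sum t c (b1 + e) (b1' + e)) * Q b b' - j (null_sum t c (b + e) (b' + e)) * Q b1 b1') = 0.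
    rewrite rmorphB !rmorphM !hj !hQ; have := theta_on_Am1 (z l) ts Hphi.
    case=> _ /(_ b b' b1 b1' e c E) H1; apply/eqP; rewrite subr_eq0; apply/eqP.
    have hq p q : \sum_h sgn C c h * (phi' (Y l (p + half_class m h)) * phi' (Y l (q + half_class m h))) =
       quad_sum c (fun a => th a tau (z l)) p q.
      by apply: eq_bigr => h _; congr (_ * (_ * _)); exact: hY.
    by rewrite !hq; exact: H1.
  have := hp2 _ h2; rewrite rmorphB !rmorphM !hp1 !hQ => /eqP.
  by rewrite subr_eq0 => /eqP.
pose v : 'rV[Om]_K := \row_i c (enum_val i).
pose MM := \matrix_(i < K, l < K) \prod_j psi (Y l (nu (enum_val i) j)).
have vM : v *m MM = 0.
  apply/rowP => l; rewrite !mxE -[RHS](Hc l).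
  rewrite [RHS](reindex (@enum_val {: KK d.+1} predT)) /=; last by apply/onW_bij/enum_val_bij.
  by apply: eq_bigr => i _; rewrite !mxE.
have uM : MM \in unitmx by rewrite unitmxE unitfE.
have v0 : v = 0 by rewrite -[v](mulmxK uM) vM mul0mx.
by have := congr1 (fun v : 'rV_K => v ord0 (enum_rank N)) v0; rewrite !mxE enum_rankK.
Qed.

Lemma normal_mon d : exists nf : multinom n -> KK d.+1 -> k,
  forall (Om : closedFieldType) (iota : {rmorphism k -> Om}) (X : B -> Om), on_Am t iota X ->
  forall J, mdeg J = d.+1 -> \prod_i pt X i ^+ J i = \sum_N iota (nf J N) * \prod_j X (nu N j).
Proof.
have [nf H] := normal_form m2 m4 (ltn0Sn d) hk.
exists (fun J => nf (mword d.+1 J)) => Om iota X hX J dJ.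
by rewrite -(prod_mword _ dJ); exact: H.
Qed.

Definition nform d : multinom n -> KK d.+1 -> k := sval (boolp.cid (normal_mon d)).

Lemma nformP d (Om : closedFieldType) (iota : {rmorphism k -> Om}) (X : B -> Om) J :
  on_Am t iota X -> mdeg J = d.+1 ->
  \prod_i pt X i ^+ J i = \sum_N iota (nform J N) * \prod_j X (nu (N : KK d.+1) j).
Proof. by move=> h; exact: (svalP (boolp.cid (normal_mon d)) Om iota X h J). Qed.

(* The ideal of A_m over every Omega is cut out, inside the polynomials, by the
   linear forms [ell l] with coefficients in k. *)
Definition Lam : Type := ({d : nat & KK d.+1} + unit)%type.
(** Coefficients of normal forms in positive degree; the constant term has a form of its own, as
    normal words are used in positive degree only. *)
Definition ell (l : Lam) (J : multinom n) : k :=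
  match l with
  | inl x => if mdeg J == (projT1 x).+1 then nform J (projT2 x) else 0
  | inr _ => (J == mnm0)%:R
  end.
Definition Ell (Om : closedFieldType) (iota : {rmorphism k -> Om}) (l : Lam) (p : mpoly n Om) : Om :=
  \sum_(J <- msupp p) mcoeff J p * iota (ell l J).

Lemma Ell_hom (Om : closedFieldType) (iota : {rmorphism k -> Om}) d (p : mpoly n Om) X :
  on_Am t iota X -> meval (pt X) (pihomog (@mdeg n) d.+1 p) =
    \sum_(N : KK d.+1) Ell iota (inl (existT _ d N)) p * \prod_j X (nu N j).
Proof.
move=> hX; rewrite pihomogE (raddf_sum (meval (pt X))) /Ell.
under [RHS]eq_bigr do rewrite mulr_suml.
rewrite exchange_big big_mkcond /=; apply: eq_bigr => J _.
case: eqP => [dJ|dJ]; last by rewrite big1 // => N _; rewrite rmorph0 mulr0 mul0r.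
rewrite mevalZ mevalX (nformP hX dJ) mulr_sumr; apply: eq_bigr => N _.
by rewrite mulrA.
Qed.

Lemma Ell_const (Om : closedFieldType) (iota : {rmorphism k -> Om}) (p : mpoly n Om) :
  Ell iota (inr tt) p = mcoeff mnm0 p.
Proof.
rewrite /Ell /=; have [h|h] := boolP (mnm0 \in msupp p).
  rewrite (bigD1_seq mnm0) ?msupp_uniq //= eqxx rmorph1 mulr1 big1 ?addr0 // => J /negbTE ->.
  by rewrite rmorph0 mulr0.
rewrite (memN_msupp_eq0 h) big_seq big1 // => J hJ.
by case: eqP => [e|_]; [rewrite e (negbTE h) in hJ|rewrite rmorph0 mulr0].
Qed.

Lemma pihomog0 (F : fieldType) (p : mpoly n F) x : meval x (pihomog (@mdeg n) 0 p) = mcoeff mnm0 p.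
Proof.
have -> : pihomog (@mdeg n) 0 p = mpolyC n (mcoeff mnm0 p).
  apply/mpolyP => J; rewrite mcoeff_pihomog mcoeffC mdeg_eq0.
  by case: eqP => [->|_]; rewrite ?mulr1 ?mulr0.
exact: mevalC.
Qed.

Lemma on_AmZ (Om : closedFieldType) (iota : {rmorphism k -> Om}) X (c : Om) : c != 0 ->
  on_Am t iota X -> on_Am t iota (fun a => c * X a).
Proof.
move=> c0 [[a ha] H]; split; first by exists a; rewrite mulf_neq0.
move=> b b' b1 b1' e h E.
have hq p q : quad_sum h (fun a => c * X a) p q = c ^+ 2 * quad_sum h X p q.
  rewrite /quad_sum mulr_sumr; apply: eq_bigr => h' _.
  by move: (sgn Om h h') (X _) (X _) => x y w; ring.
by rewrite !hq mulrCA H // mulrCA.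
Qed.

Lemma in_ideal_hom (Om : closedFieldType) (iota : {rmorphism k -> Om}) p X d :
  in_ideal t iota p -> on_Am t iota X -> meval (pt X) (pihomog (@mdeg n) d p) = 0.
Proof.
move=> hp hX; apply: cone_hom (char0_ext iota) _ _ => c c0.
exact: (hp _ (on_AmZ c0 hX)).
Qed.

(** Normal forms turn vanishing on A_m into vanishing of combinations of normal monomials, and
    [points] supplies enough points to make these independent. Degrees can be treated separately
    because A_m is a cone. *)
Lemma in_idealP (Om : closedFieldType) (iota : {rmorphism k -> Om}) p :
  in_ideal t iota p <-> forall l, Ell iota l p = 0.
Proof.
split=> [hp [[d N]|[]]|H X hX].
- have [X hX H] := points d iota; apply: (H (fun N => Ell iota (inl (existT _ d N)) p)) => l.
  by rewrite -(Ell_hom d p (hX l)); exact: (in_ideal_hom _ hp (hX l)).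
- rewrite Ell_const; have [X hX _] := points 0 iota.
  have /card_gt0P[N _] : (0 < #|{: KK 1}|)%N.
    by rewrite card_ffun expn_gt0 card_prod !card_ord muln1 (ltn_trans _ m4).
  rewrite -(pihomog0 p (pt (X (enum_rank N)))).
  exact: (in_ideal_hom _ hp (hX _)).
- rewrite [p]sum_pihomog (raddf_sum (meval (pt X))) big1 // => [[[|d] dp]] _ /=.
    by rewrite pihomog0 -(Ell_const iota).
  by rewrite (Ell_hom d p hX) big1 // => N _; rewrite H mul0r.
Qed.

(** At a generic tau the normal monomials in the theta functions are independent as well, so the
    cone over the image of C^g already detects the ideal. *)
Lemma generic_ideal tau iota p : generic tau -> theta_pt tau iota ->
  in_ideal t iota p <-> forall (c : C) z, c != 0 -> meval (fun i => c * pt (fun a : B => th a tau z) i) p = 0.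
Proof.
move=> [ts _ cd _] ht; split=> [hp c z _|H].
  rewrite meval_scale big1 // => d _; apply/eqP; rewrite mulf_eq0; apply/orP; right; apply/eqP.
  exact: (in_ideal_hom d hp (theta_on_Am1 z ts ht)).
have hz z d : meval (pt (fun a : B => th a tau z)) (pihomog (@mdeg n) d p) = 0.
  by apply: cone_hom (char0_ext iota) _ _ => c c0; exact: H.
apply/in_idealP => -[[d N]|[]].
  pose c (N : KK d.+1) := Ell iota (inl (existT (fun d => KK d.+1) d N)) p.
  refine (@monomials_independent R g m m1 d.+1 {ffun 'I_g -> 'I_m * 'I_d.+1} c
     (@nu g m d.+1) (@tot g m d.+1) tau ts (cd d.+1) _ N) => z.
  exact: etrans (esym (Ell_hom d p (theta_on_Am1 z ts ht))) (hz z d.+1).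
by rewrite Ell_const -(pihomog0 p (pt (fun a : B => th a tau 0))).
Qed.

End ThetaPoints.

(** * Polynomials vanishing on gradients *)

Section DoubleOrthogonal.
Variables (F : fieldType) (n : nat) (V : 'rV[F]_n -> Prop).
Hypotheses (V0 : V 0) (VD : forall v w, V v -> V w -> V (v + w)) (VZ : forall c v, V v -> V (c *: v)).

(** A largest independent family of elements of V, taken as the rows of A, spans V, and the columns
    of the cokernel of A test membership. *)
Lemma double_orthogonal (u : 'rV[F]_n) :
  (forall v : 'cV[F]_n, (forall w, V w -> w *m v = 0) -> u *m v = 0) -> V u.
Proof.
move=> Hu; pose P r := `[< exists A : 'M[F]_(r, n), (forall i, V (row i A)) /\ \rank A = r >].
have exP : exists r, P r.
  exists 0%N; apply/asboolP; exists 0; split; [by case|exact: mxrank0].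
have bP r : P r -> (r <= n)%N by case/asboolP=> A [_ <-]; exact: rank_leq_col.
case: (ex_maxnP exP bP) => r /asboolP[A [AV Ar]] rmax.
have VA w : V w -> (w <= A)%MS.
  move=> Vw; apply: contrapT => /negP nw.
  have : P (r + 1)%N.
    apply/asboolP; exists (col_mx A w); split.
      move=> i; case: (splitP i) => j ij.
        by rewrite (_ : i = lshift 1 j) ?rowKu //; exact: val_inj.
      have -> : i = rshift r j by exact: val_inj.
      by rewrite rowKd row_id.
    have h : (\rank A < \rank (col_mx A w))%N.
      rewrite -addsmxE; apply: rank_ltmx; rewrite ltmxE addsmxSl /=.
      by apply: contra nw; apply: submx_trans; exact: addsmxSr.
    by rewrite Ar in h; apply/eqP; rewrite eqn_leq rank_leq_row /=; apply: (leq_trans _ h); rewrite addn1.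
  by move/rmax; rewrite addn1 ltnn.
have /submxP[D ->] : (u <= A)%MS.
  rewrite submxE; apply/eqP/matrixP => a j; rewrite (ord1 a).
  have := Hu (col j (cokermx A)); rewrite colE mulmxA => H.
  have : u *m cokermx A *m delta_mx j (ord0 : 'I_1) = 0.
    by rewrite -[LHS]mulmxA mulmxA; apply: H => w /VA; rewrite submxE => /eqP h; rewrite mulmxA h mul0mx.
  move=> e; have := congr1 (fun M : 'M[F]_1 => M ord0 ord0) e; rewrite -colE !mxE => ->; by rewrite ?mxE.
rewrite mulmx_sum_row; elim/big_ind: _ => // i _; exact: VZ.
Qed.
End DoubleOrthogonal.

Section MpolyLinear.
Variables (k L : fieldType) (iota : {rmorphism k -> L}) (n : nat).

Lemma meval_sum (F : comNzRingType) (I : Type) (s : seq I) (Q : pred I) (f : I -> mpoly n F) (x : 'I_n -> F) :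
  meval x (\sum_(i <- s | Q i) f i) = \sum_(i <- s | Q i) meval x (f i).
Proof. exact: (raddf_sum (meval x)). Qed.

Lemma map_mpoly_sum (I : Type) (s : seq I) (Q : pred I) (f : I -> mpoly n k) :
  map_mpoly iota (\sum_(i <- s | Q i) f i) = \sum_(i <- s | Q i) map_mpoly iota (f i).
Proof. exact: (raddf_sum (map_mpoly iota)). Qed.

Lemma mderiv_sum (F : comNzRingType) (I : Type) (s : seq I) (Q : pred I) (f : I -> mpoly n F) j :
  mderiv j (\sum_(i <- s | Q i) f i) = \sum_(i <- s | Q i) mderiv j (f i).
Proof. exact: (raddf_sum (mderiv j)). Qed.

Lemma msum_widen (F : fieldType) N (p : mpoly n F) (h : multinom n -> F) : (msize p <= N)%N ->
  \sum_(J <- msupp p) mcoeff J p * h J = \sum_(J : bmultinom n N) mcoeff (bmnm J) p * h (bmnm J).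
Proof.
move=> le; pose I : subFinType _ := bmultinom n N.
rewrite (ssrcomplements.big_mksub I) ?msupp_uniq //=; last by move=> x /msize_mdeg_lt /leq_trans; apply.
by rewrite big_rmcond //= => j /memN_msupp_eq0 ->; rewrite mul0r.
Qed.

Lemma msum_split r (y : 'I_r -> L) (P : 'I_r -> mpoly n k) (h : multinom n -> k) (p : mpoly n L) :
  p = \sum_j y j *: map_mpoly iota (P j) ->
  \sum_(J <- msupp p) mcoeff J p * iota (h J) =
  \sum_j y j * iota (\sum_(J <- msupp (P j)) mcoeff J (P j) * h J).
Proof.
move=> pE; pose N := maxn (msize p) (\max_j msize (P j)).
have hN j : (msize (P j) <= N)%N by rewrite leq_max (leq_bigmax j) orbT.
rewrite (msum_widen (N := N)) ?leq_maxl //.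
under [RHS]eq_bigr do rewrite (msum_widen _ (hN _)) rmorph_sum mulr_sumr.
rewrite exchange_big; apply: eq_bigr => J _ /=.
rewrite pE raddf_sum mulr_suml; apply: eq_bigr => j _ /=.
by rewrite mcoeffZ mcoeff_map_mpoly rmorphM mulrA.
Qed.

Lemma msum_map (P : mpoly n k) (h : multinom n -> k) :
  \sum_(J <- msupp (map_mpoly iota P)) mcoeff J (map_mpoly iota P) * iota (h J) =
  iota (\sum_(J <- msupp P) mcoeff J P * h J).
Proof.
rewrite (@msum_split 1 (fun=> 1) (fun=> P)) ?big_ord1 ?mul1r //.
by rewrite scale1r.
Qed.

(** The scalar c is expanded along the same basis; with c = 1 this ties the basis to k in
    [divides_descent]. *)
Lemma mpoly_split (p : mpoly n L) (c : L) :
  exists r (y : 'I_r -> L) (P : 'I_r -> mpoly n k) (b : 'I_r -> k),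
  [/\ p = \sum_j y j *: map_mpoly iota (P j), c = \sum_j y j * iota (b j)
    & forall a : 'I_r -> k, \sum_j iota (a j) * y j = 0 -> forall j, a j = 0].
Proof.
pose s := msupp p; pose J0 (i : 'I_(size s)) := nth mnm0 s i.
pose v (i : option 'I_(size s)) : L := if i is Some i then mcoeff (J0 i) p else c.
have [r [y [a [H ind]]]] := ksplit iota v.
exists r, y, (fun j => \sum_i a (Some i) j *: mpolyX k (J0 i)), (a None); split=> //.
  under eq_bigr do rewrite map_mpoly_sum scaler_sumr.
  rewrite exchange_big {1}[p]mpolyE (big_nth mnm0) big_mkord; apply: eq_bigr => i _ /=.
  rewrite -[mcoeff _ _]/(v (Some i)) H scaler_suml; apply: eq_bigr => j _.
  by rewrite map_mpolyZ map_mpolyX scalerA mulrC.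
by rewrite -[c]/(v None) H; apply: eq_bigr => j _; rewrite mulrC.
Qed.

Lemma split_eq0 r (y : 'I_r -> L) (Q : 'I_r -> mpoly n k) :
  (forall a : 'I_r -> k, \sum_j iota (a j) * y j = 0 -> forall j, a j = 0) ->
  \sum_j y j *: map_mpoly iota (Q j) = 0 -> forall j, Q j = 0.
Proof.
move=> ind H j; apply/mpolyP => J; rewrite mcoeff0.
apply: (ind (fun j => mcoeff J (Q j))).
have := congr1 (mcoeff J) H; rewrite raddf_sum mcoeff0 => {2}<-; apply: eq_bigr => i _ /=.
by rewrite mcoeffZ mcoeff_map_mpoly mulrC.
Qed.

Lemma mderiv_map i (P : mpoly n k) : mderiv i (map_mpoly iota P) = map_mpoly iota (mderiv i P).
Proof.
apply/mpolyP => J; rewrite mcoeff_map_mpoly mcoeff_deriv mcoeff_map_mpoly [in RHS]mcoeff_deriv.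
exact: esym (rmorphMn _ _ _).
Qed.

Lemma meval_map_comp (lq : n.-tuple (mpoly n k)) (A : mpoly n k) (x : 'I_n -> L) :
  meval x (map_mpoly iota (comp_mpoly lq A)) =
  meval (fun i => meval x (map_mpoly iota (tnth lq i))) (map_mpoly iota A).
Proof.
rewrite comp_mpolyE [X in _ = meval _ (map_mpoly iota X)](mpolyE A) !map_mpoly_sum !meval_sum.
apply: eq_bigr => J _; rewrite !map_mpolyZ !mevalZ; congr (_ * _).
rewrite map_mpolyX mevalX !rmorph_prod; apply: eq_bigr => i _.
by rewrite !rmorphXn.
Qed.

Lemma map_mpoly_inj : injective (map_mpoly iota : mpoly n k -> mpoly n L).
Proof.
move=> P Q /mpolyP H; apply/mpolyP => J; apply: (fmorph_inj iota).
by rewrite -!mcoeff_map_mpoly.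
Qed.

End MpolyLinear.

Section DualK.
Variables (g m : nat) (k : fieldType) (t : Bm g m -> Bm g m -> k).
Variables (Lam : Type) (ell : Lam -> multinom (nB g m) -> k).
Local Notation B := (Bm g m).
Local Notation n := (nB g m).
Hypothesis char0 : forall l, (l.+1%:R : k) != 0.
Hypothesis idP : forall (Om : closedFieldType) (iota : {rmorphism k -> Om}) (p : mpoly n Om),
  in_ideal t iota p <-> forall l, \sum_(J <- msupp p) mcoeff J p * iota (ell l J) = 0.

Definition EllK (l : Lam) (P : mpoly n k) : k := \sum_(J <- msupp P) mcoeff J P * ell l J.
Definition Jk (P : mpoly n k) : Prop := forall l, EllK l P = 0.
Definition grad (P : mpoly n k) : n.-tuple (mpoly n k) := [tuple mderiv i P | i < n].
(* the polynomials over k which vanish on all gradients of the ideal at points of A_m *)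
Definition PP (A : mpoly n k) : Prop := forall P, Jk P -> Jk (comp_mpoly (grad P) A).

Lemma Jk_sum r (c : 'I_r -> k) (P : 'I_r -> mpoly n k) :
  (forall j, Jk (P j)) -> Jk (\sum_j c j *: P j).
Proof.
move=> H l.
have := @msum_split k k idfun n r c P (ell l) (\sum_j c j *: P j).
rewrite /EllK => ->; last first.
  apply: eq_bigr => j _; congr (_ *: _); apply/mpolyP => J; rewrite mcoeff_map_mpoly //.
by rewrite big1 // => j _; rewrite /= -/(EllK l (P j)) H mulr0.
Qed.

Section Points.
Variables (Om : closedFieldType) (iota : {rmorphism k -> Om}).

Lemma Jk_ideal P : Jk P <-> in_ideal t iota (map_mpoly iota P).
Proof.
rewrite idP; split=> H l; have := H l; rewrite msum_map; first by move=> h; rewrite -/(EllK l P) h rmorph0.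
by move/eqP; rewrite fmorph_eq0 => /eqP.
Qed.

Lemma ideal_split (p : mpoly n Om) r (y : 'I_r -> Om) (P : 'I_r -> mpoly n k) :
  p = \sum_j y j *: map_mpoly iota (P j) ->
  (forall a : 'I_r -> k, \sum_j iota (a j) * y j = 0 -> forall j, a j = 0) ->
  in_ideal t iota p -> forall j, Jk (P j).
Proof.
move=> pE ind /idP H j l; apply: (ind (fun j => EllK l (P j))).
by have := H l; rewrite (msum_split _ pE) => {2}<-; apply: eq_bigr => i _; rewrite mulrC.
Qed.

Lemma PP_eval A P X : PP A -> Jk P -> on_Am t iota X ->
  meval (fun i => meval (pt X) (map_mpoly iota (mderiv i P))) (map_mpoly iota A) = 0.
Proof.
move=> hA hP hX; have := (Jk_ideal _).1 (hA P hP) X hX; rewrite meval_map_comp => h.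
by rewrite -[RHS]h; apply: meval_eq => i; rewrite tnth_mktuple.
Qed.

(* A polynomial in y_1, ..., y_r vanishing at all natural numbers is zero, so it is
   enough to treat combinations of elements of Jk with natural coefficients. *)
Lemma PP_gradient A (p : mpoly n Om) X : PP A -> in_ideal t iota p -> on_Am t iota X ->
  meval (fun i => meval (pt X) (mderiv i p)) (map_mpoly iota A) = 0.
Proof.
move=> hA hp hX; have [r [y [P [_ [pE _ ind]]]]] := mpoly_split iota p 0.
have hP := ideal_split pE ind hp.
pose b j i := meval (pt X) (map_mpoly iota (mderiv i (P j))).
have ch l : (l.+1%:R : Om) != 0 by rewrite -(rmorph_nat iota) fmorph_eq0 char0.
have claim s : (s <= r)%N -> forall c : 'I_r -> Om, (forall j : 'I_r, (s <= j)%N -> exists l : nat, c j = l%:R) ->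
    meval (fun i => \sum_j c j * b j i) (map_mpoly iota A) = 0.
  elim: s => [|s IH] sr c hc.
    have [l hl] := boolp.choice (fun j => hc j (leq0n j)).
    have := PP_eval hA (@Jk_sum r (fun j => (l j)%:R) P hP) hX => h.
    rewrite -[RHS]h; apply: meval_eq => i.
    rewrite mderiv_sum map_mpoly_sum meval_sum; apply: eq_bigr => j _ /=.
    by rewrite mderivZ map_mpolyZ mevalZ rmorph_nat hl.
  pose j0 := Ordinal sr.
  have [q Hq] := meval_line (map_mpoly iota A) (fun i => \sum_(j | j != j0) c j * b j i) (b j0).
  have E c' : (forall j, j != j0 -> c' j = c j) ->
      q.[c' j0] = meval (fun i => \sum_j c' j * b j i) (map_mpoly iota A).
    move=> hc'; rewrite Hq; apply: meval_eq => i; rewrite [RHS](bigD1 j0) //= addrC; congr (_ + _).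
    by apply: eq_bigr => j jj; rewrite hc'.
  rewrite -E //; suff -> : q = 0 by rewrite horner0.
  apply: poly_nat_eq0 (nat_inj_char0 ch) _ => l.
  pose c' j := if j == j0 then l%:R else c j.
  have -> : l%:R = c' j0 by rewrite /c' eqxx.
  rewrite E => [|j /negbTE jj]; last by rewrite /c' jj.
  apply: IH => [|j js]; first exact: ltnW.
  rewrite /c'; case: eqP => [_|jj]; first by exists l.
  by apply: hc; rewrite ltn_neqAle js andbT; apply/eqP => e; apply: jj; apply: val_inj.
rewrite -[RHS](claim r (leqnn r) y) => [|j]; last by rewrite leqNgt ltn_ord.
apply: meval_eq => i; rewrite {1}pE mderiv_sum meval_sum; apply: eq_bigr => j _ /=.
by rewrite mderivZ mevalZ mderiv_map.
Qed.

(** The gradients at X of the elements of the ideal form a subspace with the tangent space as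
    orthogonal; a hyperplane through the tangent space lies in the double orthogonal. *)
Lemma tangent_gradient u : tangent_hyperplane t iota u -> exists X p,
  [/\ on_Am t iota X, in_ideal t iota p & forall i, pt u i = meval (pt X) (mderiv i p)].
Proof.
case=> [_ [X [hX _] H]].
pose V (w : 'rV[Om]_n) := exists2 p, in_ideal t iota p & forall i, w ord0 i = meval (pt X) (mderiv i p).
have [||||p hp E] := @double_orthogonal Om n V _ _ _ (\row_i pt u i).
- by exists 0 => [Y _|i]; rewrite ?meval0 // mxE mderiv0 meval0.
- move=> v w [p hp vE] [q hq wE]; exists (p + q) => [Y hY|i].
    by rewrite mevalD hp // hq // addr0.
  by rewrite mxE vE wE mderivD mevalD.
- move=> c v [p hp vE]; exists (c *: p) => [Y hY|i].
    by rewrite mevalZ hp // mulr0.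
  by rewrite mxE vE mderivZ mevalZ.
- move=> v hv; apply/matrixP => a b; rewrite !mxE (ord1 a) (ord1 b).
  rewrite (reindex (@enum_rank B)) /=; last by apply/onW_bij/enum_rank_bij.
  rewrite -[RHS](H (fun a => v (enum_rank a) ord0)).
    by apply: eq_bigr => i _; rewrite !mxE /pt enum_rankK.
  move=> p hp; have /hv : V (\row_i meval (pt X) (mderiv i p)) by exists p => // i; rewrite mxE.
  move=> e; have := congr1 (fun M : 'M[Om]_1 => M ord0 ord0) e; rewrite !mxE => h; rewrite -[RHS]h.
  rewrite [RHS](reindex (@enum_rank B)) /=; last by apply/onW_bij/enum_rank_bij.
  by apply: eq_bigr => i _; rewrite !mxE.
by exists X, p; split=> // i; rewrite -E mxE.
Qed.

Lemma PP_tangent A u : PP A -> tangent_hyperplane t iota u -> meval (pt u) (map_mpoly iota A) = 0.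
Proof.
move=> hA /tangent_gradient[X [p [hX hp E]]].
by rewrite -[RHS](PP_gradient hA hp hX); apply: meval_eq => i.
Qed.

(** For fixed P over k, substituting the gradient of P in D is linear in D, so the results for the A
    j are the components over k of the result for D; membership in the ideal passes to
    components. *)
Lemma PP_split (D : mpoly n Om) r (y : 'I_r -> Om) (A : 'I_r -> mpoly n k) :
  D = \sum_j y j *: map_mpoly iota (A j) ->
  (forall a : 'I_r -> k, \sum_j iota (a j) * y j = 0 -> forall j, a j = 0) ->
  (forall P, Jk P -> forall q : mpoly n Om,
     (forall X, meval X q = meval (fun i => meval X (mderiv i (map_mpoly iota P))) D) ->
     in_ideal t iota q) ->
  forall j, PP (A j).
Proof.
move=> DE ind H j P hP; move: j; apply: (ideal_split erefl ind).
apply: (H P hP) => X; rewrite DE !meval_sum; apply: eq_bigr => j _ /=.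
rewrite !mevalZ meval_map_comp; congr (_ * _); apply: meval_eq => i.
by rewrite tnth_mktuple mderiv_map.
Qed.

End Points.
End DualK.

(** * Hyperplanes containing a tangent space *)

Section Jets.
Variables (R : realType).
Local Notation C := R[i].

(** The expansion c0 + c1 s + O(s^2) at 0. Radii at most 1 allow the remainder of a product to be
    bounded through the coefficients. *)
Definition jet (f : C -> C) (c0 c1 : C) : Prop := exists M d : R,
  [/\ 0 <= M, 0 < d, d <= 1 & forall s, nrm s <= d -> nrm (f s - (c0 + c1 * s)) <= M * nrm s ^+ 2].

Lemma jet_eq f h c0 c1 : f =1 h -> jet f c0 c1 -> jet h c0 c1.
Proof. by move=> E [M [d [M0 d0 d1 H]]]; exists M, d; split=> // s; rewrite -E; exact: H. Qed.

Lemma jet_lin c0 c1 : jet (fun s => c0 + c1 * s) c0 c1.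
Proof.
exists 0, 1; split; rewrite ?ltr01 // => s _.
by rewrite subrr Normc.normc0 mul0r.
Qed.

Lemma jet_cst c : jet (fun=> c) c 0.
Proof. by apply: jet_eq (jet_lin c 0) => s; rewrite mul0r addr0. Qed.

Lemma jet_pserc (rho : R) a f : 0 < rho -> pserc rho a f -> jet f (a 0%N) (a 1%N).
Proof.
move=> r0 Ha; have [M M0 HM] := pserc_head 2 r0 Ha.
exists M, (Num.min rho 1); split=> //; first by rewrite lt_min r0 ltr01.
  by rewrite ge_min lexx orbT.
move=> s; rewrite le_min => /andP[s1 s2]; have := HM s s1.
by rewrite !big_ord_recr big_ord0 /= add0r expr0 expr1 mulr1.
Qed.

Lemma jetD f h a b c d : jet f a b -> jet h c d -> jet (fun s => f s + h s) (a + c) (b + d).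
Proof.
move=> [M [e [M0 e0 e1 H]]] [M' [e' [M'0 e'0 e'1 H']]].
exists (M + M'), (Num.min e e'); split; rewrite ?addr_ge0 // ?lt_min ?e0 // ?ge_min ?e1 //.
move=> s; rewrite le_min => /andP[/H h1 /H' h2].
have -> : f s + h s - (a + c + (b + d) * s) = (f s - (a + b * s)) + (h s - (c + d * s)) by ring.
by rewrite mulrDl; apply: le_trans (le_normcD _ _) _; apply: lerD.
Qed.

Lemma jetM f h a b c d : jet f a b -> jet h c d -> jet (fun s => f s * h s) (a * c) (a * d + b * c).
Proof.
move=> [M [e [M0 e0 e1 H]]] [M' [e' [M'0 e'0 e'1 H']]].
pose K := nrm c + nrm d.
have K0 : 0 <= K by rewrite addr_ge0 ?nrm_ge0.
pose K' := nrm a + nrm b + M.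
have K'0 : 0 <= K' by rewrite !addr_ge0 ?nrm_ge0.
exists (K' * M' + M * K + nrm b * nrm d), (Num.min e e'); split; rewrite ?addr_ge0 ?mulr_ge0 ?nrm_ge0 // ?lt_min ?e0 // ?ge_min ?e1 //.
move=> s; rewrite le_min => /andP[se se']; have h1 := H s se; have h2 := H' s se'.
have s1 : nrm s <= 1 by exact: le_trans se e1.
have s0 := nrm_ge0 s.
have s2 : nrm s ^+ 2 <= 1 by rewrite expr_le1.
have -> : f s * h s - (a * c + (a * d + b * c) * s) =
  f s * (h s - (c + d * s)) + (f s - (a + b * s)) * (c + d * s) + b * d * s ^+ 2 by ring.
have hf : nrm (f s) <= K'.
  have -> : f s = a + b * s + (f s - (a + b * s)) by ring.
  apply: le_trans (le_normcD _ _) _; apply: lerD; last first.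
    by apply: le_trans h1 _; rewrite ler_piMr.
  apply: le_trans (le_normcD _ _) _; apply: lerD => //.
  by rewrite Normc.normcM ler_piMr ?nrm_ge0.
have hh : nrm (c + d * s) <= K.
  apply: le_trans (le_normcD _ _) _; apply: lerD => //.
  by rewrite Normc.normcM ler_piMr ?nrm_ge0.
rewrite (mulrDl (K' * M' + M * K)) (mulrDl (K' * M')); apply: le_trans (le_normcD _ _) _; apply: lerD; last by rewrite (Normc.normcM (b * d)) (Normc.normcM b) nrmX.
apply: le_trans (le_normcD _ _) _; apply: lerD; rewrite Normc.normcM.
  by rewrite -mulrA; apply: ler_pM; rewrite ?nrm_ge0.
by rewrite mulrAC; apply: ler_pM; rewrite ?nrm_ge0.
Qed.

Lemma jet_sum (I : Type) (s : seq I) (f : I -> C -> C) (a b : I -> C) :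
  (forall i, jet (f i) (a i) (b i)) ->
  jet (fun z => \sum_(i <- s) f i z) (\sum_(i <- s) a i) (\sum_(i <- s) b i).
Proof.
move=> H; elim: s => [|i s IH].
  by rewrite !big_nil; apply: jet_eq (jet_cst 0) => z; rewrite big_nil.
by rewrite !big_cons; apply: jet_eq (jetD (H i) IH) => z; rewrite big_cons.
Qed.

Lemma jet0 c0 c1 : jet (fun=> 0) c0 c1 -> c0 = 0 /\ c1 = 0.
Proof.
move=> [M [d [M0 d0 d1 H]]].
have c00 : c0 = 0.
  have := H 0; rewrite Normc.normc0 expr0n mulr0 addr0 mulr0 sub0r => /(_ (ltW d0)).
  by rewrite normcN => h; apply: Normc.eq0_normc; apply/eqP; rewrite eq_le h nrm_ge0.
split=> //; apply: Normc.eq0_normc; apply/eqP/contraT => n0.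
have p0 : 0 < nrm c1 by rewrite lt_neqAle eq_sym n0 nrm_ge0.
pose x := Num.min d (nrm c1 / (M + 1) / 2).
have M1 : 0 < M + 1 by rewrite ltr_wpDl.
have x0 : 0 < x by rewrite lt_min d0 !divr_gt0.
have [xd xc] : x <= d /\ x <= nrm c1 / (M + 1) / 2 by rewrite /x !ge_min !lexx orbT.
have := H (toC x); rewrite nrm_toC gtr0_norm // => /(_ xd).
rewrite c00 !add0r normcN Normc.normcM nrm_toC gtr0_norm // expr2 mulrA ler_pM2r // => h.
have : M * x <= M * (nrm c1 / (M + 1) / 2) by rewrite ler_wpM2l.
have : M * (nrm c1 / (M + 1) / 2) <= nrm c1 / 2.
  rewrite mulrA ler_pM2r // mulrCA ler_piMr //; first exact: ltW.
  by rewrite ler_pdivrMr // mul1r ler_wpDr.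
by lra.
Qed.

Lemma jet_meval n (f : 'I_n -> C -> C) (a b : 'I_n -> C) : (forall i, jet (f i) (a i) (b i)) ->
  forall P : mpoly n C, jet (fun s => meval (fun i => f i s) P) (meval a P)
    (\sum_i meval a (mderiv i P) * b i).
Proof.
move=> H P.
pose ok (P : mpoly n C) := jet (fun s => meval (fun i => f i s) P) (meval a P) (\sum_i meval a (mderiv i P) * b i).
have okC c : ok (mpolyC n c).
  rewrite /ok mevalC big1 => [|i _]; last by rewrite mderivC meval0 mul0r.
  by apply: jet_eq (jet_cst c) => s; rewrite mevalC.
have okD p q : ok p -> ok q -> ok (p + q).
  rewrite /ok => hp hq; rewrite mevalD.
  have -> : \sum_i meval a (mderiv i (p + q)) * b i =
    \sum_i meval a (mderiv i p) * b i + \sum_i meval a (mderiv i q) * b i.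
    by rewrite -big_split; apply: eq_bigr => i _; rewrite mderivD mevalD mulrDl.
  by apply: jet_eq (jetD hp hq) => s; rewrite mevalD.
have okM p q : ok p -> ok q -> ok (p * q).
  rewrite /ok => hp hq; rewrite mevalM.
  have -> : \sum_i meval a (mderiv i (p * q)) * b i =
    meval a p * (\sum_i meval a (mderiv i q) * b i) + (\sum_i meval a (mderiv i p) * b i) * meval a q.
    rewrite mulr_sumr mulr_suml -big_split; apply: eq_bigr => i _ /=.
    rewrite mderivM mevalD !mevalM.
    move: (meval a p) (meval a q) (meval a _) (meval a _) => x y x' y'; ring.
  by apply: jet_eq (jetM hp hq) => s; rewrite mevalM.
have okX i : ok (mpolyX C (mnm1 i)).
  rewrite /ok mevalXU (bigD1 i) //= big1 => [|j ji]; last first.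
    by rewrite mderivX mnm1E eq_sym (negbTE ji) scale0r meval0 mul0r.
  rewrite mderivX mnm1E eqxx scale1r (_ : mnm_sub _ _ = mnm0); last first.
    by apply/mnmP => j; rewrite mnmBE mnm0E subnn.
  by rewrite mpolyX0 meval1 mul1r addr0; apply: jet_eq (H i) => s; rewrite mevalXU.
suff : ok P by [].
have ok0 : ok 0 by rewrite -(mpolyC0 n C); exact: okC.
have ok1 : ok 1 by rewrite -(mpolyC1 n C); exact: okC.
rewrite [P]mpolyE; apply: (big_ind ok ok0 okD) => J _.
rewrite -mul_mpolyC; apply: (okM _ _ (okC _)).
rewrite mpolyXE_id; apply: (big_ind ok ok1 okM) => i _.
elim: (J i) => [|l IH]; first by rewrite expr0.
by rewrite exprS; exact: okM (okX i) IH.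
Qed.
End Jets.

Lemma meval_homog (F : fieldType) n d (p : mpoly n F) (x : 'I_n -> F) c : homogeneous d p ->
  meval (fun i => c * x i) p = c ^+ d * meval x p.
Proof.
move=> /dhomogP h; rewrite !mevalE mulr_sumr; apply: eq_big_seq => J /h /= dJ.
by rewrite mulrCA -dJ mdegE -prodrXr -big_split; congr (_ * _); apply: eq_bigr => i _; rewrite exprMn.
Qed.

Lemma sum_pt (g m : nat) (A : nmodType) (f : 'I_(nB g m) -> A) :
  \sum_a f (enum_rank (a : Bm g m)) = \sum_i f i.
Proof. by rewrite [RHS](reindex (@enum_rank (Bm g m))) //; apply/onW_bij/enum_rank_bij. Qed.

Section Kernel.
Variables (R : realType) (g m : nat).
Hypotheses (m2 : ~~ odd m) (m4 : (4 <= m)%N).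
Let m1 : (1 < m)%N. Proof. exact: leq_trans m4. Qed.
Local Notation C := R[i].
Local Notation B := (Bm g m).
Local Notation n := (nB g m).
Local Notation S := (@S R g m).
Variable tau : 'M[C]_g.
Hypothesis ts : siegel tau.

Lemma S_jet p z j : bdd p -> jet (fun s => S p tau (z + s *: e_ R j)) (S p tau z) (dz_ j (S p tau) z).
Proof.
move=> bp; have [a pa a1] := S_line m1 z (e_ R j) ts bp (@ltr01 R).
have E0 : a 0%N = S p tau z.
  have [M [d [M0 d0 d1 H]]] := jet_pserc ltr01 pa.
  have := H 0; rewrite Normc.normc0 expr0n mulr0 addr0 mulr0 scale0r addr0 => /(_ (ltW d0)) h.
  by apply/eqP; rewrite eq_sym -subr_eq0; apply/eqP/Normc.eq0_normc/eqP; rewrite eq_le h nrm_ge0.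
have E1 : a 1%N = dz_ j (S p tau) z.
  rewrite a1 dz_S //; congr (_ * _); apply: S_ext => N; congr (_ * _).
  rewrite /dt (bigD1 j) //= big1 ?addr0 => [|i /negbTE ij]; rewrite /e_ !mxE.
    by rewrite !eqxx mulr1.
  by rewrite ij andbF mulr0.
by rewrite -E0 -E1; exact: jet_pserc ltr01 pa.
Qed.

Lemma th_SE (a : B) : th a tau = S (clind R a) tau.
Proof. by apply/funext => z; rewrite th_S. Qed.

Lemma th_jet (a : B) z j : jet (fun s => th a tau (z + s *: e_ R j)) (th a tau z) (dz_ j (th a tau) z).
Proof. by rewrite th_SE; exact: S_jet (bdd_clind _ _). Qed.

(** Both sides are the linear coefficient of one function along e_j, and jets are unique. *)
Lemma dz_Th (u : B -> C) z j : dz_ j (Th u tau) z = \sum_a u a * dz_ j (th a tau) z.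
Proof.
have h1 : jet (fun s => Th u tau (z + s *: e_ R j)) (Th u tau z) (dz_ j (Th u tau) z).
  have -> : Th u tau = S (fun N => u (cl m N)) tau by apply/funext => z'; rewrite Th_S.
  exact: S_jet (bdd_cl _).
have h2 : jet (fun s => Th u tau (z + s *: e_ R j)) (Th u tau z) (\sum_a u a * dz_ j (th a tau) z).
  rewrite /Th; apply: jet_sum => a.
  have := jetM (jet_cst (u a)) (th_jet a z j); rewrite mul0r addr0; exact.
have := jetD h1 (jetM (jet_cst (-1)) h2) => h3.
have [_ /eqP] : Th u tau z + -1 * Th u tau z = 0 /\
   dz_ j (Th u tau) z + (-1 * (\sum_a u a * dz_ j (th a tau) z) + 0 * Th u tau z) = 0.
  by apply: jet0; apply: jet_eq h3 => s; rewrite mulN1r subrr.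
by rewrite mul0r addr0 mulN1r subr_eq0 => /eqP.
Qed.

(* the hyperplanes u containing the tangent space of A_tau at the image of z *)
Definition W (z : 'rV[C]_g) (u : B -> C) : Prop :=
  \sum_a u a * th a tau z = 0 /\ forall j, \sum_a u a * dz_ j (th a tau) z = 0.

Lemma singular_W u : singular_fiber u tau <-> exists z, W z u.
Proof.
split=> [[z h1 h2]|[z [h1 h2]]]; exists z => //; first by split=> // j; rewrite -dz_Th.
by move=> j; rewrite dz_Th.
Qed.

(** P vanishes on the cone over the theta embedding: differentiating along the ray gives Euler's
    relation, which is the first condition, and differentiating along z_j gives the others. *)
Lemma gradient_W (P : mpoly n C) (c : C) z : c != 0 ->
  (forall c z, c != 0 -> meval (fun i => c * pt (fun a : B => th a tau z) i) P = 0) ->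
  W z (fun a => meval (fun i => c * pt (fun a : B => th a tau z) i) (mderiv (enum_rank a) P)).
Proof.
move=> c0 H; pose X i := c * pt (fun a : B => th a tau z) i.
split.
  pose f (i : 'I_n) (s : C) := X i + X i * s.
  have h : jet (fun s => meval (fun i => f i s) P) (meval X P) (\sum_i meval X (mderiv i P) * X i).
    by apply: jet_meval => i; exact: jet_lin.
  have h' : jet (fun=> 0) (meval X P) (\sum_i meval X (mderiv i P) * X i).
    have [M [d [M0 d0 d1 HM]]] := h.
    exists M, (d / 2); split=> //; rewrite ?divr_gt0 //; first lra.
    move=> s sd; have := HM s; rewrite (_ : meval _ P = 0) => [|]; first by apply; lra.
    have s1 : c * (1 + s) != 0.
      rewrite mulf_neq0 //; apply/eqP => e; have e' : s = -1 by rewrite -sub0r -e addrC addKr.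
      by move: sd; rewrite e' normcN Normc.normc1; lra.
    rewrite -[RHS](H _ z s1); apply: meval_eq => i; rewrite /f /X; ring.
  have [_ e] := jet0 h'.
  have : c * (\sum_(a : B) meval X (mderiv (enum_rank a) P) * th a tau z) = 0.
    rewrite -[RHS]e -sum_pt mulr_sumr; apply: eq_bigr => a _.
    by rewrite /X /pt enum_rankK; move: (meval _ _) (th a tau z) => x y; ring.
  by move/eqP; rewrite mulf_eq0 (negbTE c0) => /eqP.
move=> j.
have h : jet (fun=> 0) (meval X P) (\sum_i meval X (mderiv i P) * (c * dz_ j (th (enum_val i) tau) z)).
  apply: jet_eq (jet_meval (f := fun i s => c * th (enum_val i) tau (z + s *: e_ R j)) _ P); last first.
    move=> i; have := jetM (jet_cst c) (th_jet (enum_val i) z j); rewrite mul0r addr0; exact.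
  by move=> s; exact: (H c (z + s *: e_ R j) c0).
have [_ e] := jet0 h.
have : c * (\sum_(a : B) meval X (mderiv (enum_rank a) P) * dz_ j (th a tau) z) = 0.
  rewrite -[RHS]e -sum_pt mulr_sumr; apply: eq_bigr => a _.
  by rewrite enum_rankK; move: (meval _ _) (dz_ j _ z) => x y; ring.
by move/eqP; rewrite mulf_eq0 (negbTE c0) => /eqP.
Qed.

Hypothesis gd : gdet m tau != 0.

(** Its left kernel is W z, and its rank is g + 1 by [immersion]. *)
Definition Psi (z : 'rV[C]_g) : 'M[C]_(n, g.+1) :=
  \matrix_(i, j) if unlift ord0 j is Some j' then dz_ j' (th (enum_val i) tau) z
                 else th (enum_val i : B) tau z.

Lemma W_Psi z u : W z u <-> (\row_i pt u i) *m Psi z = 0.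
Proof.
split=> [[h1 h2]|H].
  apply/rowP => j; rewrite !mxE; case: (unliftP ord0 j) => [j'|] ->.
    rewrite -[RHS](h2 j') -sum_pt; apply: eq_bigr => a _.
    by rewrite !mxE liftK /pt enum_rankK.
  rewrite -[RHS]h1 -sum_pt; apply: eq_bigr => a _.
  by rewrite !mxE unlift_none /pt enum_rankK.
split=> [|j].
  have := congr1 (fun M : 'rV_g.+1 => M ord0 ord0) H; rewrite !mxE => h.
  rewrite -[RHS]h -sum_pt; apply: eq_bigr => a _.
  by rewrite !mxE unlift_none /pt enum_rankK.
have := congr1 (fun M : 'rV_g.+1 => M ord0 (lift ord0 j)) H; rewrite !mxE => h.
rewrite -[RHS]h -sum_pt; apply: eq_bigr => a _.
by rewrite !mxE liftK /pt enum_rankK.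
Qed.

Lemma gradient_Psi (P : mpoly n C) (c : C) z : c != 0 ->
  (forall c z, c != 0 -> meval (fun i => c * pt (fun a : B => th a tau z) i) P = 0) ->
  (\row_i meval (pt (fun a : B => c * th a tau z)) (mderiv i P)) *m Psi z = 0.
Proof.
move=> c0 H; have /W_Psi E := gradient_W z c0 H.
rewrite -[RHS]E; congr (_ *m _); apply/rowP => j.
by rewrite !mxE /pt enum_valK.
Qed.

Lemma Psi_full z : row_full (Psi z).
Proof.
suff : row_free (Psi z)^T by rewrite /row_free /row_full mxrank_tr.
apply: inj_row_free => v vM.
have [|v0 v1] := @immersion R g m m2 m4 tau z (v ord0 ord0) (fun j => v ord0 (lift ord0 j)) ts gd.
  move=> a; have := congr1 (fun M : 'rV_n => M ord0 (enum_rank a)) vM; rewrite !mxE big_ord_recl => h.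
  rewrite -[RHS]h; congr (_ + _).
    by rewrite !mxE unlift_none enum_rankK.
  by apply: eq_bigr => j _; rewrite !mxE liftK enum_rankK.
by apply/rowP => j; rewrite mxE; case: (unliftP ord0 j) => [j'|] ->.
Qed.

Definition pmx p q (A : C -> 'M[C]_(p, q)) : Prop := forall i j, pser 1 (fun s => A s i j).

Lemma pmx_mul p q r (A : C -> 'M[C]_(p, q)) (D : C -> 'M[C]_(q, r)) :
  pmx A -> pmx D -> pmx (fun s => A s *m D s).
Proof.
move=> hA hD i j; apply: pser_ext (@pser_sum _ 1 _ (index_enum 'I_q) xpredT (fun l s => A s i l * D s l j) _) => [s|l].
  by rewrite mxE.
exact: pserM.
Qed.

Lemma pmx_det p (A : C -> 'M[C]_p) : pmx A -> pser 1 (fun s => \det (A s)).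
Proof.
move=> hA; apply: pser_ext (@pser_sum _ 1 _ (index_enum {perm 'I_p}) xpredT
  (fun s z => (-1) ^+ s * \prod_i A z i (s i)) _) => // s.
apply: pserZ; apply: pser_ext (@pser_prod _ 1 _ (index_enum 'I_p) xpredT (fun i z => A z i (s i)) _) => //.
Qed.

Lemma pmx_adj p (A : C -> 'M[C]_p) : pmx A -> pmx (fun s => \adj (A s)).
Proof.
move=> hA i j; apply: (@pser_ext _ _ (fun s => (-1) ^+ (j + i) * \det (row' j (col' i (A s))))).
  by move=> s; rewrite mxE.
apply: pserZ; apply: (@pmx_det _ (fun s => row' j (col' i (A s)))) => a b.
by apply: pser_ext (hA (lift j a) (lift i b)) => s; rewrite !mxE.
Qed.

Lemma Psi_pmx z v : pmx (fun s => Psi (z + s *: v)).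
Proof.
move=> i j; case: (unliftP ord0 j) => [j'|] ->.
  apply: (@pser_ext _ _ (fun s => 2%:R * toC pi * iC R *
     S (fun N => clind R (enum_val i : B) N * (N j')%:~R) tau (z + s *: v))).
    by move=> s; rewrite mxE liftK th_SE dz_S //; exact: bdd_clind.
  apply: pserZ; apply: S_pser => //; apply: bddM (bdd_clind _ _) (bdd_coord _ _).
apply: (@pser_ext _ _ (fun s => S (clind R (enum_val i : B)) tau (z + s *: v))).
  by move=> s; rewrite mxE unlift_none th_SE.
by apply: S_pser => //; exact: bdd_clind.
Qed.

(* Cramer's rule extends an element of W z0 to the line z + s v *)
Lemma W_lift z v (s0 : C) (u : 'rV[C]_n) : u *m Psi (z + s0 *: v) = 0 ->
  exists w : C -> 'rV[C]_n, [/\ pmx w, w s0 = u & forall s, w s *m Psi (z + s *: v) = 0].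
Proof.
move=> Hu; pose f := fullrankfun (Psi_full (z + s0 *: v)).
pose M s := rowsub f (Psi (z + s *: v)).
have d0 : \det (M s0) != 0 by rewrite -unitfE -unitmxE fullrowsub_unit.
pose E : 'M[C]_(g.+1, n) := rowsub f 1%:M.
have ME s : M s = E *m Psi (z + s *: v) by rewrite /M rowsubE.
have pM : pmx M.
  move=> i j; apply: (@pser_ext _ _ (fun s => Psi (z + s *: v) (f i) j)); last exact: Psi_pmx.
  by move=> s; rewrite /M [RHS]mxE.
pose w1 s := \det (M s) *: u - u *m Psi (z + s *: v) *m \adj (M s) *m E.
exists (fun s => (\det (M s0))^-1 *: w1 s); split.
- have cst p q (A : 'M[C]_(p, q)) : pmx (fun=> A) by move=> i j; exact: pser_cst.
  move=> i j; apply: (@pser_ext _ _ (fun s => (\det (M s0))^-1 * (\det (M s) * u i j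
     - (u *m Psi (z + s *: v) *m \adj (M s) *m E) i j))).
    by move=> s; rewrite /w1 !mxE.
  apply: pserZ; apply: pserB; first by apply: pserM (pmx_det pM) (pser_cst _ _).
  apply: (pmx_mul (D := fun=> E)) => //; apply: pmx_mul (pmx_adj pM).
  exact: (pmx_mul (A := fun=> u)) (Psi_pmx z v).
- by rewrite /w1 Hu !mul0mx subr0 scalerA mulVf // scale1r.
move=> s; rewrite -scalemxAl /w1 mulmxBl -scalemxAl -!mulmxA -ME mul_adj_mx mulmxA.
by rewrite mul_mx_scalar subrr scaler0.
Qed.

(** Extend u1 from the parameter 0 and u2 from the parameter 1 by [W_lift], and interpolate; this
    stays in the W spaces because they are linear. *)
Lemma W_path z1 u1 z2 u2 : W z1 u1 -> W z2 u2 ->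
  exists w : C -> B -> C, [/\ forall a, pser 1 (fun s => w s a), w 0 = u1, w 1 = u2
    & forall s, W (z1 + s *: (z2 - z1)) (w s)].
Proof.
move=> /W_Psi h1 /W_Psi h2.
have [|w1 [p1 e1 H1]] := @W_lift z1 (z2 - z1) 0 (\row_i pt u1 i); first by rewrite scale0r addr0.
have [|w2 [p2 e2 H2]] := @W_lift z1 (z2 - z1) 1 (\row_i pt u2 i).
  by rewrite scale1r addrC subrK.
exists (fun s a => (1 - s) * w1 s ord0 (enum_rank a) + s * w2 s ord0 (enum_rank a)); split.
- move=> a; apply: pserD; apply: pserM; [|exact: p1|exact: pser_id|exact: p2].
  exact: pserB (pser_cst _ _) (pser_id _).
- by apply/funext => a; rewrite subr0 mul1r mul0r addr0 e1 mxE /pt enum_rankK.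
- by apply/funext => a; rewrite subrr mul1r mul0r add0r e2 mxE /pt enum_rankK.
move=> s; apply/W_Psi.
have -> : \row_i pt (fun a => (1 - s) * w1 s ord0 (enum_rank a) + s * w2 s ord0 (enum_rank a)) i =
   (1 - s) *: w1 s + s *: w2 s by apply/rowP => i; rewrite !mxE /pt enum_valK.
by rewrite mulmxDl -!scalemxAl H1 H2 !scaler0 addr0.
Qed.

End Kernel.

(** * The dual variety at a generic period matrix *)

Lemma row_kernel (F : fieldType) p q (A : 'M[F]_(p, q)) : (q < p)%N ->
  exists2 v : 'rV[F]_p, v != 0 & v *m A = 0.
Proof.
move=> qp; have : kermx A != 0.
  rewrite kermx_eq0 /row_free neq_ltn; apply/orP; left.
  exact: leq_ltn_trans (rank_leq_col A) qp.
by case/rowV0Pn => v /sub_kermxP h v0; exists v.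
Qed.

Lemma common_nonroot (F : fieldType) (p q : {poly F}) : injective (fun l : nat => l%:R : F) ->
  p != 0 -> q != 0 -> exists c, [/\ c != 0, p.[c] != 0 & q.[c] != 0].
Proof.
move=> inj p0 q0; apply: contrapT => nex.
have : 'X * (p * q) != 0 by rewrite !mulf_neq0 // polyX_eq0.
case/eqP; apply: poly_nat_eq0 inj _ => l; rewrite !hornerM hornerX.
apply: contrapT => /eqP; rewrite !mulf_eq0 !negb_or => /and3P[c0 c1 c2].
by apply: nex; exists l%:R.
Qed.

Lemma pser_meval (R : realType) (rho : R) n (f : 'I_n -> R[i] -> R[i]) (P : mpoly n R[i]) :
  (forall i, pser rho (f i)) -> pser rho (fun s => meval (fun i => f i s) P).
Proof.
move=> H; apply: (@pser_ext _ _ (fun s => \sum_(J <- msupp P) mcoeff J P * \prod_i f i s ^+ J i)).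
  by move=> s; rewrite mevalE.
apply: pser_sum => J; apply: pserZ; apply: (@pser_prod _ _ _ _ _ (fun i s => f i s ^+ J i)) => i.
exact: pserX.
Qed.

(** * Smooth points and tangent hyperplanes from a characteristic set *)

Section SmoothPoints.
Variables (g m : nat) (k : fieldType) (t : Bm g m -> Bm g m -> k).
Variables (Om : closedFieldType) (iota : {rmorphism k -> Om}) (N : nat).
Local Notation B := (Bm g m).
Local Notation n := (nB g m).
Hypothesis ch : forall l, (l.+1%:R : Om) != 0.
Hypothesis prim : forall P Q : mpoly n Om, in_ideal t iota (P * Q) ->
  in_ideal t iota P \/ in_ideal t iota Q.
Hypothesis hom : forall d (P : mpoly n Om) X, in_ideal t iota P -> on_Am t iota X ->
  meval (pt X) (pihomog (@mdeg n) d P) = 0.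
Hypothesis ne : exists X, on_Am t iota X.
Hypothesis dim : forall D : 'I_n -> bool,
  (forall f : mpoly n Om, in_ideal t iota f ->
     (forall J, mcoeff J f != 0 -> forall i, D i -> J i = 0%N) -> f = 0) ->
  (#|[pred i | ~~ D i]| <= N)%N.

Lemma quadric (a b a' b' d : B) (c : half_chars g) : exists2 f : mpoly n Om, in_ideal t iota f &
  forall X : B -> Om, meval (pt X) f = iota (null_sum t c (a' + d) (b' + d)) * quad_sum c X a b
    - iota (null_sum t c (a + d) (b + d)) * quad_sum c X a' b' \/ a + b <> a' + b'.
Proof.
pose v x : mpoly n Om := mpolyX Om (mnm1 (enum_rank (x : B))).
pose Q x y := \sum_(e : half_chars g) sgn Om c e *: (v (x + half_class m e) * v (y + half_class m e)).
have hQ X x y : meval (pt X) (Q x y) = quad_sum c X x y.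
  rewrite meval_sum; apply: eq_bigr => e _.
  by rewrite mevalZ mevalM /v !mevalXU /pt !enum_rankK.
have [E|nE] := eqVneq (a + b) (a' + b'); last first.
  by exists 0 => [X _|X]; [exact: meval0|right; apply/eqP].
exists (iota (null_sum t c (a' + d) (b' + d)) *: Q a b - iota (null_sum t c (a + d) (b + d)) *: Q a' b').
  by move=> X [_ hX]; rewrite mevalB !mevalZ !hQ hX // subrr.
by move=> X; left; rewrite mevalB !mevalZ !hQ.
Qed.

(** Where the h of [char_set] is nonzero, the pivots satisfy the Jacobian criterion. By [dim] at
    most N variables are free, so the pivots have at least n - N independent gradients; these lie in
    the left kernel of Ps, of dimension n - N, and therefore span it. So u is a combination of
    gradients. *)
Lemma smooth_tangents : exists2 h : mpoly n Om, ~ in_ideal t iota h &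
  forall X, on_Am t iota X -> meval (pt X) h != 0 ->
  forall Ps : 'M[Om]_(n, N), \rank Ps = N ->
  (forall P, in_ideal t iota P -> (\row_i meval (pt X) (mderiv i P)) *m Ps = 0) ->
  forall u, nonzero u -> (\row_i pt u i) *m Ps = 0 -> tangent_hyperplane t iota u.
Proof.
have [X0 hX0] := ne.
have [||||||D [p [h [Hp [[dh hh] nh] Hv Ht Hf]]]] := @char_set Om n ch (in_ideal t iota).
- by move=> a b ha hb X hX; rewrite mevalB ha ?hb ?subr0.
- by move=> a b hb X hX; rewrite mevalM hb ?mulr0.
- by move/(_ X0 hX0)/eqP; rewrite meval1 oner_eq0.
- exact: prim.
- by move=> d P hP X hX; exact: hom.
- by move=> X _; exact: meval0.
exists h => // X XA hX Ps rk Pgrad u u0 uW; split=> //.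
pose A := [pred i | D i]; pose r := #|A|; pose e (i : 'I_r) : 'I_n := enum_val i.
have eD i : D (e i) by have := enum_valP i; rewrite inE.
pose J := \matrix_(i < r, j < n) meval (pt X) (mderiv j (p (e i))).
(* Row i is nonzero at its pivot e i and zero beyond it, so a relation fails at its largest
   pivot. *)
have Jfree : row_free J.
  apply: inj_row_free => v vJ; apply/eqP/contraT => /rV0Pn[i0 vi0].
  have [i vi imax] : exists2 i, v ord0 i != 0 & forall l, v ord0 l != 0 -> (e l <= e i)%N.
    by case: (@arg_maxnP _ i0 (fun i => v ord0 i != 0) (fun i => nat_of_ord (e i)) vi0) => i h1 h2; exists i.
  have := congr1 (fun M : 'rV_n => M ord0 (e i)) vJ; rewrite !mxE (bigD1 i) //= big1.
    rewrite addr0 mxE => /eqP; rewrite mulf_eq0 (negbTE vi) /=.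
    by have [/negbTE -> _] := Ht (pt X) hX (e i) (eD i).
  move=> l li; have [v0|vl] := eqVneq (v ord0 l) 0; first by rewrite v0 mul0r.
  rewrite mxE; have [_ ->] := Ht (pt X) hX (e l) (eD l).
    by rewrite meval0 mulr0.
  rewrite ltn_neqAle imax // andbT; apply: contra li => /eqP h'.
  by apply/eqP/(@enum_val_inj _ A)/val_inj.
exists X; first split=> //.
  exists r, (fun i => p (e i)), h; split=> //; first by move=> i; exact: Hp.
    by split; [exists dh|].
  move=> X' nX' hX' pX'; split=> // a b a' b' d cc E.
  have van := Hv (pt X') hX'.
  have [f hf fE] := quadric a b a' b' d cc; have [fX|//] := fE X'.
  apply/eqP; rewrite -subr_eq0 -fX; apply/eqP; apply: van => // i Di.
  have iA : i \in A by rewrite inE.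
  by have := pX' (enum_rank_in iA i); rewrite /e enum_rankK_in.
move=> v vT.
have JP : J *m Ps = 0.
  apply/row_matrixP => i; rewrite row_mul row0.
  rewrite -[RHS](Pgrad _ (Hp (e i) (eD i)).1); congr (_ *m _); apply/rowP => j.
  by rewrite !mxE.
have uJ : ((\row_i pt u i) <= J)%MS.
  have sJ : (J <= kermx Ps)%MS by apply/sub_kermxP.
  have [_ /esym] := mxrank_leqif_sup sJ; rewrite mxrank_ker rk (eqP Jfree).
  have -> : r == (n - N)%N.
    rewrite eqn_leq; apply/andP; split.
      by have := mxrankS sJ; rewrite mxrank_ker rk (eqP Jfree).
    have fb := dim Hf.
    have := cardC A; rewrite card_ord -/r.
    have -> : #|[predC A]| = #|[pred i | ~~ D i]| by apply: eq_card => i; rewrite !inE.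
    by move: fb; move: #|_| => x; lia.
  by move=> h'; apply: submx_trans h'; apply/sub_kermxP; exact: uW.
have /submxP[E uE] := uJ.
have vJ : J *m (\col_i pt v i) = 0.
  apply/colP => i; rewrite !mxE.
  have := vT (p (e i)) (Hp (e i) (eD i)).1 => E0; rewrite -[RHS]E0.
  rewrite -sum_pt; apply: eq_bigr => a _.
  by rewrite !mxE /pt enum_rankK.
have := congr1 (fun M => (M *m (\col_i pt v i)) ord0 ord0) uE.
rewrite -mulmxA vJ mulmx0 !mxE => E0; rewrite -[RHS]E0 -sum_pt; apply: eq_bigr => a _.
by rewrite !mxE /pt enum_rankK.
Qed.

End SmoothPoints.

Section AtTau.
Variables (R : realType) (g m : nat).
Hypotheses (m2 : ~~ odd m) (m4 : (4 <= m)%N) (g0 : (0 < g)%N).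
Let m1 : (1 < m)%N. Proof. exact: leq_trans m4. Qed.
Local Notation C := R[i].
Local Notation B := (Bm g m).
Local Notation n := (nB g m).
Local Notation KK d := {ffun 'I_g -> 'I_m * 'I_d}.
Variables (k : fieldType) (t : B -> B -> k).
Hypothesis hk : @is_theta_field R g m k t.
Variables (tau : 'M[C]_g) (iota : {rmorphism k -> C}).
Hypotheses (G : generic m tau) (ht : theta_pt t tau iota).
Let ts : siegel tau. Proof. by case: G. Qed.
Let gd : gdet m tau != 0. Proof. by case: G. Qed.
Local Notation Phi z := (pt (fun a : B => th a tau z)).
Local Notation Cc := (R[i] : closedFieldType).

Let ch (l : nat) : (l.+1%:R : C) != 0. Proof. by rewrite pnatr_eq0. Qed.

Lemma nBE : n = (m ^ g)%N.
Proof. by rewrite card_ffun !card_ord Zp_cast. Qed.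

Lemma nB_large : (g.+1 < n)%N.
Proof.
rewrite nBE; apply: leq_trans (_ : 4 ^ g <= _)%N; last by rewrite leq_exp2r.
elim: g g0 => // -[|g' IH] _ //; have := IH isT; rewrite [(4 ^ g'.+2)%N]expnS; lia.
Qed.

(** Count monomials. In g + 2 free variables there are (s + 1)^(g+1) monomials of degree d = (g + 1)
    s whose first g + 1 exponents are at most s, against (m d)^g normal ones, and the choice s = (m
    (g + 1))^g makes the latter number s^(g+1). Some nonzero combination thus has normal form 0 and
    lies in the ideal. *)
Lemma free_bound (D : 'I_n -> bool) :
  (forall f : mpoly n C, in_ideal t iota f ->
     (forall J, mcoeff J f != 0 -> forall i, D i -> J i = 0%N) -> f = 0) ->
  (#|[pred i | ~~ D i]| <= g.+1)%N.
Proof.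
move=> HD; rewrite leqNgt; apply/negP => big.
pose e (j : 'I_g.+2) : 'I_n := @enum_val _ [pred i | ~~ D i] (widen_ord big j).
have eD j : ~~ D (e j) by have := enum_valP (widen_ord big j); rewrite inE.
have einj : injective e by move=> i j /enum_val_inj /(congr1 val) /= h; exact: val_inj.
pose s := ((m * g.+1) ^ g)%N; pose d := (g.+1 * s)%N.
have s0 : (0 < s)%N by rewrite expn_gt0 muln_gt0 (ltnW m1).
have d0 : (0 < d)%N by rewrite muln_gt0.
pose A := {ffun 'I_g.+1 -> 'I_s.+1}.
pose w (j : 'I_g.+1) : 'I_n := e (widen_ord (leqnSn _) j).
pose Mon (a : A) : multinom n :=
  mnm_add (\big[mnm_add/mnm0]_j mnm_muln (mnm1 (w j)) (a j)) (mnm_muln (mnm1 (e ord_max)) (d - \sum_j a j)).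
have sumA (a : A) : (\sum_j a j <= d)%N.
  have -> : d = (\sum_(j < g.+1) s)%N by rewrite sum_nat_const card_ord.
  by apply: leq_sum => j _; rewrite -ltnS.
have degM (a : A) : mdeg (Mon a) = d.-1.+1.
  rewrite prednK // mdegD mdegMn mdeg1 mul1n mdeg_sum.
  rewrite (eq_bigr (fun j => a j : nat)); first by rewrite subnKC.
  by move=> j _; rewrite mdegMn mdeg1 mul1n.
have wE l j : (w l == w j) = (l == j).
  by apply/eqP/eqP => [/einj/(congr1 val) h|->//]; exact: val_inj.
have wmax j : (e ord_max == w j) = false.
  by apply/eqP => /einj/(congr1 val) /= h; have := ltn_ord j; rewrite -h ltnn.
have MonE (a : A) j : Mon a (w j) = a j.
  rewrite mnmDE mnm_sumE mulmnE mnm1E wmax mul0n addn0 (bigD1 j) //= big1.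
    by rewrite mulmnE mnm1E eqxx mul1n addn0.
  by move=> l /negbTE lj; rewrite mulmnE mnm1E wE lj mul0n.
have Moninj : injective Mon.
  move=> a b ab; apply/ffunP => j; apply: val_inj; rewrite -[LHS]MonE -[RHS]MonE.
  by rewrite ab.
pose p := #|{: A}|; pose q := #|{: KK d.-1.+1}|.
have qp : (q < p)%N.
  rewrite /q /p !card_ffun card_prod !card_ord prednK // /d mulnA expnMn -/s -expnS.
  by rewrite ltn_exp2r.
pose M : 'M[C]_(p, q) := \matrix_(a, N) iota (nform m2 m4 hk (Mon (enum_val a)) (enum_val N)).
have [v v0 vM] := row_kernel M qp.
pose f : mpoly n C := \sum_(a < p) v ord0 a *: mpolyX C (Mon (enum_val a)).
have fJ J : mcoeff J f = \sum_(a < p) v ord0 a * (Mon (enum_val a) == J)%:R.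
  by rewrite raddf_sum; apply: eq_bigr => a _; rewrite /= mcoeffZ mcoeffX.
have f0 : f = 0.
  apply: HD => [X hX|J fJ0 i Di].
    rewrite meval_sum.
    transitivity (\sum_(N < q) (v *m M) ord0 N * \prod_j X (nu (enum_val N : KK d.-1.+1) j)).
      under [RHS]eq_bigr do rewrite mxE mulr_suml.
      rewrite exchange_big; apply: eq_bigr => a _ /=.
      rewrite mevalZ mevalX (nformP m2 m4 hk hX (degM _)) mulr_sumr.
      rewrite (reindex (@enum_val {: KK d.-1.+1} predT)) /=; last by apply/onW_bij/enum_val_bij.
      by apply: eq_bigr => N _; rewrite !mxE mulrA.
    by rewrite big1 // => N _; rewrite vM mxE mul0r.
  move: fJ0; rewrite fJ; case: (pselect (exists a : 'I_p, Mon (enum_val a) = J)) => [[a <-] _|nex].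
    have ne j : e j != i by apply: contraNneq (eD j) => ->.
    rewrite mnmDE mnm_sumE mulmnE mnm1E (negbTE (ne _)) mul0n addn0 big1 // => l _.
    by rewrite mulmnE mnm1E (negbTE (ne _)).
  rewrite big1 ?eqxx // => a _; case: eqP => [h|_]; last by rewrite mulr0.
  by case: nex; exists a.
case/eqP: v0; apply/rowP => a; rewrite mxE.
have := fJ (Mon (enum_val a)); rewrite f0 mcoeff0 (bigD1 a) //= eqxx mulr1 big1 ?addr0 // => b ba.
rewrite (_ : (_ == _) = false) ?mulr0 //; apply/eqP => /Moninj /enum_val_inj h.
by rewrite h eqxx in ba.
Qed.

Lemma Phi_pser (rho : R) (c : C) z v (P : mpoly n C) : 0 < rho ->
  pser rho (fun s => meval (fun i => c * Phi (z + s *: v) i) P).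
Proof.
move=> r0; apply: (@pser_meval _ _ _ (fun i s => c * Phi (z + s *: v) i)) => i.
apply: pserZ; apply: (@pser_ext _ _ (fun s => S m (clind R (enum_val i : B)) tau (z + s *: v))).
  by move=> s; rewrite /pt th_S.
by apply: S_pser => //; exact: bdd_clind.
Qed.

Lemma not_ideal (P : mpoly n C) : ~ in_ideal t iota P ->
  exists c z, c != 0 /\ meval (fun i => c * Phi z i) P != 0.
Proof.
move=> nP; apply: contrapT => nex; apply: nP; apply/(generic_ideal m2 m4 hk _ G ht) => c z c0.
by apply: contrapT => /eqP h; apply: nex; exists c, z.
Qed.

(** One scale c works for P at z1 and for Q at z2; with it both become entire functions of z, to
    which [lent_eq0] applies. *)
Lemma ideal_prime (P Q : mpoly n C) : in_ideal t iota (P * Q) ->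
  in_ideal t iota P \/ in_ideal t iota Q.
Proof.
move=> H; apply: contrapT => nPQ.
have [nP nQ] : ~ in_ideal t iota P /\ ~ in_ideal t iota Q by split=> h; apply: nPQ; [left|right].
have [c1 [z1 [c10 h1]]] := not_ideal nP; have [c2 [z2 [c20 h2]]] := not_ideal nQ.
pose pl z (P : mpoly n C) : {poly C} := \poly_(d < msize P) meval (Phi z) (pihomog (@mdeg n) d P).
have plE z P' c : (pl z P').[c] = meval (fun i => c * Phi z i) P'.
  by rewrite horner_poly meval_scale; apply: eq_bigr => d _; rewrite mulrC.
have n1 : pl z1 P != 0 by apply: contraNneq h1 => h; rewrite -plE h horner0.
have n2 : pl z2 Q != 0 by apply: contraNneq h2 => h; rewrite -plE h horner0.
have [c [c0 k1 k2]] : exists c, [/\ c != 0, meval (fun i => c * Phi z1 i) P != 0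
    & meval (fun i => c * Phi z2 i) Q != 0].
  have [c [c0 k1 k2]] := common_nonroot (@nat_inj_char0 Cc ch) n1 n2.
  by exists c; split; [exact: c0|rewrite -plE; exact: k1|rewrite -plE; exact: k2].
have L P' : lent (fun z => meval (fun i => c * Phi z i) P').
  by move=> z v rho r0; exact: Phi_pser.
have [z||] := lent_eq0 (L P) (L Q); last 2 first.
- by move=> h; case/eqP: k1; exact: h.
- by move=> h; case/eqP: k2; exact: h.
by rewrite -mevalM; exact: ((generic_ideal m2 m4 hk _ G ht).1 H c z c0).
Qed.

Lemma tangent_of_W : exists2 h : mpoly n C, ~ in_ideal t iota h &
  forall c z, c != 0 -> meval (fun i => c * Phi z i) h != 0 ->
  forall u, nonzero u -> W tau z u -> tangent_hyperplane t iota u.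
Proof.
have [h nh H] := smooth_tangents ch ideal_prime (fun d P X => @in_ideal_hom R g m m2 m4 k t hk _ iota P X d)
  (ex_intro _ _ (theta_on_Am1 m2 m4 0 ts ht)) free_bound.
exists h; first exact: nh.
move=> c z c0 hX u u0 /W_Psi uW.
have rk : \rank (Psi m tau z) = g.+1 by apply/eqP; exact: Psi_full.
refine (H (fun a => c * th a tau z) (theta_on_Am m2 m4 z ts ht c0) hX (Psi m tau z) rk _ u u0 uW).
move=> P hP; have hp := (generic_ideal m2 m4 hk _ G ht).1 hP.
exact: (gradient_Psi m4 ts z c0 hp).
Qed.

Lemma W_scale z (u : B -> C) s : W tau z u -> W tau z (fun a => s * u a).
Proof.
case=> e1 e2; split=> [|j].
  by under eq_bigr do rewrite -mulrA; rewrite -mulr_sumr e1 mulr0.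
by under eq_bigr do rewrite -mulrA; rewrite -mulr_sumr e2 mulr0.
Qed.

(* Analytic continuation along lines: the tangent hyperplanes at smooth points are
   dense among all the hyperplanes containing a tangent space of A_tau. *)
Lemma vanish_on_W (P : mpoly n C) : (forall u, tangent_hyperplane t iota u -> meval (pt u) P = 0) ->
  forall z u, W tau z u -> meval (pt u) P = 0.
Proof.
move=> HP z u uW; have [h nh Hh] := tangent_of_W.
have [c [z0 [c0 hz0]]] := not_ideal nh.
(* The path used below may pass through the zero vector, which is no hyperplane. Since g + 1 < n, W
   z0 has a nonzero element, and the nonzero multiples of it show that the constant term of P is
   0. *)
have P0 : meval (fun=> 0) P = 0.
  have [v v0 vP] := row_kernel (Psi m tau z0) nB_large.
  pose u0 (a : B) := v ord0 (enum_rank a).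
  have ptu0 : pt u0 = fun i => v ord0 i by apply/funext => i; rewrite /pt /u0 enum_valK.
  have [i vi] : exists i, v ord0 i != 0 by apply/rV0Pn.
  have W0 : W tau z0 u0.
    apply/W_Psi; rewrite -[RHS]vP; congr (_ *m _); apply/rowP => j.
    by rewrite mxE ptu0.
  have H0 d := @cone_hom Cc n P (pt u0) ch _ d.
  have E : meval (fun i => 0 * pt u0 i) P = 0.
    rewrite meval_scale big1 // => d _; rewrite H0 ?mulr0 // => s s0.
    have nz : nonzero (fun a => s * u0 a).
      by exists (enum_val i); rewrite mulf_neq0 // /u0 enum_valK.
    exact: (HP _ (Hh c z0 c0 hz0 _ nz (W_scale s W0))).
  by rewrite -[RHS]E; apply: meval_eq => j; rewrite mul0r.
have W0 : W tau z0 (fun _ : B => 0).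
  by split=> [|j]; rewrite big1 // => a _; rewrite mul0r.
have [w [pw w0 w1 wW]] := W_path m2 m4 ts gd W0 uW.
have pF1 := @Phi_pser 1 c z0 (z - z0) h ltr01.
have pF2 : pser 1 (fun s => meval (pt (w s)) P).
  by apply: (@pser_meval _ _ _ (fun i s => w s (enum_val i))).
have [s _|H|H] := pser_mul_eq0 ltr01 pF1 pF2.
- have [F1|F1] := eqVneq (meval (fun i => c * Phi (z0 + s *: (z - z0)) i) h) 0.
    by rewrite F1 mul0r.
  suff e : meval (pt (w s)) P = 0.
    by apply/eqP; rewrite mulf_eq0; apply/orP; right; apply/eqP; exact: e.
  case: (pselect (nonzero (w s))) => [nw|nw].
    exact: (HP _ (Hh c _ c0 F1 _ nw (wW s))).
  rewrite -[RHS]P0; apply: meval_eq => i.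
  by apply: contrapT => /eqP h'; apply: nw; exists (enum_val i).
- case/eqP: hz0; have := H 0; rewrite Normc.normc0 scale0r addr0 => H'.
  exact: (H' ler01).
- have := H 1; rewrite Normc.normc1 w1 => H'; exact: (H' (lexx _)).
Qed.

Variable Delta : 'M[C]_g -> mpoly n C.
Hypothesis hD : is_Delta Delta.

Lemma disc_degree_gt0 : (0 < disc_degree g m)%N.
Proof. by rewrite muln_gt0 expn_gt0 (ltnW m1) fact_gt0. Qed.

(** [Delta_support] concerns nonzero u; at 0 both sides hold, the left one because Delta has
    positive degree. *)
Lemma Delta_zero (x : 'I_n -> C) :
  meval x (Delta tau) = 0 <-> exists z, W tau z (fun a => x (enum_rank a)).
Proof.
pose u (a : B) := x (enum_rank a).
have xE : pt u = x by apply/funext => i; rewrite /pt /u enum_valK.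
case: (pselect (exists a, u a != 0)) => [nu|nu].
  by rewrite -singular_W // -(Delta_support hD nu ts) xE.
have u0 a : u a = 0 by apply: contrapT => /eqP h; apply: nu; exists a.
split=> _.
  by exists 0; split=> [|j]; rewrite big1 // => a _; rewrite -/(u a) u0 mul0r.
have := meval_homog x 0 (Delta_homog hD ts).
rewrite expr0n eqn0Ngt disc_degree_gt0 mul0r => E; rewrite -[RHS]E.
by apply: meval_eq => i; rewrite mul0r -xE /pt u0.
Qed.

Lemma Delta_gradient (P : mpoly n k) (q : mpoly n C) : in_ideal t iota (map_mpoly iota P) ->
  (forall X, meval X q = meval (fun i => meval X (mderiv i (map_mpoly iota P))) (Delta tau)) ->
  in_ideal t iota q.
Proof.
move=> hP Hq; have HP := (generic_ideal m2 m4 hk _ G ht).1 hP.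
apply/(generic_ideal m2 m4 hk _ G ht) => c z c0; rewrite Hq.
by apply/Delta_zero; exists z; exact: gradient_W.
Qed.

Lemma ev_pser (rho : R) (H : {poly mpoly n C}) (x : C -> 'I_n -> C) (s : C -> C) :
  (forall i, pser rho (fun a => x a i)) -> pser rho s -> pser rho (fun a => ev H (x a) (s a)).
Proof.
move=> hx hs; apply: (@pser_ext _ _ (fun a => \sum_(l < size H) meval (x a) H`_l * s a ^+ l)).
  move=> a; rewrite /ev (@horner_coef_wide _ (size H)) ?size_poly //.
  by apply: eq_bigr => l _; rewrite coef_map.
by apply: pser_sum => l; apply: pserM (pserX _ hs); apply: (@pser_meval _ _ _ (fun i a => x a i)).
Qed.

(* Two points of the discriminant are joined by an analytic path inside it, on
   which a product of power series vanishes only if a factor does. *)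
Lemma Delta_irreducible (p : 'I_n -> C) (H1 H2 : {poly mpoly n C}) :
  (forall u s, meval (fun i => u i + s * p i) (Delta tau) = 0 -> ev (H1 * H2) u s = 0) ->
  (forall u s, meval (fun i => u i + s * p i) (Delta tau) = 0 -> ev H1 u s = 0) \/
  (forall u s, meval (fun i => u i + s * p i) (Delta tau) = 0 -> ev H2 u s = 0).
Proof.
move=> H; apply: contrapT => nH.
have pick (H0 : {poly mpoly n C}) : ~ (forall u s, meval (fun i => u i + s * p i) (Delta tau) = 0 -> ev H0 u s = 0) ->
   exists u s, meval (fun i => u i + s * p i) (Delta tau) = 0 /\ ev H0 u s != 0.
  move=> nn; apply: contrapT => nex; apply: nn => u s us.
  by apply: contrapT => /eqP h; apply: nex; exists u, s.
have [u1 [s1 [/Delta_zero[z1 W1] n1]]] := pick H1 (fun h => nH (or_introl h)).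
have [u2 [s2 [/Delta_zero[z2 W2] n2]]] := pick H2 (fun h => nH (or_intror h)).
have [w [pw w0 w1 wW]] := W_path m2 m4 ts gd W1 W2.
(* w runs inside the discriminant; x is chosen so that x + s p = w along the path. *)
pose s a := s1 + a * (s2 - s1).
pose x a i := w a (enum_val i) - s a * p i.
have ps : pser 1 s by apply: pserD (pser_cst _ _) (pserM (pser_id _) (pser_cst _ _)).
have px i : pser 1 (fun a => x a i) by apply: pserB (pw _) (pserM ps (pser_cst _ _)).
have [a _|E|E] := pser_mul_eq0 ltr01 (ev_pser H1 px ps) (ev_pser H2 px ps).
- rewrite -evM; apply: H; apply/Delta_zero; exists (z1 + a *: (z2 - z1)).
  have -> : (fun b : B => x a (enum_rank b) + s a * p (enum_rank b)) = w a.
    by apply/funext => b; rewrite /x enum_rankK subrK.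
  exact: wW.
- case/eqP: n1; have := E 0; rewrite Normc.normc0 => /(_ ler01) h; rewrite -[RHS]h.
  have s0E : s 0 = s1 by rewrite /s mul0r addr0.
  have -> // : x 0 = u1.
    by apply/funext => i; rewrite /x s0E w0 enum_valK addrK.
  by rewrite s0E.
- case/eqP: n2; have := E 1; rewrite Normc.normc1 => /(_ (lexx _)) h; rewrite -[RHS]h.
  have s1E : s 1 = s2 by rewrite /s mul1r addrC subrK.
  have -> // : x 1 = u2.
    by apply/funext => i; rewrite /x s1E w1 enum_valK addrK.
  by rewrite s1E.
Qed.

Lemma Delta_divides (p u0 : 'I_n -> C) : meval p (Delta tau) != 0 -> meval u0 (Delta tau) = 0 ->
  \sum_i p i * meval u0 (mderiv i (Delta tau)) != 0 ->
  forall P : mpoly n C, (forall u, tangent_hyperplane t iota u -> meval (pt u) P = 0) ->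
  exists Q, P = Delta tau * Q.
Proof.
move=> hp hu hu' P HP.
apply: (@principal_prime Cc n ch p _ _ disc_degree_gt0 (Delta_homog hD ts) hp).
- by exists u0.
- exact: Delta_irreducible.
move=> u /Delta_zero[z uW]; have := vanish_on_W HP uW.
by move=> h; rewrite -[RHS]h; apply: meval_eq => i; rewrite /pt enum_valK.
Qed.

End AtTau.

(** * Persistence of simple roots *)

Lemma horner_deriv_sum (A : comNzRingType) (I : finType) (c : I -> A) (B : I -> {poly A}) s :
  (\sum_i c i *: B i)^`().[s] = \sum_i c i * (B i)^`().[s].
Proof.
rewrite (big_morph (@deriv A) (@derivD A) (deriv0 A)) horner_sum.
by apply: eq_bigr => i _; rewrite derivZ hornerZ.
Qed.

Section Continuity.
Variable R : realType.
Local Notation C := R[i].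

Definition cont0 (f : R -> C) : Prop := forall e : R, 0 < e -> exists2 d : R, 0 < d &
  forall t, 0 <= t -> t <= 1 -> t < d -> nrm (f t - f 0) < e.

Lemma cont0_cst c : cont0 (fun=> c).
Proof. by move=> e e0; exists 1 => // t _ _ _; rewrite subrr Normc.normc0. Qed.

Lemma cont0D f h : cont0 f -> cont0 h -> cont0 (fun t => f t + h t).
Proof.
move=> Hf Hh e e0; have e2 : 0 < e / 2 by rewrite divr_gt0.
have [d d0 H] := Hf _ e2; have [d' d'0 H'] := Hh _ e2.
exists (Num.min d d'); first by rewrite lt_min d0.
move=> t t0 t1; rewrite lt_min => /andP[td td'].
have -> : f t + h t - (f 0 + h 0) = (f t - f 0) + (h t - h 0) by ring.
by apply: le_lt_trans (le_normcD _ _) _; rewrite [e]splitr; apply: ltrD; [exact: H|exact: H'].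
Qed.

Lemma cont0M f h : cont0 f -> cont0 h -> cont0 (fun t => f t * h t).
Proof.
move=> Hf Hh e e0; pose K := nrm (f 0) + nrm (h 0) + 1.
have K0 : 0 < K by rewrite ltr_wpDl // addr_ge0 ?nrm_ge0.
pose e' := Num.min 1 (e / 2 / K).
have e'0 : 0 < e' by rewrite lt_min ltr01 !divr_gt0.
have [e'1 e'e] : e' <= 1 /\ e' <= e / 2 / K by rewrite /e' !ge_min !lexx orbT.
have [d d0 H] := Hf _ e'0; have [d' d'0 H'] := Hh _ e'0.
exists (Num.min d d'); first by rewrite lt_min d0.
move=> t t0 t1; rewrite lt_min => /andP[td td'].
have h1 := H t t0 t1 td; have h2 := H' t t0 t1 td'.
have -> : f t * h t - f 0 * h 0 = f t * (h t - h 0) + (f t - f 0) * h 0 by ring.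
have hf : nrm (f t) <= K.
  have -> : f t = f 0 + (f t - f 0) by rewrite addrC subrK.
  apply: le_trans (le_normcD _ _) _; rewrite /K -addrA lerD2l.
  by apply: le_trans (ltW h1) _; apply: le_trans e'1 _; rewrite ler_wpDl ?nrm_ge0.
have hh : nrm (h 0) <= K by rewrite /K; have := nrm_ge0 (f 0); have := nrm_ge0 (h 0); lra.
have Ke : K * e' <= e / 2 by rewrite mulrC -ler_pdivlMr.
apply: le_lt_trans (le_normcD _ _) _; rewrite !Normc.normcM [e]splitr.
have i1 : nrm (f t) * nrm (h t - h 0) <= K * nrm (h t - h 0) by rewrite ler_wpM2r ?nrm_ge0.
have i2 : nrm (f t - f 0) * nrm (h 0) <= nrm (f t - f 0) * K by rewrite ler_wpM2l ?nrm_ge0.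
have i3 : K * nrm (h t - h 0) < K * e' by rewrite ltr_pM2l.
have i4 : nrm (f t - f 0) * K < e' * K by rewrite ltr_pM2r.
by rewrite mulrC in i4; rewrite [e' * K]mulrC in i4; lra.
Qed.

Lemma cont0_sum (I : Type) (s : seq I) (f : I -> R -> C) :
  (forall i, cont0 (f i)) -> cont0 (fun t => \sum_(i <- s) f i t).
Proof.
move=> H; elim: s => [|i s IH].
  by have := cont0_cst 0; congr cont0; apply/funext => t; rewrite big_nil.
by have := cont0D (H i) IH; congr cont0; apply/funext => t; rewrite big_cons.
Qed.

Lemma cont0_neq0 f : cont0 f -> f 0 != 0 -> exists2 d : R, 0 < d &
  forall t, 0 <= t -> t <= 1 -> t < d -> f t != 0.
Proof.
move=> Hf; rewrite -nrm_gt0 => /Hf[d d0 H]; exists d => // t t0 t1 td.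
have := H t t0 t1 td; apply: contraTneq => ->.
by rewrite sub0r normcN ltxx.
Qed.

Lemma nrm_tri (a b : C) : nrm a <= nrm b + nrm (a - b).
Proof. by have := le_normcD b (a - b); rewrite addrC subrK. Qed.

(** The logarithmic derivative at 0 is the sum of -1 / z over the roots z, each term being at most 1
    / r in modulus; the bound is written without division. *)
Lemma far_roots (q : {poly C}) (r : R) : (forall s, q.[s] = 0 -> r <= nrm s) -> 0 <= r ->
  r * nrm q^`().[0] <= (size q)%:R * nrm q.[0].
Proof.
move=> H r0; have [q0|q0] := eqVneq q 0.
  by rewrite q0 deriv0 horner0 Normc.normc0 mulr0 size_poly0 mul0r.
have [rs qE] := closed_field_poly_normal q.
have l0 : lead_coef q != 0 by rewrite lead_coef_eq0.
have Hr s : s \in rs -> r <= nrm s.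
  move=> hs; apply: H; rewrite qE hornerZ horner_prod (big_rem s hs) /=.
  by rewrite hornerXsubC subrr mul0r mulr0.
have key : r * nrm (\prod_(z <- rs) ('X - z%:P))^`().[0] <= (size rs)%:R * nrm (\prod_(z <- rs) ('X - z%:P)).[0].
  elim: rs Hr {qE} => [|z rs IH] Hr.
    by rewrite big_nil -polyC1 derivC horner0 Normc.normc0 mulr0 mul0r.
  have {}IH := IH (fun s hs => Hr s ltac:(by rewrite inE hs orbT)).
  have hz := Hr z (mem_head _ _).
  rewrite big_cons derivM derivXsubC mul1r hornerD !hornerM hornerXsubC sub0r.
  move: (\prod_(j <- rs) _) IH => p IH.
  rewrite Normc.normcM normcN [(size (z :: rs))%:R]mulrS.
  have t1 : r * nrm (p.[0] + - z * p^`().[0]) <= r * (nrm p.[0] + nrm z * nrm p^`().[0]).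
    apply: ler_wpM2l => //; apply: le_trans (le_normcD _ _) _.
    by rewrite Normc.normcM normcN.
  have t2 : r * nrm p.[0] <= nrm z * nrm p.[0] by rewrite ler_wpM2r ?nrm_ge0.
  have t3 : nrm z * (r * nrm p^`().[0]) <= nrm z * ((size rs)%:R * nrm p.[0]) by rewrite ler_wpM2l ?nrm_ge0.
  move: t1 t2 t3; move: (nrm _) (nrm z) (nrm _) (nrm _) (size rs)%:R => a b c d e t1 t2 t3.
  by nra.
have sz : size q = (size rs).+1.
  by rewrite qE size_scale // size_prod_XsubC.
rewrite qE derivZ !hornerZ !Normc.normcM -qE sz.
have lp := nrm_ge0 (lead_coef q); move: key lp.
have := nrm_ge0 (\prod_(z <- rs) ('X - z%:P)).[0].
rewrite [(size rs).+1%:R]mulrS.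
move: (nrm (lead_coef q)) (nrm _) (nrm _) (size rs)%:R => a b c d c0 key a0.
rewrite mulrCA [X in _ <= X]mulrCA ler_wpM2l //; apply: le_trans key _.
by rewrite mulrDl mul1r ler_wpDl.
Qed.

Lemma poly_cont (q : {poly C}) (e : R) : 0 < e -> exists2 r : R, 0 < r &
  forall s, nrm s < r -> nrm (q.[s] - q.[0]) < e.
Proof.
move=> e0; have [a Ha] := pser_poly 1 q; have [M M0 HM] := pserc_head 1 ltr01 Ha.
have a0 : a 0%N = q.[0].
  have := HM 0; rewrite Normc.normc0 => /(_ ler01).
  rewrite big_ord1 expr0 mulr1 expr1 mulr0 => h.
  by apply/eqP; rewrite eq_sym -subr_eq0 -nrm_eq0 eq_le h nrm_ge0.
have M1 : 0 < M + 1 by rewrite ltr_wpDl.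
exists (Num.min 1 (e / (M + 1))); first by rewrite lt_min ltr01 divr_gt0.
move=> s; rewrite lt_min => /andP[s1 se]; have := HM s (ltW s1).
rewrite big_ord1 expr0 mulr1 expr1 a0 => h; apply: le_lt_trans h _.
rewrite ltr_pdivlMr // in se; have := nrm_ge0 s; rewrite mulrDr mulr1 in se => s0.
by rewrite mulrC; lra.
Qed.

(* By [far_roots], a small value and a large derivative at 0 force a root near 0. *)
Lemma simple_root_near (I : finType) (B : I -> {poly C}) (c : R -> I -> C) :
  (forall i, cont0 (fun t => c t i)) ->
  let Q t := \sum_i c t i *: B i in
  (Q 0).[0] = 0 -> (Q 0)^`().[0] != 0 -> exists2 d : R, 0 < d &
  forall t, 0 <= t -> t <= 1 -> t < d -> exists s, (Q t).[s] = 0 /\ (Q t)^`().[s] != 0.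
Proof.
move=> Hc Q Q0 Q'0.
have QE t s : (Q t).[s] = \sum_i c t i * (B i).[s].
  by rewrite horner_sum; apply: eq_bigr => i _; rewrite hornerZ.
have Q'E t s : (Q t)^`().[s] = \sum_i c t i * (B i)^`().[s].
  exact: horner_deriv_sum.
pose kap := nrm (Q 0)^`().[0]; have k0 : 0 < kap by rewrite nrm_gt0.
(* K bounds the sum of the [nrm (c t i)] for small t, so that on the disc of radius r the derivative
   of Q t moves by at most kap / 2. *)
pose K := \sum_i (nrm (c 0 i) + 1) + 1.
have K0 : 0 < K by rewrite ltr_wpDl // sumr_ge0 // => i _; rewrite addr_ge0 ?nrm_ge0.
pose eta := kap / 2 / K; have eta0 : 0 < eta by rewrite !divr_gt0.
have [r [r0 Hr]] : exists r : R, 0 < r /\ forall i s, nrm s < r -> nrm ((B i)^`().[s] - (B i)^`().[0]) < eta.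
  have [f Hf] := boolp.choice (fun i : I => ltac:(have [r h1 h2] := poly_cont (B i)^`() eta0; exact: (ex_intro (fun r : R => 0 < r /\ forall s, nrm s < r -> nrm ((B i)^`().[s] - (B i)^`().[0]) < eta) r (conj h1 h2)))).
  have [r r0 Hr] := fin_min (fun i => (Hf i).1).
  by exists r; split=> // i s sr; apply: (Hf i).2; apply: lt_le_trans sr _; exact: Hr.
have [dc [dc0 Hdc]] : exists d : R, 0 < d /\ forall i t, 0 <= t -> t <= 1 -> t < d -> nrm (c t i) <= nrm (c 0 i) + 1.
  have [f Hf] := boolp.choice (fun i : I => ltac:(have [x h1 h2] := Hc i 1 ltr01; exact: (ex_intro (fun x : R => 0 < x /\ forall t, 0 <= t -> t <= 1 -> t < x -> nrm (c t i - c 0 i) < 1) x (conj h1 h2)))).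
  have [x x0 Hx] := fin_min (fun i => (Hf i).1).
  exists x; split=> // i t t0 t1 tr; have := (Hf i).2 t t0 t1 (lt_le_trans tr (Hx i)).
  move=> h; have -> : c t i = c 0 i + (c t i - c 0 i) by rewrite addrC subrK.
  by apply: le_trans (le_normcD _ _) _; rewrite lerD2l ltW.
pose N := \max_i size (B i).
have sN t : (size (Q t) <= N)%N.
  apply: leq_trans (size_sum _ _ _) _; apply/bigmax_leqP => i _.
  by apply: leq_trans (size_scale_leq _ _) _; exact: leq_bigmax.
have cQ : cont0 (fun t => (Q t).[0]).
  have := @cont0_sum _ (index_enum I) (fun i t => c t i * (B i).[0]) (fun i => cont0M (Hc i) (cont0_cst _)).
  by congr cont0; apply/funext => t; rewrite QE.
have cQ' : cont0 (fun t => (Q t)^`().[0]).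
  have := @cont0_sum _ (index_enum I) (fun i t => c t i * (B i)^`().[0]) (fun i => cont0M (Hc i) (cont0_cst _)).
  by congr cont0; apply/funext => t; rewrite Q'E.
have N1 : 0 < (N%:R : R) + 1 by rewrite ltr_wpDl.
have k2 : 0 < kap / 2 by rewrite divr_gt0.
have [d1 d10 H1] := cQ _ (divr_gt0 (mulr_gt0 r0 k2) N1).
have [d2 d20 H2] := cQ' _ k2.
exists (Num.min dc (Num.min d1 d2)); first by rewrite !lt_min dc0 d10.
move=> t t0 t1; rewrite !lt_min => /and3P[tc td1 td2].
have := H1 t t0 t1 td1; rewrite Q0 subr0 ltr_pdivlMr // => q1.
have q2 := H2 t t0 t1 td2.
have q2' : kap / 2 < nrm (Q t)^`().[0].
  have : kap <= nrm (Q t)^`().[0] + nrm ((Q t)^`().[0] - (Q 0)^`().[0]).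
    by rewrite nrmB /kap; exact: nrm_tri.
  by move: q2; lra.
have [s [sr sQ]] : exists s, nrm s < r /\ (Q t).[s] = 0.
  apply: contrapT => nex.
  have := @far_roots (Q t) r _ (ltW r0).
  have hh : forall s, (Q t).[s] = 0 -> r <= nrm s.
    by move=> s hs; rewrite leNgt; apply/negP => sr; apply: nex; exists s.
  move/(_ hh); have := nrm_ge0 (Q t).[0] => n0.
  have : ((size (Q t))%:R : R) * nrm (Q t).[0] <= N%:R * nrm (Q t).[0] by rewrite ler_wpM2r // ler_nat.
  have : r * (kap / 2) < r * nrm (Q t)^`().[0] by rewrite ltr_pM2l.
  by rewrite mulrDr mulr1 in q1; move: q1; rewrite [nrm (Q t).[0] * N%:R]mulrC; lra.
exists s; split=> //; rewrite -nrm_gt0.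
have : nrm ((Q t)^`().[s] - (Q t)^`().[0]) <= kap / 2.
  rewrite !Q'E -sumrB; apply: le_trans (nrm_sum _ _ _) _.
  apply: (@le_trans _ _ (\sum_i (nrm (c 0 i) + 1) * eta)).
    apply: ler_sum => i _; rewrite -mulrBr Normc.normcM; apply: ler_pM; rewrite ?nrm_ge0 //.
      exact: Hdc.
    by apply: ltW; exact: Hr.
  rewrite -mulr_suml; have : K * eta = kap / 2 by rewrite /eta mulrC divfK // gt_eqF.
  move=> <-; rewrite ler_wpM2r ?ltW // /K; exact: ltr_pwDr.
have : nrm (Q t)^`().[0] <= nrm (Q t)^`().[s] + nrm ((Q t)^`().[s] - (Q t)^`().[0]).
  by rewrite nrmB; exact: nrm_tri.
by lra.
Qed.

End Continuity.

(** * Restriction of polynomials to lines *)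

Section LineRestriction.
Variables (F : closedFieldType) (n : nat) (p : 'I_n -> F).
Local Notation Rx := (mpoly n F).

Definition lin_at (u : 'I_n -> F) (G : Rx) : {poly F} := map_poly (meval u) (lin p G).

Lemma lin_atE u G s : (lin_at u G).[s] = meval (fun i => u i + s * p i) G.
Proof. exact: lin_ev. Qed.

Lemma lin_at_deriv u G s : (lin_at u G)^`().[s] =
  \sum_i p i * meval (fun i => u i + s * p i) (mderiv i G).
Proof.
rewrite /lin_at deriv_map lin_deriv rmorph_sum horner_sum; apply: eq_bigr => i _.
by rewrite -/(ev _ _ _) evZ mevalC lin_ev.
Qed.

Lemma lin_at_sum (I : Type) (r : seq I) (c : I -> F) (G : I -> Rx) u :
  lin_at u (\sum_(i <- r) c i *: G i) = \sum_(i <- r) c i *: lin_at u (G i).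
Proof.
have LD a b : lin_at u (a + b) = lin_at u a + lin_at u b.
  rewrite /lin_at; have -> : lin p (a + b) = lin p a + lin p b by rewrite /lin rmorphD.
  exact: rmorphD.
have LZ x a : lin_at u (x *: a) = x *: lin_at u a.
  rewrite /lin_at; have -> : lin p (x *: a) = (mpolyC n x)%:P * lin p a by rewrite /lin mmapZ.
  by rewrite rmorphM /= map_polyC /= mevalC mul_polyC.
have L0 : lin_at u 0 = 0.
  rewrite /lin_at; have -> : lin p 0 = 0 by rewrite /lin raddf0.
  exact: rmorph0.
elim: r => [|i r IH]; first by rewrite !big_nil.
by rewrite !big_cons LD LZ IH.
Qed.

Lemma line_root d G u : (0 < d)%N -> homogeneous d G -> meval p G != 0 ->
  exists s, meval (fun i => u i + s * p i) G = 0.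
Proof.
move=> d0 hG pG; have [s1 s2] := lin_topco p hG.
have sz : size (lin_at u G) = d.+1.
  apply/eqP; rewrite eqn_leq (leq_trans (size_poly _ _) s1) /= ltnNge; apply/negP => h.
  have e : (lin_at u G)`_d = meval p G.
    by rewrite [LHS]coef_map /= s2; exact: mevalC.
  by case/eqP: pG; rewrite -e nth_default.
have /closed_rootP[s /rootP hs] : size (lin_at u G) != 1%N by rewrite sz; lia.
by exists s; rewrite -lin_atE.
Qed.

(** Every other monomial of degree d contains a variable that is 0 here. *)
Lemma meval_pure d (i0 : 'I_n) (G : Rx) : homogeneous d G ->
  meval (fun i => (i == i0)%:R) G = mcoeff (mnm_muln (mnm1 i0) d) G.
Proof.
move=> /dhomogP hG; have [h|h] := boolP (mnm_muln (mnm1 i0) d \in msupp G); last first.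
  rewrite (memN_msupp_eq0 h) mevalE big_seq big1 // => J JG.
  have [i ii0 Ji] : exists2 i, i != i0 & J i != 0%N.
    apply: contrapT => nex; case/negP: h; suff <- : J = mnm_muln (mnm1 i0) d by [].
    have J0 i : i != i0 -> J i = 0%N by move=> ii; apply: contrapT => /eqP hh; apply: nex; exists i.
    apply/mnmP => i; rewrite mulmnE mnm1E; have [<-|ii] := eqVneq i0 i; last by rewrite J0 1?eq_sym.
    rewrite -(hG J JG) /= mdegE (bigD1 i0) //= big1 => [|j /J0 //].
    by rewrite addn0 mul1n.
  by rewrite (bigD1 i) //= (negbTE ii0) expr0n (negbTE Ji) mul0r mulr0.
rewrite mevalE (bigD1_seq (mnm_muln (mnm1 i0) d)) ?msupp_uniq //= [X in _ + X]big_seq_cond.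
rewrite [X in _ + X]big1 => [|J /andP[JG Jne]].
  rewrite addr0 big1 ?mulr1 // => i _; rewrite mulmnE mnm1E eq_sym.
  by case: eqP => _; rewrite ?expr1n // mul0n expr0.
have [i ii0 Ji] : exists2 i, i != i0 & J i != 0%N.
  apply: contrapT => nex; case/eqP: Jne.
  have J0 i : i != i0 -> J i = 0%N by move=> ii; apply: contrapT => /eqP hh; apply: nex; exists i.
  apply/mnmP => i; rewrite mulmnE mnm1E; have [<-|ii] := eqVneq i0 i; last by rewrite J0 1?eq_sym.
  rewrite -(hG J JG) /= mdegE (bigD1 i0) //= big1 => [|j /J0 //].
  by rewrite addn0 mul1n.
by rewrite (bigD1 i) //= (negbTE ii0) expr0n (negbTE Ji) mul0r mulr0.
Qed.

End LineRestriction.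

(** * Continuity of the discriminant *)

Lemma hom_msize (F : nzRingType) n d (p : mpoly n F) : homogeneous d p -> (msize p <= d.+1)%N.
Proof.
by move=> /dhomogP h; rewrite msizeE; apply/bigmax_leqP_seq => J /h /= -> _.
Qed.

Lemma hom_msize_eq (F : nzRingType) n d (p : mpoly n F) : p != 0 -> homogeneous d p -> msize p = d.+1.
Proof.
move=> p0 h; apply/eqP; rewrite eqn_leq hom_msize //=.
have [J hJ] : exists J, J \in msupp p.
  case E : (msupp p) (msupp_eq0 p) => [|J s]; first by rewrite eqxx (negbTE p0).
  by move=> _; exists J; rewrite mem_head.
by have /dhomogP hh := h; have /= <- := hh J hJ; exact: msize_mdeg_lt.
Qed.

Lemma hom_coef (F : nzRingType) n d (p : mpoly n F) J : homogeneous d p -> mdeg J != d -> mcoeff J p = 0.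
Proof.
by move=> h; exact: dhomog_nemf_coeff h.
Qed.

Section DeltaContinuity.
Variables (R : realType) (g m : nat).
Hypotheses (m2 : ~~ odd m) (m4 : (4 <= m)%N) (g0 : (0 < g)%N).
Let m1 : (1 < m)%N. Proof. exact: leq_trans m4. Qed.
Local Notation C := R[i].
Local Notation B := (Bm g m).
Local Notation n := (nB g m).
Local Notation Cc := (R[i] : closedFieldType).
Local Notation J0 := (pure_power g m (disc_degree g m)).
Variable Delta : 'M[C]_g -> mpoly n C.
Hypothesis hD : is_Delta Delta.

(** Complex differentiability with error constant 1 gives a Lipschitz bound at tau0. *)
Lemma Delta_near J tau0 : siegel tau0 -> exists K d : R, [/\ 0 <= K, 0 < d &
  forall H : 'M[C]_g, H^T = H -> forall e, e <= d -> (forall i j, nrm (H i j) < e) ->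
  nrm (mcoeff J (Delta (tau0 + H)) - mcoeff J (Delta tau0)) <= K * e].
Proof.
move=> s0; have [L HL] := Delta_holo hD J s0; have [d d0 Hd] := HL 1 ltr01.
exists (\sum_i \sum_j (nrm (L i j) + 1)), d; split=> //.
  by apply: sumr_ge0 => i _; apply: sumr_ge0 => j _; rewrite addr_ge0 ?nrm_ge0.
move=> H Hs e ed He.
have h1 i j : `|H i j| < toC d.
  by rewrite nrmE /toC ltcR; exact: lt_le_trans (He i j) ed.
have := Hd H Hs h1.
have -> : \sum_i \sum_j `|H i j| = toC (\sum_i \sum_j nrm (H i j)).
  rewrite /toC rmorph_sum; apply: eq_bigr => i _; rewrite rmorph_sum; apply: eq_bigr => j _.
  exact: nrmE.
rewrite nrmE -[toC 1 * _]rmorphM mul1r /toC lecR.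
set x := mcoeff J (Delta (tau0 + H)) - _; set y := \sum_i \sum_j L i j * H i j => hxy.
have hy : nrm y <= \sum_i \sum_j nrm (L i j) * nrm (H i j).
  apply: le_trans (nrm_sum _ _ _) _; apply: ler_sum => i _.
  apply: le_trans (nrm_sum _ _ _) _; apply: ler_sum => j _.
  by rewrite Normc.normcM.
apply: le_trans (nrm_tri x y) _; apply: le_trans (lerD hy hxy) _.
rewrite -big_split mulr_suml; apply: ler_sum => i _; rewrite -big_split mulr_suml.
apply: ler_sum => j _ /=; rewrite mulrDl mul1r; apply: lerD; last exact: ltW.
by rewrite ler_wpM2l ?nrm_ge0 // ltW.
Qed.

Lemma cont0_ext (f h : R -> C) : (forall t, 0 <= t -> t <= 1 -> f t = h t) -> cont0 f -> cont0 h.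
Proof.
move=> E Hf e e0; have [d d0 H] := Hf e e0; exists d => // t t0 t1 td.
by rewrite -!E // H.
Qed.

Lemma seg0 (a b : 'M[C]_g) : seg a b 0 = a.
Proof. by rewrite /seg toC0 scale0r addr0. Qed.

Lemma Delta_cont J tau0 tauG : siegel tau0 -> siegel tauG ->
  cont0 (fun t => mcoeff J (Delta (seg tau0 tauG t))).
Proof.
move=> s0 sG e e0; have [K [d [K0 d0 H]]] := Delta_near J s0.
pose D := tauG - tau0; pose M := \sum_i \sum_j nrm (D i j) + 1.
have hM i j : nrm (D i j) < M.
  rewrite /M (bigD1 i) //= (bigD1 j) //=.
  have h1 : 0 <= \sum_(i0 < g | i0 != j) nrm (D i i0) by apply: sumr_ge0 => l _; exact: nrm_ge0.
  have h2 : 0 <= \sum_(i0 < g | i0 != i) \sum_j0 nrm (D i0 j0).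
    by apply: sumr_ge0 => l _; apply: sumr_ge0 => l' _; exact: nrm_ge0.
  move: (nrm (D i j)) h1 h2; move: (\sum_(_ | _) _) (\sum_(_ | _) _) => x y z; lra.
have M0 : 0 < M.
  by rewrite ltr_wpDl // sumr_ge0 // => i _; apply: sumr_ge0 => j _; exact: nrm_ge0.
have KM : 0 < (K + 1) * M by rewrite mulr_gt0 // ltr_wpDl.
exists (Num.min (d / M) (e / ((K + 1) * M))); first by rewrite lt_min !divr_gt0.
move=> t t0 t1; rewrite lt_min => /andP[td te]; rewrite seg0.
move: t0; rewrite le_eqVlt => /orP[/eqP <-|t0]; first by rewrite seg0 subrr Normc.normc0.
have := H (toC t *: D) _ (t * M).
have -> : tau0 + toC t *: D = seg tau0 tauG t by [].
have Ds : (toC t *: D)^T = toC t *: D.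
  by rewrite linearZ /= linearB /= s0.1 sG.1.
move/(_ Ds); rewrite ltr_pdivlMr // in td; move/(_ (ltW td)).
have hh : forall i j, nrm ((toC t *: D) i j) < t * M.
  by move=> i j; rewrite mxE Normc.normcM nrm_toC gtr0_norm // ltr_pM2l.
move/(_ hh) => h; apply: le_lt_trans h _; rewrite ltr_pdivlMr // in te.
have : 0 < t * M by rewrite mulr_gt0.
have E : t * ((K + 1) * M) = K * (t * M) + t * M by ring.
by rewrite E in te; lra.
Qed.

Lemma Delta_expand tau : siegel tau -> Delta tau =
  \sum_(J : bmultinom n (disc_degree g m).+1) mcoeff (bmnm J) (Delta tau) *: mpolyX C (bmnm J).
Proof. by move=> ts; apply: mpolywE; exact: hom_msize (Delta_homog hD ts). Qed.

Lemma seg_in (a b : 'M[C]_g) t : siegel a -> siegel b -> 0 <= t -> t <= 1 -> siegel (seg a b t).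
Proof. by move=> ? ? t0 t1; apply: seg_siegel => //; rewrite t0. Qed.

Lemma Delta_meval_cont x tau0 tauG : siegel tau0 -> siegel tauG ->
  cont0 (fun t => meval x (Delta (seg tau0 tauG t))).
Proof.
move=> s0 sG; apply: (@cont0_ext (fun t => \sum_(J : bmultinom n (disc_degree g m).+1)
   mcoeff (bmnm J) (Delta (seg tau0 tauG t)) * meval x (mpolyX C (bmnm J)))).
  move=> t t0 t1; rewrite [in RHS](Delta_expand (seg_in s0 sG t0 t1)) meval_sum.
  by apply: eq_bigr => J _; rewrite mevalZ.
by apply: cont0_sum => J; apply: cont0M (cont0_cst _); exact: Delta_cont.
Qed.

Let ch (l : nat) : (l.+1%:R : C) != 0. Proof. by rewrite pnatr_eq0. Qed.

(** Start from tau0 where f_{J0} is nonzero: on a line in the direction of u_0, Delta then has full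
    degree in s, hence a root. [Delta_reduced] moves this singular fiber slightly to a point where
    the gradient of Delta is nonzero. *)
Lemma singular_start : exists tau (u : 'I_n -> C), [/\ siegel tau, mcoeff J0 (Delta tau) != 0,
  meval u (Delta tau) = 0 & exists i, meval u (mderiv i (Delta tau)) != 0].
Proof.
have [tau0 s0 J00] := Delta_J0 hD.
pose a1 : B := [ffun=> 1%R].
have a10 : a1 != 0.
  apply/eqP => /ffunP/(_ (Ordinal g0)); rewrite !ffunE => /(congr1 val) /=.
  by rewrite Zp_cast // modn_small.
pose i0 := enum_rank (0 : B); pose i1 := enum_rank a1.
have i10 : i1 != i0 by rewrite (inj_eq enum_rank_inj).
have hp : meval (fun i => (i == i0)%:R) (Delta tau0) != 0.
  by rewrite (@meval_pure Cc n _ i0 _ (Delta_homog hD s0)).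
have [s hs] := @line_root Cc n _ _ _ (fun i => (i == i1)%:R) (disc_degree_gt0 g m4) (Delta_homog hD s0) hp.
pose u (a : B) : C := (enum_rank a == i1)%:R + s * (enum_rank a == i0)%:R.
have u1 : u a1 = 1 by rewrite /u eqxx (negbTE i10) mulr0 addr0.
have ptu : pt u = fun i => (i == i1)%:R + s * (i == i0)%:R by apply/funext => i; rewrite /pt /u enum_valK.
have un : exists a, u a != 0 by exists a1; rewrite u1 oner_neq0.
have sf : singular_fiber u tau0.
  by apply/(Delta_support hD un s0); rewrite ptu.
have [K [d [K0 d0 Hn]]] := Delta_near J0 s0.
have f0 : 0 < nrm (mcoeff J0 (Delta tau0)) by rewrite nrm_gt0.
have K1 : 0 < K + 1 by rewrite ltr_wpDl.
(* The bound 1/2 keeps the coordinate a1 of u' away from 0, and the others keep f_{J0} nonzero at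
   tau'. *)
pose e := Num.min (1 / 2) (Num.min d (nrm (mcoeff J0 (Delta tau0)) / (K + 1))).
have e0 : 0 < e by rewrite !lt_min d0 !divr_gt0.
have [e1 e2 e3] : [/\ e <= 1 / 2, e <= d & e <= nrm (mcoeff J0 (Delta tau0)) / (K + 1)].
  by rewrite /e !ge_min !lexx !orbT.
have [u' [tau' [s' sf' hu htau [i hi]]]] := Delta_reduced hD un s0 sf e0.
exists tau', (pt u'); split=> //.
- have hH : (tau' - tau0)^T = tau' - tau0 by rewrite linearB /= s0.1 s'.1.
  have h1 : forall i j, nrm ((tau' - tau0) i j) < e.
    by move=> a b; have := htau a b; rewrite nrmE /toC ltcR !mxE.
  have E : tau0 + (tau' - tau0) = tau' by rewrite addrC subrK.
  have := Hn _ hH e e2 h1; rewrite E => h.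
  apply: contraTneq e0 => z0; rewrite z0 sub0r normcN in h.
  rewrite ler_pdivlMr // mulrDr mulr1 mulrC in e3.
  by rewrite -leNgt; lra.
- apply/(Delta_support hD _ s') => //; exists a1; apply/eqP => z0.
  have := hu a1; rewrite nrmE /toC ltcR u1 z0 sub0r normcN Normc.normc1 => h.
  by move: h e1; lra.
- by exists i.
Qed.

(** At the point of [singular_start], the root of Delta on a suitable line is simple, so it
    persists, still simple, when tau is moved to a nearby generic point of a segment. *)
Lemma good_tau : exists tau (p u : 'I_n -> C), [/\ generic m tau, mcoeff J0 (Delta tau) != 0,
  meval p (Delta tau) != 0, meval u (Delta tau) = 0
  & \sum_i p i * meval u (mderiv i (Delta tau)) != 0].
Proof.
have [tau2 [u2 [s2 J2 D2 [i hi]]]] := singular_start.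
have [p hp hp'] : exists2 p : 'I_n -> C, meval p (Delta tau2) != 0 &
   \sum_i p i * meval u2 (mderiv i (Delta tau2)) != 0.
  (* The direction p has to avoid the zeros of Delta tau2 and of its differential at u2, both
     nonzero polynomials in p. *)
  pose lf : mpoly n C := \sum_i meval u2 (mderiv i (Delta tau2)) *: mpolyX C (mnm1 i).
  have lf0 : lf != 0.
    apply: contraNneq hi => /(congr1 (mcoeff (mnm1 i))); rewrite mcoeff0 /lf raddf_sum /= (bigD1 i) //=.
    rewrite mcoeffZ mcoeffX eqxx mulr1 big1 ?addr0 => [->//|j ji].
    rewrite mcoeffZ mcoeffX (_ : (mnm1 j == mnm1 i) = false) ?mulr0 //.
    by apply/eqP => /mnmP/(_ i); rewrite !mnm1E eqxx (negbTE ji).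
  have D0 : Delta tau2 != 0 by apply: contraNneq J2 => ->; rewrite mcoeff0.
  have [p hp] := @mpoly_nonzero Cc n ch _ (mulf_neq0 D0 lf0).
  have hp2 : meval p (Delta tau2) * meval p lf != 0 by rewrite -mevalM.
  move: hp2; rewrite mulf_eq0 negb_or => /andP[h1 h2]; exists p => //.
  suff <- : meval p lf = \sum_i p i * meval u2 (mderiv i (Delta tau2)) by [].
  by rewrite meval_sum; apply: eq_bigr => j _; rewrite mevalZ mevalXU mulrC.
have [tG sG HG] := generic_near m2 m4 s2.
pose c t (J : bmultinom n (disc_degree g m).+1) := mcoeff (bmnm J) (Delta (seg tau2 tG t)).
pose Bp (J : bmultinom n (disc_degree g m).+1) : {poly C} := @lin_at Cc n p u2 (mpolyX C (bmnm J)).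
have QE t : 0 <= t -> t <= 1 -> \sum_J c t J *: Bp J = @lin_at Cc n p u2 (Delta (seg tau2 tG t)).
  move=> t0 t1; rewrite [in RHS](Delta_expand (seg_in s2 sG t0 t1)).
  by rewrite (@lin_at_sum Cc n p).
have Q0E := QE 0 (lexx _) ler01; rewrite seg0 in Q0E.
have u20 (u : 'I_n -> C) : (fun j => u j + 0 * p j) = u by apply/funext => j; rewrite mul0r addr0.
have [||d1 d10 H1] := @simple_root_near R _ Bp c (fun J => Delta_cont _ s2 sG).
- by rewrite Q0E (@lin_atE Cc n p) u20.
- by rewrite Q0E (@lin_at_deriv Cc n p) u20.
have J2' : mcoeff J0 (Delta (seg tau2 tG 0)) != 0 by rewrite seg0.
have [d2 d20 H2] := cont0_neq0 (Delta_cont J0 s2 sG) J2'.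
have hp0 : meval p (Delta (seg tau2 tG 0)) != 0 by rewrite seg0.
have [d3 d30 H3] := cont0_neq0 (Delta_meval_cont p s2 sG) hp0.
pose e := Num.min d1 (Num.min d2 d3).
have e0 : 0 < e by rewrite !lt_min d10 d20.
have [e1 e2 e3] : [/\ e <= d1, e <= d2 & e <= d3] by rewrite /e !ge_min !lexx !orbT.
have [t /andP[/andP[t0 te] t1] Gt] := HG (e / 2) (divr_gt0 e0 (ltr0Sn _ 1)).
have te' : t < e by lra.
have [s [hs hs']] := H1 t t0 t1 (lt_le_trans te' e1).
rewrite QE // in hs hs'.
exists (seg tau2 tG t), p, (fun j => u2 j + s * p j); split.
- exact: Gt.
- exact: H2 t t0 t1 (lt_le_trans te' e2).
- exact: H3 t t0 t1 (lt_le_trans te' e3).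
- by rewrite -[RHS]hs (@lin_atE Cc n p).
- by rewrite (@lin_at_deriv Cc n p) in hs'.
Qed.

End DeltaContinuity.

(** * The generator over k *)

Section Descent.
Variables (k L : fieldType) (iota : {rmorphism k -> L}) (n : nat).

Lemma mcoeff_map J (P : mpoly n k) : mcoeff J (map_mpoly iota P) = iota (mcoeff J P).
Proof. exact: mcoeff_map_mpoly. Qed.

Lemma map_mpolyM (P Q : mpoly n k) :
  map_mpoly iota (P * Q) = map_mpoly iota P * map_mpoly iota Q.
Proof. exact: rmorphM. Qed.

(** Write Q and 1 in a basis of a finite-dimensional k-subspace of L: comparing coefficients gives b
    j P = F H j for each j, and some b j is nonzero. *)
Lemma divides_descent (P F : mpoly n k) (Q : mpoly n L) :
  map_mpoly iota P = map_mpoly iota F * Q -> exists H, P = F * H.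
Proof.
move=> E; have [r [y [H [b [QE bE ind]]]]] := mpoly_split iota Q 1.
have h0 : forall j, b j *: P - F * H j = 0.
  apply: (split_eq0 ind).
  transitivity ((\sum_j y j * iota (b j)) *: map_mpoly iota P - map_mpoly iota F * \sum_j y j *: map_mpoly iota (H j)).
    rewrite scaler_suml mulr_sumr -sumrB; apply: eq_bigr => j _.
    have -> : map_mpoly iota (b j *: P - F * H j) = iota (b j) *: map_mpoly iota P - map_mpoly iota F * map_mpoly iota (H j).
      by rewrite -map_mpolyZ -map_mpolyM; exact: raddfB.
    by rewrite scalerBr scalerA -scalerAr.
  by rewrite -bE -QE scale1r E subrr.
have [j bj] : exists j, b j != 0.
  apply: contrapT => nex; have : (1 : L) != 0 by exact: oner_neq0.
  case/eqP; rewrite bE big1 // => j _.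
  have -> : b j = 0 by apply: contrapT => /eqP h; apply: nex; exists j.
  by rewrite rmorph0 mulr0.
exists ((b j)^-1 *: H j); rewrite -scalerAr.
have /eqP := h0 j; rewrite subr_eq0 => /eqP <-.
by rewrite scalerA mulVf // scale1r.
Qed.

Lemma hom_divides (F : fieldType) d (P D Q : mpoly n F) : homogeneous d P -> homogeneous d D ->
  P = D * Q -> exists c, P = c *: D.
Proof.
move=> hP hD E; have [P0|P0] := eqVneq P 0; first by exists 0; rewrite scale0r.
have D0 : D != 0 by apply: contraNneq P0 => h; rewrite E h mul0r.
have Q0 : Q != 0 by apply: contraNneq P0 => h; rewrite E h mulr0.
have := msizeM D0 Q0; rewrite -E (hom_msize_eq P0 hP) (hom_msize_eq D0 hD) => sz.
have Q1 : (msize Q <= 1)%N by move: sz; move: (msize Q) => s; rewrite addSn /=; lia.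
exists (mcoeff mnm0 Q); rewrite {1}E {1}(msize1_polyC Q1) mulrC.
exact: mul_mpolyC.
Qed.

Lemma map_homogeneous d (P : mpoly n k) : homogeneous d P -> homogeneous d (map_mpoly iota P).
Proof.
move=> hP; apply/dhomogP => J; rewrite mcoeff_msupp mcoeff_map fmorph_eq0 => hJ.
by apply: contraNeq hJ => /(hom_coef hP) ->.
Qed.
End Descent.

Section Uniqueness.
Variables (g m : nat) (k : fieldType) (t : Bm g m -> Bm g m -> k).
Local Notation n := (nB g m).

(** Divisibility both ways makes the degrees equal, so the quotient is a constant, which the
    coefficient of the pure power shows to be 1. *)
Lemma monic_unique (F G : mpoly n k) : monic_in_u0 F -> monic_in_u0 G ->
  (exists H, F = G * H) -> (exists H, G = F * H) -> G = F.
Proof.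
move=> [d hF F1] [e hG G1] [H FE] [H' GE].
have F0 : F != 0 by apply/eqP => h; move/eqP: F1; rewrite h mcoeff0 eq_sym oner_eq0.
have G0 : G != 0 by apply/eqP => h; move/eqP: G1; rewrite h mcoeff0 eq_sym oner_eq0.
have H0 : H != 0 by apply: contraNneq F0 => h; rewrite FE h mulr0.
have H'0 : H' != 0 by apply: contraNneq G0 => h; rewrite GE h mulr0.
have de : d = e.
  have := msizeM G0 H0; have := msizeM F0 H'0; rewrite -FE -GE (hom_msize_eq F0 hF) (hom_msize_eq G0 hG).
  move: H0 H'0; rewrite -!msize_poly_eq0 -!lt0n; move: (msize H) (msize H') => a b; lia.
subst e; have [c Gc] := hom_divides hG hF GE.
have := G1; rewrite Gc mcoeffZ F1 mulr1 => c1.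
by rewrite c1 scale1r.
Qed.
End Uniqueness.

Section Final.
Variables (R : realType) (g m : nat).
Hypotheses (m2 : ~~ odd m) (m4 : (4 <= m)%N) (g0 : (0 < g)%N).
Let m1 : (1 < m)%N. Proof. exact: leq_trans m4. Qed.
Local Notation C := R[i].
Local Notation B := (Bm g m).
Local Notation n := (nB g m).
Local Notation Cc := (R[i] : closedFieldType).
Local Notation D0 := (disc_degree g m).
Local Notation J0 := (pure_power g m D0).
Variables (k : fieldType) (t : B -> B -> k).
Hypothesis hk : @is_theta_field R g m k t.
Variable Delta : 'M[C]_g -> mpoly n C.
Hypothesis hD : is_Delta Delta.

Local Notation el := (@ell R g m m2 m4 k t hk).
Local Notation PPk := (PP el).
Let idP (Om : closedFieldType) (iota : {rmorphism k -> Om}) (p : mpoly n Om) :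
  in_ideal t iota p <-> forall l, \sum_(J <- msupp p) mcoeff J p * iota (el l J) = 0.
Proof. exact: in_idealP. Qed.
Let ch0 := char0_theta m2 m4 hk.

(** Generic points accumulate at tau along the segment of [generic_near]. *)
Lemma zero_of_generic (f : 'M[C]_g -> C) :
  (forall a b, siegel a -> siegel b -> cont0 (fun x => f (seg a b x))) ->
  (forall tau, generic m tau -> f tau = 0) -> forall tau, siegel tau -> f tau = 0.
Proof.
move=> Hc Hg tau ts; have [tG sG HG] := generic_near m2 m4 ts.
have hc := Hc tau tG ts sG.
have [//|nz] := eqVneq (f tau) 0.
have nz' : f (seg tau tG 0) != 0 by rewrite seg0.
have [d d0 H] := cont0_neq0 hc nz'.
have [x /andP[/andP[x0 xd] x1] Gx] := HG (d / 2) (divr_gt0 d0 (ltr0Sn _ 1)).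
have xd' : x < d by lra.
by have := H x x0 x1 xd'; rewrite (Hg _ Gx) eqxx.
Qed.

Lemma ieval_cont (p : Defs.ipoly g m) (a b : 'M[C]_g) : siegel a -> siegel b ->
  cont0 (fun x => ieval (thS (seg a b x)) p).
Proof.
move=> sa sb; have [rho r0 H] := ieval_an m4 p sa sb.
have [] := H 0; first by rewrite lexx ler01.
move=> c Hc e e0; have [M M0 HM] := pserc_head 1 r0 Hc.
have f0 : ieval (thS a) p = c 0%N.
  have := HM 0; rewrite Normc.normc0 => /(_ (ltW r0)); rewrite big_ord1 expr0 mulr1 expr1 mulr0.
  rewrite toC0 addr0 scale0r addr0 => h.
  by apply/eqP; rewrite -subr_eq0 -nrm_eq0 eq_le h nrm_ge0.
have M1 : 0 < M + 1 by rewrite ltr_wpDl.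
exists (Num.min rho (e / (M + 1))); first by rewrite lt_min r0 divr_gt0.
move=> x x0 x1; rewrite lt_min => /andP[xr xe]; rewrite seg0 f0.
have := HM (toC x); rewrite nrm_toC ger0_norm // => /(_ (ltW xr)).
rewrite big_ord1 expr0 mulr1 expr1 toC0 add0r => h; apply: le_lt_trans h _.
rewrite ltr_pdivlMr // mulrDr mulr1 mulrC in xe; lra.
Qed.

Lemma Delta_components tau (iota : {rmorphism k -> C}) : generic m tau -> theta_pt t tau iota ->
  exists r (y : 'I_r -> C) (A : 'I_r -> mpoly n k),
  [/\ Delta tau = \sum_j y j *: map_mpoly iota (A j), forall j, PPk (A j)
    & forall j, homogeneous D0 (A j)].
Proof.
move=> G ht; have [r [y [A [_ [DE _ ind]]]]] := mpoly_split iota (Delta tau) 0.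
have ts : siegel tau by case: G.
exists r, y, A; split; first exact: DE.
  apply: (@PP_split g m k t _ el idP Cc iota _ r y A DE ind) => P hP q Hq.
  apply: (Delta_gradient m2 m4 hk G ht hD (P := P)) => //.
  exact/(Jk_ideal idP).
move=> j; apply/dhomogP => J; rewrite mcoeff_msupp => hJ; apply/eqP.
apply: contraNT hJ => dJ; apply/eqP.
apply: (ind (fun j => mcoeff J (A j))).
have := hom_coef (Delta_homog hD ts) dJ; rewrite DE raddf_sum /= => E.
by rewrite -[RHS]E; apply: eq_bigr => i _; rewrite mcoeffZ mcoeff_map mulrC.
Qed.

Lemma PP_scale c A : PPk A -> PPk (c *: A).
Proof.
move=> hA P hP; rewrite comp_mpolyZ.
have := @Jk_sum g m k _ el 1 (fun=> c) (fun=> comp_mpoly (grad P) A) (fun=> hA P hP).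
by rewrite big_ord1.
Qed.

(** At the tau of [good_tau], every element of [PPk] of degree D0 becomes a multiple of Delta tau
    over C, so all are proportional. One component of Delta tau has a nonzero coefficient at J0;
    normalised, it is F, and the factors of proportionality, read off at J0, lie in k. *)
Lemma monic_generator : exists (F : mpoly n k) (tau : 'M[C]_g) (iota : {rmorphism k -> C}),
  [/\ PPk F, homogeneous D0 F /\ mcoeff J0 F = 1,
      theta_pt t tau iota,
      forall G : mpoly n k, (forall u, tangent_hyperplane t (iota : {rmorphism k -> Cc}) u ->
        meval (pt u) (map_mpoly iota G) = 0) -> exists H, G = F * H
    & forall A, PPk A -> homogeneous D0 A -> A = mcoeff J0 A *: F].
Proof.
have [tau [p [u [G J0n hp hu hu']]]] := good_tau m2 m4 g0 hD.
have [iota ht] := generic_iota hk G.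
have ts : siegel tau by case: G.
have dv := Delta_divides m2 m4 g0 hk G ht hD hp hu hu'.
have prop A : PPk A -> homogeneous D0 A -> exists c, map_mpoly iota A = c *: Delta tau.
  move=> hA hA'; have [v tv|Q E] := dv (map_mpoly iota A).
    exact: (PP_tangent ch0 idP hA tv).
  exact: (hom_divides (map_homogeneous iota hA') (Delta_homog hD ts) E).
have [r [y [A [DE APP Ah]]]] := Delta_components G ht.
have [j Aj] : exists j, mcoeff J0 (A j) != 0.
  apply: contrapT => nex; case/eqP: J0n; rewrite DE raddf_sum big1 // => j _ /=.
  have -> : mcoeff J0 (y j *: map_mpoly iota (A j)) = y j * iota (mcoeff J0 (A j)).
    by rewrite mcoeffZ mcoeff_map.
  have -> : mcoeff J0 (A j) = 0 by apply: contrapT => /eqP h; apply: nex; exists j.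
  by rewrite rmorph0 mulr0.
pose F := (mcoeff J0 (A j))^-1 *: A j.
have FP : PPk F by exact: PP_scale.
have Fh : homogeneous D0 F by apply: dhomogZ; exact: Ah.
have F1 : mcoeff J0 F = 1 by rewrite mcoeffZ mulVf.
have [cF cFE] := prop F FP Fh.
have cF1 : cF * mcoeff J0 (Delta tau) = 1.
  by have := congr1 (mcoeff J0) cFE; rewrite mcoeff_map F1 rmorph1 mcoeffZ.
have cF0 : cF != 0 by apply/eqP => h; move/eqP: cF1; rewrite h mul0r eq_sym oner_eq0.
have DF : Delta tau = cF^-1 *: map_mpoly iota F by rewrite cFE scalerA mulVf // scale1r.
exists F, tau, iota; split; [exact: FP|by split|exact: ht| |].
  move=> P HP; have [Q E] := dv (map_mpoly iota P) HP.
  apply: (@divides_descent k Cc iota n P F (cF^-1 *: Q)).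
  by rewrite E DF -scalerAl -scalerAr.
move=> A' hA' hA'h; have [c cE] := prop A' hA' hA'h.
apply: (map_mpoly_inj (iota := iota)); rewrite map_mpolyZ cE cFE scalerA; congr (_ *: _).
have := congr1 (mcoeff J0) cE; rewrite mcoeff_map mcoeffZ => ->.
by rewrite -mulrA [X in _ * X]mulrC cF1 mulr1.
Qed.

(** F comes from one particular tau, but the components of Delta at any generic tau satisfy the same
    conditions over k and hence are multiples of F. *)
Lemma Delta_generic F tau (iota : {rmorphism k -> C}) : generic m tau -> theta_pt t tau iota ->
  mcoeff J0 F = 1 -> (forall A, PPk A -> homogeneous D0 A -> A = mcoeff J0 A *: F) ->
  Delta tau = mcoeff J0 (Delta tau) *: map_mpoly iota F.
Proof.
move=> G ht F1 HF; have [r [y [A [DE APP Ah]]]] := Delta_components G ht.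
have E : Delta tau = (\sum_j y j * iota (mcoeff J0 (A j))) *: map_mpoly iota F.
  rewrite {1}DE scaler_suml; apply: eq_bigr => j _.
  by rewrite {1}(HF _ (APP j) (Ah j)) map_mpolyZ scalerA.
rewrite {1}E; congr (_ *: _).
by have := congr1 (mcoeff J0) E; rewrite mcoeffZ mcoeff_map F1 rmorph1 mulr1.
Qed.

(** The cross products are continuous along segments, so it is enough to compare them at generic
    tau, where [Delta_generic] gives the ratio. *)
Lemma coefficients_quotient F : mcoeff J0 F = 1 ->
  (forall A, PPk A -> homogeneous D0 A -> A = mcoeff J0 A *: F) ->
  forall J, is_quotient t (mcoeff J F) (fun tau : 'M[C]_g => mcoeff J (Delta tau))
    (fun tau : 'M[C]_g => mcoeff J0 (Delta tau)).
Proof.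
move=> F1 HF J; have [_ /(_ (mcoeff J F))[p [q [q0 E]]]] := hk.
exists p, q; split=> // tau ts; apply/eqP; rewrite -subr_eq0; apply/eqP.
rewrite !ieval_thS //; move: tau ts.
apply: (zero_of_generic (f := fun tau => mcoeff J (Delta tau) * ieval (thS tau) q
  - mcoeff J0 (Delta tau) * ieval (thS tau) p)) => [a b sa sb|tau G].
  have h1 := cont0M (Delta_cont hD J sa sb) (ieval_cont q sa sb).
  have h2 := cont0M (Delta_cont hD J0 sa sb) (ieval_cont p sa sb).
  have := cont0D h1 (cont0M (cont0_cst (-1)) h2); congr cont0; apply/funext => x.
  by rewrite mulN1r.
have ts : siegel tau by case: G.
have [iota ht] := generic_iota hk G.
have q0' : ieval (thth tau) q != 0 by rewrite -ht fmorph_eq0.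
rewrite {1}(Delta_generic G ht F1 HF) mcoeffZ mcoeff_map E fmorph_div !ht -!ieval_thS //.
by rewrite -mulrA divfK // subrr.
Qed.

End Final.

Theorem theorem6p3 (R : realType) (g m : nat) (hg : (1 < g)%N) (hm : (4 <= m)%N)
  (hm2 : ~~ odd m)
  (k : fieldType) (t : Bm g m -> Bm g m -> k) (hk : @is_theta_field R g m k t)
  (Delta : 'M[R[i]]_g -> mpoly (nB g m) R[i]) (hDelta : is_Delta Delta) :
  exists F : mpoly (nB g m) k,
    (forall J : multinom (nB g m),
       is_quotient t (mcoeff J F)
         (fun tau : 'M[R[i]]_g => mcoeff J (Delta tau))
         (fun tau : 'M[R[i]]_g =>
            mcoeff (pure_power g m (disc_degree g m)) (Delta tau)))
    /\ defining_equation t F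
    /\ monic_in_u0 F
    /\ (forall G : mpoly (nB g m) k,
          defining_equation t G -> monic_in_u0 G -> G = F).
Proof.
have [F [tau [iota [FP [Fh F1] ht Fdiv HF]]]] := monic_generator hm2 hm (ltnW hg) hk hDelta.
have ch0 := char0_theta hm2 hm hk.
have idP (Om : closedFieldType) (io : {rmorphism k -> Om}) (p : mpoly (nB g m) Om) :
    in_ideal t io p <-> forall l, \sum_(J <- msupp p) mcoeff J p * io (ell hm2 hm hk l J) = 0.
  exact: in_idealP.
have Fdef : defining_equation t F.
  split; first by exists (disc_degree g m).
  (* A single embedding of k in C suffices for divisibility by F; conversely F vanishes on the
     tangent hyperplanes over every Omega because [PP] is a condition over k. *)
  move=> G; split=> [HG|[H ->] Om io u [u0 hu]].
    apply: Fdiv => u tu; apply: (HG _ iota u); split; first by case: tu.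
    by move=> p; exact.
  have Fu : meval (pt u) (map_mpoly io F) = 0.
    by apply: hu => u' tu'; exact: (PP_tangent ch0 idP FP tu').
  by rewrite map_mpolyM mevalM Fu mul0r.
have Fmon : monic_in_u0 F by exists (disc_degree g m).
exists F; split; first exact: (coefficients_quotient hDelta F1 HF).
split; first exact: Fdef.
split; first exact: Fmon.
move=> G [Gh Gdef] Gmon; apply: (monic_unique Fmon Gmon).
  by apply/Gdef; apply/(Fdef.2 F); exists 1; rewrite mulr1.
by apply/(Fdef.2 G); apply/Gdef; exists 1; rewrite mulr1.
Qed.
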